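(* Assume the following. (a) $b$ and $\sigma$ are continuous on $H\times\Lambda_0$ and there is $C>0$ such that $\|b(x,a)-b(x',a)\|_H\le C\|x-x'\|_H$, $\|\sigma(x,a)-\sigma(x',a)\|_{L_2(\Xi,H)}\le C\|x-x'\|_H$, $\|b(x,a)\|_H\le C(1+\|x\|_H+\|a\|_\Lambda)$ and $\|\sigma(x,a)\|_{L_2(\Xi,H)}\le C(1+\|x\|_H+\|a\|_\Lambda)$ for all $x,x'\in H$, $a\in\Lambda_0$. (b) $l$ is continuous on $H\times\Lambda_0$ and there is $C>0$ such that $|l(x,a)-l(x',a)|\le C\|x-x'\|_H$, $|l(x,a)|\le C(1+\|x\|_H+\|a\|_\Lambda^2)$ and $|g(x)-g(x')|\le C\|x-x'\|_H$ for all $x,x'\in H$, $a\in\Lambda_0$; moreover, if $\Lambda_0$ is unbounded, $l$ and $g$ are bounded from below. (c) $b:H\times\Lambda\to H$ and $\sigma:H\times\Lambda\to L_2(\Xi,H)$ are Fréchet differentiable in the first variable and there is $C>0$ such that $\|D_xb(x,a)-D_xb(x',a)\|_{L(H)}\le C\|x-x'\|_H$ and $\|D_x\sigma(x,a)-D_x\sigma(x',a)\|_{L(H,L_2(\Xi,H))}\le C\|x-x'\|_H$ for all $x,x'\in H$, $a\in\Lambda_0$. (d) $l(\cdot,a)$ is semiconcave uniformly in $a\in\Lambda_0$ (i.e. with a semiconcavity constant independent of $a$), and $g$ is semiconcave. Then, for every $t\in[0,T]$, the function $V(t,\cdot)$ is semiconcave with semiconcavity constant $C_1\mathrm e^{C_2(T-t)}$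 for some $C_1,C_2\ge0$ independent of $t,T$.
   Context: $H$ and $\Xi$ are real separable Hilbert spaces, $\Lambda$ is a real separable Banach space, $\Lambda_0\subset\Lambda$ is convex, $p>2$ and $0<T<\infty$ are fixed. $L(\cdot,\cdot)$ denotes bounded linear operators, $L(H)=L(H,H)$, and $L_2(\Xi,H)$ Hilbert--Schmidt operators. $A:\mathcal D(A)\subset H\to H$ is linear, densely defined and maximal dissipative; it generates a $C_0$-semigroup of contractions $(\mathrm e^{sA})_{s\ge 0}$. The coefficients are functions $b:H\times\Lambda\to H$, $\sigma:H\times\Lambda\to L_2(\Xi,H)$, $l:H\times\Lambda\to\mathbb R$, $g:H\to\mathbb R$. A function $v:H\to\mathbb R$ is semiconcave with semiconcavity constant $C$ if $\lambda v(x)+(1-\lambda)v(x')-v(\lambda x+(1-\lambda)x')\le C\lambda(1-\lambda)\|x-x'\|_H^2$ for all $\lambda\in[0,1]$, $x,x'\in H$. For $t\in[0,T]$, a reference probability space $(\Omega,\mathscr F,(\mathscr F^t_s)_{s\in[t,T]},\mathbb P,(W(s))_{s\in[t,T]})$ is fixed: $(\Omega,\mathscr F,\mathbb P)$ is complete, $W$ is a cylindrical Wiener process in $\Xi$ with $W(t)=0$ $\mathbb P$-a.s., and $\mathscr F^t_s$ is generated by $\{W(\tau):t\le\tau\le s\}$ and the $\mathbb P$-null sets. $\mathcal U_t$ is the set of all $\mathscr F^t_s$-progressively measurable $a(\cdot):[t,T]\times\Omega\to\Lambda_0$ with $\mathbb E\int_t^T\|a(s)\|_\Lambda^p\,\mathrm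 ds<\infty$. $X(\cdot;t,x,a(\cdot))$ is the mild solution with continuous trajectories of $\mathrm dX(s)=[AX(s)+b(X(s),a(s))]\mathrm ds+\sigma(X(s),a(s))\mathrm dW(s)$, $X(t)=x$, i.e. $X(s)=\mathrm e^{(s-t)A}x+\int_t^s\mathrm e^{(s-r)A}b(X(r),a(r))\mathrm dr+\int_t^s\mathrm e^{(s-r)A}\sigma(X(r),a(r))\mathrm dW(r)$. Further $J(t,x;a(\cdot))=\mathbb E\big[\int_t^T l(X(s),a(s))\mathrm ds+g(X(T))\big]$ with $X(s)=X(s;t,x,a(\cdot))$, and the value function is $V(t,x)=\inf_{a(\cdot)\in\mathcal U_t}J(t,x;a(\cdot))$. *)

(* Defs.v *)
From HB Require Import structures.
From mathcomp Require Import all_boot all_order all_algebra.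
From mathcomp Require Import all_classical all_reals all_analysis.
From mathcomp Require Import ring lra.

Set Implicit Arguments.
Unset Strict Implicit.
Unset Printing Implicit Defensive.

Import Order.TTheory GRing.Theory Num.Theory.
Import numFieldNormedType.Exports.

Local Open Scope classical_set_scope.
Local Open Scope ring_scope.

HB.mixin Record isHilbert (R : realType) H & CompleteNormedModule R H := {
  inner : H -> H -> R ;
  innerC : forall x y, inner x y = inner y x ;
  innerDl : forall x y z, inner (x + y) z = inner x z + inner y z ;
  innerZl : forall c x y, inner (c *: x) y = c * inner x y ;
  innerxx : forall x, inner x x = `|x| ^+ 2
}.

#[short(type="hilbertType")]
HB.structure Definition Hilbert (R : realType) :=
  {H of CompleteNormedModule R H & isHilbert R H}.

Arguments inner {R H} : rename.

Definition separable (T : topologicalType) :=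
  exists2 D : set T, countable D & dense D.

Section InnerTheory.
Variables (R : realType) (H : hilbertType R).
Implicit Types x y z : H.

Lemma innerDr x y z : inner x (y + z) = inner x y + inner x z.
Proof. by rewrite innerC innerDl !(innerC _ x). Qed.

Lemma innerZr c x y : inner x (c *: y) = c * inner x y.
Proof. by rewrite innerC innerZl innerC. Qed.

Lemma inner0l y : inner 0 y = 0.
Proof. by rewrite -(scale0r 0) innerZl mul0r. Qed.

Lemma inner_sumr n (f : 'I_n -> H) x :
  inner x (\sum_i f i) = \sum_i inner x (f i).
Proof.
apply: (big_morph (inner x)) => [y z|]; first exact: innerDr.
by rewrite innerC inner0l.
Qed.

Definition orthonormal n (e : 'I_n -> H) :=
  forall i j, inner (e i) (e j) = (i == j)%:R.

Lemma bessel n (e : 'I_n -> H) x : orthonormal e ->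
  \sum_i inner x (e i) ^+ 2 <= `|x| ^+ 2.
Proof.
move=> oe; pose y := \sum_i inner x (e i) *: e i.
have xy : inner x y = \sum_i inner x (e i) ^+ 2.
  by rewrite inner_sumr; apply: eq_bigr => i _; rewrite innerZr -expr2.
have yy : inner y y = \sum_i inner x (e i) ^+ 2.
  rewrite {2}/y inner_sumr; apply: eq_bigr => i _.
  rewrite innerZr (innerC y).
  rewrite /y inner_sumr (bigD1 i)//= big1 ?addr0 => [|j ji].
    by rewrite innerZr oe eqxx mulr1 -expr2.
  by rewrite innerZr oe eq_sym (negbTE ji) mulr0.
have : 0 <= inner (x + (-1) *: y) (x + (-1) *: y) by rewrite innerxx sqr_ge0.
rewrite innerDl !innerDr !innerZl !innerZr (innerC y x) xy yy innerxx.
by lra.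
Qed.

End InnerTheory.

Record bounded_op (R : realType) (V W : normedModType R) := BoundedOp {
  bounded_op_fun :> {linear V -> W} ;
  bounded_op_continuous : continuous bounded_op_fun
}.

Definition opnorm (R : realType) (V W : normedModType R) (f : V -> W) : \bar R :=
  ereal_sup [set `|f x|%:E | x in [set x | `|x| <= 1]].

Lemma l2_minkowski (R : realType) n (a b : 'I_n -> R) (s t : R) :
  0 <= s -> 0 <= t ->
  \sum_i a i ^+ 2 <= s ^+ 2 -> \sum_i b i ^+ 2 <= t ^+ 2 ->
  \sum_i (a i + b i) ^+ 2 <= (s + t) ^+ 2.
Proof.
have zero (c : 'I_n -> R) : \sum_i c i ^+ 2 <= 0 -> forall i, c i = 0.
  move=> c0 i; apply/eqP; rewrite -sqrf_eq0 eq_le sqr_ge0 andbT.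
  apply: le_trans c0; rewrite (bigD1 i)//= lerDl.
  by apply: sumr_ge0 => j _; exact: sqr_ge0.
rewrite le_eqVlt => /predU1P[<- t0|s0].
  rewrite expr0n/= => /zero a0 bt; rewrite add0r; apply: le_trans bt.
  by apply: ler_sum => i _; rewrite a0 add0r.
rewrite le_eqVlt => /predU1P[<- aS|t0 aS bT].
  rewrite expr0n/= => /zero b0; rewrite addr0; apply: le_trans aS.
  by apply: ler_sum => i _; rewrite b0 addr0.
have key i : (a i + b i) ^+ 2 <=
    (s + t) / s * a i ^+ 2 + (s + t) / t * b i ^+ 2.
  rewrite -subr_ge0 (_ : _ - _ = (t * a i - s * b i) ^+ 2 / (s * t)).
    by rewrite divr_ge0 ?sqr_ge0// mulr_ge0// ltW.
  by field; rewrite ?gt_eqF.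
apply: (le_trans (ler_sum _ (fun i _ => key i))).
rewrite big_split/= -!mulr_sumr.
have -> : (s + t) ^+ 2 = (s + t) / s * s ^+ 2 + (s + t) / t * t ^+ 2.
  by field; rewrite ?gt_eqF.
by apply: lerD; apply: ler_wpM2l => //; rewrite divr_ge0 ?addr_ge0 ?ltW.
Qed.

Section HilbertSchmidt.
Variables (R : realType) (Xi H : hilbertType R).
Implicit Types f g : Xi -> H.

(* The sum of the `|f e_k| ^+ 2 over an orthonormal basis (e_k) does not depend
   on the basis, and is the supremum of the following sums. *)
Definition hs_sums f : set R :=
  [set r | exists n (e : 'I_n -> Xi),
    orthonormal e /\ r = \sum_i `|f (e i)| ^+ 2].

Lemma hs_sums0 f : hs_sums f 0.
Proof.
exists 0%N, (fun=> 0); split; first by case.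
by rewrite big_ord0.
Qed.

Definition hs_norm f : R := Num.sqrt (sup (hs_sums f)).

Definition is_hs : {pred Xi -> H} :=
  [pred f | `[< linear f /\ has_ubound (hs_sums f) >]].

Lemma is_hsP f : f \in is_hs <-> linear f /\ has_ubound (hs_sums f).
Proof. by rewrite inE; split => // /asboolP. Qed.

Lemma hs_norm_ge0 f : 0 <= hs_norm f. Proof. exact: sqrtr_ge0. Qed.

Lemma hs_norm_ub f n (e : 'I_n -> Xi) : has_ubound (hs_sums f) ->
  orthonormal e -> \sum_i `|f (e i)| ^+ 2 <= hs_norm f ^+ 2.
Proof.
move=> fub oe; have ub r : hs_sums f r -> r <= sup (hs_sums f).
  by move=> fr; apply: ub_le_sup.
rewrite sqr_sqrtr; last exact/ub/hs_sums0.
by apply: ub; exists n, e.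
Qed.

Lemma hs_norm_le f (M : R) : 0 <= M ->
  (forall n (e : 'I_n -> Xi), orthonormal e ->
    \sum_i `|f (e i)| ^+ 2 <= M ^+ 2) ->
  has_ubound (hs_sums f) /\ hs_norm f <= M.
Proof.
move=> M0 fM; have ub : ubound (hs_sums f) (M ^+ 2).
  by move=> _ [n [e [oe ->]]]; exact: fM.
split; first by exists (M ^+ 2).
rewrite -[leRHS]ger0_norm// -sqrtr_sqr ler_wsqrtr//.
by apply: ge_sup => //; exists 0; exact: hs_sums0.
Qed.

Lemma hs_normD_subproof f g :
  has_ubound (hs_sums f) -> has_ubound (hs_sums g) ->
  has_ubound (hs_sums (f + g)) /\ hs_norm (f + g) <= hs_norm f + hs_norm g.
Proof.
move=> fub gub; apply: hs_norm_le => [|n e oe].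
  by rewrite addr_ge0 ?hs_norm_ge0.
apply: (@le_trans _ _ (\sum_i (`|f (e i)| + `|g (e i)|) ^+ 2)).
  apply: ler_sum => i _; rewrite lerXn2r ?nnegrE ?addr_ge0//.
  exact: ler_normD.
by apply: l2_minkowski; rewrite ?hs_norm_ge0 ?hs_norm_ub.
Qed.

Lemma hs_normZ_subproof (c : R) f : has_ubound (hs_sums f) ->
  has_ubound (hs_sums (c *: f)) /\ hs_norm (c *: f) <= `|c| * hs_norm f.
Proof.
move=> fub; apply: hs_norm_le => [|n e oe].
  by rewrite mulr_ge0 ?hs_norm_ge0.
rewrite exprMn; apply: le_trans (_ : `|c| ^+ 2 * _ <= _); last first.
  by apply: ler_wpM2l; [exact: sqr_ge0|exact: (hs_norm_ub fub oe)].
by rewrite mulr_sumr; apply: ler_sum => i _; rewrite normrZ exprMn.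
Qed.

Lemma is_hs_submod : GRing.submod_closed is_hs.
Proof.
split=> [|c f g].
  apply/is_hsP; split.
    by move=> c x y; rewrite /= scaler0 addr0.
  apply: (proj1 (@hs_norm_le _ 0 _ _)) => // n e oe.
  by rewrite big1 ?sqr_ge0// => i _; rewrite normr0 expr0n.
move=> /is_hsP[lf fub] /is_hsP[lg gub]; apply/is_hsP; split.
  move=> k x y; rewrite /= !fctE lf lg !scalerDr !scalerA (mulrC k).
  by rewrite addrACA.
by have [/hs_normD_subproof/(_ gub)[]] := hs_normZ_subproof c fub.
Qed.

HB.instance Definition _ := GRing.isSubmodClosed.Build R _ is_hs is_hs_submod.

Record hs := HS { hs_fun :> Xi -> H ; _ : hs_fun \in is_hs }.

HB.instance Definition _ := [isSub for hs_fun].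
HB.instance Definition _ := [Choice of hs by <:].
HB.instance Definition _ := [SubChoice_isSubLmodule of hs by <:].

Lemma hs_linear (f : hs) : linear f.
Proof. by have /is_hsP[] := valP f. Qed.

Lemma hs_ubound (f : hs) : has_ubound (hs_sums f).
Proof. by have /is_hsP[] := valP f. Qed.

HB.instance Definition _ (f : hs) := GRing.isLinear.Build R Xi H _ f (hs_linear f).

Lemma hs_normD (f g : hs) : hs_norm (f + g) <= hs_norm f + hs_norm g.
Proof. exact: (proj2 (hs_normD_subproof (hs_ubound f) (hs_ubound g))). Qed.

Lemma hs_normZ (c : R) (f : hs) : hs_norm (c *: f) = `|c| * hs_norm f.
Proof.
have le k (h : hs) : hs_norm (k *: h) <= `|k| * hs_norm h.
  exact: (proj2 (hs_normZ_subproof k (hs_ubound h))).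
apply/eqP; rewrite eq_le le/=; have [->|c0] := eqVneq c 0.
  by rewrite normr0 mul0r hs_norm_ge0.
rewrite -ler_pdivlMl ?normr_gt0// -normfV.
apply: le_trans (le c^-1 (c *: f)).
by rewrite scalerA mulVf// scale1r.
Qed.

Lemma hs_norm0_eq0 (f : hs) : hs_norm f = 0 -> f = 0.
Proof.
move=> f0; apply/val_inj/funext => x /=.
have [->|x0] := eqVneq x 0; first by rewrite linear0.
pose e := fun _ : 'I_1 => `|x|^-1 *: x.
have oe : orthonormal e.
  move=> i j; rewrite !ord1 eqxx innerxx normrZ normfV normr_id.
  by rewrite mulVf ?normr_eq0// expr1n.
have := hs_norm_ub (hs_ubound f) oe; rewrite f0 expr0n/= big_ord1 linearZ/=.
rewrite normrZ exprMn pmulr_rle0; last first.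
  by rewrite exprn_gt0// normr_gt0 invr_eq0 normr_eq0.
by move=> fx; apply/eqP; rewrite -normr_eq0 -sqrf_eq0 eq_le fx sqr_ge0.
Qed.

HB.instance Definition _ :=
  Lmodule_isNormed.Build R hs hs_normD hs_normZ hs_norm0_eq0.

Lemma rank1_is_hs (x : Xi) (h : H) : (fun y => inner x y *: h) \in is_hs.
Proof.
apply/is_hsP; split.
  by move=> c y z; rewrite innerDr innerZr scalerDl scalerA.
apply: (proj1 (@hs_norm_le _ (`|x| * `|h|) _ _)) => [|n e oe].
  by rewrite mulr_ge0.
under eq_bigr do rewrite normrZ exprMn real_normK ?num_real//.
rewrite -mulr_suml exprMn; apply: ler_wpM2r; first exact: sqr_ge0.
exact: bessel.
Qed.

Definition rank1 x h : hs := HS (rank1_is_hs x h).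

Lemma comp_is_hs (B : bounded_op H H) (f : hs) : B \o f \in is_hs.
Proof.
apply/is_hsP; split.
  by move=> c x y; rewrite /= !linearP.
have /linear_boundedP[M [_ BM]] :=
  @continuous_linear_bounded _ _ _ 0 B (@bounded_op_continuous _ _ _ B 0).
pose K := `|M| + 1; have K0 : 0 <= K by rewrite addr_ge0.
have {}BM x : `|B x| <= K * `|x|.
  by apply: BM; rewrite /K ltr_pwDr// ler_norm.
apply: (proj1 (@hs_norm_le _ (K * hs_norm f) _ _)) => [|n e oe].
  by rewrite mulr_ge0// hs_norm_ge0.
apply: (@le_trans _ _ (\sum_i K ^+ 2 * `|f (e i)| ^+ 2)).
  apply: ler_sum => i _; rewrite -exprMn lerXn2r ?nnegrE ?mulr_ge0//.
  exact: BM.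
rewrite -mulr_sumr exprMn; apply: ler_wpM2l; first exact: sqr_ge0.
exact: (hs_norm_ub (hs_ubound f)).
Qed.

Definition hs_comp (B : bounded_op H H) (f : hs) : hs := HS (comp_is_hs B f).

End HilbertSchmidt.

Section Semigroups.
Variables (R : realType) (H : hilbertType R).

(* An unbounded operator is a pair (D, A) of a domain D and a total function A
   whose values outside D are irrelevant. *)
Definition linear_on (D : set H) (A : H -> H) :=
  D 0 /\ forall (c : R) x y, D x -> D y ->
    D (c *: x + y) /\ A (c *: x + y) = c *: A x + A y.

Definition dissipative (D : set H) (A : H -> H) :=
  forall x, D x -> inner (A x) x <= 0.

Definition maximal_dissipative (D : set H) (A : H -> H) :=
  dissipative D A /\
  forall (D' : set H) (A' : H -> H), linear_on D' A' -> dissipative D' A' ->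
    D `<=` D' -> {in D, A' =1 A} -> D' `<=` D.

Definition contraction_semigroup (S : R -> bounded_op H H) :=
  [/\ forall x, S 0 x = x,
      forall s r x, 0 <= s -> 0 <= r -> S (s + r) x = S s (S r x),
      forall x, S s x @[s --> 0^'+] --> x &
      forall s x, 0 <= s -> `|S s x| <= `|x|].

Definition generates (D : set H) (A : H -> H) (S : R -> bounded_op H H) :=
  forall x y,
    (D x /\ A x = y) <-> h^-1 *: (S h x - x) @[h --> 0^'+] --> y.

End Semigroups.

Definition semiconcave (R : realType) (V : normedModType R) (C : R) (v : V -> R) :=
  forall (k : R) x y, 0 <= k <= 1 ->
    k * v x + (1 - k) * v y - v (k *: x + (1 - k) *: y) <=
    C * k * (1 - k) * `|x - y| ^+ 2.

Definition borel (T : ptopologicalType) := g_sigma_algebraType (@open T).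

Section Bochner.
Variables (R : realType) (V : completeNormedModType R).
Let mu := @lebesgue_measure R.

Record step := Step {
  step_size : nat ;
  step_set : 'I_step_size -> set (measurableTypeR R) ;
  step_val : 'I_step_size -> V }.

Arguments step_set : clear implicits.
Arguments step_val : clear implicits.

Definition step_fun (f : step) (r : R) : V :=
  \sum_i \1_(step_set f i) r *: step_val f i.

Definition step_integral (f : step) : V :=
  \sum_i fine (mu (step_set f i)) *: step_val f i.

Definition is_bochner_integral (D : set (measurableTypeR R)) (f : R -> V) (y : V) :=
  measurable_fun D (f : measurableTypeR R -> borel V) /\
  exists u : nat -> step,
    [/\ forall n i, [/\ measurable (step_set (u n) i), step_set (u n) i `<=` D &
           (mu (step_set (u n) i) < +oo)%E],
        (\int[mu]_(r in D) (`|f r - step_fun (u n) r|)%:E)%E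
          @[n --> \oo] --> 0%E &
        step_integral (u n) @[n --> \oo] --> y].

End Bochner.

Section Stochastic.
Variables (R : realType) (Xi : hilbertType R).
Variables (d : measure_display) (Om : measurableType d) (P : probability Om R).
Variables (W : R -> Xi -> Om -> R) (t : R).
Let mu := @lebesgue_measure R.

(* W s xi plays the role of "<W s, xi>": a cylindrical process is known through
   the real random variables it induces on Xi. *)
Definition wiener_filtration (s : R) : set (set Om) :=
  <<s [set F | exists r xi B, [/\ t <= r <= s, measurable B &
                                  F = W r xi @^-1` (B : set R)]]
      `|` P.-negligible >>.

Record cylindrical_wiener (T : R) : Prop := {
  wiener_measurable : forall s xi, t <= s <= T ->
    measurable_fun [set: Om] (W s xi) ;
  wiener_linear : forall s (c : R) xi eta, t <= s <= T ->
    {ae P, forall w, W s (c *: xi + eta) w = c * W s xi w + W s eta w} ;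
  wiener_start : forall xi, {ae P, forall w, W t xi w = 0} ;
  wiener_continuous : forall xi,
    {ae P, forall w, {within `[t, T], continuous (fun s => W s xi w)}} ;
  wiener_increment : forall s r (xi : Xi) (B : set R), t <= s -> s < r -> r <= T ->
    xi != 0 -> measurable B ->
    P [set w | B (W r xi w - W s xi w)] =
      normal_prob 0 (Num.sqrt (r - s) * `|xi|) B ;
  wiener_independent : forall s r (xi : Xi) F (B : set R),
    t <= s -> s < r -> r <= T ->
    wiener_filtration s F -> measurable B ->
    P (F `&` [set w | B (W r xi w - W s xi w)]) =
      (P F * P [set w | B (W r xi w - W s xi w)%R])%E }.

Definition reference_space (T : R) :=
  measure_is_complete P /\ cylindrical_wiener T.

Definition progressive (V : ptopologicalType) (T : R) (f : R -> Om -> V) :=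
  forall s, t <= s <= T ->
    measurable_fun (`[t, s] `*` setT)
      ((fun z => f z.1 z.2) :
        measurableTypeR R * g_sigma_algebraType (wiener_filtration s) ->
        borel V).

Variable H : hilbertType R.

(* The process sum_i 1_]u_i, v_i] 1_F_i (xi_i (x) h_i). *)
Record elementary := Elementary {
  elem_size : nat ;
  elem_start : 'I_elem_size -> R ;
  elem_end : 'I_elem_size -> R ;
  elem_event : 'I_elem_size -> set Om ;
  elem_dir : 'I_elem_size -> Xi ;
  elem_val : 'I_elem_size -> H }.

Arguments elem_start : clear implicits.
Arguments elem_end : clear implicits.
Arguments elem_event : clear implicits.
Arguments elem_dir : clear implicits.
Arguments elem_val : clear implicits.

Definition elementary_on (T : R) (e : elementary) := forall i,
  [/\ t <= elem_start e i, elem_start e i <= elem_end e i, elem_end e i <= T &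
      wiener_filtration (elem_start e i) (elem_event e i)].

Definition elementary_fun (e : elementary) (r : R) (w : Om) : hs Xi H :=
  \sum_i (\1_(`]elem_start e i, elem_end e i]) r * \1_(elem_event e i) w) *:
    rank1 (elem_dir e i) (elem_val e i).

Definition elementary_integral (e : elementary) (w : Om) : H :=
  \sum_i (\1_(elem_event e i) w *
    (W (elem_end e i) (elem_dir e i) w - W (elem_start e i) (elem_dir e i) w)) *:
    elem_val e i.

(* y is (a version of) the integral of Phi over [t, s] with respect to W. *)
Definition is_ito_integral (s : R) (Phi : R -> Om -> hs Xi H) (y : Om -> H) :=
  [/\ progressive s Phi, measurable_fun setT (y : Om -> borel H) &
   exists e : nat -> elementary,
     [/\ forall n, elementary_on s (e n),
       (\int[P]_w \int[mu]_(r in `[t, s])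
          (`|Phi r w - elementary_fun (e n) r w| ^+ 2)%:E)%E
         @[n --> \oo] --> 0%E &
       (\int[P]_w (`|y w - elementary_integral (e n) w| ^+ 2)%:E)%E
         @[n --> \oo] --> 0%E]].

Variables (L : completeNormedModType R) (L0 : set L) (p T : R).
Variables (S : R -> bounded_op H H).
Variables (b : H -> L -> H) (sigma : H -> L -> hs Xi H).
Variables (l : H -> L -> R) (g : H -> R).

Definition controls : set (R -> Om -> L) :=
  [set a | [/\ forall s w, t <= s <= T -> L0 (a s w),
     progressive T a &
     (\int[P]_w \int[mu]_(s in `[t, T]) (`|a s w| `^ p)%:E < +oo)%E]].

Definition mild_solution (x : H) (a : R -> Om -> L) (X : R -> Om -> H) :=
  [/\ progressive T X,
   forall w, {within `[t, T], continuous (fun s => X s w)} &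
   forall s, t <= s <= T -> exists Ib Is : Om -> H,
     [/\ {ae P, forall w, is_bochner_integral `[t, s]
            (fun r => S (s - r) (b (X r w) (a r w))) (Ib w)},
         is_ito_integral s
            (fun r w => hs_comp (S (s - r)) (sigma (X r w) (a r w))) Is &
         {ae P, forall w, X s w = S (s - t) x + Ib w + Is w}]].

(* Mild solutions are unique up to indistinguishability. *)
Definition state (x : H) (a : R -> Om -> L) : R -> Om -> H :=
  xget (fun _ _ => 0) (mild_solution x a).

Definition cost (x : H) (a : R -> Om -> L) : \bar R :=
  let X := state x a in
  'E_P[(fun w => \int[mu]_(s in `[t, T]) l (X s w) (a s w) + g (X T w))%R]%E.

Definition value (x : H) : \bar R := ereal_inf [set cost x a | a in controls].

End Stochastic.

(* Main.v *)
(* For a fixed control let X, X', Z be the mild solutions started at x, x' and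
z = k x + (1 - k) x'. Gronwall type estimates give E|X - X'|^4 <= C |x - x'|^4;
since the coefficients are C^{1,1} in x, the process Y = k X + (1 - k) X' - Z solves
an equation forced by terms of size k (1 - k) |X - X'|^2, so that
E|Y| <= C k (1 - k) |x - x'|^2. Semiconcavity of l, g along X, X' and their Lipschitz
continuity along Y make the cost semiconcave uniformly in the control, and an infimum
inherits this. All estimates carry exponential weights exp (c (s - t)), which replace
Gronwall's lemma. As the state is chosen by xget, existence of mild solutions is needed
too: Picard iterates converge uniformly by a maximal inequality. *)
From HB Require Import structures.
From mathcomp Require Import all_boot all_order all_algebra.
From mathcomp Require Import all_classical all_reals all_analysis.
From mathcomp Require Import measurable_realfun ring lra.
Require Import Defs.

Set Implicit Arguments.
Unset Strict Implicit.
Unset Printing Implicit Defensive.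

Import Order.TTheory GRing.Theory Num.Theory.
Import numFieldNormedType.Exports.

Local Open Scope classical_set_scope.
Local Open Scope ring_scope.

Implicit Type R : realType.

Notation measT := (measurable_fun setT).
Notation leb := (@lebesgue_measure _).
Notation realM := measurableTypeR.
Notation mcst := measurable_cst.
Notation mEFinP := measurable_EFinP.

(** Three obstacles shape the proof. A mild solution need not be a semimartingale, so no Ito formula
    is used: every bound comes from elementary processes, one increment at a time, and the square
    root of the fourth moment of a partial sum obeys a linear recursion. A mild solution comes
    without moment bounds, so differences are first estimated on the event that they stayed below
    [N]; decreasing, left continuous families of events do the work of stopping times, and [N] tends
    to infinity by Fatou. The maximal inequality for convolutions needs a recursion in time:
    approximate integrands are moved by the semigroup inside each cell, so that grid values satisfy
    [x_{k+1} = S(delta)(x_k + increment)] with a contraction. Drift and noise share one abstract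
    integrator. The rate [c] of the weights depends only on the constants of the coefficients and is
    so large that the integral terms return at most half of the unknown bound, which is absorbed;
    this makes the final constants independent of [t] and [T]. Fourth moments enter because the
    quadratic forcing is measured in mean square. *)

Lemma ler_eq (R : numDomainType) (x y : R) : x = y -> x <= y.
Proof. by move=> ->. Qed.

(** * Borel measurability of maps into separable normed spaces *)

Definition dense_seq R (V : normedModType R) (v : nat -> V) :=
 forall (x : V) (e : R), 0 < e -> exists n, `|x - v n| < e.

Section Borel.
Variables (R : realType).

Lemma separable_seq (V : normedModType R) : separable V -> exists v : nat -> V, dense_seq v.
Proof.
move=> [D /countable_injP[f finj] dD].
exists (fun n => xget 0 [set x | D x /\ f x = n]) => x e e0.
have [||y [xy Dy]] := dD (ball x e).
- by exists x; exact: ballxx.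
- exact: ball_open.
exists (f y); rewrite (_ : xget _ _ = y).
 by move: xy; rewrite -ball_normE.
apply: xget_unique => //= z [Dz fz].
by apply: finj => //; rewrite inE.
Qed.

(** An open set is the union of the balls inside it that are centred at some [v n] with radius
    [1/(k+1)], a countable family. This reduces measurability of vector valued maps to that of real
    distances. It asks for no completeness, so it also serves [hs], which is only a normed module
    here. *)
Lemma borel_ballP d (T : measurableType d) (V : normedModType R) (v : nat -> V)
  (D : set T) (f : T -> V) : dense_seq v -> measurable D ->
 (forall n, measurable_fun D (fun z => `|f z - v n| : R)) ->
 measurable_fun D (f : T -> borel V).
Proof.
move=> dv mD mf; apply: (@measurability _ _ _ (borel V) D _ (@open V)) => //.
move=> _ [U oU <-].
rewrite (_ : D `&` f @^-1` U = \bigcup_n \bigcup_(k in [set k | ball (v n) (k.+1%:R^-1 : R) `<=` U])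
  (D `&` (fun z => `|f z - v n|) @^-1` `]-oo, k.+1%:R^-1[)).
 apply: bigcupT_measurable => n; apply: bigcup_measurable => k _. exact: mf.
apply/seteqP; split=> [z [Dz Uz]|z [n _ [k] /= kU [Dz]]].
 have /nbhs_ballP[e /= e0 eU] : nbhs (f z) U by exact: open_nbhs_nbhs.
 have [k kE] : exists k : nat, k.+1%:R^-1 < e / 2.
  have [k _ /(_ _ (leqnn _))] := near_infty_natSinv_lt (PosNum (divr_gt0 e0 (ltr0n R 2))).
  by exists k.
 have [n vn] := dv (f z) (k.+1%:R^-1) (ltac:(by rewrite invr_gt0)). exists n => //; exists k => /=.
  move=> y; rewrite -ball_normE /= => vy; apply: eU. rewrite -ball_normE /=.
  apply: (le_lt_trans (ler_distD (v n) _ _)). by rewrite (splitr e) ltrD// (lt_trans _ kE).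
 by split => //=; rewrite in_itv.
rewrite /= in_itv/= => fz; split => //.
by apply: kU; rewrite -ball_normE /= distrC.
Qed.

Lemma borel_comp d (T : measurableType d) (V : ptopologicalType) (D : set T)
  (f : T -> V) (phi : V -> R) : continuous phi -> measurable D ->
 measurable_fun D (f : T -> borel V) -> measurable_fun D (phi \o f).
Proof.
move=> /continuousP cphi mD mf.
have mphi : measT (phi : borel V -> R).
 apply: (measurability _ (RGenOpens.measurableE R)) => _ [_ [x [y ->]] <-].
 by rewrite setTI; apply: sub_sigma_algebra; exact/cphi/interval_open.
exact: measurableT_comp mphi mf.
Qed.

Lemma borel_real d (T : measurableType d) (D : set T) (f : T -> R) :
 measurable D -> measurable_fun D f <->
 measurable_fun D (f : T -> borel R).
Proof.
move=> mD; split=> mf; last by apply: (@borel_comp _ _ R _ f idfun) => // x; exact: cvg_id.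
apply: (@measurability _ _ _ (borel R) D _ (@open R)) => //.
by move=> _ [U oU <-]; apply: mf => //; exact: open_measurable.
Qed.

Lemma borel_norm d (T : measurableType d) (V : normedModType R) (D : set T)
  (f : T -> V) (y : V) : measurable D ->
 measurable_fun D (f : T -> borel V) -> measurable_fun D (fun z => `|f z - y| : R).
Proof.
move=> mD; apply: (@borel_comp _ _ V _ f (fun x => `|x - y|)) => // x.
apply: cvg_norm; apply: cvgB; [exact: cvg_id|exact: cvg_cst].
Qed.

Lemma borel_cvg d (T : measurableType d) (V : normedModType R) (v : nat -> V)
  (D : set T) (h : nat -> T -> V) (f : T -> V) : dense_seq v -> measurable D ->
 (forall n, measurable_fun D (h n : T -> borel V)) ->
 (forall z, D z -> h ^~ z @ \oo --> f z) ->
 measurable_fun D (f : T -> borel V).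
Proof.
move=> dv mD mh hf; apply: (borel_ballP dv mD) => n.
apply: (@measurable_fun_cvg _ _ _ D (fun m z => `|h m z - v n|)) => //.
 by move=> m; exact: borel_norm.
by move=> z Dz; apply: cvg_norm; apply: cvgB; [exact: hf|exact: cvg_cst].
Qed.

Lemma borel_pair_open d (T : measurableType d) (V W : normedModType R)
  (v : nat -> V) (w : nat -> W) (D : set T) (X : T -> V) (Y : T -> W)
  (O : set (V * W)) : dense_seq v -> dense_seq w -> measurable D ->
 measurable_fun D (X : T -> borel V) -> measurable_fun D (Y : T -> borel W) ->
 open O -> measurable (D `&` [set z | O (X z, Y z)]).
Proof.
move=> dv dw mD mX mY oO.
rewrite (_ : _ `&` _ = \bigcup_n \bigcup_m \bigcup_(k in
  [set k | ball (v n) (k.+1%:R^-1 : R) `*` ball (w m) (k.+1%:R^-1 : R) `<=` O])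
  ((D `&` (fun z => `|X z - v n|) @^-1` `]-oo, k.+1%:R^-1[) `&`
  (D `&` (fun z => `|Y z - w m|) @^-1` `]-oo, k.+1%:R^-1[))).
 apply: bigcupT_measurable => n; apply: bigcupT_measurable => m. apply: bigcup_measurable => k _.
 by apply: measurableI; apply: borel_norm.
apply/seteqP; split=> [z [Dz Oz]|z [n _ [m _ [k] /= kU [[Dz +] [_ +]]]]].
 have /nbhs_ballP[e /= e0 eO] : nbhs (X z, Y z) O by exact: open_nbhs_nbhs.
 have [k kE] : exists k : nat, k.+1%:R^-1 < e / 2.
  have [k _ /(_ _ (leqnn _))] := near_infty_natSinv_lt (PosNum (divr_gt0 e0 (ltr0n R 2))).
  by exists k.
 have [n vn] := dv (X z) (k.+1%:R^-1) (ltac:(by rewrite invr_gt0)).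
 have [m wm] := dw (Y z) (k.+1%:R^-1) (ltac:(by rewrite invr_gt0)).
 exists n => //; exists m => //; exists k => /=; last first.
  by split; split => //=; rewrite in_itv.
 move=> [x y] []; rewrite -!ball_normE /= => vx wy; apply: eO. split; rewrite -ball_normE /=.
  apply: (le_lt_trans (ler_distD (v n) _ _)). by rewrite (splitr e) ltrD// (lt_trans _ kE).
 apply: (le_lt_trans (ler_distD (w m) _ _)). by rewrite (splitr e) ltrD// (lt_trans _ kE).
rewrite /= !in_itv/= => Xz Yz; split => //.
by apply: kU; split; rewrite -ball_normE /= distrC.
Qed.

(** Continuity is only available on a subset: the coefficients are continuous on [H] times [L0], and
    [U (s - r)] only makes sense for [r <= s]. A preimage is then the trace on [A] of an open set
    [G], and [(X, Y)] never leaves [A]. *)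
Lemma borel_comp2 d (T : measurableType d) (V W : normedModType R)
  (U : ptopologicalType) (v : nat -> V) (w : nat -> W) (D : set T)
  (X : T -> V) (Y : T -> W) (A : set (V * W)) (f : V * W -> U) :
 dense_seq v -> dense_seq w -> measurable D ->
 measurable_fun D (X : T -> borel V) -> measurable_fun D (Y : T -> borel W) ->
 (forall z, D z -> A (X z, Y z)) -> {within A, continuous f} ->
 measurable_fun D ((fun z => f (X z, Y z)) : T -> borel U).
Proof.
move=> dv dw mD mX mY AXY /continuousP cf.
apply: (@measurability _ _ _ (borel U) D _ (@open U)) => //.
move=> _ [B oB <-].
have /open_subspaceP[G oG GA] := cf B oB.
have -> : D `&` (fun z => f (X z, Y z)) @^-1` B = D `&` [set z | G (X z, Y z)].
 apply/seteqP; split => z [Dz] /= Bz; split => //.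
  have [] // : (G `&` A) (X z, Y z). by rewrite GA; split => //; exact: AXY.
 have [] // : ((f : subspace A -> U) @^-1` B `&` A) (X z, Y z).
 by rewrite -GA; split => //; exact: AXY.
exact: (borel_pair_open dv dw).
Qed.

Lemma borelD d (T : measurableType d) (V : normedModType R) (v : nat -> V)
  (D : set T) (X Y : T -> V) : dense_seq v -> measurable D ->
 measurable_fun D (X : T -> borel V) -> measurable_fun D (Y : T -> borel V) ->
 measurable_fun D ((fun z => X z + Y z) : T -> borel V).
Proof.
move=> dv mD mX mY.
apply: (@borel_comp2 _ _ _ _ _ v v D X Y setT (fun z => z.1 + z.2)) => //.
apply: continuous_subspaceT => z.
exact: add_continuous.
Qed.

Lemma dense_seq_real : exists w : nat -> R, dense_seq w.
Proof.
apply: separable_seq; exists (range (@ratr R)).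
 by apply: sub_countable (card_image_le _ _) _; exact: countableP.
exact: dense_rat.
Qed.

Lemma borelZ d (T : measurableType d) (V : normedModType R) (v : nat -> V)
  (D : set T) (c : T -> R) (Y : T -> V) : dense_seq v -> measurable D ->
 measurable_fun D c -> measurable_fun D (Y : T -> borel V) ->
 measurable_fun D ((fun z => c z *: Y z) : T -> borel V).
Proof.
move=> dv mD /borel_real mX mY; have [w dw] := dense_seq_real.
apply: (@borel_comp2 _ _ _ _ _ w v D c Y setT (fun z => z.1 *: z.2)) => //.
 exact: mX.
apply: continuous_subspaceT => z.
exact: scale_continuous.
Qed.

Lemma borelB d (T : measurableType d) (V : normedModType R) (v : nat -> V)
  (D : set T) (X Y : T -> V) : dense_seq v -> measurable D ->
 measurable_fun D (X : T -> borel V) -> measurable_fun D (Y : T -> borel V) ->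
 measurable_fun D ((fun z => X z - Y z) : T -> borel V).
Proof.
move=> dv mD mX mY; apply: (borelD dv) => //.
under eq_fun do rewrite -scaleN1r.
by apply: (borelZ dv) => //; exact: mcst.
Qed.

Lemma borel_sum d (T : measurableType d) (V : normedModType R) (v : nat -> V)
  (D : set T) (I : Type) (s : seq I) (X : I -> T -> V) : dense_seq v ->
 measurable D -> (forall i, measurable_fun D (X i : T -> borel V)) ->
 measurable_fun D ((fun z => \sum_(i <- s) X i z) : T -> borel V).
Proof.
move=> dv mD mX; elim: s => [|i s IH].
 by under eq_fun do rewrite big_nil; exact: mcst.
under eq_fun do rewrite big_cons.
by apply: (borelD dv).
Qed.

Lemma borel_norm0 d (T : measurableType d) (V : normedModType R) (D : set T)
  (f : T -> V) : measurable D ->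
 measurable_fun D (f : T -> borel V) -> measurable_fun D (fun z => `|f z| : R).
Proof.
move=> mD mf; under eq_fun do rewrite -[f _]subr0.
exact: borel_norm.
Qed.

Lemma borel_normX d (T : measurableType d) (V : normedModType R) (D : set T)
  (f : T -> V) n : measurable D ->
 measurable_fun D (f : T -> borel V) -> measurable_fun D (fun z => `|f z| ^+ n : R).
Proof. by move=> mD mf; apply: measurable_funX; exact: borel_norm0. Qed.

End Borel.

(** * A reflexive procedure for identities in abelian groups *)

Section Abel.
Variables (V : zmodType).

Inductive gexp := GVar of nat | GAdd of gexp & gexp | GOpp of gexp | GZero.

Fixpoint geval (e : seq V) (x : gexp) : V := match x with
 | GVar n => nth 0 e n
 | GAdd a b => geval e a + geval e b
 | GOpp a => - geval e a
 | GZero => 0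
 end.

Fixpoint gcoef (x : gexp) (i : nat) : int := match x with
 | GVar n => (i == n)%:Z
 | GAdd a b => gcoef a i + gcoef b i
 | GOpp a => - gcoef a i
 | GZero => 0
 end.

Lemma gevalE e x : geval e x = \sum_(i < size e) nth 0 e i *~ gcoef x i.
Proof.
elim: x => [n|a IHa b IHb|a IHa|] /=; rewrite ?IHa ?IHb.
- have [nm|mn] := ltnP n (size e).
  rewrite (bigD1 (Ordinal nm))//= eqxx big1 ?addr0// => i /negbTE ni.
  by rewrite (_ : (val i == n) = false) ?mulr0z.
 rewrite nth_default// big1// => i _. by rewrite ltn_eqF ?mulr0z// (leq_trans _ mn).
- by rewrite -big_split/=; apply: eq_bigr => i _; rewrite mulrzDr.
- by rewrite -sumrN; apply: eq_bigr => i _; rewrite mulrNz.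
- by rewrite big1// => i _; rewrite mulr0z.
Qed.

(** A group expression is determined by the integer coefficients of its atoms, and these are
    compared by computation. The tactic [abel] reifies both sides and applies this lemma; it serves
    for vectors, where [ring] does not apply. *)
Lemma geval_eq e x y : all (fun i => gcoef x i == gcoef y i) (iota 0 (size e)) ->
 geval e x = geval e y.
Proof.
move=> /allP h; rewrite !gevalE; apply: eq_bigr => i _.
by rewrite (eqP (h i _))// mem_iota ltn_ord.
Qed.

End Abel.

Ltac gindex x l := lazymatch l with
 | x :: _ => constr:(O)
 | _ :: ?l' => let n := gindex x l' in constr:(S n)
 end.
Ltac gmem x l := lazymatch l with
 | nil => constr:(false)
 | x :: _ => constr:(true)
 | _ :: ?l' => gmem x l'
 end.
Ltac gatoms t l := lazymatch t with
 | GRing.add ?a ?b => let l1 := gatoms a l in gatoms b l1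
 | GRing.opp ?a => gatoms a l
 | GRing.zero => l
 | _ => let b := gmem t l in lazymatch b with true => l | false => constr:(t :: l) end
 end.
Ltac greify t l := lazymatch t with
 | GRing.add ?a ?b => let x := greify a l in let y := greify b l in constr:(GAdd x y)
 | GRing.opp ?a => let x := greify a l in constr:(GOpp x)
 | GRing.zero => constr:(GZero)
 | _ => let n := gindex t l in constr:(GVar n)
 end.
Ltac abel := lazymatch goal with
 | |- @eq ?V ?a ?b => let l0 := gatoms a (@nil V) in let l := gatoms b l0 in
   let x := greify a l in let y := greify b l in
   exact: (@geval_eq _ l x y (erefl true))
 end.

(** * Finite orthonormal families *)

Section Inner.
Variables (R : realType) (H : hilbertType R).
Implicit Types x y z : H.

Lemma inner0r x : inner x 0 = 0.
Proof. by rewrite innerC inner0l. Qed.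

Lemma innerNl x y : inner (- x) y = - inner x y.
Proof. by rewrite -scaleN1r innerZl mulN1r. Qed.

Lemma innerNr x y : inner x (- y) = - inner x y.
Proof. by rewrite innerC innerNl innerC. Qed.

Lemma innerBl x y z : inner (x - y) z = inner x z - inner y z.
Proof. by rewrite innerDl innerNl. Qed.

Lemma innerBr x y z : inner x (y - z) = inner x y - inner x z.
Proof. by rewrite innerDr innerNr. Qed.

Lemma inner_suml (I : Type) (s : seq I) (f : I -> H) y :
 inner (\sum_(i <- s) f i) y = \sum_(i <- s) inner (f i) y.
Proof.
apply: (big_morph (fun x => inner x y)) => [u v|]; first exact: innerDl.
exact: inner0l.
Qed.

Lemma inner_sum (I : Type) (s : seq I) (f : I -> H) y :
 inner y (\sum_(i <- s) f i) = \sum_(i <- s) inner y (f i).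
Proof. by rewrite innerC inner_suml; under eq_bigr do rewrite innerC. Qed.

Lemma normD_inner x y : `|x + y| ^+ 2 = `|x| ^+ 2 + 2 * inner x y + `|y| ^+ 2.
Proof. rewrite -!innerxx innerDl !innerDr (innerC y x); ring. Qed.

Lemma inner_le x y : `|inner x y| <= `|x| * `|y|.
Proof.
have [->|y0] := eqVneq y 0; first by rewrite inner0r !normr0 mulr0.
have ny : 0 < `|y| by rewrite normr_gt0.
pose c := inner x y / `|y| ^+ 2.
have : 0 <= `|x + (- c) *: y| ^+ 2 by rewrite sqr_ge0.
rewrite normD_inner normrZ innerZr normrN exprMn -[`|c| ^+ 2]normrX.
rewrite (ger0_norm (sqr_ge0 c)) => h.
rewrite -(@ler_pXn2r _ 2)// ?nnegrE ?mulr_ge0// exprMn -normrX.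
rewrite (ger0_norm (sqr_ge0 _)).
have cE : inner x y = c * `|y| ^+ 2 by rewrite /c divfK// expf_neq0// gt_eqF.
have : 0 <= `|y| ^+ 2 * (`|x| ^+ 2 + 2 * (- c * inner x y) + c ^+ 2 * `|y| ^+ 2).
 by rewrite mulr_ge0// sqr_ge0.
rewrite {1 2}cE; nra.
Qed.

Lemma orthonormal_norm n (g : 'I_n -> H) (c : 'I_n -> R) : orthonormal g ->
 `|\sum_i c i *: g i| ^+ 2 = \sum_i c i ^+ 2.
Proof.
move=> og; rewrite -innerxx inner_suml; apply: eq_bigr => i _.
rewrite innerZl inner_sum (bigD1 i)//= big1 ?addr0 => [|j ji].
 by rewrite innerZr og eqxx mulr1 -expr2.
by rewrite innerZr og eq_sym (negbTE ji) mulr0.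
Qed.

(** Membership in the span of [g], written as a Fourier expansion, which is the form in which
    Parseval and coordinates are used. *)
Definition spanned n (g : 'I_n -> H) (y : H) := y = \sum_i inner y (g i) *: g i.

Lemma spanned_norm n (g : 'I_n -> H) y : orthonormal g -> spanned g y ->
 `|y| ^+ 2 = \sum_i inner y (g i) ^+ 2.
Proof. by move=> og yE; rewrite {1}yE orthonormal_norm. Qed.

Definition ocons n (g : 'I_n -> H) (u : H) (i : 'I_n.+1) : H :=
 if unlift ord0 i is Some j then g j else u.

Lemma ocons0 n (g : 'I_n -> H) u : ocons g u ord0 = u.
Proof. by rewrite /ocons unlift_none. Qed.

Lemma oconsS n (g : 'I_n -> H) u j : ocons g u (lift ord0 j) = g j.
Proof. by rewrite /ocons liftK. Qed.

Lemma ocons_orthonormal n (g : 'I_n -> H) u : orthonormal g -> `|u| = 1 ->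
 (forall i, inner u (g i) = 0) -> orthonormal (ocons g u).
Proof.
move=> og u1 ug i j.
case: (unliftP ord0 i) => [i'|] ->; case: (unliftP ord0 j) => [j'|] ->; rewrite ?oconsS ?ocons0.
- by rewrite og (inj_eq lift_inj).
- by rewrite innerC ug eq_sym (negbTE (neq_lift _ _)).
- by rewrite ug (negbTE (neq_lift _ _)).
- by rewrite innerxx u1 expr1n eqxx.
Qed.

(** The vectors of [ys] are adjoined one at a time: the residual [z] is either zero or, once
    normalized, a new unit vector orthogonal to the old ones, so that earlier expansions survive.
    Such finite families replace an infinite orthonormal basis everywhere below. *)
Lemma gram_schmidt (n0 : nat) (g0 : 'I_n0 -> H) (ys : seq H) : orthonormal g0 ->
 exists n (g : 'I_n -> H), [/\ orthonormal g,
  (forall y, y \in ys -> spanned g y) & (forall y, spanned g0 y -> spanned g y)].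
Proof.
move=> og0; elim: ys => [|y ys [n [g [og gs g0g]]]]; first by exists n0, g0.
pose z := y - \sum_i inner y (g i) *: g i.
have zg i : inner z (g i) = 0.
 rewrite innerBl inner_suml (bigD1 i)//= innerZl og eqxx mulr1 big1 ?addr0 ?subrr//.
 by move=> j ji; rewrite innerZl og (negbTE ji) mulr0.
have [z0|z0] := eqVneq z 0.
 exists n, g; split=> // x; rewrite inE => /predU1P[->|]; last exact: gs.
 by apply/eqP; rewrite -subr_eq0; exact/eqP.
pose u := `|z|^-1 *: z.
have nz : `|z| != 0 by rewrite normr_eq0.
have u1 : `|u| = 1 by rewrite normrZ normfV normr_id mulVf.
have ug i : inner u (g i) = 0 by rewrite innerZl zg mulr0.
have ou := ocons_orthonormal og u1 ug.
have ext x : spanned g x -> spanned (ocons g u) x.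
 move=> xE; rewrite /spanned big_ord_recl ocons0. under eq_bigr do rewrite oconsS.
 rewrite (_ : inner x u = 0) ?scale0r ?add0r//. rewrite xE inner_suml big1// => i _.
 by rewrite innerZl [X in _ * X]innerC ug mulr0.
exists n.+1, (ocons g u); split=> // [x|x /g0g/ext//].
rewrite inE => /predU1P[->|/gs/ext//].
rewrite /spanned big_ord_recl ocons0.
under eq_bigr do rewrite oconsS.
have -> : inner y u *: u = z.
 have yz : y = z + \sum_i inner y (g i) *: g i by rewrite subrK.
 rewrite {1}yz innerDl inner_suml [X in _ + X]big1 ?addr0; last first.
  by move=> i _; rewrite innerZl [X in _ * X]innerC ug mulr0.
 rewrite innerZr innerxx scalerA -[RHS]scale1r; congr (_ *: _). by field.
by rewrite subrK.
Qed.

Lemma orthonormal0 (f : 'I_0 -> H) : orthonormal f.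
Proof. by case. Qed.

End Inner.

(** * Finite rank approximation in the Hilbert-Schmidt norm *)

Section HS.
Variables (R : realType) (Xi H : hilbertType R).
Implicit Types (f g : hs Xi H) (c : seq (Xi * H)).

Lemma hs_normE f : `|f| = hs_norm f.
Proof. by []. Qed.

Lemma hs_sumE (I : Type) (s : seq I) (F : I -> hs Xi H) y :
 (\sum_(i <- s) F i) y = \sum_(i <- s) F i y.
Proof. by elim/big_rec2: _ => //= i a b _ <-. Qed.

Lemma hsBE f g y : (f - g) y = f y - g y. Proof. by []. Qed.
Lemma hs_ge f n (e : 'I_n -> Xi) : orthonormal e -> \sum_i `|f (e i)| ^+ 2 <= `|f| ^+ 2.
Proof. exact: (hs_norm_ub (hs_ubound f)). Qed.

Lemma hs_le f (M : R) : 0 <= M -> (forall n (e : 'I_n -> Xi), orthonormal e ->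
 \sum_i `|f (e i)| ^+ 2 <= M ^+ 2) -> `|f| <= M.
Proof. by move=> M0 fM; have [] := hs_norm_le M0 fM. Qed.

Definition rk c : hs Xi H := \sum_(x <- c) rank1 x.1 x.2.

Lemma rkE c y : rk c y = \sum_(x <- c) inner x.1 y *: x.2.
Proof. exact: hs_sumE. Qed.

(** The adjoint of [rk c] applied to [g p]: pairing with it gives the coordinate of [rk c y] along
    [g p]. *)
Definition rk_coord c n (g : 'I_n -> H) (p : 'I_n) : Xi := \sum_(x <- c) inner x.2 (g p) *: x.1.

Lemma rk_coordE c n (g : 'I_n -> H) (F : Xi -> R) : (forall x, x \in c -> spanned g x.2) ->
 \sum_(x <- c) F x.1 *: x.2 =
 \sum_p (\sum_(x <- c) inner x.2 (g p) * F x.1) *: g p.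
Proof.
move=> cg; under [RHS]eq_bigr do rewrite scaler_suml.
rewrite exchange_big/=; apply: eq_big_seq => x xc.
rewrite {1}(cg _ xc) scaler_sumr; apply: eq_bigr => p _.
by rewrite scalerA mulrC.
Qed.

Lemma rk_apply c n (g : 'I_n -> H) y : (forall x, x \in c -> spanned g x.2) ->
 rk c y = \sum_p inner (rk_coord c g p) y *: g p.
Proof.
move=> cg; rewrite rkE (rk_coordE (fun x => inner x y) cg).
apply: eq_bigr => p _; rewrite inner_suml; congr (_ *: _).
by apply: eq_bigr => x _; rewrite innerZl.
Qed.

(** Bessel bounds the sums over all orthonormal families of [Xi], and a family that spans the
    finitely many vectors [rk_coord c g p] attains the bound. *)
Lemma rk_norm c n (g : 'I_n -> H) : orthonormal g -> (forall x, x \in c -> spanned g x.2) ->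
 `|rk c| ^+ 2 = \sum_p `|rk_coord c g p| ^+ 2.
Proof.
move=> og cg.
have E := rk_apply _ cg.
apply/eqP; rewrite eq_le; apply/andP; split.
 set M := \sum_p _; have M0 : 0 <= M by apply: sumr_ge0 => p _; exact: sqr_ge0.
 rewrite -(sqr_sqrtr M0) ler_sqr ?nnegrE ?sqrtr_ge0 ?normr_ge0//.
 apply: hs_le; first exact: sqrtr_ge0. move=> m e oe; rewrite (sqr_sqrtr M0).
 under eq_bigr do rewrite E orthonormal_norm//.
 rewrite exchange_big; apply: ler_sum => p _; exact: bessel.
have [m [e [oe eE _]]] := gram_schmidt [seq rk_coord c g p | p <- enum 'I_n]
  (@orthonormal0 _ _ (fun=> 0 : Xi)).
apply: le_trans (hs_ge (rk c) oe).
under [leRHS]eq_bigr do rewrite E orthonormal_norm//.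
rewrite exchange_big; apply: ler_sum => p _.
by rewrite (spanned_norm oe)//; apply: eE; apply: map_f; rewrite mem_enum.
Qed.

Lemma rank1_le (x : Xi) (h : H) : `|rank1 x h| <= `|x| * `|h|.
Proof.
apply: hs_le => [|n e oe]; first by rewrite mulr_ge0.
under eq_bigr do rewrite normrZ exprMn real_normK ?num_real//.
rewrite -mulr_suml exprMn; apply: ler_wpM2r; first exact: sqr_ge0.
exact: bessel.
Qed.

(** Choose [u] orthonormal with [|f u_i|^2] summing up to almost [|f|^2], and let [Pm] be the
    projection on its span. The remainder is [f (1 - Pm)], and its square norm is at most [|f|^2]
    minus that sum, by Pythagoras. *)
Lemma hs_finite_rank f (e : R) : 0 < e ->
 exists n (u : 'I_n -> Xi), `|f - \sum_i rank1 (u i) (f (u i))| <= e.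
Proof.
move=> e0; have [n [u [ou]]] : exists n (u : 'I_n -> Xi), orthonormal u /\
  `|f| ^+ 2 - e ^+ 2 < \sum_i `|f (u i)| ^+ 2.
 have hs : has_sup (hs_sums f) by split; [exists 0; exact: hs_sums0|exact: hs_ubound].
 have [_ [n [u [ou ->]]] h] := sup_adherent (exprn_gt0 2 e0) hs.
 exists n, u; split => //; rewrite hs_normE sqr_sqrtr//.
 by apply: ub_le_sup; [exact: hs_ubound|exact: hs_sums0].
move=> uf; exists n, u; apply: hs_le => [|m w ow]; first exact: ltW.
pose Pm x : Xi := \sum_i inner x (u i) *: u i.
have fE x : (f - \sum_i rank1 (u i) (f (u i))) x = f (x - Pm x).
 rewrite hsBE hs_sumE (linearB f) (linear_sum f); congr (_ - _).
 by apply: eq_bigr => i _; rewrite linearZ innerC.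
have Pu x i : inner (x - Pm x) (u i) = 0.
 rewrite innerBl inner_suml (bigD1 i)//= innerZl ou eqxx mulr1 big1 ?addr0 ?subrr//.
 by move=> j ji; rewrite innerZl ou (negbTE ji) mulr0.
have Psym x y : inner x (y - Pm y) = inner (x - Pm x) y.
 rewrite innerBr innerBl inner_suml inner_sum; congr (_ - _).
 by apply: eq_bigr => i _; rewrite innerZl innerZr mulrC (innerC y).
have Pnorm x : `|x - Pm x| ^+ 2 = `|x| ^+ 2 - \sum_i inner x (u i) ^+ 2.
 have Pz : Pm (x - Pm x) = 0.
  by rewrite /Pm big1// => i _; rewrite Pu scale0r.
 rewrite -innerxx -Psym Pz subr0 innerBr innerxx inner_sum; congr (_ - _).
 by apply: eq_bigr => i _; rewrite innerZr expr2.
(* For a test family [w], only the finite dimensional span of [v] matters. There [|f x|^2] is the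
   sum of the squares of the linear forms [phi l], so [1 - Pm] can be moved from [w] onto [phi l];
   Bessel for [w] and Pythagoras for [phi l] conclude. *)
have [k [v [ov vw uv]]] := gram_schmidt [seq w j - Pm (w j) | j <- enum 'I_m] ou.
have [q [g [og gf _]]] := gram_schmidt [seq f (v l) | l <- enum 'I_k]
  (@orthonormal0 _ _ (fun=> 0 : H)).
pose c := [seq (v l, f (v l)) | l <- enum 'I_k].
have cg x : x \in c -> spanned g x.2.
 by move=> /mapP[l _ ->]; apply: gf; apply: map_f; rewrite mem_enum.
pose phi := rk_coord c g.
have A x : spanned v x -> `|f x| ^+ 2 = \sum_l inner (phi l) x ^+ 2.
 move=> vx; rewrite -(orthonormal_norm (fun l => inner (phi l) x) og).
 rewrite -rk_apply// rkE big_map big_enum/=.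
 congr (`|_| ^+ 2); rewrite {1}vx linear_sum; apply: eq_bigr => i _. by rewrite linearZ innerC.
have B : \sum_l `|phi l| ^+ 2 <= `|f| ^+ 2.
 apply: le_trans (hs_ge f ov).
 under eq_bigr do rewrite /phi /rk_coord big_map big_enum /= orthonormal_norm//.
 rewrite exchange_big; apply: ler_sum => l _.
 by rewrite -spanned_norm//; apply: gf; apply: map_f; rewrite mem_enum.
under eq_bigr => j _.
 rewrite fE A; last by apply: vw; apply: map_f; rewrite mem_enum. under eq_bigr do rewrite Psym.
 over.
rewrite exchange_big/=.
apply: (@le_trans _ _ (\sum_l `|phi l - Pm (phi l)| ^+ 2)).
 by apply: ler_sum => l _; exact: bessel.
under eq_bigr do rewrite Pnorm.
rewrite sumrB exchange_big/=.
rewrite (eq_bigr (fun i => `|f (u i)| ^+ 2)); last first.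
 move=> i _; rewrite A//; apply: uv; rewrite /spanned (bigD1 i)//= big1.
  by rewrite ou eqxx scale1r addr0.
 by move=> j ji; rewrite ou eq_sym (negbTE ji) scale0r.
by apply: (le_trans (lerB B (lexx _))); lra.
Qed.

Lemma sub_rank1 (x x' : Xi) (h h' : H) :
 `|rank1 x h - rank1 x' h'| <= `|x - x'| * `|h| + `|x'| * `|h - h'|.
Proof.
have -> : rank1 x h - rank1 x' h' = rank1 (x - x') h + rank1 x' (h - h').
 apply/val_inj/funext => y. change (inner x y *: h - inner x' y *: h' =
     inner (x - x') y *: h + inner x' y *: (h - h')).
 by rewrite innerBl scalerBl scalerBr addrA subrK.
by apply: le_trans (ler_normD _ _) _; rewrite lerD// rank1_le.
Qed.

(** After truncation to finite rank, each vector is replaced by one of the dense sequences. The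
    remaining data are finite lists of pairs of integers, which [pickle] enumerates. *)
Lemma hs_dense_seq : separable Xi -> separable H ->
 exists c : nat -> seq (Xi * H), dense_seq (fun n => rk (c n)).
Proof.
move=> /separable_seq[x dx] /separable_seq[h dh].
pose ev (l : seq (nat * nat)) := [seq (x i.1, h i.2) | i <- l].
exists (fun n => if unpickle n is Some l then ev l else [::]) => f e e0.
suff [l fl] : exists l : seq (nat * nat), `|f - rk (ev l)| < e.
 by exists (pickle l); rewrite pickleK.
have [n [u fu]] := hs_finite_rank f (divr_gt0 e0 (ltr0n R 2)).
have app (y : Xi) (z : H) (d : R) : 0 < d ->
  exists i : nat * nat, `|rank1 y z - rank1 (x i.1) (h i.2)| < d.
 move=> d0; have z0 : 0 < `|z| + 1 by rewrite ltr_wpDl.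
 have [i yi] := dx y _ (divr_gt0 (divr_gt0 d0 (ltr0n R 2)) z0).
 have x0 : 0 < `|x i| + 1 by rewrite ltr_wpDl.
 have [j zj] := dh z _ (divr_gt0 (divr_gt0 d0 (ltr0n R 2)) x0).
 exists (i, j); apply: le_lt_trans (sub_rank1 _ _ _ _) _ => /=.
 move: yi zj; rewrite !ltr_pdivlMr// !mulrDr !mulr1 => yi zj.
 have := normr_ge0 (y - x i); have := normr_ge0 (z - h j); lra.
have e2 : 0 < e / 2 / n.+1%:R by rewrite !divr_gt0.
have [i iP] := choice (fun j => app (u j) (f (u j)) _ e2).
exists [seq i j | j <- enum 'I_n].
have -> : rk (ev [seq i j | j <- enum 'I_n]) = \sum_j rank1 (x (i j).1) (h (i j).2).
 by rewrite /rk /ev !big_map -big_enum.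
apply: (le_lt_trans (ler_distD (\sum_i0 rank1 (u i0) (f (u i0))) _ _)).
rewrite (splitr e) ler_ltD// -sumrB; apply: le_lt_trans (ler_norm_sum _ _ _) _.
apply: (@le_lt_trans _ _ (\sum_(j < n) e / 2 / n.+1%:R)).
 by apply: ler_sum => j _; exact/ltW/iP.
rewrite sumr_const card_ord -[ltLHS]mulr_natr -mulrA gtr_pMr ?divr_gt0//.
by rewrite mulrC ltr_pdivrMr// mul1r ltr_nat.
Qed.

End HS.

(** * Contraction semigroups acting on vectors and on Hilbert-Schmidt operators *)

Section HSComp.
Variables (R : realType) (Xi H : hilbertType R) (S : R -> bounded_op H H)
 (hS : contraction_semigroup S).
Implicit Types (f g : hs Xi H).

Lemma sg_contr s x : 0 <= s -> `|S s x| <= `|x|.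
Proof. by case: hS => _ _ _; apply. Qed.

Lemma sg_add s r x : 0 <= s -> 0 <= r -> S (s + r) x = S s (S r x).
Proof. by case: hS => _ h _ _; exact: h. Qed.

Lemma sg0 x : S 0 x = x.
Proof. by case: hS. Qed.

Lemma sg_right x (e : R) : 0 < e -> exists2 d, 0 < d & forall s, 0 <= s < d -> `|S s x - x| < e.
Proof.
case: hS => _ _ /(_ x) + _ e0.
move=> /cvgrPdist_lt/(_ _ e0)[d /= d0 h]; exists d => // s /andP[].
rewrite le_eqVlt => /predU1P[<- _|s0 sd]; first by rewrite sg0 subrr normr0.
by rewrite distrC; apply: h => //=; rewrite sub0r normrN gtr0_norm.
Qed.

Lemma hs_comp_contr s f : 0 <= s -> `|hs_comp (S s) f| <= `|f|.
Proof.
move=> s0; apply: hs_le => // n e oe.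
apply: le_trans (hs_ge f oe); apply: ler_sum => i _.
by rewrite ler_sqr ?nnegrE// sg_contr.
Qed.

Lemma hs_compD s f g : hs_comp (S s) (f + g) = hs_comp (S s) f + hs_comp (S s) g.
Proof. by apply/val_inj/funext => y; exact: (linearD (S s)). Qed.

Lemma hs_compZ s k f : hs_comp (S s) (k *: f) = k *: hs_comp (S s) f.
Proof. by apply/val_inj/funext => y; exact: (linearZZ (S s)). Qed.

Lemma hs_compB s f g : hs_comp (S s) (f - g) = hs_comp (S s) f - hs_comp (S s) g.
Proof. by rewrite -scaleN1r hs_compD hs_compZ scaleN1r. Qed.

Lemma hs_comp_rank1 s (x : Xi) (h : H) : hs_comp (S s) (rank1 x h) = rank1 x (S s h).
Proof. by apply/val_inj/funext => y /=; rewrite linearZ. Qed.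

Lemma hs_comp_sum s (I : Type) (l : seq I) (F : I -> hs Xi H) :
 hs_comp (S s) (\sum_(i <- l) F i) = \sum_(i <- l) hs_comp (S s) (F i).
Proof.
elim: l => [|i l IH]; last by rewrite !big_cons hs_compD IH.
by rewrite !big_nil; apply/val_inj/funext => y /=; rewrite linear0.
Qed.

Lemma hs_comp_add s r f : 0 <= s -> 0 <= r ->
 hs_comp (S (s + r)) f = hs_comp (S s) (hs_comp (S r) f).
Proof. by move=> s0 r0; apply/val_inj/funext => y /=; rewrite sg_add. Qed.

(** Strong continuity gives the claim for operators of rank one and hence for finite sums;
    contractivity carries it over to [f], with a quarter of [e] for each of the three error
    terms. *)
Lemma hs_comp_right f (e : R) : 0 < e ->
 exists2 d, 0 < d & forall s, 0 <= s < d -> `|hs_comp (S s) f - f| < e.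
Proof.
move=> e0; pose P g := forall e', 0 < e' ->
 exists2 d, 0 < d & forall s, 0 <= s < d -> `|hs_comp (S s) g - g| < e'.
have P1 x h : P (rank1 x h).
 move=> e' e'0; have x0 : 0 < `|x| + 1 by rewrite ltr_wpDl.
 have [d d0 dP] := sg_right h (divr_gt0 e'0 x0). exists d => // s sd; rewrite hs_comp_rank1.
 apply: le_lt_trans (sub_rank1 _ _ _ _) _; rewrite subrr normr0 mul0r add0r.
 have := dP _ sd; rewrite ltr_pdivlMr//; apply: le_lt_trans. by rewrite mulrC ler_wpM2l// lerDl.
have P0 : P 0.
 by move=> e' e'0; exists 1 => // s _; rewrite -(scale0r 0) hs_compZ !scale0r subrr normr0.
have PD g h : P g -> P h -> P (g + h).
 move=> Pg Ph e' e'0; have e2 : 0 < e' / 2 by rewrite divr_gt0.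
 have [d d0 dP] := Pg _ e2; have [d' d'0 d'P] := Ph _ e2.
 exists (Num.min d d'); first by rewrite lt_min d0.
 move=> s /andP[s0]; rewrite lt_min => /andP[sd sd']. rewrite hs_compD opprD addrACA (splitr e').
 apply: le_lt_trans (ler_normD _ _) _. by apply: ltrD; [apply: dP|apply: d'P]; apply/andP.
have e4 : 0 < e / 4 by rewrite divr_gt0.
have [n [u fu]] := hs_finite_rank f e4.
set g := \sum_i _ in fu.
have Pg : P g by rewrite /g; elim/big_ind: _ => // i _; exact: P1.
have [d d0 dP] := Pg _ e4.
exists d => // s sd; have /andP[s0 _] := sd.
have -> : hs_comp (S s) f - f = hs_comp (S s) (f - g) + (hs_comp (S s) g - g)
  - (f - g).
 by rewrite hs_compB; abel.
have := hs_comp_contr (f - g) s0; have := dP _ sd; move: fu => A B C.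
apply: le_lt_trans (ler_normB _ _) _; apply: le_lt_trans (lerD (ler_normD _ _) (lexx _)) _.
move: A B C; move: `|f - g| `|_ - g| `|hs_comp _ _| => a1 a2 a3; lra.
Qed.

End HSComp.

Section JointCont.
Variables (R : realType) (V : normedModType R) (U : R -> V -> V) (U0 : forall x, U 0 x = x)
 (Uadd : forall s r x, 0 <= s -> 0 <= r -> U (s + r) x = U s (U r x))
 (UB : forall s x y, U s (x - y) = U s x - U s y)
 (Uc : forall s x, 0 <= s -> `|U s x| <= `|x|)
 (Ur : forall x e, 0 < e -> exists2 d, 0 < d & forall s, 0 <= s < d -> `|U s x - x| < e).

(** The common part [U (min s r)] factors out and is a contraction, which leaves the orbit of [y] at
    time [|s - r|] near its start. The abstract [U] is used both for [S] on [H] and for composition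
    with [S] on [hs]. *)
Lemma semigroup_dist s r x y : 0 <= s -> 0 <= r ->
 `|U s x - U r y| <= `|U `|s - r| y - y| + `|x - y|.
Proof.
move=> s0 r0; have -> : U s x - U r y = (U s y - U r y) + U s (x - y).
 by rewrite UB; abel.
apply: le_trans (ler_normD _ _) _; apply: lerD; last exact: Uc.
have [sr|/ltW rs] := leP s r.
 have -> : U r y = U s (U (r - s) y) by rewrite -Uadd ?subr_ge0// addrC subrK.
 rewrite -UB (distrC s) (ger0_norm (_ : 0 <= r - s)) ?subr_ge0//.
 by rewrite -[leRHS]normrN opprB; exact: Uc.
have -> : U s y = U r (U (s - r) y) by rewrite -Uadd ?subr_ge0// addrC subrK.
by rewrite -UB (ger0_norm (_ : 0 <= s - r)) ?subr_ge0//; exact: Uc.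
Qed.

Lemma semigroup_cont (s : R) :
 {within [set z : V * R | z.2 <= s], continuous (fun z => U (s - z.2) z.1)}.
Proof.
apply/subspace_continuousP => -[x r] /= rs; apply/cvgrPdist_lt => e e0.
have e2 : 0 < e / 2 by rewrite divr_gt0.
have [d d0 dP] := Ur x e2.
rewrite near_withinE; apply/nbhs_ballP; exists (Num.min d (e / 2)) => /=.
 by rewrite lt_min d0.
move=> [y q] []; rewrite -!ball_normE /= !lt_min => /andP[_ xy] /andP[rq _] qs.
rewrite distrC; apply: le_lt_trans (semigroup_dist _ _ _ _) _; rewrite ?subr_ge0//.
rewrite (splitr e); apply: ltrD; last by rewrite distrC.
apply: dP; rewrite normr_ge0/=.
by rewrite (_ : s - q - (s - r) = r - q)//; ring.
Qed.

End JointCont.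

(** * Integrals of nonnegative functions *)

Section IntegralMonotone.
Context d (T : measurableType d) (R : realType).
Variables (mu : {measure set T -> \bar R}).
Implicit Types (D : set T) (f g : T -> \bar R).
Local Open Scope ereal_scope.
Import HBNNSimple.

(* The integral of a nonnegative function is a supremum over simple functions,
  so monotonicity needs no measurability. *)
Lemma le_ae_int D f g : measurable D -> (forall x, D x -> 0 <= f x) ->
 (forall x, D x -> 0 <= g x) ->
 {ae mu, forall x, D x -> f x <= g x} ->
 \int[mu]_(x in D) f x <= \int[mu]_(x in D) g x.
Proof.
move=> mD f0 g0 [N [mN N0 fgN]]; rewrite !(integral_mkcond D).
have f0' x : 0 <= (f \_ D) x by apply: erestrict_ge0.
have g0' x : 0 <= (g \_ D) x by apply: erestrict_ge0.
rewrite !ge0_integralTE//; apply: ge_ereal_sup => _ [h /= hf <-].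
have mNC : measurable (~` N) by exact: measurableC.
pose h' := [the {nnsfun T >-> R} of (proj_nnsfun h mNC)].
have h'N x : ~ N x -> h' x = h x.
 by move=> Nx; rewrite (_ : h' x = h x * mindic R mNC x)%R// mindicE mem_set// mulr1.
have h'N0 x : N x -> h' x = 0%R.
 by move=> Nx; rewrite (_ : h' x = h x * mindic R mNC x)%R// mindicE memNset/= ?mulr0//; exact.
have -> : sintegral mu h = sintegral mu h'.
 rewrite -!integralT_nnsfun; apply: ge0_ae_eq_integral => //.
 - exact/mEFinP.
 - exact/mEFinP.
 - by move=> x _; rewrite lee_fin.
 - by move=> x _; rewrite lee_fin.
 exists N; split=> // x; apply: contra_notP => Nx _. by rewrite h'N.
apply: ereal_sup_ubound; exists h' => // x; change ((h' x)%:E <= (g \_ D) x).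
have [Nx|Nx] := pselect (N x); first by rewrite (h'N0 x Nx).
rewrite (h'N x Nx) (le_trans (hf x))// !patchE; case: ifPn => // /set_mem Dx.
by apply: contra_notT Nx => fg; apply: fgN => /= /(_ Dx); exact/negP.
Qed.

Lemma le_int D f g : measurable D -> (forall x, D x -> 0 <= f x) -> (forall x, D x -> f x <= g x) ->
 \int[mu]_(x in D) f x <= \int[mu]_(x in D) g x.
Proof.
move=> mD f0 fg; apply: le_ae_int => //; last exact: aeW.
by move=> x Dx; exact: le_trans (f0 x Dx) (fg x Dx).
Qed.

Lemma intZ D (f : T -> R) (k : R) : measurable D -> measurable_fun D f ->
 (forall x, 0 <= f x)%R -> (0 <= k)%R ->
 \int[mu]_(x in D) (k * f x)%:E = k%:E * \int[mu]_(x in D) (f x)%:E.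
Proof.
move=> mD mf f0 k0; under eq_integral do rewrite EFinM.
rewrite ge0_integralZl_EFin//; first by move=> x _; rewrite lee_fin.
exact/mEFinP.
Qed.

Lemma intD D (f g : T -> R) : measurable D -> measurable_fun D f -> measurable_fun D g ->
 (forall x, 0 <= f x)%R -> (forall x, 0 <= g x)%R ->
 \int[mu]_(x in D) (f x + g x)%:E =
 \int[mu]_(x in D) (f x)%:E + \int[mu]_(x in D) (g x)%:E.
Proof.
move=> mD mf mg f0 g0; under eq_integral do rewrite EFinD.
rewrite ge0_integralD//.
- by move=> x _; rewrite lee_fin.
- exact/mEFinP.
- by move=> x _; rewrite lee_fin.
- exact/mEFinP.
Qed.

End IntegralMonotone.

(** * Gaussian moments, symmetry and independence *)

Section Gauss.
Variables (R : realType).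

Lemma normal_density (s : R) (f : R -> \bar R) : s != 0 -> (forall x, 0 <= f x)%E -> measT f ->
 (\int[normal_prob 0 s]_x f x = \int[leb]_x (f x * (normal_pdf 0 s x)%:E))%E.
Proof.
move=> s0 f0 mf.
have dom := normal_prob_dominates (0 : R) s.
pose nu : {finite_measure set _ -> \bar R} :=
 [the {finite_measure set _ -> \bar R} of normal_prob (0:R) s].
have /= <- := @Radon_Nikodym_SigmaFinite.change_of_variables _ _ R nu
 leb dom f setT f0 measurableT mf.
have fint := Radon_Nikodym_SigmaFinite.f_integrable dom.
apply: ae_eq_integral => //.
- by apply: emeasurable_funM => //; exact: measurable_int fint.
- by apply: emeasurable_funM => //; apply/mEFinP; exact: measurable_normal_pdf.
apply: ae_eqe_mul2l; apply: integral_ae_eq => //.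
- by apply/mEFinP; exact: measurable_normal_pdf.
- by move=> A _ mA; rewrite -Radon_Nikodym_SigmaFinite.f_integral.
Qed.

(** The exponents add up to [- z^2 / (4 s^2)], the exponent of the centred normal law of variance
    [2 s^2]. The peaks differ by a factor of square root of 2, rounded up to 2. *)
Lemma exp_pdf_le (s z : R) : 0 < s -> expR (z ^+ 2 / (4 * s ^+ 2)) * normal_pdf 0 s z <=
 2 * normal_pdf 0 (Num.sqrt 2 * s) z.
Proof.
move=> s0; have s20 : 0 < Num.sqrt 2 * s :> R by rewrite mulr_gt0// sqrtr_gt0.
rewrite !normal_pdfE ?gt_eqF// /normal_fun /normal_peak !subr0 exprMn sqr_sqrtr//.
rewrite mulrCA -expRD [leRHS]mulrA.
have -> : z ^+ 2 / (4 * s ^+ 2) + - z ^+ 2 / (s ^+ 2 *+ 2) =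
  - z ^+ 2 / ((2 * s ^+ 2) *+ 2) by field; rewrite gt_eqF.
apply: ler_wpM2r; first exact: expR_ge0.
have p0 : 0 < s ^+ 2 * pi *+ 2 by rewrite mulrn_wgt0// mulr_gt0 ?exprn_gt0 ?pi_gt0.
have -> : 2 * s ^+ 2 * pi *+ 2 = 2 * (s ^+ 2 * pi *+ 2) by ring.
rewrite sqrtrM// invfM mulrA ler_peMl ?invr_ge0 ?sqrtr_ge0//.
rewrite ler_pdivlMr ?sqrtr_gt0// mul1r -[leRHS]ger0_norm// -sqrtr_sqr.
by rewrite ler_wsqrtr//; lra.
Qed.

Lemma sqr_le_expR (x : R) : 0 <= x -> x ^+ 2 <= 4 * expR x.
Proof.
move=> x0; have -> : x = x / 2 + x / 2 by rewrite -splitr.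
rewrite expRD; have := expR_ge1Dx (x / 2).
have : 0 <= x / 2 by rewrite divr_ge0.
by move: (x / 2) => y y0 h; nra.
Qed.

(** Any function dominated by [c exp (z^2 / (4 s^2))] has integral at most [2 c]. Taking [z^2] and
    [z^4] gives the constants 8 and 128 in place of the sharp 1 and 3, without integration by parts;
    only their finiteness matters later. *)
Lemma normal_moment_le (s : R) (f : R -> R) (c : R) : 0 < s -> 0 <= c -> measT f ->
 (forall z, 0 <= f z <= c * expR (z ^+ 2 / (4 * s ^+ 2))) ->
 (\int[normal_prob 0 s]_x (f x)%:E <= (2 * c)%:E)%E.
Proof.
move=> s0 c0 mf fc; have f0 z : 0 <= f z by case/andP: (fc z).
rewrite normal_density ?gt_eqF//; last exact/mEFinP.
apply: (@le_trans _ _ (\int[leb]_x ((2 * c)%:E * (normal_pdf 0 (Num.sqrt 2 * s) x)%:E))%E).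
 apply: le_int => // z _; first by rewrite mule_ge0 ?lee_fin ?normal_pdf_ge0.
 rewrite lee_fin; apply: (@le_trans _ _ (c * expR (z ^+ 2 / (4 * s ^+ 2)) * normal_pdf 0 s z)).
  by rewrite ler_wpM2r ?normal_pdf_ge0//; case/andP: (fc z).
 rewrite -[leLHS]mulrA -[leRHS]mulrA [leRHS]mulrCA; apply: ler_wpM2l => //. exact: exp_pdf_le.
rewrite ge0_integralZl_EFin ?mulr_ge0//; last 2 first.
- by move=> x _; rewrite lee_fin normal_pdf_ge0.
- by apply/mEFinP; exact: measurable_normal_pdf.
by rewrite integral_normal_pdf mule1.
Qed.

Lemma normal_moment2 (s : R) : 0 < s -> (\int[normal_prob 0 s]_x (x ^+ 2)%:E <= (8 * s ^+ 2)%:E)%E.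
Proof.
move=> s0; have -> : 8 * s ^+ 2 = 2 * (4 * s ^+ 2) by ring.
apply: normal_moment_le => //.
- by rewrite mulr_ge0// sqr_ge0.
- move=> z; rewrite sqr_ge0/=.
 have := expR_ge1Dx (z ^+ 2 / (4 * s ^+ 2)).
 have s20 : 0 < 4 * s ^+ 2 by rewrite mulr_gt0 ?exprn_gt0.
 rewrite -ler_pdivrMl// mulrC; apply: le_trans. by rewrite lerDr.
Qed.

Lemma normal_moment4 (s : R) : 0 < s ->
 (\int[normal_prob 0 s]_x (x ^+ 4)%:E <= (128 * s ^+ 4)%:E)%E.
Proof.
move=> s0; have -> : 128 * s ^+ 4 = 2 * (64 * s ^+ 4) by ring.
apply: normal_moment_le => //.
- by rewrite mulr_ge0// exprn_even_ge0.
- move=> z; rewrite exprn_even_ge0//=.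
 have s20 : 0 < 4 * s ^+ 2 by rewrite mulr_gt0 ?exprn_gt0.
 have y0 : 0 <= z ^+ 2 / (4 * s ^+ 2) by rewrite divr_ge0 ?sqr_ge0// ltW.
 have := sqr_le_expR y0; set E := expR _ => h.
 have -> : z ^+ 4 = 16 * s ^+ 4 * (z ^+ 2 / (4 * s ^+ 2)) ^+ 2 by field; rewrite gt_eqF.
 have -> : 64 * s ^+ 4 * E = 16 * s ^+ 4 * (4 * E) by ring.
 by rewrite ler_wpM2l// mulr_ge0// exprn_even_ge0.
Qed.

Lemma normal_probN (s : R) (A : set R) : measurable A -> s != 0 ->
 normal_prob 0 s (-%R @^-1` A) = normal_prob 0 s A.
Proof.
move=> mA s0.
have mN : measurable_fun [set: R] (-%R : R -> realM R) by exact: oppr_measurable.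
rewrite /normal_prob.
transitivity (\int[pushforward leb (-%R : _ -> realM R)]_(x in A)
  (normal_pdf 0 s x)%:E)%E; last first.
 by apply: eq_measure_integral => B mB _; exact: lebesgue_measureN.
rewrite ge0_integral_pushforward//=; last 2 first.
- by apply/mEFinP; apply: measurable_funTS; exact: measurable_normal_pdf.
- by move=> x _; rewrite lee_fin normal_pdf_ge0.
apply: eq_integral => x _ /=; congr EFin.
by rewrite !normal_pdfE// /normal_fun !subr0 sqrrN.
Qed.

End Gauss.

Section Independence.
Context d (T : measurableType d) (R : realType) (P : probability T R).

(** The joint law agrees with the product of the laws on rectangles, hence everywhere by uniqueness
    of the product measure; then Tonelli splits the integral. *)
Lemma indep_integral (X Y : T -> R) (f h : R -> \bar R) : measT X -> measT Y ->
 (forall A B, measurable A -> measurable B ->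
  P (X @^-1` A `&` Y @^-1` B) = P (X @^-1` A) * P (Y @^-1` B))%E ->
 measT f -> measT h ->
 (forall x, 0 <= f x)%E -> (forall x, 0 <= h x)%E ->
 (\int[P]_w (f (X w) * h (Y w)) = (\int[P]_w f (X w)) * (\int[P]_w h (Y w)))%E.
Proof.
move=> mX mY ind mf mh f0 h0.
have mXY : measT (fun w => (X w, Y w)) by exact: measurable_fun_pair.
pose X' : {RV P >-> R} := mfun_Sub (mem_set mX).
pose Y' : {RV P >-> R} := mfun_Sub (mem_set mY).
pose XY : {RV P >-> (R * R)%type} := mfun_Sub (mem_set mXY).
have mfh : measurable_fun [set: R * R] (fun z : R * R => (f z.1 * h z.2)%E).
 by apply: emeasurable_funM; apply: measurableT_comp.
have fh0 (z : R * R) : (0 <= f z.1 * h z.2)%E by rewrite mule_ge0.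
transitivity (\int[distribution P XY]_z (f z.1 * h z.2))%E.
 by rewrite ge0_integral_distribution.
rewrite -[in RHS](ge0_integral_distribution X' mf f0).
rewrite -[in RHS](ge0_integral_distribution Y' mh h0).
transitivity (\int[distribution P X' \x distribution P Y']_z (f z.1 * h z.2))%E.
 apply: eq_measure_integral => A mA _; apply/esym. apply: product_measure_unique => //.
rewrite fubini_tonelli1//= /fubini_F.
transitivity (\int[distribution P X']_x (f x * \int[distribution P Y']_y h y))%E.
 by apply: eq_integral => x _; rewrite -ge0_integralZl.
by rewrite ge0_integralZr// integral_ge0.
Qed.

End Independence.

(** Writes the positive part of a product through nonnegative functions of each factor, so that
    independence applies to them. The negative part follows by changing the sign of [b]. *)
Lemma max_mulD (R : realDomainType) (a b : R) : Num.max (a * b) 0 =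
 Num.max a 0 * Num.max b 0 + Num.max (- a) 0 * Num.max (- b) 0.
Proof.
have [a0|/ltW a0] := leP 0 a; have [b0|/ltW b0] := leP 0 b.
- have na : - a <= 0 by rewrite oppr_le0.
 have ab : 0 <= a * b by rewrite mulr_ge0. by rewrite (max_l ab) (max_r na) mul0r addr0.
- have na : - a <= 0 by rewrite oppr_le0.
 have ab : a * b <= 0 by rewrite mulr_ge0_le0. by rewrite (max_r ab) (max_r na) mul0r mulr0 addr0.
- have nb : - b <= 0 by rewrite oppr_le0.
 have ab : a * b <= 0 by rewrite mulr_le0_ge0. by rewrite (max_r ab) (max_r nb) mul0r mulr0 addr0.
- have na : 0 <= - a by rewrite oppr_ge0.
 have nb : 0 <= - b by rewrite oppr_ge0. have ab : 0 <= a * b by rewrite mulr_le0.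
 by rewrite (max_l ab) (max_l na) (max_l nb) mul0r add0r mulrNN.
Qed.

Lemma inner_continuousl R (H : hilbertType R) (h : H) : continuous (fun y => inner y h).
Proof.
move=> y; apply/cvgrPdist_lt => e e0.
have h0 : 0 < `|h| + 1 by rewrite ltr_wpDl.
apply/nbhs_ballP; exists (e / (`|h| + 1)) => /=; first by rewrite divr_gt0.
move=> z; rewrite -ball_normE /= ltr_pdivlMr// => yz.
rewrite -innerBl; apply: le_lt_trans (inner_le _ _) _.
by apply: le_lt_trans yz; rewrite ler_wpM2l// lerDl.
Qed.

Lemma inner_sqr_le R (H : hilbertType R) (x y : H) : inner x y ^+ 2 <= `|x| ^+ 2 * `|y| ^+ 2.
Proof.
rewrite -[leLHS]ger0_norm ?sqr_ge0// normrX -exprMn.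
by apply: lerXn2r; rewrite ?nnegrE ?mulr_ge0//; exact: inner_le.
Qed.

Lemma sum_CS (R : realFieldType) n (u v : 'I_n -> R) :
 (\sum_i u i * v i) ^+ 2 <= (\sum_i u i ^+ 2) * (\sum_i v i ^+ 2).
Proof.
rewrite expr2 !mulr_suml.
under eq_bigr do rewrite mulr_sumr.
under [leRHS]eq_bigr do rewrite mulr_sumr.
have sw : \sum_i \sum_j u i ^+ 2 * v j ^+ 2 = \sum_i \sum_j u j ^+ 2 * v i ^+ 2.
 by rewrite exchange_big.
rewrite -(@ler_pM2l _ 2)// (mulr_natl _ 2) mulr2n mulr_natl mulr2n {2}sw -!big_split/=.
apply: ler_sum => i _; rewrite -!big_split/=; apply: ler_sum => j _.
by have := sqr_ge0 (u i * v j - u j * v i); nra.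
Qed.

(** * Moments of Wiener increments with adapted coefficients *)

Section Wiener.
Variables (R : realType) (Xi H : hilbertType R)
 (d : measure_display) (Om : measurableType d) (P : probability Om R)
 (W : R -> Xi -> Om -> R) (t T : R)
 (HW : reference_space P W t T).

Definition filt s := wiener_filtration P W t s.
(** The points of [Om] with the filtration at time [s] as measurable sets: being adapted at time [s]
    becomes plain measurability of a map out of [Gs s]. *)
Definition Gs s := g_sigma_algebraType (filt s).

Lemma filt_sigma s : sigma_algebra setT (filt s).
Proof. exact: smallest_sigma_algebra. Qed.

Lemma measGs s (A : set Om) : (measurable : set (set (Gs s))) A <-> filt s A.
Proof. by rewrite /measurable /= sigma_algebra_id//; exact: filt_sigma. Qed.

Lemma filt_mono s r A : s <= r -> filt s A -> filt r A.
Proof.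
move=> sr; apply: sub_sigma_algebra2 => B [[q [xi [C [/andP[tq qs] mC ->]]]]|nB].
 by left; exists q, xi, C; split => //; rewrite tq (le_trans qs).
by right.
Qed.

Lemma filt_negl s A : P.-negligible A -> filt s A.
Proof. by move=> nA; apply: sub_sigma_algebra; right. Qed.

(** The filtration contains all negligible sets, and these are measurable because [P] is
    complete. *)
Lemma filt_meas s A : s <= T -> filt s A -> measurable A.
Proof.
case: HW => cP wW sT; suff: filt s `<=` measurable by apply.
apply: smallest_sub; first exact: sigma_algebra_measurable.
move=> B [[q [xi [C [/andP[tq qs] mC ->]]]]|nB]; last exact: cP.
rewrite -[_ @^-1` _]setTI; apply: (wiener_measurable wW) => //.
by rewrite tq (le_trans qs).
Qed.

Lemma Gs_fun_mono s r d' (U : measurableType d') (f : Om -> U) : s <= r ->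
 measT (f : Gs s -> U) -> measT (f : Gs r -> U).
Proof.
move=> sr mf mT B mB; apply/measGs; apply: (filt_mono sr).
by apply/measGs; exact: mf.
Qed.

Lemma Gs_fun s d' (U : measurableType d') (f : Om -> U) : s <= T ->
 measT (f : Gs s -> U) -> measT f.
Proof.
move=> sT mf _ B mB; apply: (filt_meas sT); apply/measGs; exact: mf.
Qed.

Lemma W_adapted s xi : t <= s -> measT (W s xi : Gs s -> R).
Proof.
move=> ts _ B mB; rewrite setTI; apply: sub_sigma_algebra.
by apply: sub_sigma_algebra; left; exists s, xi, B; rewrite ts lexx.
Qed.

Lemma W_meas s xi : t <= s <= T -> measT (W s xi).
Proof. by case: HW => _ wW; exact: (wiener_measurable wW). Qed.

Lemma W_zero s : t <= s <= T -> {ae P, forall w, W s 0 w = 0}.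
Proof.
case: HW => _ wW sT; have := wiener_linear wW 1 0 0 sT.
by apply: filterS => w; rewrite scaler0 add0r mul1r => h; lra.
Qed.

Lemma W_sum s (c : seq (R * Xi)) : t <= s <= T ->
 {ae P, forall w, W s (\sum_(x <- c) x.1 *: x.2) w = \sum_(x <- c) x.1 * W s x.2 w}.
Proof.
case: HW => _ wW sT; elim: c => [|[k x] c IH].
 by apply: filterS (W_zero sT) => w; rewrite !big_nil.
apply: filterS2 IH (wiener_linear wW k x (\sum_(x <- c) x.1 *: x.2) sT) => w h.
by rewrite !big_cons /= => ->; rewrite h.
Qed.

Definition dW s r xi w := W r xi w - W s xi w.

Lemma dW_meas s r xi : t <= s -> s <= r -> r <= T -> measT (dW s r xi).
Proof.
move=> ts sr rT; apply: measurable_funB; apply: W_meas.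
 by rewrite (le_trans ts)//.
by rewrite ts (le_trans sr).
Qed.

(** The law of an increment is prescribed only for [s < r] and [xi != 0]. The other increments
    vanish almost surely, by linearity of [W], and are treated apart. *)
Lemma dW_degenerate s r xi : t <= s -> s <= r -> r <= T ->
 (s == r) || (xi == 0) -> {ae P, forall w, dW s r xi w = 0}.
Proof.
move=> ts sr rT /orP[/eqP ->|/eqP ->].
 by apply: aeW => w; rewrite /dW subrr.
have h1 : t <= s <= T by rewrite ts (le_trans sr).
have h2 : t <= r <= T by rewrite (le_trans ts).
by apply: filterS2 (W_zero h1) (W_zero h2) => w; rewrite /dW => -> ->; rewrite subrr.
Qed.

Lemma dW_law s r xi (h : R -> \bar R) : t <= s -> s < r -> r <= T -> xi != 0 ->
 (forall x, 0 <= h x)%E -> measT h ->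
 (\int[P]_w h (dW s r xi w) = \int[normal_prob 0 (Num.sqrt (r - s) * `|xi|)]_z h z)%E.
Proof.
case: HW => _ wW ts sr rT xi0 h0 mh.
have mX : measT (dW s r xi : Om -> realM R).
 exact: (dW_meas xi ts (ltW sr) rT).
pose X : {RV P >-> realM R} := @mfun_Sub _ _ Om (realM R) (dW s r xi) (mem_set mX).
rewrite -(ge0_integral_distribution X mh h0).
apply: eq_measure_integral => A mA _.
exact: (wiener_increment wW ts sr rT xi0 mA).
Qed.

Lemma dW_indep s r xi (rho : Om -> R) (f h : R -> \bar R) :
 t <= s -> s < r -> r <= T -> measT (rho : Gs s -> R) ->
 measT f -> measT h ->
 (forall x, 0 <= f x)%E -> (forall x, 0 <= h x)%E ->
 (\int[P]_w (f (rho w) * h (dW s r xi w)) = (\int[P]_w f (rho w)) * (\int[P]_w h (dW s r xi w)))%E.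
Proof.
case: HW => _ wW ts sr rT mrho; apply: indep_integral.
- by apply: Gs_fun mrho; rewrite (le_trans (ltW sr)).
- by apply: dW_meas => //; exact: ltW.
- move=> A B mA mB.
 apply: (wiener_independent wW xi ts sr rT) => //.
 by apply/measGs; rewrite -[_ @^-1` _]setTI; exact: mrho.
Qed.

Lemma dW_moment s r xi (rho : Om -> R) (k : nat) (c : R) :
 t <= s -> s <= r -> r <= T -> measT (rho : Gs s -> R) ->
 (forall w, 0 <= rho w) -> ~~ odd k -> (0 < k)%N -> 0 <= c ->
 (forall q : R, 0 < q -> (\int[normal_prob 0 q]_x (x ^+ k)%:E <= (c * q ^+ k)%:E)%E) ->
 (\int[P]_w (rho w * dW s r xi w ^+ k)%:E <=
  (c * (Num.sqrt (r - s) * `|xi|) ^+ k)%:E * \int[P]_w (rho w)%:E)%E.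
Proof.
move=> ts sr rT mrho rho0 ek k0 c0 cP.
have [dg|] := boolP ((s == r) || (xi == 0)).
 apply: (@le_trans _ _ 0%E); last first.
  rewrite mule_ge0 ?lee_fin ?integral_ge0// => [|w _]; last by rewrite lee_fin.
  by rewrite mulr_ge0// exprn_even_ge0.
 rewrite -(integral0 P setT). apply: le_ae_int => // [w _|].
  by rewrite lee_fin mulr_ge0// exprn_even_ge0.
 apply: filterS (dW_degenerate ts sr rT dg) => w -> _. by rewrite expr0n gtn_eqF// mulr0.
rewrite negb_or => /andP[sr0 xi0]; have {sr0}sr : s < r by rewrite lt_neqAle sr0.
have q0 : 0 < Num.sqrt (r - s) * `|xi|.
 by rewrite mulr_gt0 ?normr_gt0// sqrtr_gt0 subr_gt0.
under eq_integral do rewrite EFinM.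
(* [dW_indep] wants functions that are nonnegative on the whole line, so [rho] enters through its
   absolute value. *)
have -> : (\int[P]_w ((rho w)%:E * (dW s r xi w ^+ k)%:E) =
  \int[P]_w ((`|rho w|)%:E * (dW s r xi w ^+ k)%:E))%E.
 by apply: eq_integral => w _; rewrite ger0_norm.
rewrite (@dW_indep s r xi rho (fun x => `|x|%:E) (fun x => (x ^+ k)%:E))//; last 3 first.
- by apply/mEFinP; exact: normr_measurable.
- by apply/mEFinP; exact: exprn_measurable.
- by move=> x; rewrite lee_fin exprn_even_ge0.
rewrite muleC; under [X in (_ * X)%E]eq_integral do rewrite ger0_norm//.
apply: lee_wpmul2r; first by apply: integral_ge0 => w _; rewrite lee_fin.
rewrite (@dW_law s r xi (fun x => (x ^+ k)%:E))//; first exact: cP.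
- by move=> x; rewrite lee_fin exprn_even_ge0.
- by apply/mEFinP; exact: exprn_measurable.
Qed.

Lemma dW_moment2 s r xi (rho : Om -> R) : t <= s -> s <= r -> r <= T -> measT (rho : Gs s -> R) ->
 (forall w, 0 <= rho w) ->
 (\int[P]_w (rho w * dW s r xi w ^+ 2)%:E <=
  (8 * (r - s) * `|xi| ^+ 2)%:E * \int[P]_w (rho w)%:E)%E.
Proof.
move=> ts sr rT mrho rho0.
apply: le_trans (dW_moment xi (k := 2) (c := 8) ts sr rT mrho rho0 _ _ _ _) _ => //.
 by move=> q q0; exact: normal_moment2.
by rewrite exprMn sqr_sqrtr ?subr_ge0// mulrA.
Qed.

Lemma dW_moment4 s r xi (rho : Om -> R) : t <= s -> s <= r -> r <= T -> measT (rho : Gs s -> R) ->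
 (forall w, 0 <= rho w) ->
 (\int[P]_w (rho w * dW s r xi w ^+ 4)%:E <=
  (128 * (r - s) ^+ 2 * `|xi| ^+ 4)%:E * \int[P]_w (rho w)%:E)%E.
Proof.
move=> ts sr rT mrho rho0.
apply: le_trans (dW_moment xi (k := 4) (c := 128) ts sr rT mrho rho0 _ _ _ _) _ => //.
 by move=> q q0; exact: normal_moment4.
by rewrite exprMn (exprM _ 2 2) sqr_sqrtr ?subr_ge0// mulrA.
Qed.

(** The mean is zero by symmetry: positive and negative parts of the increment have equal integrals,
    so by independence the positive and the negative part of the product have the same integral.
    That integral is finite, since [|x| <= 1 + x^2] reduces integrability to [dW_moment2]. *)
Lemma dW_mean s r xi (rho : Om -> R) : t <= s -> s <= r -> r <= T -> measT (rho : Gs s -> R) ->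
 (\int[P]_w (`|rho w|)%:E < +oo)%E ->
 P.-integrable setT (fun w => (rho w * dW s r xi w)%:E) /\
 (\int[P]_w (rho w * dW s r xi w)%:E = 0)%E.
Proof.
move=> ts sr rT mrho rhoi.
have mrho' : measT rho by apply: Gs_fun mrho; rewrite (le_trans sr).
have mdW := dW_meas xi ts sr rT.
have mX : measT (fun w => (rho w * dW s r xi w)%:E).
 by apply/mEFinP; exact: measurable_funM.
have mrhon : measT (fun w => `|rho w| : R) by exact: measurableT_comp.
have mrhonG : measT ((fun w => `|rho w|) : Gs s -> R).
 exact: (@measurableT_comp _ _ _ (Gs s) R R _ setT rho).
have m2 : (\int[P]_w (`|rho w| * dW s r xi w ^+ 2)%:E < +oo)%E.
 apply: le_lt_trans (dW_moment2 xi ts sr rT mrhonG _) _ => //.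
 by rewrite lte_mul_pinfty// lee_fin !mulr_ge0 ?subr_ge0.
have iX : P.-integrable setT (fun w => (rho w * dW s r xi w)%:E).
 apply/integrableP; split=> //.
 apply: (@le_lt_trans _ _ (\int[P]_w ((`|rho w|)%:E + (`|rho w| * dW s r xi w ^+ 2)%:E))%E).
  apply: le_int => // w _; rewrite abse_EFin -EFinD lee_fin normrM.
  rewrite -[X in X + _]mulr1 -mulrDr ler_wpM2l//.
  have := sqr_ge0 (`|dW s r xi w| - 1); rewrite sqrrB1 -normrX.
  rewrite (ger0_norm (sqr_ge0 _)) -mulr_natr; have := normr_ge0 (dW s r xi w); lra.
 rewrite ge0_integralD//; last 3 first.
 - exact/mEFinP.
 - by move=> w _; rewrite lee_fin mulr_ge0// sqr_ge0.
 - by apply/mEFinP/measurable_funM => //; exact: measurable_funX.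
 exact: lte_add_pinfty.
split=> //.
have [dg|] := boolP ((s == r) || (xi == 0)).
 rewrite (ae_eq_integral (cst 0%E))// ?integral0//.
 by apply: filterS (dW_degenerate ts sr rT dg) => w -> _; rewrite mulr0.
rewrite negb_or => /andP[sr0 xi0]; have {sr0}lsr : s < r by rewrite lt_neqAle sr0.
have q0 : 0 < Num.sqrt (r - s) * `|xi|.
 by rewrite mulr_gt0 ?normr_gt0// sqrtr_gt0 subr_gt0.
pose q := Num.sqrt (r - s) * `|xi|.
pose pp (x : R) : \bar R := (Num.max x 0)%:E.
pose pn (x : R) : \bar R := (Num.max (- x) 0)%:E.
have mpp : measT pp.
 by apply/mEFinP; exact: measurable_maxr.
have mpn : measT pn.
 by apply/mEFinP; apply: measurable_maxr => //; exact: oppr_measurable.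
have pp0 x : (0 <= pp x)%E by rewrite lee_fin le_max lexx orbT.
have pn0 x : (0 <= pn x)%E by rewrite lee_fin le_max lexx orbT.
have sym : (\int[P]_w pn (dW s r xi w) = \int[P]_w pp (dW s r xi w))%E.
 rewrite !dW_law// -/q.
 transitivity (\int[pushforward (normal_prob 0 q) (-%R : R -> realM R)]_z pp z)%E.
  rewrite ge0_integral_pushforward//; exact: oppr_measurable.
 apply: eq_measure_integral => A mA _. by apply: normal_probN => //; rewrite gt_eqF.
have E1 : (\int[P]_w (fun w => (rho w * dW s r xi w)%:E)^\+ w =
  \int[P]_w (pp (rho w) * pp (dW s r xi w)) +
  \int[P]_w (pn (rho w) * pn (dW s r xi w)))%E.
 rewrite -ge0_integralD//; last 4 first.
 - by move=> w _; rewrite mule_ge0.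
 - by apply: emeasurable_funM; apply: measurableT_comp.
 - by move=> w _; rewrite mule_ge0.
 - by apply: emeasurable_funM; apply: measurableT_comp.
 apply: eq_integral => w _; rewrite funeposE /pp /pn -!EFinM -EFinD -EFin_max. by rewrite -max_mulD.
have E2 : (\int[P]_w (fun w => (rho w * dW s r xi w)%:E)^\- w =
  \int[P]_w (pp (rho w) * pn (dW s r xi w)) +
  \int[P]_w (pn (rho w) * pp (dW s r xi w)))%E.
 rewrite -ge0_integralD//; last 4 first.
 - by move=> w _; rewrite mule_ge0.
 - by apply: emeasurable_funM; apply: measurableT_comp.
 - by move=> w _; rewrite mule_ge0.
 - by apply: emeasurable_funM; apply: measurableT_comp.
 apply: eq_integral => w _; rewrite funenegE /pp /pn -!EFinM -EFinD -EFinN -EFin_max.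
 by rewrite -mulrN max_mulD opprK.
have ppos : (\int[P]_w (fun w => (rho w * dW s r xi w)%:E)^\+ w)%E \is a fin_num.
 rewrite ge0_fin_numE; last by apply: integral_ge0. by apply: integral_funepos_lt_pinfty.
have I f h := @dW_indep s r xi rho f h ts lsr rT mrho.
rewrite integralE; move: ppos.
by rewrite E1 E2 (I pp pp)// (I pn pn)// (I pp pn)// (I pn pp)// sym => /subee.
Qed.

Definition cinc s r (c : seq (Xi * H)) w : H := \sum_(x <- c) dW s r x.1 w *: x.2.

Variables (vH : nat -> H) (dvH : dense_seq vH).

Lemma cinc_meas s r c : t <= s -> s <= r -> r <= T -> measT (cinc s r c : Om -> borel H).
Proof.
move=> ts sr rT; apply: (borel_sum _ dvH) => // x.
by apply: (borelZ dvH) => //; exact: dW_meas.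
Qed.

(** The coordinate of the increment along [g p] is the increment of [W] in the direction
    [rk_coord c g p]. Linearity of [W] holds only almost surely for each combination, and finitely
    many combinations occur. *)
Lemma cinc_norm s r c n (g : 'I_n -> H) : t <= s -> s <= r -> r <= T ->
 orthonormal g -> (forall x, x \in c -> spanned g x.2) ->
 {ae P, forall w, `|cinc s r c w| ^+ 2 = \sum_p dW s r (rk_coord c g p) w ^+ 2}.
Proof.
move=> ts sr rT og cg.
have h1 : t <= s <= T by rewrite ts (le_trans sr).
have h2 : t <= r <= T by rewrite (le_trans ts).
have [N /= [mN N0 NP]] : {ae P, forall w, forall p : 'I_n,
  dW s r (rk_coord c g p) w = \sum_(x <- c) inner x.2 (g p) * dW s r x.1 w}.
 have A p : {ae P, forall w,
   dW s r (rk_coord c g p) w = \sum_(x <- c) inner x.2 (g p) * dW s r x.1 w}.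
  have e1 := W_sum [seq (inner x.2 (g p), x.1) | x <- c] h1.
  have e2 := W_sum [seq (inner x.2 (g p), x.1) | x <- c] h2.
  apply: filterS2 e1 e2 => w; rewrite !big_map /= /dW /rk_coord => -> ->.
  by rewrite -sumrB; apply: eq_bigr => x _; rewrite mulrBr.
 by apply: filter_forall.
exists N; split=> //; apply: subset_trans NP => w /= h h'; apply: h.
rewrite /cinc (rk_coordE (fun xi => dW s r xi w) cg) orthonormal_norm//.
by apply: eq_bigr => p _; rewrite h'.
Qed.

Lemma cinc_moment2 s r c (rho : Om -> R) : t <= s -> s <= r -> r <= T ->
 measT (rho : Gs s -> R) -> (forall w, 0 <= rho w) ->
 (\int[P]_w (rho w * `|cinc s r c w| ^+ 2)%:E <=
  \int[P]_w (rho w)%:E * (8 * (r - s) * `|rk c| ^+ 2)%:E)%E.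
Proof.
move=> ts sr rT mrho rho0.
have mrho' : measT rho by apply: Gs_fun mrho; rewrite (le_trans sr).
have [n [g [og gc _]]] := gram_schmidt [seq x.2 | x <- c] (@orthonormal0 _ _ (fun=> 0 : H)).
have cg x : x \in c -> spanned g x.2 by move=> xc; apply: gc; exact: map_f.
apply: (@le_trans _ _ (\int[P]_w \sum_p (rho w * dW s r (rk_coord c g p) w ^+ 2)%:E)%E).
 apply: le_ae_int => //.
 - by move=> w _; rewrite lee_fin mulr_ge0// sqr_ge0.
 - by move=> w _; apply: sume_ge0 => p _; rewrite lee_fin mulr_ge0// sqr_ge0.
 - apply: filterS (cinc_norm ts sr rT og cg) => w -> _.
  by rewrite sumEFin mulr_sumr.
rewrite ge0_integral_sum//; last 2 first.
- move=> p; apply/mEFinP/measurable_funM => //.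
 by apply: measurable_funX; exact: dW_meas.
- by move=> p w _; rewrite lee_fin mulr_ge0// sqr_ge0.
apply: (@le_trans _ _ (\sum_p (8 * (r - s) * `|rk_coord c g p| ^+ 2)%:E * \int[P]_w (rho w)%:E)%E).
 by apply: lee_sum => p _; exact: dW_moment2.
rewrite -ge0_sume_distrl; last first.
 by move=> p _; rewrite lee_fin !mulr_ge0 ?subr_ge0 ?sqr_ge0.
by rewrite muleC (rk_norm og cg) sumEFin mulr_sumr.
Qed.

(** Cauchy-Schwarz with the weights [|z p|] bounds the square of the sum of [d_p^2] by [M] times the
    sum of [d_p^4 / |z p|^2]. Only fourth moments of single increments remain, no joint ones. *)
Lemma cinc_moment4 s r c (rho : Om -> R) : t <= s -> s <= r -> r <= T ->
 measT (rho : Gs s -> R) -> (forall w, 0 <= rho w) ->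
 (\int[P]_w (rho w * `|cinc s r c w| ^+ 4)%:E <=
  \int[P]_w (rho w)%:E * (128 * (r - s) ^+ 2 * `|rk c| ^+ 4)%:E)%E.
Proof.
move=> ts sr rT mrho rho0.
have mrho' : measT rho by apply: Gs_fun mrho; rewrite (le_trans sr).
have [n [g [og gc _]]] := gram_schmidt [seq x.2 | x <- c] (@orthonormal0 _ _ (fun=> 0 : H)).
have cg x : x \in c -> spanned g x.2 by move=> xc; apply: gc; exact: map_f.
pose M := `|rk c| ^+ 2; pose z p := rk_coord c g p.
have ME : M = \sum_p `|z p| ^+ 2 by exact: rk_norm.
have M0 : 0 <= M by rewrite sqr_ge0.
(* Where [z p = 0] the quotient is 0 by convention, so the weighted identity needs the increment
   itself to vanish. *)
have zae : {ae P, forall w, forall p, z p = 0 -> dW s r (z p) w = 0}.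
 apply: filter_forall => p; have [zp|zp] := eqVneq (z p) 0; last first.
  by apply: aeW => w zp0; rewrite zp0 eqxx in zp.
 rewrite zp; have := dW_degenerate ts sr rT (xi := 0); rewrite eqxx orbT => /(_ isT).
 by apply: filterS.
apply: (@le_trans _ _ (\int[P]_w \sum_p (M / `|z p| ^+ 2 * (rho w * dW s r (z p) w ^+ 4))%:E)%E).
 apply: le_ae_int => //.
 - by move=> w _; rewrite lee_fin mulr_ge0// exprn_even_ge0.
 - move=> w _; apply: sume_ge0 => p _.
  by rewrite lee_fin mulr_ge0 ?divr_ge0 ?sqr_ge0// mulr_ge0// exprn_even_ge0.
 - apply: filterS2 (cinc_norm ts sr rT og cg) zae => w E Z _.
  rewrite sumEFin lee_fin (exprM _ 2 2) E.
  have -> : \sum_p M / `|z p| ^+ 2 * (rho w * dW s r (z p) w ^+ 4) =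
    rho w * (M * \sum_p (dW s r (z p) w ^+ 2 / `|z p|) ^+ 2).
   by rewrite !mulr_sumr; apply: eq_bigr => p _; rewrite exprMn exprVn; ring.
  rewrite ler_wpM2l// ME.
  apply: le_trans (sum_CS (fun p => `|z p|) (fun p => dW s r (z p) w ^+ 2 / `|z p|)).
  apply: ler_eq; congr (_ ^+ 2). apply: eq_bigr => p _; have [zp|zp] := eqVneq (z p) 0.
   by rewrite Z// zp normr0 mul0r expr0n.
  by rewrite mulrC divfK// normr_eq0.
rewrite ge0_integral_sum//; last 2 first.
- move=> p; apply/mEFinP/measurable_funM => //; apply/measurable_funM => //.
 by apply: measurable_funX; exact: dW_meas.
- by move=> p w _; rewrite lee_fin mulr_ge0 ?divr_ge0 ?sqr_ge0// mulr_ge0// exprn_even_ge0.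
apply: (@le_trans _ _ (\sum_p (128 * (r - s) ^+ 2 * M * `|z p| ^+ 2)%:E * \int[P]_w (rho w)%:E)%E).
 apply: lee_sum => p _; under eq_integral do rewrite EFinM.
 rewrite ge0_integralZl_EFin//; last 3 first.
 - by move=> w _; rewrite lee_fin mulr_ge0// exprn_even_ge0.
 - apply/mEFinP/measurable_funM => //.
  by apply: measurable_funX; exact: dW_meas.
 - by rewrite divr_ge0// sqr_ge0.
 apply: le_trans (lee_wpmul2l _ (dW_moment4 (z p) ts sr rT mrho rho0)) _.
  by rewrite lee_fin divr_ge0// sqr_ge0.
 rewrite muleA -EFinM; apply: lee_wpmul2r.
  by apply: integral_ge0 => w _; rewrite lee_fin.
 rewrite lee_fin; have [zp|zp] := eqVneq (z p) 0.
  by rewrite zp normr0 !expr0n/= !mulr0.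
 by apply: ler_eq; field; rewrite normr_eq0.
rewrite -ge0_sume_distrl; last first.
 by move=> p _; rewrite lee_fin mulr_ge0 ?sqr_ge0// mulr_ge0// mulr_ge0// sqr_ge0.
rewrite muleC sumEFin -mulr_sumr -ME (exprM _ 2 2) -/M.
by rewrite -[X in (_ * X%:E <= _)%E]mulrA -expr2.
Qed.

(** An operator valued random variable with finitely many values is a list of events with rank one
    operators; at [w] it reduces to the deterministic list of the items whose event has occurred. *)
Definition sel (e : seq (set Om * Xi * H)) w : seq (Xi * H) :=
 [seq (i.1.2, i.2) | i <- e & `[< i.1.1 w >]].

Definition events_at s (e : seq (set Om * Xi * H)) := forall i, i \in e -> filt s i.1.1.

Lemma events_atS s i e : events_at s (i :: e) -> filt s i.1.1 /\ events_at s e.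
Proof.
move=> h; split; first by apply: h; rewrite inE eqxx.
by move=> j je; apply: h; rewrite inE je orbT.
Qed.

Definition ival (e : seq (set Om * Xi * H)) w : hs Xi H := rk (sel e w).

Definition iinc s r e w : H := cinc s r (sel e w) w.

Lemma sel_meas s d' (U : measurableType d') (A : seq (Xi * H) -> Om -> U) e c :
 s <= T -> events_at s e -> (forall c, measT (A c)) ->
 measT (fun w => A (c ++ sel e w) w).
Proof.
move=> sT; elim: e c => [|i e IH] c ee mA.
 by rewrite (_ : (fun _ => _) = A (c ++ [::])).
have [Fi ee'] := events_atS ee.
rewrite (_ : (fun _ => _) = (fun w => if `[< i.1.1 w >]
  then A ((c ++ [:: (i.1.2, i.2)]) ++ sel e w) w else A (c ++ sel e w) w)); last first.
 by apply/funext => w; rewrite /sel /=; case: ifP => // _; rewrite -catA.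
apply: measurable_fun_ifT; [|exact: IH|exact: IH].
apply: (@measurable_fun_bool _ _ _ _ true); rewrite setTI.
rewrite (_ : _ @^-1` _ = i.1.1); first exact: filt_meas Fi.
by apply/seteqP; split => w /= /asboolP.
Qed.

(** A substitute for conditioning at time [s]: by induction on [e], the weight [rho] is split along
    an event and its complement, both adapted, until the list is deterministic and the bound for
    fixed [c] applies. *)
Lemma freeze_items s (A : seq (Xi * H) -> Om -> R) (B : seq (Xi * H) -> R)
  (rho : Om -> R) e : s <= T -> events_at s e ->
 (forall c, measT (A c)) -> (forall c w, 0 <= A c w) ->
 (forall c, 0 <= B c) ->
 (forall c (rho : Om -> R), measT (rho : Gs s -> R) -> (forall w, 0 <= rho w) ->
  (\int[P]_w (rho w * A c w)%:E <= \int[P]_w (rho w)%:E * (B c)%:E)%E) ->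
 measT (rho : Gs s -> R) -> (forall w, 0 <= rho w) ->
 (\int[P]_w (rho w * A (sel e w) w)%:E <= \int[P]_w (rho w * B (sel e w))%:E)%E.
Proof.
move=> sT ee mA A0 B0 AB.
suff : forall c (rho : Om -> R), measT (rho : Gs s -> R) -> (forall w, 0 <= rho w) ->
 (\int[P]_w (rho w * A (c ++ sel e w) w)%:E <=
  \int[P]_w (rho w * B (c ++ sel e w))%:E)%E by move=> /(_ [::]); apply.
elim: e ee => [|i e IH] ee c {}rho mrho rho0.
 have mrho' : measT rho by exact: Gs_fun mrho.
 have -> : (\int[P]_w (rho w * A (c ++ sel [::] w) w)%:E = \int[P]_w (rho w * A c w)%:E)%E.
  by apply: eq_integral => w _; rewrite cats0.
 have -> : (\int[P]_w (rho w * B (c ++ sel [::] w))%:E = \int[P]_w ((B c)%:E * (rho w)%:E))%E.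
  by apply: eq_integral => w _; rewrite cats0 mulrC EFinM.
 rewrite ge0_integralZl_EFin//; last 2 first.
 - by move=> w _; rewrite lee_fin.
 - exact/mEFinP.
 by rewrite muleC; exact: AB.
have [Fi ee'] := events_atS ee.
have mFi : measurable i.1.1 by exact: filt_meas Fi.
have mrho' : measT rho by exact: Gs_fun mrho.
pose r1 w := \1_(i.1.1) w * rho w; pose r2 w := \1_(~` i.1.1) w * rho w.
have gF : (measurable : set (set (Gs s))) i.1.1 by exact/measGs.
have m1 : measT (r1 : Gs s -> R).
 by apply: measurable_funM => //; exact: measurable_indic.
have m2 : measT (r2 : Gs s -> R).
 by apply: measurable_funM => //; apply: measurable_indic; exact: measurableC.
have r10 w : 0 <= r1 w by rewrite mulr_ge0.
have r20 w : 0 <= r2 w by rewrite mulr_ge0.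
pose c' := c ++ [:: (i.1.2, i.2)].
have E (D : seq (Xi * H) -> Om -> R) : (forall c, measT (D c)) -> (forall c w, 0 <= D c w) ->
  (\int[P]_w (rho w * D (c ++ sel (i :: e) w) w)%:E = \int[P]_w (r1 w * D (c' ++ sel e w) w)%:E +
   \int[P]_w (r2 w * D (c ++ sel e w) w)%:E)%E.
 move=> mD D0; rewrite -ge0_integralD//; last 4 first.
 - by move=> w _; rewrite lee_fin mulr_ge0.
 - apply/mEFinP/measurable_funM; first exact: Gs_fun m1.
  exact: (@sel_meas s _ _ D e c' sT ee' mD).
 - by move=> w _; rewrite lee_fin mulr_ge0.
 - apply/mEFinP/measurable_funM; first exact: Gs_fun m2.
  exact: (@sel_meas s _ _ D e c sT ee' mD).
 apply: eq_integral => w _; rewrite -EFinD; congr EFin.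
 rewrite /r1 /r2 !indicE /sel /=; case: asboolP => Fw.
  rewrite mem_set// memNset ?mul1r ?mul0r ?addr0/=; last exact. by rewrite /c' -catA.
 by rewrite memNset// mem_set// mul1r mul0r mul0r add0r.
rewrite (E A)// (E (fun c _ => B c))//.
by apply: leeD; exact: IH.
Qed.

Lemma iinc_moment2 s r e (rho : Om -> R) : t <= s -> s <= r -> r <= T ->
 events_at s e -> measT (rho : Gs s -> R) -> (forall w, 0 <= rho w) ->
 (\int[P]_w (rho w * `|iinc s r e w| ^+ 2)%:E <=
  \int[P]_w (rho w * (8 * (r - s) * `|ival e w| ^+ 2))%:E)%E.
Proof.
move=> ts sr rT ee mrho rho0.
apply: (@freeze_items s (fun c w => `|cinc s r c w| ^+ 2)
 (fun c => 8 * (r - s) * `|rk c| ^+ 2)) => //.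
- exact: le_trans rT.
- by move=> c; apply: borel_normX => //; exact: cinc_meas.
- by move=> c; rewrite !mulr_ge0 ?subr_ge0 ?sqr_ge0.
- by move=> c rho'; exact: cinc_moment2.
Qed.

Lemma iinc_moment4 s r e (rho : Om -> R) : t <= s -> s <= r -> r <= T ->
 events_at s e -> measT (rho : Gs s -> R) -> (forall w, 0 <= rho w) ->
 (\int[P]_w (rho w * `|iinc s r e w| ^+ 4)%:E <=
  \int[P]_w (rho w * (128 * (r - s) ^+ 2 * `|ival e w| ^+ 4))%:E)%E.
Proof.
move=> ts sr rT ee mrho rho0.
apply: (@freeze_items s (fun c w => `|cinc s r c w| ^+ 4)
 (fun c => 128 * (r - s) ^+ 2 * `|rk c| ^+ 4)) => //.
- exact: le_trans rT.
- by move=> c; apply: borel_normX => //; exact: cinc_meas.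
- by move=> c; rewrite mulr_ge0 ?exprn_even_ge0// mulr_ge0// sqr_ge0.
- by move=> c rho'; exact: cinc_moment4.
Qed.

Lemma iincE s r e w : iinc s r e w = \sum_(i <- e) (\1_(i.1.1) w * dW s r i.1.2 w) *: i.2.
Proof.
rewrite /iinc /cinc /sel big_map big_filter [LHS]big_mkcond /=.
apply: eq_bigr => i _; rewrite indicE; case: asboolP => Fw.
 by rewrite mem_set// mul1r.
by rewrite memNset// mul0r scale0r.
Qed.

Lemma ivalE e w : ival e w = \sum_(i <- e) \1_(i.1.1) w *: rank1 i.1.2 i.2.
Proof.
rewrite /ival /rk /sel big_map big_filter [LHS]big_mkcond /=.
apply: eq_bigr => i _; rewrite indicE; case: asboolP => Fw.
 by rewrite mem_set// scale1r.
by rewrite memNset// scale0r.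
Qed.

Lemma iinc_meas s r e : t <= s -> s <= r -> r <= T -> events_at s e ->
 measT (iinc s r e : Om -> borel H).
Proof.
move=> ts sr rT ee.
apply: (@sel_meas s _ (borel H) (cinc s r) e [::]) => //.
 exact: le_trans rT.
by move=> c; exact: cinc_meas.
Qed.

(** This is the martingale property, proved item by item: [inner (x w) i.2] times the indicator of
    the event is adapted at time [s], so [dW_mean] applies to each term. *)
Lemma iinc_mean s r e (x : Om -> H) : t <= s -> s <= r -> r <= T ->
 events_at s e -> measT (x : Gs s -> borel H) ->
 (\int[P]_w (`|x w|)%:E < +oo)%E ->
 P.-integrable setT (fun w => (inner (x w) (iinc s r e w))%:E) /\
 (\int[P]_w (inner (x w) (iinc s r e w))%:E = 0)%E.
Proof.
move=> ts sr rT ee mx ix.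
have one i : i \in e -> P.-integrable setT
  (fun w => (inner (x w) ((\1_(i.1.1) w * dW s r i.1.2 w) *: i.2))%:E) /\
  (\int[P]_w (inner (x w) ((\1_(i.1.1) w * dW s r i.1.2 w) *: i.2))%:E = 0)%E.
 move=> ie; have Fi := ee _ ie.
 have gF : (measurable : set (set (Gs s))) i.1.1 by exact/measGs.
 have mh : measT ((fun w => \1_(i.1.1) w * inner (x w) i.2) : Gs s -> R).
  apply: measurable_funM; first exact: measurable_indic.
  apply: (@borel_comp R _ (Gs s) H setT x (fun y => inner y i.2)) => //. exact: inner_continuousl.
 have := dW_mean i.1.2 ts sr rT mh.
 have -> : (fun w => (\1_(i.1.1) w * inner (x w) i.2 * dW s r i.1.2 w)%:E) =
   (fun w => (inner (x w) ((\1_(i.1.1) w * dW s r i.1.2 w) *: i.2))%:E).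
  by apply/funext => w; rewrite innerZr mulrAC.
 apply; apply: (@le_lt_trans _ _ (\int[P]_w ((`|i.2|)%:E * (`|x w|)%:E))%E).
  apply: le_int => // w _; rewrite lee_fin normrM indicE.
  apply: le_trans (_ : 1 * `|inner (x w) i.2| <= _).
   by apply: ler_wpM2r => //; case: (_ \in _); rewrite ?normr1 ?normr0.
  by rewrite mul1r mulrC inner_le.
 rewrite ge0_integralZl_EFin// ?lte_mul_pinfty//. apply/mEFinP/borel_norm0 => //.
 by apply: Gs_fun mx; exact: le_trans rT.
elim: e ee one => [|i e IH] ee one.
 rewrite (_ : (fun _ => _) = cst 0%E); last first.
  by apply/funext => w; rewrite iincE big_nil inner0r.
 by rewrite integral0; split => //; exact: integrable0.
have [Fi ee'] := events_atS ee.
have [|I1 I2] := IH ee'; first by move=> j je; apply: one; rewrite inE je orbT.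
have [|J1 J2] := one i; first by rewrite inE eqxx.
have E : (fun w => (inner (x w) (iinc s r (i :: e) w))%:E) =
  (fun w => (inner (x w) ((\1_(i.1.1) w * dW s r i.1.2 w) *: i.2))%:E +
   (inner (x w) (iinc s r e w))%:E)%E.
 by apply/funext => w; rewrite !iincE big_cons innerDr.
by rewrite E; split; [exact: integrableD|rewrite integralD// I2 J2 adde0].
Qed.

Lemma iinc_adapted s r e : t <= s -> s <= r -> r <= T -> events_at s e ->
 measT (iinc s r e : Gs r -> borel H).
Proof.
move=> ts sr rT ee; rewrite (funext (iincE s r e)).
elim: e ee => [|i e IH] ee.
 by under eq_fun do rewrite big_nil; exact: mcst.
have [Fi ee'] := events_atS ee.
under eq_fun do rewrite big_cons.
apply: (@borelD R _ (Gs r) H vH) => //; last exact: IH.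
apply: (@borelZ R _ (Gs r) H vH) => //.
apply: measurable_funM.
 by apply: measurable_indic; apply/measGs; exact: filt_mono Fi.
apply: measurable_funB; first by apply: W_adapted; exact: le_trans sr.
by apply: (Gs_fun_mono sr); exact: W_adapted.
Qed.

Lemma ival_bound e : exists2 K : R, 0 <= K & forall w, `|ival e w| <= K.
Proof.
exists (\sum_(i <- e) `|i.1.2| * `|i.2|); first by apply: sumr_ge0 => i _; rewrite mulr_ge0.
move=> w; rewrite ivalE; apply: le_trans (ler_norm_sum _ _ _) _.
apply: ler_sum => i _; rewrite normrZ -[leRHS]mul1r; apply: ler_pM => //.
 by rewrite indicE; case: (_ \in _); rewrite ?normr1 ?normr0.
exact: rank1_le.
Qed.

Lemma ival_norm_meas s e : s <= T -> events_at s e -> measT (fun w => `|ival e w| : R).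
Proof.
move=> sT ee.
by apply: (@sel_meas s _ R (fun c _ => `|rk c|) e [::]).
Qed.

Lemma ival_pow_lty (k : nat) e : (\int[P]_w (`|ival e w| ^+ k)%:E < +oo)%E.
Proof.
have [K K0 eK] := ival_bound e.
apply: (@le_lt_trans _ _ (\int[P]_w (K ^+ k)%:E)%E).
 apply: le_int => // w _; rewrite lee_fin ?exprn_ge0//. by apply: lerXn2r; rewrite ?nnegrE.
by rewrite integral_cst//= probability_setT mule1 ltry.
Qed.

(** Expanding the square, the cross term has mean zero because both [A] and [x] are adapted at time
    [s]. The event [A] is there for the maximal inequality, where it says that the chain has not yet
    left a ball. *)
Lemma step2 s r e (x : Om -> H) (A : set Om) : t <= s -> s <= r -> r <= T ->
 events_at s e -> measT (x : Gs s -> borel H) -> filt s A ->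
 (\int[P]_w (`|x w| ^+ 2)%:E < +oo)%E ->
 (\int[P]_w (\1_A w * `|(x w + iinc s r e w)| ^+ 2)%:E <= \int[P]_w (\1_A w * `|x w| ^+ 2)%:E +
  (8 * (r - s))%:E * \int[P]_w (`|ival e w| ^+ 2)%:E)%E.
Proof.
move=> ts sr rT ee mx FA ix.
have sT : s <= T by exact: le_trans rT.
have mA := filt_meas sT FA.
have gA : (measurable : set (set (Gs s))) A by exact/measGs.
have mx' : measT (x : Om -> borel H) by exact: Gs_fun mx.
have m1 : measT (\1_A : Gs s -> R) by exact: measurable_indic.
have m1' : measT (\1_A : Om -> R) by exact: measurable_indic.
have mi := iinc_meas ts sr rT ee.
have mi2 : measT (fun w => `|iinc s r e w| ^+ 2 : R).
 by exact: borel_normX.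
have mx2 : measT (fun w => `|x w| ^+ 2 : R).
 by exact: borel_normX.
have y0 w : 0 <= \1_A w :> R by [].
have y1 w : \1_A w <= 1 :> R by rewrite indicE; case: (_ \in _).
have c0 : 0 <= 8 * (r - s) by rewrite mulr_ge0 ?subr_ge0.
have iA : (\int[P]_w (\1_A w * `|iinc s r e w| ^+ 2)%:E <=
  (8 * (r - s))%:E * \int[P]_w (`|ival e w| ^+ 2)%:E)%E.
 apply: le_trans (iinc_moment2 ts sr rT ee m1 _) _ => //.
 rewrite -ge0_integralZl_EFin//; last first.
  by apply/mEFinP/measurable_funX; exact: ival_norm_meas ee.
 apply: le_int => // w _; rewrite ?lee_fin ?mulr_ge0 ?subr_ge0 ?sqr_ge0//.
 by apply: ler_piMl => //; rewrite mulr_ge0 ?sqr_ge0.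
pose xA w := \1_A w *: x w.
have mxA : measT (xA : Gs s -> borel H).
 by apply: (@borelZ R _ (Gs s) H vH).
have [I1 I2] : P.-integrable setT (fun w => (inner (xA w) (iinc s r e w))%:E) /\
  (\int[P]_w (inner (xA w) (iinc s r e w))%:E = 0)%E.
 apply: iinc_mean => //. apply: (@le_lt_trans _ _ (\int[P]_w (1 + (`|x w| ^+ 2)%:E))%E).
  apply: le_int => // w _; rewrite -EFinD lee_fin normrZ ger0_norm//.
  apply: le_trans (ler_piMl _ (y1 w)) _ => //.
  by have := sqr_ge0 (`|x w| - 1); have := normr_ge0 (x w); nra.
 rewrite ge0_integralD//; last exact/mEFinP.
 by rewrite lte_add_pinfty// integral_cst//= probability_setT mule1 ltry.
have I3 : P.-integrable setT (fun w => (\1_A w * `|x w| ^+ 2)%:E).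
 apply/integrableP; split; first by apply/mEFinP; exact: measurable_funM.
 apply: le_lt_trans ix; apply: le_int => // w _.
 by rewrite abse_EFin lee_fin ger0_norm ?mulr_ge0 ?sqr_ge0// ler_piMl ?sqr_ge0.
have I4 : P.-integrable setT (fun w => (\1_A w * `|iinc s r e w| ^+ 2)%:E).
 apply/integrableP; split; first by apply/mEFinP; exact: measurable_funM.
 apply: le_lt_trans (_ : (8 * (r - s))%:E * \int[P]_w (`|ival e w| ^+ 2)%:E < +oo)%E.
  apply: le_trans iA; apply: le_int => // w _.
  by rewrite abse_EFin lee_fin ger0_norm ?mulr_ge0 ?sqr_ge0.
 by rewrite lte_mul_pinfty// ?ival_pow_lty// lee_fin.
have -> : (fun w => (\1_A w * `|(x w + iinc s r e w)| ^+ 2)%:E) =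
  (fun w => ((\1_A w * `|x w| ^+ 2)%:E + 2%:E * (inner (xA w) (iinc s r e w))%:E) +
       (\1_A w * `|iinc s r e w| ^+ 2)%:E)%E.
 apply/funext => w; rewrite -EFinM -!EFinD; congr EFin. by rewrite normD_inner innerZl; ring.
have I5 : P.-integrable setT (fun w => 2%:E * (inner (xA w) (iinc s r e w))%:E)%E.
 exact: integrableZl.
rewrite integralD//; last exact: integrableD.
rewrite integralD// integralZl// I2 mule0 adde0.
by rewrite leeD2l.
Qed.

(** Cauchy-Schwarz, obtained by integrating Young's inequality with weights that are optimal when
    both bounds are attained. *)
Lemma int_AMGM (f g : Om -> R) (a b : R) : 0 < a -> 0 < b ->
 (forall w, 0 <= f w) -> (forall w, 0 <= g w) ->
 measT f -> measT g ->
 (\int[P]_w (f w ^+ 2)%:E <= (a ^+ 2)%:E)%E ->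
 (\int[P]_w (g w ^+ 2)%:E <= (b ^+ 2)%:E)%E ->
 (\int[P]_w (f w * g w)%:E <= (a * b)%:E)%E.
Proof.
move=> a0 b0 f0 g0 mf mg fa gb.
apply: (@le_trans _ _ (\int[P]_w ((b / (2 * a))%:E * (f w ^+ 2)%:E +
  (a / (2 * b))%:E * (g w ^+ 2)%:E))%E).
 apply: le_int => // w _; first by rewrite lee_fin mulr_ge0.
 rewrite -!EFinM -EFinD lee_fin -subr_ge0.
 have -> : b / (2 * a) * f w ^+ 2 + a / (2 * b) * g w ^+ 2 - f w * g w =
   (b * f w - a * g w) ^+ 2 / (2 * a * b) by field; rewrite !gt_eqF.
 by rewrite divr_ge0 ?sqr_ge0// !mulr_ge0// ltW.
rewrite ge0_integralD//; last 4 first.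
- by move=> w _; rewrite -EFinM lee_fin mulr_ge0 ?sqr_ge0// divr_ge0 ?mulr_ge0// ltW.
- by apply: emeasurable_funM => //; apply/mEFinP; exact: measurable_funX.
- by move=> w _; rewrite -EFinM lee_fin mulr_ge0 ?sqr_ge0// divr_ge0 ?mulr_ge0// ltW.
- by apply: emeasurable_funM => //; apply/mEFinP; exact: measurable_funX.
rewrite !ge0_integralZl_EFin//; last 6 first.
- by move=> w _; rewrite lee_fin sqr_ge0.
- by apply/mEFinP; exact: measurable_funX.
- by rewrite divr_ge0 ?mulr_ge0// ltW.
- by move=> w _; rewrite lee_fin sqr_ge0.
- by apply/mEFinP; exact: measurable_funX.
- by rewrite divr_ge0 ?mulr_ge0// ltW.
have -> : (a * b)%:E = ((b / (2 * a))%:E * (a ^+ 2)%:E + (a / (2 * b))%:E * (b ^+ 2)%:E)%E.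
 by rewrite -!EFinM -EFinD; congr EFin; field; rewrite !gt_eqF.
by apply: leeD; apply: lee_wpmul2l => //; rewrite lee_fin divr_ge0 ?mulr_ge0// ltW.
Qed.

(** Stated for square roots of fourth moments because there the recursion is additive: the increment
    contributes [32 (r - s) b]. The expansion produces [64 (r - s) a b + 384 (r - s)^2 b^2], and the
    constant 32 completes the square. *)
Lemma step4 s r e (x : Om -> H) (a b : R) : t <= s -> s <= r -> r <= T ->
 events_at s e -> measT (x : Gs s -> borel H) -> 0 < a -> 0 < b ->
 (\int[P]_w (`|x w| ^+ 4)%:E <= (a ^+ 2)%:E)%E ->
 (\int[P]_w (`|ival e w| ^+ 4)%:E <= (b ^+ 2)%:E)%E ->
 (\int[P]_w (`|(x w + iinc s r e w)| ^+ 4)%:E <= ((a + 32 * (r - s) * b) ^+ 2)%:E)%E.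
Proof.
move=> ts sr rT ee mx a0 b0 xa eb.
have sT : s <= T by exact: le_trans rT.
have mx' : measT (x : Om -> borel H) by exact: Gs_fun mx.
have mi := iinc_meas ts sr rT ee.
have mxn : measT (fun w => `|x w| : R) by exact: borel_norm0.
have mxnG : measT ((fun w => `|x w|) : Gs s -> R).
 by apply: (@borel_norm0 R _ (Gs s)).
have min : measT (fun w => `|iinc s r e w| : R) by exact: borel_norm0.
have men := ival_norm_meas sT ee.
pose q w := `|x w| ^+ 2 *: x w.
have mq : measT (q : Gs s -> borel H).
 by apply: (@borelZ R _ (Gs s) H vH) => //; exact: measurable_funX.
have rs0 : 0 <= r - s by rewrite subr_ge0.
have lt4 (f : Om -> R) (k : R) : (forall w, 0 <= f w) ->
  (\int[P]_w (f w ^+ 4)%:E <= (k ^+ 2)%:E)%E -> measT f ->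
  (\int[P]_w (f w ^+ 3)%:E < +oo)%E.
 move=> f0 fk mf; apply: (@le_lt_trans _ _ (\int[P]_w (1 + (f w ^+ 4)%:E))%E).
  apply: le_int => // w _; rewrite -?EFinD lee_fin ?exprn_ge0//. have := f0 w; move: (f w) => z z0.
  have [z1|z1] := leP z 1.
   by apply: le_trans (exprn_ile1 _ z0 z1) _; rewrite lerDl exprn_ge0.
  rewrite (exprSr z 3) -[leLHS]mulr1.
  by apply: ler_wpDl => //; apply: ler_wpM2l; rewrite ?exprn_ge0// ltW.
 rewrite ge0_integralD//; last 2 first.
 - by move=> w _; rewrite lee_fin exprn_ge0.
 - by apply/mEFinP; exact: measurable_funX.
 rewrite lte_add_pinfty ?(le_lt_trans fk) ?ltry//.
 by rewrite integral_cst//= probability_setT mule1 ltry.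
have [I1 I2] : P.-integrable setT (fun w => (inner (q w) (iinc s r e w))%:E) /\
  (\int[P]_w (inner (q w) (iinc s r e w))%:E = 0)%E.
 apply: iinc_mean => //. apply: (@le_lt_trans _ _ (\int[P]_w (`|x w| ^+ 3)%:E)%E).
  by apply: le_int => // w _; rewrite lee_fin normrZ normrX normr_id -exprSr.
 exact: (lt4 _ a).
have J1 : (\int[P]_w (`|x w| ^+ 2 * `|iinc s r e w| ^+ 2)%:E <= (8 * (r - s) * (a * b))%:E)%E.
 apply: le_trans (iinc_moment2 ts sr rT ee (rho := fun w => `|x w| ^+ 2) _ _) _.
 - exact: measurable_funX.
 - by move=> w; rewrite sqr_ge0.
 under eq_integral do rewrite mulrCA EFinM. rewrite ge0_integralZl_EFin//; last 2 first.
 - by apply/mEFinP/measurable_funM; exact: measurable_funX.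
 - by rewrite mulr_ge0.
 rewrite [leRHS]EFinM lee_wpmul2l ?lee_fin ?mulr_ge0//. apply: int_AMGM => //.
 - exact: measurable_funX.
 - exact: measurable_funX.
 - by under eq_integral do rewrite -exprM.
 - by under eq_integral do rewrite -exprM.
have J2 : (\int[P]_w (`|iinc s r e w| ^+ 4)%:E <= (128 * (r - s) ^+ 2 * b ^+ 2)%:E)%E.
 have h1 : measT (cst 1 : Gs s -> R) by exact: mcst.
 have := iinc_moment4 ts sr rT ee (rho := cst 1) h1 (fun _ => ler01).
 under eq_integral do rewrite mul1r.
 move=> h; apply: le_trans h _; under eq_integral do rewrite mul1r.
 under eq_integral do rewrite EFinM. rewrite ge0_integralZl_EFin//; last 2 first.
 - by apply/mEFinP; exact: measurable_funX.
 - by rewrite mulr_ge0// sqr_ge0.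
 by rewrite [leRHS]EFinM lee_wpmul2l// lee_fin mulr_ge0// sqr_ge0.
have mm2 : measT (fun w => `|x w| ^+ 2 * `|iinc s r e w| ^+ 2).
 by apply: measurable_funM; exact: measurable_funX.
have I3 : P.-integrable setT (fun w => (`|x w| ^+ 4)%:E).
 apply/integrableP; split; first by apply/mEFinP; exact: measurable_funX.
 under eq_integral do rewrite abse_EFin normrX normr_id. exact: le_lt_trans xa (ltry _).
have I4 : P.-integrable setT (fun w => (`|x w| ^+ 2 * `|iinc s r e w| ^+ 2)%:E).
 apply/integrableP; split; first exact/mEFinP.
 under eq_integral do rewrite abse_EFin normrM !normrX !normr_id. exact: le_lt_trans J1 (ltry _).
have I5 : P.-integrable setT (fun w => (`|iinc s r e w| ^+ 4)%:E).
 apply/integrableP; split; first by apply/mEFinP; exact: measurable_funX.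
 under eq_integral do rewrite abse_EFin normrX normr_id. exact: le_lt_trans J2 (ltry _).
have I6 := integrableZl measurableT 4 I1.
have I7 := integrableZl measurableT 8 I4.
have I8 := integrableZl measurableT 3 I5.
have I9 := integrableD measurableT I3 I6.
have I10 := integrableD measurableT I7 I8.
apply: (@le_trans _ _ (\int[P]_w (((`|x w| ^+ 4)%:E + 4%:E * (inner (q w) (iinc s r e w))%:E) +
  (8%:E * (`|x w| ^+ 2 * `|iinc s r e w| ^+ 2)%:E + 3%:E * (`|iinc s r e w| ^+ 4)%:E)))%E).
 apply: le_int => // w _. rewrite -!EFinM -!EFinD lee_fin (exprM _ 2 2) normD_inner innerZl.
 rewrite (exprM `|x w| 2 2) (exprM `|iinc s r e w| 2 2). have := inner_sqr_le (x w) (iinc s r e w).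
 have := sqr_ge0 `|x w|; have := sqr_ge0 `|iinc s r e w|.
 move: (`|x w| ^+ 2) (`|iinc s r e w| ^+ 2) (inner _ _) => p1 p2 p3 h1 h2 h3.
 (* With [p3] the inner product, [4 p3 p2 <= 2 p3^2 + 2 p2^2] and [p3^2 <= p1 p2] give the
    coefficients 8 and 3. *)
 have := sqr_ge0 (p3 - p2); nra.
rewrite (integralD measurableT I9 I10) (integralD measurableT I3 I6).
rewrite (integralD measurableT I7 I8) !integralZl// I2 mule0 adde0.
apply: (@le_trans _ _ ((a ^+ 2)%:E + (8%:E * (8 * (r - s) * (a * b))%:E +
  3%:E * (128 * (r - s) ^+ 2 * b ^+ 2)%:E))%E).
 by apply: leeD => //; apply: leeD; apply: lee_wpmul2l.
rewrite -!EFinM -!EFinD lee_fin -subr_ge0.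
have -> : (a + 32 * (r - s) * b) ^+ 2 -
 (a ^+ 2 + (8 * (8 * (r - s) * (a * b)) + 3 * (128 * (r - s) ^+ 2 * b ^+ 2))) =
 640 * ((r - s) * b) ^+ 2 by ring.
by apply: mulr_ge0; [exact: ler0n|exact: sqr_ge0].
Qed.

End Wiener.

(** * Discrete chains with contractions between increments *)

Section Chain.
Variables (R : realType) (Xi H : hilbertType R)
 (d : measure_display) (Om : measurableType d) (P : probability Om R)
 (W : R -> Xi -> Om -> R) (t T : R)
 (HW : reference_space P W t T)
 (vH : nat -> H)
 (dvH : dense_seq vH).
Local Notation F := (filt P W t).
Local Notation G := (Gs P W t).
Variables (tau : nat -> R) (e : nat -> seq (set Om * Xi * H)) (C : nat -> H -> H)
 (tau_t : forall k, t <= tau k) (tauS : forall k, tau k <= tau k.+1)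
 (tau_T : forall k, tau k <= T) (ee : forall k, events_at P W t (tau k) (e k))
 (mC : forall k, measT (C k : borel H -> borel H))
 (Cc : forall k x, `|C k x| <= `|x|).

(** [C j] is the identity for a plain stochastic integral and the semigroup over one cell for a
    stochastic convolution. *)
Fixpoint chain k w : H :=
 if k is j.+1 then C j (chain j w + iinc W (tau j) (tau j.+1) (e j) w) else 0.

Lemma chain_adapted k : measT (chain k : G (tau k) -> borel H).
Proof.
elim: k => [|k IH] /=; first exact: mcst.
apply: (@measurableT_comp _ _ _ (G (tau k.+1)) (borel H) (borel H) _ setT _ (mC k)).
apply: (@borelD R _ (G (tau k.+1)) H vH) => //.
 exact: (Gs_fun_mono (tauS k)).
exact: (iinc_adapted dvH).
Qed.

Lemma chain_meas k : measT (chain k : Om -> borel H).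
Proof. exact: (Gs_fun HW (tau_T k) (@chain_adapted k)). Qed.

Definition energy k : \bar R :=
 (\sum_(j < k) (8 * (tau j.+1 - tau j))%:E * \int[P]_w (`|ival (e j) w| ^+ 2)%:E)%E.

Lemma chain_energyS k : energy k.+1 = (energy k +
 (8 * (tau k.+1 - tau k))%:E * \int[P]_w (`|ival (e k) w| ^+ 2)%:E)%E.
Proof. by rewrite /energy big_ord_recr. Qed.

Lemma energy_lty k : (energy k < +oo)%E.
Proof.
rewrite /energy; apply: lte_sum_pinfty => j _; apply: lte_mul_pinfty => //.
 by rewrite lee_fin mulr_ge0 ?subr_ge0.
exact: ival_pow_lty.
Qed.

Lemma filt_setT s : F s setT.
Proof. by apply/measGs; exact: measurableT. Qed.

Lemma chain2 k : (\int[P]_w (`|chain k w| ^+ 2)%:E <= energy k)%E.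
Proof.
elim: k => [|k IH].
 under eq_integral do rewrite /= normr0 expr0n/=. by rewrite integral0 /energy big_ord0.
rewrite chain_energyS.
have ix := le_lt_trans IH (energy_lty k).
have := step2 HW dvH (tau_t k) (tauS k) (tau_T k.+1) (@ee k) (@chain_adapted k)
 (@filt_setT (tau k)) ix.
under eq_integral do rewrite indicT mul1r.
under [X in (_ <= X + _)%E -> _]eq_integral do rewrite indicT mul1r.
move=> h; apply: le_trans (leeD2r _ IH); apply: le_trans h.
by apply: le_int => // w _; rewrite lee_fin lerXn2r ?nnegrE// Cc.
Qed.

Definition below (l : R) k : set Om := [set w | forall j, (j <= k)%N -> `|chain j w| < l].

Lemma belowS l k : below l k.+1 = below l k `&` [set w | `|chain k.+1 w| < l].
Proof.
apply/seteqP; split=> w.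
 move=> h; split; last exact: h. by move=> j jk; apply: h; exact: leqW.
move=> [h1 h2] j; rewrite leq_eqVlt => /predU1P[->//|]; exact: h1.
Qed.

Lemma chain_norm_lt l k : F (tau k) [set w | `|chain k w| < l].
Proof.
apply/measGs; rewrite -[X in measurable X]setTI.
have := @borel_norm0 R _ (G (tau k)) H setT _ measurableT (@chain_adapted k).
move=> /(_ measurableT `]-oo, l[%classic (measurable_itv _)).
by congr measurable; apply/seteqP; split => w /=; rewrite in_itv.
Qed.

Lemma below_filt l k : F (tau k) (below l k).
Proof.
elim: k => [|k IH].
 rewrite (_ : below l 0 = [set w | `|chain 0 w| < l]); first exact: chain_norm_lt.
 by apply/seteqP; split=> w; [exact|move=> h j; rewrite leqn0 => /eqP ->].
rewrite belowS; apply/measGs; apply: measurableI; apply/measGs.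
 exact: filt_mono (tauS k) _.
exact: chain_norm_lt.
Qed.

(* Stopping the chain when its norm first reaches l gives a weak type bound. *)
Lemma chain_max l k : 0 < l -> ((l ^+ 2)%:E * P (~` below l k) <= energy k)%E.
Proof.
move=> l0.
have mb j : measurable (below l j) by exact: (filt_meas HW (tau_T j) (@below_filt l j)).
have mx2 j : measT (fun w => `|chain j w| ^+ 2 : R).
 by apply: borel_normX => //; exact: chain_meas.
have mi (A : set Om) : measurable A -> measT (\1_A : Om -> R).
 by move=> mA; exact: measurable_indic.
suff h : (\int[P]_w (l ^+ 2 * \1_(~` below l k) w + \1_(below l k) w * `|chain k w| ^+ 2)%:E
  <= energy k)%E.
 apply: le_trans h; rewrite intD//; last 3 first.
 - by apply: measurable_funM => //; apply: mi; exact: measurableC.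
 - by apply: measurable_funM => //; exact: mi.
 - by move=> w; rewrite mulr_ge0// sqr_ge0.
 rewrite intZ ?sqr_ge0//; last by apply: mi; exact: measurableC.
 rewrite integral_indic ?setIT//; last exact: measurableC.
 by rewrite leeDl// integral_ge0// => w _; rewrite lee_fin mulr_ge0.
elim: k => [|k IH].
 rewrite /energy big_ord0 -(integral0 P setT); apply: le_int => // w _.
  by rewrite lee_fin addr_ge0// mulr_ge0// sqr_ge0.
 have -> : below l 0 = setT.
  by apply/seteqP; split=> // u _ j; rewrite leqn0 => /eqP -> /=; rewrite normr0.
 by rewrite lee_fin setCT indic0 /= normr0 expr0n/= !mulr0 addr0.
rewrite chain_energyS; apply: le_trans (leeD2r _ IH).
have ix := le_lt_trans (chain2 k) (energy_lty k).
have := step2 HW dvH (tau_t k) (tauS k) (tau_T k.+1) (@ee k) (@chain_adapted k)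
 (@below_filt l k) ix.
pose y w := chain k w + iinc W (tau k) (tau k.+1) (e k) w => S.
have mC1 : measT (fun w => l ^+ 2 * \1_(~` below l k) w : R).
 by apply: measurable_funM => //; apply: mi; exact: measurableC.
have m1 : measT (fun w => \1_(below l k) w * `|chain k w| ^+ 2 : R).
 by apply: measurable_funM => //; exact: mi.
rewrite [X in (_ <= X + _)%E]intD//; last by move=> w; rewrite mulr_ge0// sqr_ge0.
have my2 : measT (fun w => `|y w| ^+ 2 : R).
 apply: borel_normX => //. apply: (borelD dvH) => //; first exact: chain_meas.
 exact: (iinc_meas HW dvH).
rewrite -addeA; apply: le_trans (leeD2l _ S).
rewrite -intD//; last 2 first.
- by apply: measurable_funM => //; exact: mi.
- by move=> w; rewrite mulr_ge0// sqr_ge0.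
apply: le_int => // w _; first by rewrite lee_fin addr_ge0// mulr_ge0// sqr_ge0.
rewrite lee_fin belowS !indicE !in_setC !in_setI.
case: (w \in below l k); rewrite /= ?mulr0 ?mul0r ?addr0 ?add0r ?mul1r//.
case: (boolP (w \in _)) => lw; rewrite /= ?mulr0 ?mul0r ?addr0 ?add0r ?mul1r ?mulr1.
 by apply: lerXn2r; rewrite ?nnegrE ?Cc.
apply: lerXn2r; rewrite ?nnegrE ?(ltW l0)//; apply: le_trans (Cc k _).
by rewrite leNgt; apply: contra lw => h; exact/mem_set.
Qed.

(** Iteration of [step4]. The chain starts at 0 while [step4] asks for a positive bound on the
    square root of the moment, which is why [eps] is added. *)
Lemma chain4 (b : nat -> R) (eps : R) k : (forall j x, C j x = x) -> 0 < eps ->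
 (forall j, 0 < b j) ->
 (forall j, (\int[P]_w (`|ival (e j) w| ^+ 4)%:E <= (b j ^+ 2)%:E)%E) ->
 (\int[P]_w (`|chain k w| ^+ 4)%:E <=
  ((eps + 32 * \sum_(j < k) (tau j.+1 - tau j) * b j) ^+ 2)%:E)%E.
Proof.
move=> Cid e0 b0 hb; elim: k => [|k IH].
 under eq_integral do rewrite /= normr0 expr0n/=. by rewrite integral0 lee_fin sqr_ge0.
rewrite big_ord_recr mulrDr addrA (mulrA 32 (_ - _)).
under eq_integral do rewrite /= Cid.
apply: (step4 HW dvH) => //; first exact: chain_adapted.
apply: ltr_wpDr => //; apply: mulr_ge0; first exact: ler0n.
by apply: sumr_ge0 => j _; rewrite mulr_ge0 ?subr_ge0// ltW.
Qed.

End Chain.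

(** * Integrals over time and probability *)

Section ProcessIntegral.
Variables (R : realType) (d : measure_display) (Om : measurableType d)
 (P : probability Om R) (t : R).
Implicit Types (f g : R -> Om -> R) (s : R).

(** The integrals are iterated in the order of the definitions of controls and of the stochastic
    integral; Tonelli is applied to the extension by zero outside the strip. *)
Definition EI s f : \bar R := (\int[P]_w \int[leb]_(r in `[t, s]) (f r w)%:E)%E.

Definition strip s : set (realM R * Om) := `[t, s] `*` setT.

Definition pmeas s f := measurable_fun (strip s) (fun z : realM R * Om => f z.1 z.2).

Lemma strip_meas s : measurable (strip s).
Proof. by apply: measurableX => //; exact: measurable_itv. Qed.

Local Notation patched s f := ((fun z : realM R * Om => (f z.1 z.2)%:E) \_ (strip s)).

Lemma patched_meas s f : pmeas s f -> measT (patched s f).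
Proof.
move=> mf; apply/(measurable_restrictT _ (strip_meas s)).
exact/mEFinP.
Qed.

Lemma patched_ge0 s f : (forall r w, t <= r <= s -> 0 <= f r w) -> forall z, (0 <= patched s f z)%E.
Proof.
move=> f0 [r w]; rewrite patchE; case: ifPn => // /set_mem[/= + _].
by rewrite in_itv lee_fin; exact: f0.
Qed.

Lemma patchedE s f w : (\int[leb]_(r in `[t, s]) (f r w)%:E = \int[leb]_r patched s f (r, w))%E.
Proof.
rewrite integral_mkcond; apply: eq_integral => r _; rewrite !patchE.
by rewrite /strip in_setX /= in_setT andbT.
Qed.

Lemma patchedE2 s f r : (\int[P]_w patched s f (r, w) =
  ((fun r => \int[P]_w (f r w)%:E) \_ `[t, s]%classic) r)%E.
Proof.
rewrite patchE; case: ifPn => rs.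
 apply: eq_integral => w _; rewrite patchE /strip in_setX /= in_setT andbT. by rewrite rs.
rewrite (_ : point = 0%E)// -[RHS](integral0 P setT); apply: eq_integral => w _.
by rewrite patchE /strip in_setX /= in_setT andbT (negbTE rs).
Qed.

Lemma EI_prod s f : pmeas s f -> (forall r w, t <= r <= s -> 0 <= f r w) ->
 (EI s f = \int[leb \x P]_(z in strip s) (f z.1 z.2)%:E)%E.
Proof.
move=> mf f0; rewrite integral_mkcond.
rewrite (fubini_tonelli2 _ (patched_meas mf) (patched_ge0 f0)).
by apply: eq_integral => w _; rewrite patchedE.
Qed.

Lemma EI_swap s f : pmeas s f -> (forall r w, t <= r <= s -> 0 <= f r w) ->
 (EI s f = \int[leb]_(r in `[t, s]) \int[P]_w (f r w)%:E)%E.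
Proof.
move=> mf f0; rewrite [RHS]integral_mkcond.
transitivity (\int[leb]_r \int[P]_w patched s f (r, w))%E; last first.
 by apply: eq_integral => r _; rewrite patchedE2.
rewrite (fubini_tonelli _ (patched_meas mf) (patched_ge0 f0)).
by apply: eq_integral => w _; rewrite patchedE.
Qed.

Lemma EI_inner_meas s f : pmeas s f -> (forall r w, t <= r <= s -> 0 <= f r w) ->
 measT (fun w => \int[leb]_(r in `[t, s]) (f r w)%:E)%E.
Proof.
move=> mf f0.
have := measurable_fun_fubini_tonelli_G (m1 := leb) _ (patched_meas mf) (patched_ge0 f0).
by apply: eq_measurable_fun => w _; rewrite patchedE.
Qed.

Lemma EI_section s f w : pmeas s f -> measurable_fun `[t, s] (fun r => f r w).
Proof.
move=> mf.
have h : measT (fun r : realM R => patched s f (r, w)).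
 apply: (measurableT_comp (patched_meas mf)). exact: measurable_pair2.
apply/mEFinP/(measurable_restrictT _ (measurable_itv _)).
move: h; apply: eq_measurable_fun => r _; rewrite !patchE.
by rewrite /strip in_setX /= in_setT andbT.
Qed.

Lemma EI_section2 s f r : t <= r <= s -> pmeas s f -> measT (f r).
Proof.
move=> rs mf; apply/mEFinP.
have h : measT (fun w : Om => patched s f (r, w)).
 apply: (measurableT_comp (patched_meas mf)). exact: measurable_pair1.
move: h; apply: eq_measurable_fun => w _; rewrite !patchE.
by rewrite /strip in_setX /= in_setT andbT mem_set//= in_itv.
Qed.

Lemma EI_ge0 s f : (forall r w, t <= r <= s -> 0 <= f r w) -> (0 <= EI s f)%E.
Proof.
move=> f0; apply: integral_ge0 => w _; apply: integral_ge0 => r /=.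
by rewrite in_itv lee_fin; exact: f0.
Qed.

Lemma EI_le s f g : (forall r w, t <= r <= s -> 0 <= f r w <= g r w) -> (EI s f <= EI s g)%E.
Proof.
move=> fg; apply: le_int => // w _.
 apply: integral_ge0 => r /=; rewrite in_itv/= => rs.
 by have /andP[h _] := fg r w rs; rewrite lee_fin.
apply: le_int; first exact: measurable_itv.
 by move=> r /=; rewrite in_itv/= => rs; have /andP[h _] := fg r w rs; rewrite lee_fin.
by move=> r /=; rewrite in_itv/= => rs; have /andP[_ h] := fg r w rs; rewrite lee_fin.
Qed.

Lemma EI_D s f g : pmeas s f -> pmeas s g -> (forall r w, 0 <= f r w) -> (forall r w, 0 <= g r w) ->
 (EI s (fun r w => f r w + g r w)%R = EI s f + EI s g)%E.
Proof.
move=> mf mg f0 g0; rewrite !EI_prod//.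
- by rewrite intD//; exact: strip_meas.
- by apply: measurable_funD.
- by move=> r w _; rewrite addr_ge0.
Qed.

Lemma EI_Z s f k : pmeas s f -> (forall r w, 0 <= f r w) -> 0 <= k ->
 (EI s (fun r w => k * f r w)%R = k%:E * EI s f)%E.
Proof.
move=> mf f0 k0; rewrite !EI_prod//.
- by rewrite intZ//; exact: strip_meas.
- by apply: measurable_funM.
- by move=> r w _; rewrite mulr_ge0.
Qed.

Lemma EI_cst s (k : R) : t <= s -> 0 <= k -> EI s (fun _ _ => k) = (k * (s - t))%:E.
Proof.
move=> ts k0; rewrite /EI.
under eq_integral do rewrite integral_cst//=.
rewrite integral_cst//= probability_setT mule1.
rewrite lebesgue_measure_itv/= lte_fin; case: ltP => [_|st].
 by rewrite -EFinB -EFinM.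
by rewrite mule0 (_ : s = t) ?subrr ?mulr0//; apply/eqP; rewrite eq_le ts st.
Qed.

Lemma EI_dct s (f : nat -> R -> Om -> R) g :
 (forall n, pmeas s (f n)) -> pmeas s g -> (forall n r w, 0 <= f n r w) ->
 (forall n r w, t <= r <= s -> f n r w <= g r w) ->
 (EI s g < +oo)%E ->
 (forall r w, t <= r <= s -> f ^~ r ^~ w @ \oo --> 0) ->
 EI s (f n) @[n --> \oo] --> 0%E.
Proof.
move=> mf mg f0 fg gi f00.
have g0 r w : t <= r <= s -> 0 <= g r w.
 by move=> rs; apply: le_trans (f0 0%N r w) (fg _ _ _ rs).
under eq_fun do rewrite EI_prod//.
rewrite -(integral0 (leb \x P)%E (strip s)).
have mS := strip_meas s.
apply: (@dominated_cvg _ _ _ _ _ mS _ _ (fun z => (g z.1 z.2)%:E)) => //.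
- by move=> n; apply/mEFinP; exact: mf.
- move=> [r w] /= [/= rs _]; apply/cvg_EFin; first by near=> n.
 apply: f00; by rewrite in_itv in rs.
- apply/integrableP; split; first by apply/mEFinP; exact: mg.
 apply: le_lt_trans gi; rewrite EI_prod//; apply: le_int => // -[r w].
 by move=> [/= rs _]; rewrite lee_fin ger0_norm// g0//; rewrite in_itv in rs.
- move=> n [r w] [/= rs _]; rewrite lee_fin ger0_norm// fg//.
Unshelve. all: by end_near. Qed.

End ProcessIntegral.

(** * Time grids and processes that are constant on cells *)

Section Grid.
Variables (R : realType) (tau : nat -> R) (tauS : forall k, tau k <= tau k.+1).

Lemma grid_mono j k : (j <= k)%N -> tau j <= tau k.
Proof.
elim: k => [|k IH]; first by rewrite leqn0 => /eqP ->.
by rewrite leq_eqVlt => /predU1P[->//|]; rewrite ltnS => /IH/le_trans; exact.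
Qed.

(** Cells are open on the left, so that a value known at [tau k] is used only afterwards. Grid
    points may repeat; the cell between equal points is empty. *)
Definition cell k (r : R) : R := (tau k < r <= tau k.+1)%R%:R.

Lemma cellE k r : cell k r = (r <= tau k.+1)%R%:R - (r <= tau k)%R%:R.
Proof.
rewrite /cell; have := tauS k.
case: (leP r (tau k)) => h1; case: (leP r (tau k.+1)) => h2 h3; rewrite ?subrr ?subr0//.
by have := lt_le_trans h2 (le_trans h1 h3); rewrite ltxx.
Qed.

Lemma cell_uniq j k r : tau j < r <= tau j.+1 -> k != j -> cell k r = 0.
Proof.
move=> /andP[r1 r2] kj; rewrite /cell; case: andP => // -[k1 k2].
move: kj; rewrite neq_lt => /orP[|] h.
 by have := le_lt_trans (le_trans k2 (grid_mono h)) r1; rewrite ltxx.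
by have := le_lt_trans (le_trans r2 (grid_mono h)) k1; rewrite ltxx.
Qed.

Lemma cell_exists N r : tau 0%N < r <= tau N -> exists2 j, (j < N)%N & tau j < r <= tau j.+1.
Proof.
elim: N => [|N IH] /andP[r0 rN].
 by have := lt_le_trans r0 rN; rewrite ltxx.
case: (leP r (tau N)) => h.
 by have [|j jN jr] := IH; [rewrite r0|exists j => //; exact: leqW].
by exists N => //; rewrite h.
Qed.

Lemma cellP N r : (forall k, (k < N)%N -> cell k r = 0) \/
 exists2 j, (j < N)%N & [/\ tau j < r <= tau j.+1, cell j r = 1 & forall k, k != j -> cell k r = 0].
Proof.
have [|n0] := pselect (exists2 j, (j < N)%N & tau j < r <= tau j.+1).
 by move=> [j jN jr]; right; exists j => //; split => //;
  [rewrite /cell jr|move=> k; exact: cell_uniq].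
left; move=> k kN; rewrite /cell; case: (boolP (tau k < r <= tau k.+1)) => // h.
by exfalso; apply: n0; exists k.
Qed.

Definition gfun (V : lmodType R) N (Om : Type) (a : nat -> Om -> V) r w : V :=
 \sum_(k < N) cell k r *: a k w.

Lemma gfun_cell (V : lmodType R) N Om (a : nat -> Om -> V) r w j : (j < N)%N ->
 tau j < r <= tau j.+1 -> gfun N a r w = a j w.
Proof.
move=> jN jr; rewrite /gfun (bigD1 (Ordinal jN))//= big1 ?addr0.
 by rewrite /cell jr scale1r.
move=> k kj; rewrite (@cell_uniq j k)// ?scale0r//; apply: contra kj => /eqP kj.
Qed.

Lemma gfun0 (V : lmodType R) N Om (a : nat -> Om -> V) r w :
 (forall k, (k < N)%N -> cell k r = 0) -> gfun N a r w = 0.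
Proof. by move=> h; rewrite /gfun big1// => k _; rewrite h ?scale0r. Qed.

Lemma gfun_map (V V' : lmodType R) N Om (phi : V -> V') (a : nat -> Om -> V) r w :
 phi 0 = 0 -> phi (gfun N a r w) = gfun N (fun k w => phi (a k w)) r w.
Proof.
move=> phi0; case: (cellP N r) => [h|[j jN [jr _ _]]]; first by rewrite !gfun0.
by rewrite !(gfun_cell _ _ jN jr).
Qed.

Lemma telescope_min N (V : zmodType) (f : R -> V) v a : (a <= N)%N -> v = tau a ->
 \sum_(k < N) (if tau k < v then f (tau k.+1) - f (tau k) else 0) = f v - f (tau 0%N).
Proof.
move=> aN va; transitivity (\sum_(k < N) (f (Num.min (tau k.+1) v) - f (Num.min (tau k) v))).
 apply: eq_bigr => k _; case: ltP => kv.
  rewrite (min_idPl _)//. rewrite va; apply: grid_mono; rewrite ltnNge; apply/negP => ak.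
  by have := lt_le_trans kv (eq_ind_r (fun x => x <= _) (grid_mono ak) va); rewrite ltxx.
 by rewrite (min_idPr _) ?subrr//; exact: le_trans (tauS k).
have -> : f v = f (Num.min (tau N) v).
 by rewrite (min_idPr _)// va grid_mono.
have -> : f (tau 0%N) = f (Num.min (tau 0%N) v).
 by rewrite (min_idPl _)// va grid_mono.
elim: N {aN} => [|N IH]; first by rewrite big_ord0 subrr.
by rewrite big_ord_recr /= IH; abel.
Qed.

(** Cuts the interval from [u] to [v] along a grid that contains both ends. With [f] a path of [W]
    or an indicator in time, this refines elementary integrals and elementary processes at once. *)
Lemma telescope N (V : zmodType) (f : R -> V) u v a b : (a <= N)%N -> (b <= N)%N ->
 u = tau a -> v = tau b -> u <= v ->
 \sum_(k < N) (if (u <= tau k) && (tau k < v) then f (tau k.+1) - f (tau k) else 0)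
 = f v - f u.
Proof.
move=> aN bN ua vb uv.
have -> : f v - f u = (f v - f (tau 0%N)) - (f u - f (tau 0%N)).
 by rewrite opprB addrA subrK.
rewrite -(telescope_min f aN ua) -(telescope_min f bN vb) -sumrB.
apply: eq_bigr => k _; case: (leP u (tau k)) => h1; case: ltP => h2; rewrite ?subr0 ?subrr//.
by have := lt_le_trans h1 (le_trans uv h2); rewrite ltxx.
Qed.

End Grid.

Section UniformGrid.
Variables (R : realType) (t s : R).

(** The index is truncated at [N], so that a grid is an infinite monotone sequence that stays at
    [s]. *)
Definition ugrid N k : R := t + (s - t) * ((minn k N)%:R / N%:R).

Lemma ugrid0 N : ugrid N 0 = t.
Proof. by rewrite /ugrid min0n mul0r mulr0 addr0. Qed.

Lemma ugridN N k : (0 < N)%N -> (N <= k)%N -> ugrid N k = s.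
Proof.
move=> N0 Nk; rewrite /ugrid (minn_idPr Nk) divff ?mulr1 1?addrC ?subrK//.
by rewrite pnatr_eq0 -lt0n.
Qed.

Variables (ts : t <= s).

Lemma ugridS N k : ugrid N k <= ugrid N k.+1.
Proof.
rewrite /ugrid lerD2l ler_wpM2l ?subr_ge0// ler_wpM2r ?invr_ge0// ler_nat.
by rewrite leq_min geq_minr (leq_trans (geq_minl _ _)).
Qed.

Lemma ugrid_t N k : t <= ugrid N k.
Proof. by rewrite -(ugrid0 N); apply: grid_mono => //; exact: ugridS. Qed.

Lemma ugrid_s N k : (0 < N)%N -> ugrid N k <= s.
Proof.
move=> N0; rewrite -(@ugridN N (maxn k N)) ?leq_maxr//.
by apply: grid_mono; [exact: ugridS|exact: leq_maxl].
Qed.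

Lemma ugrid_mesh N k : ugrid N k.+1 - ugrid N k <= (s - t) / N%:R.
Proof.
rewrite /ugrid opprD addrACA subrr add0r -mulrBr ler_wpM2l ?subr_ge0// -mulrBl.
have h : (minn k.+1 N)%:R <= (minn k N)%:R + 1 :> R.
 rewrite natr1 ler_nat; apply: leq_trans (_ : minn k.+1 N.+1 <= _)%N.
  by rewrite leq_min geq_minl leqW// geq_minr.
 by rewrite minnSS.
by rewrite -[leRHS]mul1r; apply: ler_wpM2r; [rewrite invr_ge0|lra].
Qed.

Lemma ugrid_dense q r : t < r <= s -> q < r -> exists N0, forall N, (N0 <= N)%N -> (0 < N)%N ->
 exists2 j, (j < N)%N & q < ugrid N j < r.
Proof.
move=> /andP[tr rs] qr; have rq : 0 < r - q by rewrite subr_gt0.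
have st : 0 < s - t by rewrite subr_gt0 (lt_le_trans tr).
exists (Num.truncn ((s - t) / (r - q))).+1 => N hN N0.
have [j jN /andP[j1 j2]] : exists2 j, (j < N)%N & ugrid N j < r <= ugrid N j.+1.
 apply: cell_exists; rewrite ugrid0 ugridN// tr rs//.
exists j => //; rewrite j1 andbT.
have := ugrid_mesh N j; have h : (s - t) / N%:R < r - q.
 rewrite ltr_pdivrMr ?ltr0n// mulrC -ltr_pdivrMr//.
 by apply: lt_le_trans (truncnS_gt _) _; rewrite ler_nat.
by lra.
Qed.

End UniformGrid.

(** * Elementary processes as lists, and their common refinement *)

Section Items.
Variables (R : realType) (Xi H : hilbertType R)
 (d : measure_display) (Om : measurableType d) (P : probability Om R)
 (W : R -> Xi -> Om -> R) (t : R).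
Implicit Types (D : seq (R * R * (set Om * Xi * H))) (e : seq (set Om * Xi * H)).

(** Lists of items instead of indexed families: addition of elementary processes becomes
    concatenation. *)
Definition efun D r w : hs Xi H := \sum_(x <- D)
 (\1_(`]x.1.1, x.1.2]) r * \1_(x.2.1.1) w) *: rank1 x.2.1.2 x.2.2.

Definition eint D w : H := \sum_(x <- D) (\1_(x.2.1.1) w * dW W x.1.1 x.1.2 x.2.1.2 w) *: x.2.2.

Definition eon s D := forall x, x \in D ->
 [/\ t <= x.1.1, x.1.1 <= x.1.2, x.1.2 <= s & filt P W t x.1.1 x.2.1.1].

Definition elist (x : elementary Xi Om H) : seq (R * R * (set Om * Xi * H)) :=
 [seq (elem_start i, elem_end i, (elem_event i, elem_dir i, elem_val i)) |
  i <- enum 'I_(elem_size x)].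

Definition list_elem D : elementary Xi Om H := @Elementary R Xi d Om H (size D)
  (fun i => (tnth (in_tuple D) i).1.1) (fun i => (tnth (in_tuple D) i).1.2)
  (fun i => (tnth (in_tuple D) i).2.1.1) (fun i => (tnth (in_tuple D) i).2.1.2)
  (fun i => (tnth (in_tuple D) i).2.2).

Lemma elist_fun x r w : elementary_fun x r w = efun (elist x) r w.
Proof. by rewrite /efun big_map big_enum. Qed.

Lemma elist_int x w : elementary_integral W x w = eint (elist x) w.
Proof. by rewrite /eint big_map big_enum. Qed.

Lemma elist_on s x : elementary_on P W t s x -> eon s (elist x).
Proof. by move=> h _ /mapP[i _ ->]; exact: h. Qed.

Lemma list_elem_fun D r w : elementary_fun (list_elem D) r w = efun D r w.
Proof. by rewrite /efun big_tnth. Qed.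

Lemma list_elem_int D w : elementary_integral W (list_elem D) w = eint D w.
Proof. by rewrite /eint big_tnth. Qed.

Lemma list_elem_on s D : eon s D -> elementary_on P W t s (list_elem D).
Proof. by move=> h i; apply: (h (tnth (in_tuple D) i)); exact: mem_tnth. Qed.

Definition eneg k D : seq (R * R * (set Om * Xi * H)) := [seq (x.1, (x.2.1, k *: x.2.2)) | x <- D].

Lemma eneg_fun k D r w : efun (eneg k D) r w = k *: efun D r w.
Proof.
rewrite /efun /eneg big_map scaler_sumr; apply: eq_bigr => x _ /=.
rewrite (_ : rank1 _ (k *: _) = k *: rank1 x.2.1.2 x.2.2).
 by rewrite [LHS]scalerA [RHS]scalerA mulrC.
apply: (@val_inj _ _ (hs Xi H)); apply/funext => y /=.
by rewrite -[RHS]/(k *: (inner _ y *: _)) !scalerA mulrC.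
Qed.

Lemma eneg_int k D w : eint (eneg k D) w = k *: eint D w.
Proof.
rewrite /eint /eneg big_map scaler_sumr; apply: eq_bigr => x _ /=.
by rewrite !scalerA mulrC.
Qed.

Lemma eneg_on s k D : eon s D -> eon s (eneg k D).
Proof. by move=> h _ /mapP[x /h hx ->]. Qed.

Lemma ecat_fun D D' r w : efun (D ++ D') r w = efun D r w + efun D' r w.
Proof. by rewrite /efun big_cat. Qed.

Lemma ecat_int D D' w : eint (D ++ D') w = eint D w + eint D' w.
Proof. by rewrite /eint big_cat. Qed.

Lemma ecat_on s D D' : eon s D -> eon s D' -> eon s (D ++ D').
Proof. by move=> h h' x; rewrite mem_cat => /orP[/h|/h']. Qed.

Definition restr (A : set Om) e : seq (set Om * Xi * H) := [seq (i.1.1 `&` A, i.1.2, i.2) | i <- e].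

Lemma restr_val A e w : ival (restr A e) w = \1_A w *: ival e w.
Proof.
rewrite !ivalE /restr big_map scaler_sumr; apply: eq_bigr => i _ /=.
by rewrite indicI scalerA mulrC.
Qed.

Lemma restr_inc A e s r w : iinc W s r (restr A e) w = \1_A w *: iinc W s r e w.
Proof.
rewrite !iincE /restr big_map scaler_sumr; apply: eq_bigr => i _ /=.
by rewrite indicI scalerA; congr (_ *: _); rewrite /=; ring.
Qed.

Lemma restr_at A e s : filt P W t s A -> events_at P W t s e -> events_at P W t s (restr A e).
Proof.
move=> FA h _ /mapP[i /h Fi ->] /=.
by apply/measGs; apply: measurableI; exact/measGs.
Qed.

Definition mpts s N D : seq R := sort <=%R
 (flatten [seq [:: x.1.1; x.1.2] | x <- D] ++ mkseq (ugrid t s N) N.+1).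
Definition mgrid s N D k := nth s (mpts s N D) k.
Definition mcell s N D k : seq (set Om * Xi * H) :=
 [seq x.2 | x <- D & (x.1.1 <= mgrid s N D k) && (mgrid s N D k < x.1.2)].

Section Merge.
Variables (s : R) (N : nat) (D : seq (R * R * (set Om * Xi * H)))
 (ts : t <= s) (N0 : (0 < N)%N) (hD : eon s D).
Local Notation tau := (mgrid s N D).
Local Notation M := (size (mpts s N D)).

Lemma mpts_bound x : x \in mpts s N D -> t <= x <= s.
Proof.
rewrite mem_sort mem_cat => /orP[|/mapP[k _ ->]].
 move=> /flattenP[_ /mapP[y yD ->]]; have [h1 h2 h3 _] := hD yD.
 rewrite !inE => /orP[]/eqP ->; first by rewrite h1 (le_trans h2). by rewrite h3 (le_trans h1).
by rewrite ugrid_t// ugrid_s.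
Qed.

Lemma mgrid_bound k : t <= tau k <= s.
Proof.
have [kM|kM] := ltnP k M; first exact/mpts_bound/mem_nth.
by rewrite /mgrid nth_default// ts lexx.
Qed.

Lemma mgridS k : tau k <= tau k.+1.
Proof.
have [kM|kM] := ltnP k.+1 M; last first.
 by rewrite [leRHS]/mgrid nth_default//; case/andP: (mgrid_bound k).
rewrite /mgrid; apply: (sorted_leq_nth le_trans le_refl) => //.
 exact: (sort_sorted (@le_total _ _)).
by rewrite inE ltnW.
Qed.

Lemma mgrid_mem x : x \in mpts s N D -> exists2 a, (a <= M)%N & x = tau a.
Proof.
move=> xp; exists (index x (mpts s N D)); first by rewrite ltnW// index_mem.
by rewrite /mgrid nth_index.
Qed.

Lemma mgrid_start x : x \in D -> exists2 a, (a <= M)%N & x.1.1 = tau a.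
Proof.
move=> xD; apply: mgrid_mem; rewrite mem_sort mem_cat; apply/orP; left.
by apply/flattenP; exists [:: x.1.1; x.1.2]; [apply/mapP; exists x|rewrite inE eqxx].
Qed.

Lemma mgrid_end x : x \in D -> exists2 a, (a <= M)%N & x.1.2 = tau a.
Proof.
move=> xD; apply: mgrid_mem; rewrite mem_sort mem_cat; apply/orP; left.
apply/flattenP; exists [:: x.1.1; x.1.2]; first by apply/mapP; exists x.
by rewrite !inE eqxx orbT.
Qed.

Lemma mgrid_ugrid j : (j <= N)%N -> exists2 a, (a <= M)%N & ugrid t s N j = tau a.
Proof.
move=> jN; apply: mgrid_mem; rewrite mem_sort mem_cat; apply/orP; right.
by apply/mapP; exists j => //; rewrite mem_iota.
Qed.

Lemma mcell_at k : events_at P W t (tau k) (mcell s N D k).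
Proof.
move=> _ /mapP[x + ->]; rewrite mem_filter => /andP[/andP[h _] xD].
by have [_ _ _] := hD xD; exact: filt_mono.
Qed.

(** An item is active on a cell exactly when its interval covers the cell, and its event, known when
    the item starts, is still adapted when the cell starts. *)
Lemma mcell_fun r w : efun D r w = gfun tau M (fun k => ival (mcell s N D k)) r w.
Proof.
rewrite /gfun; under eq_bigr do rewrite ivalE big_map big_filter big_mkcond scaler_sumr/=.
rewrite exchange_big /=; apply: eq_big_seq => x xD.
have [a aM ua] := mgrid_start xD; have [b bM vb] := mgrid_end xD.
have [_ uv _ _] := hD xD.
transitivity ((\sum_(k < M) (if (x.1.1 <= tau k) && (tau k < x.1.2) then
  (r <= tau k.+1)%R%:R - (r <= tau k)%R%:R else 0 : R)) *:
  (\1_(x.2.1.1) w *: rank1 x.2.1.2 x.2.2)).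
 rewrite (telescope mgridS (fun x => (r <= x)%R%:R : R) aM bM ua vb uv).
 rewrite scalerA; congr (_ * _ *: _); rewrite indicE mem_setE in_itv /=.
 case: (leP r x.1.1) => h1; case: (leP r x.1.2) => h2; rewrite ?subrr ?subr0//.
 by have := lt_le_trans h2 (le_trans h1 uv); rewrite ltxx.
rewrite scaler_suml; apply: eq_bigr => k _; rewrite -cellE; last exact: mgridS.
by case: ifP; rewrite ?scale0r ?scaler0.
Qed.

Lemma mcell_int w : eint D w = \sum_(k < M) iinc W (tau k) (tau k.+1) (mcell s N D k) w.
Proof.
under eq_bigr do rewrite iincE big_map big_filter big_mkcond /=.
rewrite exchange_big /=; apply: eq_big_seq => x xD.
have [a aM ua] := mgrid_start xD; have [b bM vb] := mgrid_end xD.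
have [_ uv _ _] := hD xD.
rewrite /dW -(telescope mgridS (fun q => W q x.2.1.2 w) aM bM ua vb uv).
rewrite mulr_sumr scaler_suml; apply: eq_bigr => k _.
by case: ifP; rewrite ?mulr0 ?scale0r.
Qed.

End Merge.
End Items.

Section GridIntegral.
Variables (R : realType) (d : measure_display) (Om : measurableType d)
 (P : probability Om R) (t s : R).

Definition rfun (tau : nat -> R) N (a : nat -> Om -> R) r w : R :=
 \sum_(k < N) cell tau k r * a k w.

Variables (tau : nat -> R) (tauS : forall k, tau k <= tau k.+1) (tau_b : forall k, t <= tau k <= s).

Lemma gfun_real (V : normedModType R) N (phi : V -> R) (a : nat -> Om -> V) r w :
 phi 0 = 0 -> phi (gfun tau N a r w) = rfun tau N (fun k w => phi (a k w)) r w.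
Proof. exact: (@gfun_map R tau tauS V R^o). Qed.

Lemma cell_meas k : measT (cell tau k).
Proof.
rewrite (_ : cell tau k = \1_(`]tau k, tau k.+1])); first exact: measurable_indic.
by apply/funext => r; rewrite indicE mem_setE in_itv.
Qed.

Lemma rfun_meas d' (Om' : measurableType d') (D : set (realM R * Om'))
  N (a : nat -> Om' -> R) : measurable D ->
 (forall k, (k < N)%N -> measurable_fun D (fun z => a k z.2)) ->
 measurable_fun D (fun z : realM R * Om' => \sum_(k < N) cell tau k z.1 * a k z.2).
Proof.
move=> mD ma; apply: measurable_sum => k; apply: measurable_funM; last exact: ma.
by apply: measurable_funTS; apply: measurableT_comp (cell_meas k) measurable_fst.
Qed.

Lemma rfun_pmeas N (a : nat -> Om -> R) : (forall k, (k < N)%N -> measT (a k)) ->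
 pmeas t s (rfun tau N a).
Proof.
move=> ma; apply: rfun_meas => [|k kN]; first exact: strip_meas.
by apply: measurable_funTS; apply: measurableT_comp (ma k kN) measurable_snd.
Qed.

Lemma EI_rfun N (a : nat -> Om -> R) : (forall k, (k < N)%N -> measT (a k)) ->
 (forall k w, 0 <= a k w) ->
 EI P t s (rfun tau N a) =
 (\sum_(k < N) (tau k.+1 - tau k)%:E * \int[P]_w (a k w)%:E)%E.
Proof.
elim: N => [|N IH] ma a0.
 rewrite big_ord0 /EI -(integral0 P setT); apply: eq_integral => w _.
 rewrite -[RHS](integral0 (@lebesgue_measure R) `[t, s]); apply: eq_integral => r _.
 by rewrite /rfun big_ord0.
have c0 k r : 0 <= cell tau k r by rewrite /cell.
have -> : EI P t s (rfun tau N.+1 a) = EI P t s (fun r w => rfun tau N a r w +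
  cell tau N r * a N w)%R.
 by congr EI; apply/funext => r; apply/funext => w; rewrite /rfun big_ord_recr.
have mN : pmeas t s (fun r w => cell tau N r * a N w).
 apply: measurable_funM.
  by apply: measurable_funTS; apply: measurableT_comp (cell_meas N) measurable_fst.
 by apply: measurable_funTS; apply: measurableT_comp (ma N _) measurable_snd.
rewrite EI_D//; last 3 first.
- by apply: rfun_pmeas => k kN; apply: ma; exact: leqW.
- by move=> r w; apply: sumr_ge0 => k _; rewrite mulr_ge0.
- by move=> r w; rewrite mulr_ge0.
rewrite IH//; last by move=> k kN; apply: ma; exact: leqW.
rewrite big_ord_recr /=; congr (_ + _)%E; rewrite EI_swap//; last first.
 by move=> r w _; rewrite mulr_ge0.
have mN' := ma N (ltnSn N).
under eq_integral do rewrite intZ//.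
rewrite ge0_integralZr//; last 3 first.
- by apply/mEFinP/measurable_funTS; exact: cell_meas.
- by move=> r _; rewrite lee_fin.
- by apply: integral_ge0 => w _; rewrite lee_fin.
congr (_ * _)%E; under eq_integral => r _.
 rewrite (_ : cell tau N r = \1_(`]tau N, tau N.+1]) r); last first.
  by rewrite indicE mem_setE in_itv.
 over.
rewrite integral_indic; [|exact: measurable_itv|exact: measurable_itv].
rewrite setIidl; last first.
 move=> r /=; rewrite !in_itv /= => /andP[h1 h2].
 have /andP[b1 _] := tau_b N; have /andP[_ b2] := tau_b N.+1.
 by rewrite (le_trans b1 (ltW h1)) (le_trans h2).
etransitivity; first exact: (@lebesgue_measure_itv R `]tau N, tau N.+1]).
rewrite /= lte_fin; case: ltP => [_|h]; first by rewrite -EFinB.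
by rewrite (_ : tau N.+1 = tau N) ?subrr//; apply/eqP; rewrite eq_le h tauS.
Qed.

End GridIntegral.

(** Lets the error of a discretized bound tend to zero even when [Y] is infinite. *)
Lemma lee_lim0 R (X Y : \bar R) (K : R) (e : nat -> \bar R) :
 0 <= K -> (0 <= Y)%E -> e @ \oo --> 0%E ->
 (forall n, (X <= K%:E * (Y + e n))%E) -> (X <= K%:E * Y)%E.
Proof.
move=> K0 Y0 e0 h.
have cv : (fun n => K%:E * (Y + e n))%E @ \oo --> (K%:E * Y)%E.
 rewrite -[X in _ --> (_ * X)%E]adde0; apply: cvgeZl => //.
 by apply: cvgeD; [rewrite fin_num_adde_defl|exact: cvg_cst|exact: e0].
rewrite -(cvg_lim _ cv)//; apply: lime_ge; first by apply/cvg_ex; eexists; exact: cv.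
by near=> n; exact: h.
Unshelve. all: by end_near. Qed.

(** * Localization by a decreasing family of adapted events *)

Section Localization.
Variables (R : realType) (Xi H : hilbertType R)
 (d : measure_display) (Om : measurableType d) (P : probability Om R)
 (W : R -> Xi -> Om -> R) (t T s : R)
 (HW : reference_space P W t T)
 (vH : nat -> H)
 (dvH : dense_seq vH)
 (tsT : t <= s <= T).
Local Notation F := (filt P W t).
Local Notation EI := (EI P t).
Implicit Types D : seq (R * R * (set Om * Xi * H)).

Let ts : t <= s. Proof. by case/andP: tsT. Qed.
Let sT : s <= T. Proof. by case/andP: tsT. Qed.

Lemma rfun_cell (tau : nat -> R) N (a : nat -> Om -> R) r w j :
 (forall k, tau k <= tau k.+1) -> (j < N)%N ->
 tau j < r <= tau j.+1 -> rfun tau N a r w = a j w.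
Proof. by move=> h; exact: (@gfun_cell R tau h R^o). Qed.

Lemma rfun0 (tau : nat -> R) N (a : nat -> Om -> R) r w :
 (forall k, (k < N)%N -> cell tau k r = 0) -> rfun tau N a r w = 0.
Proof. exact: (@gfun0 R tau R^o). Qed.

Lemma efun_bound (D : seq (R * R * (set Om * Xi * H))) :
 exists2 K : R, 0 <= K & forall r w, `|efun D r w| <= K.
Proof.
exists (\sum_(x <- D) `|rank1 x.2.1.2 x.2.2|); first by apply: sumr_ge0.
move=> r w; apply: le_trans (ler_norm_sum _ _ _) _; apply: ler_sum => x _.
rewrite normrZ -[leRHS]mul1r; apply: ler_wpM2r => //.
by rewrite !indicE; case: (_ \in _); case: (_ \in _); rewrite /= ?mulr0 ?mul0r ?mulr1 ?normr0 ?normr1.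
Qed.

Lemma efun_start D w : eon P W t s D -> efun D t w = 0.
Proof.
move=> hD; rewrite /efun big_seq big1// => x xD; have [h _ _ _] := hD x xD.
by rewrite indicE mem_setE in_itv /= ltNge h /= mul0r scale0r.
Qed.

Lemma efun_pow_pmeas D n : (0 < n)%N -> eon P W t s D -> pmeas t s (fun r w => `|efun D r w| ^+ n).
Proof.
move=> n0 hD.
have -> : (fun r w => `|efun D r w| ^+ n) = rfun (mgrid t s 1 D) (size (mpts t s 1 D))
  (fun k w => `|ival (mcell t s 1 D k) w| ^+ n).
 apply/funext => r; apply/funext => w. rewrite (@mcell_fun _ _ _ _ _ P W t s 1 D ts _ hD)//.
 rewrite (@gfun_real R _ Om _ _ _ _ (fun x : hs Xi H => `|x| ^+ n))//.
  exact: (mgridS ts _ hD).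
 by rewrite normr0 expr0n gtn_eqF.
apply: rfun_pmeas => k _; apply: measurable_funX.
have /andP[_ h] := mgrid_bound ts (ltn0Sn 0) hD k.
apply: (ival_norm_meas HW (le_trans h sT)).
exact: mcell_at.
Qed.

Variables (G : R -> set Om) (FG : forall r, t <= r <= s -> F r (G r))
 (Gle : forall q r, t <= q -> q <= r -> G r `<=` G q)
 (Glc : forall r w, t < r <= s -> (forall q, t <= q < r -> G q w) -> G r w).

(** The indicator of the stochastic interval on which [G] still holds. The time [t] is removed
    because cells are open on the left, so that no grid process sees it. *)
Definition gind r w : R := (t < r)%R%:R * \1_(G r) w.

Lemma gind01 r w : gind r w = 0 \/ gind r w = 1 /\ G r w.
Proof.
rewrite /gind; case: (t < r); rewrite /= ?mul0r ?mul1r; last by left.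
rewrite indicE; case: (boolP (w \in G r)) => [/set_mem|_]; by [right|left].
Qed.

Lemma gind_ge0 r w : 0 <= gind r w.
Proof. by case: (gind01 r w) => [->//|[->]]. Qed.

Lemma gind_le1 r w : gind r w <= 1.
Proof. by case: (gind01 r w) => [->//|[->]]. Qed.

(* Left continuity of G makes the grid values of its indicator converge. *)
Lemma gind_grid r w : t < r <= s ->
 exists q, t <= q < r /\ forall tau N, (forall k, tau k <= tau k.+1) ->
  (forall k, t <= tau k) -> tau 0%N < r <= tau N ->
  (exists2 j : nat, (j <= N)%N & q <= tau j < r) ->
  rfun tau N (fun k => \1_(G (tau k))) r w = gind r w.
Proof.
move=> /andP[tr rs]; rewrite /gind tr mul1r.
have [Gr|nGr] := pselect (G r w).
 exists t; split=> [|tau N tauS taut tr' _]; first by rewrite lexx.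
 have [j jN jr] := cell_exists tr'; rewrite (rfun_cell _ _ tauS jN jr).
 rewrite !indicE !mem_set//; apply: Gle Gr => //; by case/andP: jr => /ltW.
have [q [tq nGq]] : exists q, t <= q < r /\ ~ G q w.
 apply: contrapT => h; apply: nGr; apply: Glc; first by rewrite tr.
 by move=> q tq; apply: contrapT => nG; apply: h; exists q.
exists q; split=> // tau N tauS taut tr' [i iN /andP[qi ir]].
have [j jN jr] := cell_exists tr'; rewrite (rfun_cell _ _ tauS jN jr).
rewrite !indicE !memNset// => Gj; apply: nGq; apply: Gle Gj; first by case/andP: tq.
apply: le_trans qi _; apply: (grid_mono tauS); rewrite leqNgt; apply/negP => ji.
have /andP[_ h] := jr; have := lt_le_trans ir (le_trans h (grid_mono tauS ji)).
by rewrite ltxx.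
Qed.

Lemma gind_cvg q r w : q <= s -> t <= r <= q ->
 rfun (ugrid t q N.+1) N.+1 (fun k => \1_(G (ugrid t q N.+1 k))) r w @[N --> \oo] --> gind r w.
Proof.
move=> qs /andP[]; rewrite le_eqVlt => /predU1P[<- tq|tr rq].
 apply: cvg_near_cst; near=> N; rewrite /gind ltxx mul0r rfun0// => k _.
 by have := ugrid_t tq N.+1 k; rewrite /cell leNgt => /negbTE ->; rewrite andFb.
have [|u [/andP[tu ur] hu]] := @gind_grid r w; first by rewrite tr (le_trans rq).
have tq : t <= q by rewrite (le_trans (ltW tr)).
have [|N0 hN] := @ugrid_dense _ _ _ tq u r _ ur; first by rewrite tr.
apply: cvg_near_cst; near=> N; apply: hu.
- exact: ugridS.
- exact: ugrid_t.
- by rewrite ugrid0 ugridN// tr.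
have [||j jN /andP[j1 j2]] := hN N.+1 => //; last first.
 by exists j; [exact: ltnW|rewrite (ltW j1)].
by apply: leqW; near: N; exists N0.
Unshelve. all: by end_near. Qed.

Lemma gind_prog q : t <= q <= s -> measurable_fun (`[t, q] `*` setT)
 (fun z : realM R * Gs P W t q => gind z.1 z.2).
Proof.
move=> /andP[tq qs]; have mS : measurable (`[t, q] `*` setT : set (realM R * Gs P W t q)).
 by apply: measurableX => //; exact: measurable_itv.
have [v dv] := @dense_seq_real R; apply/(borel_real _ mS).
pose h N (z : realM R * Gs P W t q) :=
 rfun (ugrid t q N.+1) N.+1 (fun k => \1_(G (ugrid t q N.+1 k))) z.1 z.2.
apply: (@borel_cvg _ _ _ R v _ h) => //.
 move=> N; apply/(borel_real _ mS); apply: rfun_meas => // k kN.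
 apply: measurable_funTS; apply: measurableT_comp measurable_snd.
 apply: measurable_indic; apply/measGs.
 apply: (@filt_mono _ _ _ _ _ _ _ (ugrid t q N.+1 k)); first exact: ugrid_s.
 apply: FG; rewrite ugrid_t//=; apply: le_trans qs; exact: ugrid_s.
move=> [r w] [/= + _]; rewrite in_itv => rq; exact: gind_cvg.
Qed.

Lemma Gs_pmeas q (f : R -> Om -> R) : q <= T -> measurable_fun (`[t, q] `*` setT)
 (fun z : realM R * Gs P W t q => f z.1 z.2 : R) -> pmeas t q f.
Proof.
move=> qT mf _ B mB; have := mf _ B mB.
have mS : measurable (`[t, q] `*` setT : set (realM R * Gs P W t q)).
 by apply: measurableX => //; exact: measurable_itv.
move=> /(_ mS) h.
have mid : measT (fun z : realM R * Om => (z.1, z.2) : realM R * Gs P W t q).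
 apply/measurable_fun_pairP; split; first exact: measurable_fst.
 have mi : measT ((fun w => w) : Om -> Gs P W t q).
  by apply: (Gs_fun HW qT); exact: measurable_id.
 exact: (measurableT_comp mi measurable_snd).
have := mid measurableT _ h; rewrite setTI.
by congr measurable; apply/seteqP; split => -[r w].
Qed.

(** On [G s] every earlier [G (tau k)] holds, so restricting each cell to [G (tau k)] does not
    change the integral there; off [G s] the left side vanishes. The second moment bound for the
    restricted chain then gives the factor 8. *)
Lemma loc_grid N D : (0 < N)%N -> eon P W t s D ->
 (\int[P]_w (\1_(G s) w * `|eint W D w| ^+ 2)%:E <=
  8%:E * EI s (fun r w => rfun (mgrid t s N D) (size (mpts t s N D))
   (fun k => \1_(G (mgrid t s N D k))) r w * `|efun D r w| ^+ 2)%R)%E.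
Proof.
move=> N0 hD; pose tau := mgrid t s N D; pose M := size (mpts t s N D).
pose e k := restr (G (tau k)) (mcell t s N D k).
have tauS : forall k, tau k <= tau k.+1 by exact: (mgridS ts N0 hD).
have taub k : t <= tau k <= s by exact: (mgrid_bound ts N0 hD).
have taut k : t <= tau k by case/andP: (taub k).
have tauT k : tau k <= T by case/andP: (taub k) => _ h; exact: le_trans h sT.
have ee k : events_at P W t (tau k) (e k).
 by apply: restr_at; [exact: FG|exact: mcell_at].
pose C := (fun _ x => x) : nat -> H -> H.
have mC k : measT (C k : borel H -> borel H) by exact: measurable_id.
have Cc k x : `|C k x| <= `|x| by [].
have c2 := chain2 HW dvH taut tauS tauT ee mC Cc M.
have E1 w : G s w -> eint W D w = chain W tau e C M w.
 move=> Gs; rewrite (mcell_int ts N0 hD) -/M -/tau.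
 elim: (M) => [|k IH] /=; first by rewrite big_ord0.
 rewrite big_ord_recr /= IH restr_inc indicE mem_set ?scale1r//.
 by case/andP: (taub k) => a1 a2; exact: Gle Gs.
have -> : (fun r w => rfun tau M (fun k => \1_(G (tau k))) r w * `|efun D r w| ^+ 2) =
  rfun tau M (fun k w => `|ival (e k) w| ^+ 2).
 apply/funext => r; apply/funext => w.
 case: (cellP tauS M r) => [h|[j jM [jr _ _]]]; first by rewrite !rfun0// mul0r.
 rewrite !(rfun_cell _ _ tauS jM jr) (mcell_fun ts N0 hD) (gfun_cell tauS _ _ jM jr).
 rewrite restr_val normrZ exprMn indicE.
 by case: (_ \in _); rewrite /= ?normr1 ?normr0 ?expr1n ?expr0n.
have mi k : measT (fun w => `|ival (e k) w| ^+ 2).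
 by apply: measurable_funX; exact: (ival_norm_meas HW (tauT k)).
rewrite EI_rfun//.
apply: le_trans (_ : (\int[P]_w (`|chain W tau e C M w| ^+ 2)%:E <= _)%E).
 apply: le_int => // w _; rewrite lee_fin.
 rewrite indicE; case: (boolP (w \in G s)) => /= [/set_mem/E1 ->|_].
  by rewrite mul1r.
 by rewrite mul0r sqr_ge0.
apply: le_trans c2 _; rewrite /energy ge0_sume_distrr; last first.
 move=> k _; apply: mule_ge0; first by rewrite lee_fin subr_ge0.
 by apply: integral_ge0 => w _; rewrite lee_fin sqr_ge0.
by apply: lee_sum => k _; rewrite muleA -EFinM.
Qed.

(** As the uniform part of the merged grid is refined, the grid values of the indicator of [G]
    converge to [gind] by left continuity, dominated because elementary processes are bounded. *)
Lemma localization D : eon P W t s D -> (\int[P]_w (\1_(G s) w * `|eint W D w| ^+ 2)%:E <=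
  8%:E * EI s (fun r w => gind r w * `|efun D r w| ^+ 2)%R)%E.
Proof.
move=> hD; have [K K0 hK] := efun_bound D.
pose rho N := rfun (mgrid t s N.+1 D) (size (mpts t s N.+1 D))
 (fun k => \1_(G (mgrid t s N.+1 D k))).
have tauS N := mgridS ts (ltn0Sn N) hD.
have taub N := mgrid_bound ts (ltn0Sn N) hD.
have taut N k : t <= mgrid t s N.+1 D k by case/andP: (taub N k).
have m2 : pmeas t s (fun r w => `|efun D r w| ^+ 2) by exact: efun_pow_pmeas.
have mG : pmeas t s gind by apply: Gs_pmeas => //; apply: gind_prog; rewrite ts lexx.
have mrho N : pmeas t s (rho N).
 apply: rfun_pmeas => k kM; apply: measurable_indic. have /andP[h1 h2] := taub N k.
 by apply: (filt_meas HW (le_trans h2 sT)); apply: FG; rewrite h1.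
(* Only an upper bound is sought, so the positive part of the discretization error is enough. *)
pose err N r w := Num.max (rho N r w - gind r w) 0 * `|efun D r w| ^+ 2.
have rho1 N r w : 0 <= rho N r w <= 1.
 case: (cellP (tauS N) (size (mpts t s N.+1 D)) r) => [h|[j jM [jr _ _]]].
  by rewrite /rho rfun0// lexx ler01.
 by rewrite /rho (rfun_cell _ _ (tauS N) jM jr) indicE; case: (_ \in _); rewrite /= ?lexx ?ler01.
have err0 N r w : 0 <= err N r w.
 by rewrite mulr_ge0 ?sqr_ge0// le_max lexx orbT.
have merr N : pmeas t s (err N).
 apply: measurable_funM => //; apply: measurable_maxr => //.
 by apply: measurable_funB; [exact: mrho|exact: mG].
have cv : EI s (err N) @[N --> \oo] --> 0%E.
 apply: (@EI_dct _ _ _ P t s err (fun _ _ => K ^+ 2)) => //.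
 - exact: mcst.
 - move=> N r w _; rewrite /err -[leRHS]mul1r; apply: ler_pM.
  + by rewrite le_max lexx orbT.
  + exact: sqr_ge0.
  + rewrite ge_max ler01 andbT; have /andP[_ h] := rho1 N r w.
   by have := gind_ge0 r w; lra.
  + by apply: lerXn2r; rewrite ?nnegrE.
 - by rewrite EI_cst ?sqr_ge0// ltry.
 move=> r w /andP[]; rewrite le_eqVlt => /predU1P[<- _|tr rs].
  apply: cvg_near_cst; near=> N. by rewrite /err efun_start// normr0 expr0n mulr0.
 have [|q [/andP[tq qr] hq]] := @gind_grid r w; first by rewrite tr.
 have [|N0 hN] := @ugrid_dense _ _ _ ts q r _ qr; first by rewrite tr.
 apply: cvg_near_cst; near=> N; rewrite /err /rho hq ?subrr ?maxxx ?mul0r//.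
 - have [a aM ua] := @mgrid_ugrid _ _ _ _ _ t s N.+1 D 0%N (leq0n _).
  have [b bM ub] := @mgrid_ugrid _ _ _ _ _ t s N.+1 D N.+1 (leqnn _).
  rewrite ugrid0 in ua; rewrite ugridN// in ub. apply/andP; split.
   apply: le_lt_trans tr; rewrite [leRHS]ua; exact: (grid_mono (tauS N)).
  by apply: le_trans rs _; apply: le_trans (grid_mono (tauS N) bM); rewrite -ub.
 - have [||j jN /andP[j1 j2]] := hN N.+1 => //.
   by apply: leqW; near: N; exists N0.
  have [a aM ua] := @mgrid_ugrid _ _ _ _ _ t s N.+1 D j (ltnW jN).
  by exists a => //; rewrite -ua (ltW j1).
have le N : (\int[P]_w (\1_(G s) w * `|eint W D w| ^+ 2)%:E <=
  8%:E * (EI s (fun r w => gind r w * `|efun D r w| ^+ 2)%R + EI s (err N)))%E.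
 apply: le_trans (loc_grid (ltn0Sn N) hD) _; apply: lee_wpmul2l => //.
 rewrite -EI_D//; last 2 first.
 - exact: measurable_funM.
 - by move=> r w; rewrite mulr_ge0 ?sqr_ge0// gind_ge0.
 apply: EI_le => r w _; have /andP[h0 _] := rho1 N r w.
 rewrite mulr_ge0 ?sqr_ge0//= /err -mulrDl; apply: ler_wpM2r; first exact: sqr_ge0.
 by rewrite -lerBlDl le_max lexx.
apply: lee_lim0 cv le => //; apply: EI_ge0 => r w _.
by rewrite mulr_ge0 ?sqr_ge0// gind_ge0.
Unshelve. all: by end_near. Qed.

End Localization.

(** * Density of simple adapted processes *)

Lemma diff_quot R (F : R -> R) (x L e : R) : derivable F x 1 -> derive1 F x = L -> 0 < e ->
 exists2 dl, 0 < dl & forall u v, u < v -> v <= x -> x - u <= 2 * (v - u) ->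
  x - u < dl -> `|(F v - F u) / (v - u) - L| <= e.
Proof.
move=> dF <- e0; have e40 : 0 < e / 4 by rewrite divr_gt0.
have : h^-1 *: ((F \o shift x) (h *: 1) - F x) @[h --> 0^'] --> derive1 F x.
 by rewrite derive1E.
move=> /cvgrPdist_lt /(_ _ e40) /nbhs_ballP[dl /= dl0 hd].
have key y : x - dl < y -> y <= x -> `|F y - F x - derive1 F x * (y - x)| <= e / 4 * (x - y).
 move=> y1; rewrite le_eqVlt => /predU1P[->|y2].
  by rewrite !subrr mulr0 subr0 normr0 mulr0.
 have yx : y - x != 0 by rewrite subr_eq0 lt_eqF.
 have := hd (y - x); rewrite /ball /= sub0r normrN ltr0_norm ?subr_lt0// => /(_ _ yx).
 rewrite [_ *: 1]mulr1 subrK => /(_ _) h.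
 have {}h : `|derive1 F x - (y - x)^-1 * (F y - F x)| < e / 4 by apply: h; lra.
 have -> : F y - F x - derive1 F x * (y - x) =
   - (derive1 F x - (y - x)^-1 * (F y - F x)) * (y - x) by field.
 rewrite normrM normrN (ltr0_norm (_ : y - x < 0)) ?subr_lt0// opprB.
 by apply: ler_wpM2r; [rewrite subr_ge0 ltW|exact: ltW].
exists dl => // u v uv vx h1 h2; have vu : 0 < v - u by rewrite subr_gt0.
have Ku : `|F u - F x - derive1 F x * (u - x)| <= e / 4 * (x - u) by apply: key; lra.
have Kv : `|F v - F x - derive1 F x * (v - x)| <= e / 4 * (x - v) by apply: key; lra.
have -> : (F v - F u) / (v - u) - derive1 F x =
 ((F v - F x - derive1 F x * (v - x)) - (F u - F x - derive1 F x * (u - x))) / (v - u).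
 by field; rewrite gt_eqF.
rewrite normrM normfV (gtr0_norm vu) ler_pdivrMr//.
apply: le_trans (ler_normB _ _) _; apply: le_trans (lerD Kv Ku) _.
by nra.
Qed.

Lemma ae_imp R d (T : measurableType d) (m : {measure set T -> \bar R})
  (A B : T -> Prop) : (forall x, A x -> B x) ->
 {ae m, forall x, A x} -> {ae m, forall x, B x}.
Proof. by move=> h; apply: filterS; exact: h. Qed.

Lemma ae_imp2 R d (T : measurableType d) (m : {measure set T -> \bar R})
  (A B C : T -> Prop) : (forall x, A x -> B x -> C x) ->
 {ae m, forall x, A x} -> {ae m, forall x, B x} -> {ae m, forall x, C x}.
Proof. by move=> h; apply: filterS2; exact: h. Qed.

(** Convergence is assumed for almost every time on each path, as the Lebesgue differentiation
    theorem provides it. Dominated convergence is applied first in time, then in probability. *)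
Lemma EI_dct_ae R d (Om : measurableType d) (P : probability Om R)
  (t s : R) (f : nat -> R -> Om -> R) (K : R) :
 (forall n, pmeas t s (f n)) -> (forall n r w, 0 <= f n r w <= K) ->
 (forall w, {ae @lebesgue_measure R, forall r, `[t, s]%classic r -> f n r w @[n --> \oo] --> 0}) ->
 EI P t s (f n) @[n --> \oo] --> 0%E.
Proof.
move=> mf fK f0; have f_ge0 n r w : 0 <= f n r w by case/andP: (fK n r w).
have fin (k : R) : (@lebesgue_measure R).-integrable `[t, s] (cst k%:E).
 apply/integrableP; split; first exact: mcst.
 rewrite integral_cst//= lebesgue_measure_itv /=.
 by case: ifP => _; rewrite ?mule0 ?ltry// -EFinB -EFinM ltry.
have inner w : (\int[leb]_(r in `[t, s]) (f n r w)%:E)%E @[n --> \oo] --> 0%E.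
 have [] := @dominated_convergence _ _ _ (@lebesgue_measure R) `[t, s]
  (measurable_itv _) (fun n r => (f n r w)%:E) (cst 0%E) (cst K%:E).
 - by move=> n; apply/mEFinP; exact: EI_section (mf n).
 - exact: mcst.
 - apply: ae_imp (f0 w) => r h rs; apply/cvg_EFin; first by near=> n.
  exact: h.
 - exact: fin.
 - by apply: aeW => r n _; rewrite lee_fin ger0_norm//; case/andP: (fK n r w).
 by move=> _ _; rewrite integral0.
pose b : \bar R := (\int[leb]_(r in `[t, s]) cst K%:E r)%E.
have bfin : b \is a fin_num by apply: integrable_fin_num (fin K); exact: measurable_itv.
rewrite -[X in _ --> X](integral0 P setT).
apply: (@dominated_cvg _ _ _ P _ measurableT _ _ (cst b)) => //.
- by move=> n; apply: EI_inner_meas.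
- apply/integrableP; split; first exact: mcst.
 rewrite integral_cst//= probability_setT mule1. by rewrite -(fineK bfin) ltry.
- move=> n w _; rewrite gee0_abs; last by apply: integral_ge0 => r _; rewrite lee_fin.
 apply: le_int => [|r _|r _]; [exact: measurable_itv|by rewrite lee_fin|].
 by rewrite lee_fin; case/andP: (fK n r w).
Unshelve. all: by end_near. Qed.

Section IndicatorDensity.
Variables (R : realType) (Xi : hilbertType R)
 (d : measure_display) (Om : measurableType d) (P : probability Om R)
 (W : R -> Xi -> Om -> R) (t T s : R)
 (HW : reference_space P W t T)
 (ts : t < s) (sT : s <= T).
Variables (a : R -> Om -> R) (a01 : forall r w, a r w = 0 \/ a r w = 1)
 (ma : forall q, t <= q <= s -> measurable_fun (`[t, q] `*` setT)
  (fun z : realM R * Gs P W t q => a z.1 z.2)).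

Let ts' := ltW ts.
Local Notation tau N := (ugrid t s N.+1).

Lemma a_bound r w : 0 <= a r w <= 1.
Proof. by case: (a01 r w) => ->; rewrite ?lexx ?ler01. Qed.

Lemma a_pmeas : pmeas t s a.
Proof. by apply: (Gs_pmeas HW sT); apply: ma; rewrite ts' lexx. Qed.

Definition prim q w : R := (\int[leb]_(u in `[t, q]) a u w)%R.

Lemma a_section w : measurable_fun `[t, s] (fun r => a r w).
Proof. exact: EI_section a_pmeas. Qed.

Lemma a_integrable w u v : t <= u -> v <= s -> leb.-integrable `[u, v] (fun r => (a r w)%:E).
Proof.
move=> tu vs; apply: (@le_integrable _ _ _ leb _ _ _ (cst 1%E)) => //.
- apply/mEFinP; apply: measurable_funS (a_section w) => //.
 move=> r /=; rewrite !in_itv/= => /andP[h1 h2]. by rewrite (le_trans tu) ?(le_trans h2).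
- move=> r _; rewrite lee_fin ger0_norm ?normr1; by case/andP: (a_bound r w).
- apply/integrableP; split; first exact: mcst.
 under eq_integral do rewrite /= normr1. rewrite integral_cst//= mul1e lebesgue_measure_itv /=.
 by case: ifP => _; rewrite ?ltry// -EFinB ltry.
Qed.

Lemma prim_adapted q : t <= q <= s -> measT (prim q : Gs P W t q -> R).
Proof.
move=> tqs; apply: (measurableT_comp (@fine_measurable R setT measurableT)).
apply: (@EI_inner_meas R _ (Gs P W t q) t q a); first exact: ma.
by move=> r w _; case/andP: (a_bound r w).
Qed.

Lemma prim_diff u v w : t <= u -> u <= v -> v <= s -> 0 <= prim v w - prim u w <= v - u.
Proof.
move=> tu uv vs.
have -> : prim v w - prim u w = (\int[leb]_(r in `]u, v]) a r w)%R.
 rewrite /prim (@Rintegral_itvB _ _ (BLeft t) (BRight v))//= ?bnd_simp//. exact: a_integrable.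
have ia : leb.-integrable `]u, v] (fun r => (a r w)%:E).
 apply: integrableS (a_integrable w tu vs) => //.
 by move=> r /=; rewrite !in_itv/= => /andP[/ltW -> ->].
apply/andP; split; first by apply: Rintegral_ge0 => r _; case/andP: (a_bound r w).
have -> : v - u = (\int[leb]_(r in `]u, v]) 1)%R.
 rewrite Rintegral_cst//= mul1r lebesgue_measure_itv /= lte_fin.
 by case: ltP => // h; rewrite (_ : u = v) ?subrr//; apply/eqP; rewrite eq_le uv.
apply: le_Rintegral => //.
 apply/integrableP; split; first exact: mcst. under eq_integral do rewrite /= normr1.
 rewrite integral_cst//= mul1e lebesgue_measure_itv /=.
 by case: ifP => _; rewrite ?ltry// -EFinB ltry.
by move=> r _; case/andP: (a_bound r w).
Qed.

(** The average of [a] over the preceding cell, hence adapted at [tau N k]; averaging over the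
    current cell would look into the future. The first cell has no predecessor and gets 0. *)
Definition slope N k w : R := if k is j.+1 then
 (prim (tau N k) w - prim (tau N j) w) / ((s - t) / N.+1%:R) else 0.

Lemma slope_bound N k w : 0 <= slope N k w <= 1.
Proof.
case: k => [|k]; rewrite /slope ?lexx ?ler01//.
have h0 : 0 < (s - t) / N.+1%:R by rewrite divr_gt0 ?subr_gt0// ltr0n.
have /andP[h1 h2] := @prim_diff (tau N k) (tau N k.+1) w (ugrid_t ts' _ _)
 (ugridS ts' _ _) (ugrid_s ts' _ (ltn0Sn N)).
rewrite divr_ge0 ?(ltW h0)//= ler_pdivrMr// mul1r.
exact: le_trans h2 (ugrid_mesh ts' _ _).
Qed.

Lemma tau_b N k : t <= tau N k <= s.
Proof. by rewrite ugrid_t// ugrid_s. Qed.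

Lemma slope_adapted N k : measT (slope N k : Gs P W t (tau N k) -> R).
Proof.
case: k => [|k]; first exact: mcst.
apply: measurable_funM; last exact: mcst.
apply: measurable_funB; first by apply: prim_adapted; exact: tau_b.
apply: (Gs_fun_mono (ugridS ts' N.+1 k)); apply: prim_adapted; exact: tau_b.
Qed.

Lemma ugrid_step N k : (k < N.+1)%N -> tau N k.+1 - tau N k = (s - t) / N.+1%:R.
Proof.
move=> kN; rewrite /ugrid (minn_idPl (kN : (k.+1 <= N.+1)%N)) (minn_idPl (ltnW kN)).
rewrite opprD addrACA subrr add0r -mulrBr -mulrBl -[k.+1]addn1 natrD [_ + 1]addrC addrK.
by rewrite mul1r.
Qed.

(** The averages are difference quotients of the primitive over intervals that end before [r] but
    have length comparable to their distance from [r]; at almost every [r] they converge to the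
    derivative [a r w]. *)
Lemma slope_cvg w : {ae leb, forall r, `[t, s]%classic r ->
 rfun (tau N) N.+1 (slope N) r w @[N --> \oo] --> a r w}.
Proof.
pose f := (fun r => a r w) \_ `[t, s]%classic.
have fi : leb.-integrable setT (EFin \o f).
 have mI : measurable (`[t, s]%classic : set (realM R)) by exact: measurable_itv.
 have := proj1 (integrable_mkcond _ mI) (a_integrable w (lexx t) (lexx s)).
 by rewrite restrict_EFin.
have lf : locally_integrable setT f.
 by apply: integrable_locally; [exact: measurable_itv|exact: a_integrable].
have fiy y : leb.-integrable `[t, y] (EFin \o f).
 by apply: integrableS fi.
have neq : {ae leb, forall r, r <> t}.
 exists [set t]; split; [exact: measurable_set1|exact: lebesgue_measure_set1|].
 by move=> r /= /contrapT.
have ftc := FTC1 (a := BLeft t) fiy lf.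
suff main : forall r : R, t < r -> r <= s ->
  derivable (fun x => \int[leb]_(u in `[t, x]) f u)%R r 1 ->
  derive1 (fun x => \int[leb]_(u in `[t, x]) f u)%R r = f r ->
  rfun (tau N) N.+1 (slope N) r w @[N --> \oo] --> a r w.
 apply: ae_imp2 ftc neq => r h rt /=; rewrite in_itv/= => /andP[tr rs].
 have {}tr : t < r by rewrite lt_neqAle tr andbT; apply/eqP => /esym.
 have tr' : (t%:E < (r : R)%:E)%E by rewrite lte_fin. by have [d1 d2] := h tr'; exact: main.
move=> r tr rs d1 d2.
have fE q u : q <= s -> `[t, q]%classic u -> f u = a u w.
 move=> qs /=; rewrite in_itv/= => /andP[tu uq].
 by rewrite /f patchE mem_set//= in_itv/= tu (le_trans uq).
have FE q : q <= s -> (\int[leb]_(u in `[t, q]) f u)%R = prim q w.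
 by move=> qs; apply: eq_Rintegral => u /set_mem; exact: fE.
rewrite (fE s r) // in d2; last by rewrite /= in_itv/= (ltW tr).
apply/cvgrPdist_le => e e0; have [dl dl0 hd] := diff_quot d1 d2 e0.
(* A mesh below [r - t] keeps [r] out of the first cell, where the default value would be used, and
   a mesh below [dl / 2] keeps the preceding cell within [dl] of [r]. *)
have m0 : 0 < Num.min (r - t) (dl / 2) by rewrite lt_min subr_gt0 tr divr_gt0.
have st0 : 0 < s - t by rewrite subr_gt0.
near=> N.
have hN : (s - t) / N.+1%:R < Num.min (r - t) (dl / 2).
 rewrite ltr_pdivrMr ?ltr0n// mulrC -ltr_pdivrMr//.
 apply: lt_le_trans (truncnS_gt _) _; rewrite ler_nat ltnS.
 by near: N; exists (Num.truncn ((s - t) / Num.min (r - t) (dl / 2))).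
have [j jN jr] : exists2 j, (j < N.+1)%N & tau N j < r <= tau N j.+1.
 by apply: cell_exists; rewrite ugrid0 ugridN// tr rs.
rewrite (rfun_cell _ _ (ugridS ts' _) jN jr).
have /andP[j1 j2] := jr; have := ugrid_step jN; move: hN; rewrite lt_min => /andP[hN1 hN2].
case: j jN jr j1 j2 => [|i] iN jr j1 j2 hs.
 exfalso; rewrite ugrid0 in hs; move: hN1 j2 hs. by move: (_ / _) (tau N 1%N) => h y; lra.
have hi := ugrid_step (ltnW iN).
rewrite /slope -hi distrC -!FE; [|exact: ugrid_s|exact: ugrid_s].
have hh : 0 < (s - t) / N.+1%:R by rewrite divr_gt0// ltr0n.
move: hN1 hN2 hs hi hh j1 j2; move: (_ / _) (tau N i.+2) (tau N i.+1) (tau N i) => *.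
by apply: hd; lra.
Unshelve. all: by end_near. Qed.

(** Rounding the average to the nearer of 0 and 1 turns a real approximation of a process with
    values 0 and 1 into an adapted event. *)
Definition ev N k : set Om := [set w | 2^-1 <= slope N k w].

Lemma ev_filt N k : filt P W t (tau N k) (ev N k).
Proof.
apply/measGs; have := @slope_adapted N k measurableT.
move=> /(_ `[2^-1, +oo[%classic (measurable_itv _)); rewrite setTI.
by congr measurable; apply/seteqP; split => w /=; rewrite in_itv/= andbT.
Qed.

Lemma indicator_density :
 EI P t s (fun r w => `|a r w - rfun (tau N) N.+1 (fun k => \1_(ev N k)) r w|) @[N --> \oo] --> 0%E.
Proof.
pose f N r w := `|a r w - rfun (tau N) N.+1 (fun k => \1_(ev N k)) r w|.
have ev01 N k w : 0 <= (\1_(ev N k) w : R) <= 1.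
 by rewrite indicE; case: (_ \in _); rewrite /= ?lexx ?ler01.
have r01 N r w : 0 <= rfun (tau N) N.+1 (fun k => \1_(ev N k)) r w <= 1.
 case: (cellP (ugridS ts' N.+1) N.+1 r) => [h|[j jM [jr _ _]]].
  by rewrite rfun0// lexx ler01.
 by rewrite (rfun_cell _ _ (ugridS ts' _) jM jr).
have fb N r w : 0 <= f N r w <= 1.
 rewrite normr_ge0/= ler_norml; have /andP[h1 h2] := r01 N r w.
 by have /andP[h3 h4] := a_bound r w; apply/andP; split; lra.
have mev N k : measT (\1_(ev N k) : Om -> R).
 apply: measurable_indic; apply: (filt_meas HW _ (@ev_filt N k)).
 by apply: le_trans sT; exact: ugrid_s.
have mf N : pmeas t s (f N).
 apply: measurableT_comp => //; apply: measurable_funB; first exact: a_pmeas.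
 by apply: rfun_pmeas => k kN.
apply: (@EI_dct_ae _ _ _ P t s f 1) => // w.
apply: ae_imp (slope_cvg w) => r h rts; have {}h := h rts.
(* Rounding at one half is wrong only where the average misses [a] by at least one half, whence the
   factor 2. *)
apply: (@squeeze_cvgr _ _ _ _ (fun _ => 0) (fun N => 2 * `|a r w - rfun (tau N) N.+1 (slope N) r w|)).
- near=> N; have /andP[-> _] /= := fb N r w; rewrite /f.
 case: (cellP (ugridS ts' N.+1) N.+1 r) => [h'|[j jM [jr _ _]]].
  by rewrite !rfun0// ler_peMl// ler1n.
 rewrite !(rfun_cell _ _ (ugridS ts' _) jM jr) indicE.
 have /andP[s0 s1] := slope_bound N j w; case: (boolP (w \in ev N j)) => [/set_mem|/negP] /= hev.
  rewrite /ev /= in hev; case: (a01 r w) => ->.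
   by rewrite sub0r normrN normr1 sub0r normrN ger0_norm//; lra.
  by rewrite subrr normr0 mulr_ge0.
 have {}hev : slope N j w < 2^-1 by rewrite ltNge; apply/negP => ?; apply: hev; rewrite inE.
 case: (a01 r w) => ->; first by rewrite subrr normr0 mulr_ge0.
 by rewrite subr0 normr1 ger0_norm; lra.
- exact: cvg_cst.
have h1 : a r w - rfun (tau N) N.+1 (slope N) r w @[N --> \oo] --> (0 : R).
 by rewrite -[X in _ --> X](subrr (a r w)); apply: cvgB => //; exact: cvg_cst.
have h2 : `|a r w - rfun (tau N) N.+1 (slope N) r w| @[N --> \oo] --> (0 : R).
 by rewrite -[X in _ --> X](@normr0 R R); exact: cvg_norm.
rewrite -(mulr0 (2 : R)).
apply: cvgM; [exact: cvg_cst|exact: h2].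
Unshelve. all: by end_near. Qed.

End IndicatorDensity.

Lemma cvge0_le R (e : nat -> \bar R) (dl : R) : e @ \oo --> 0%E -> 0 < dl ->
 exists N0, forall n, (N0 <= n)%N -> (e n <= dl%:E)%E.
Proof.
move=> h d0; have : nbhs (0 : \bar R)%E [set x | (x < dl%:E)%E].
 by apply: open_nbhs_nbhs; split; [exact: open_ereal_lt_ereal|rewrite /= lte_fin].
move=> /h [N0 _ hN]; exists N0 => n nN; apply: ltW; exact: (hN n).
Qed.

Lemma exprDn_le R (x y : R) n : 0 <= x -> 0 <= y -> (x + y) ^+ n <= 2 ^+ n * (x ^+ n + y ^+ n).
Proof.
move=> x0 y0; have [xy|/ltW xy] := leP x y.
 apply: le_trans (_ : (2 * y) ^+ n <= _).
  by apply: lerXn2r; rewrite ?nnegrE ?addr_ge0 ?mulr_ge0//; lra.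
 rewrite exprMn; apply: ler_wpM2l; first exact: exprn_ge0. by rewrite lerDr exprn_ge0.
apply: le_trans (_ : (2 * x) ^+ n <= _).
 by apply: lerXn2r; rewrite ?nnegrE ?addr_ge0 ?mulr_ge0//; lra.
rewrite exprMn; apply: ler_wpM2l; first exact: exprn_ge0.
by rewrite lerDl exprn_ge0.
Qed.

Section Nearest.
Variables (R : realType) (V : normedModType R) (v : nat -> V).

(** The best approximation of [x] among the first members of the sequence, computed by successive
    comparisons. It is built from comparisons of distances only, which keeps it measurable. *)
Fixpoint nearest n x : V := if n is k.+1 then
 (if `|x - v k.+1| < `|x - nearest k x| then v k.+1 else nearest k x) else v 0%N.

Definition closer k x : R := (`|x - v k.+1| < `|x - nearest k x|)%R%:R.

(** The indicator that [nearest n x] is the [j]-th candidate. A process with values in a normed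
    space thereby becomes a finite sum of fixed vectors with coefficients 0 or 1. *)
Fixpoint weight n j x : R := if n is k.+1 then
 (if j == k.+1 then closer k x else (1 - closer k x) * weight k j x) else (j == 0%N)%:R.

Lemma weight01 n j x : weight n j x = 0 \/ weight n j x = 1.
Proof.
elim: n => [|n IH] /=; first by case: (j == 0%N); [right|left].
rewrite /closer; case: (_ < _); rewrite /= ?subrr ?subr0 ?mul0r ?mul1r.
 by case: ifP; [right|left].
by case: ifP; [left|].
Qed.

Lemma nearest_sum n x : nearest n x = \sum_(j < n.+1) weight n j x *: v j.
Proof.
elim: n => [|n IH]; first by rewrite big_ord1 /= scale1r.
rewrite big_ord_recr /= eqxx.
have -> : \sum_(i < n.+1) (if val i == n.+1 then closer n x
  else (1 - closer n x) * weight n i x) *: v i =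
  (1 - closer n x) *: nearest n x.
 rewrite IH scaler_sumr; apply: eq_bigr => i _. by rewrite (ltn_eqF (ltn_ord i)) scalerA.
by rewrite /closer; case: (_ < _); rewrite /= ?subrr ?subr0 ?scale0r ?scale1r ?add0r ?addr0.
Qed.

Lemma nearest_le n x j : (j <= n)%N -> `|x - nearest n x| <= `|x - v j|.
Proof.
elim: n => [|n IH]; first by rewrite leqn0 => /eqP ->.
rewrite leq_eqVlt => /predU1P[->|/IH h] /=; case: ltP => // h'.
exact: ltW (lt_le_trans h' h).
Qed.

Lemma nearest_cvg x : dense_seq v -> `|x - nearest n x| @[n --> \oo] --> (0 : R).
Proof.
move=> dv; apply/cvgr0Pnorm_lt => e e0; have [j xj] := dv x e e0.
near=> n; rewrite normr_id; apply: le_lt_trans xj; apply: nearest_le.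
by near: n; exists j.
Unshelve. all: by end_near. Qed.

Section Meas.
Variables (d : measure_display) (T : measurableType d) (D : set T) (F : T -> V)
 (mD : measurable D) (mF : measurable_fun D (F : T -> borel V)).

Lemma lt_meas (f g : T -> R) : measurable_fun D f -> measurable_fun D g ->
 measurable_fun D (fun z => (f z < g z)%R%:R : R).
Proof.
move=> mf mg; have mb : measT (fun b : bool => b%:R : R) by [].
exact: (measurableT_comp mb (measurable_fun_ltr mf mg)).
Qed.

Lemma dist_nearest_meas n : measurable_fun D (fun z => `|F z - nearest n (F z)|).
Proof.
elim: n => [|n IH]; first exact: borel_norm.
rewrite (_ : (fun _ => _) = fun z => Num.min (`|F z - nearest n (F z)|) (`|F z - v n.+1|)).
 by apply: measurable_minr => //; exact: borel_norm.
by apply/funext => z /=; case: ltP.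
Qed.

Lemma closer_meas n : measurable_fun D (fun z => closer n (F z)).
Proof. by apply: lt_meas; [exact: borel_norm|exact: dist_nearest_meas]. Qed.

Lemma weight_meas n j : measurable_fun D (fun z => weight n j (F z)).
Proof.
elim: n => [|n IH] /=; first exact: mcst.
case: (j == n.+1); first exact: closer_meas.
apply: measurable_funM => //; apply: measurable_funB; first exact: mcst.
exact: closer_meas.
Qed.

End Meas.
End Nearest.

Section Density.
Variables (R : realType) (Xi : hilbertType R) (V : normedModType R)
 (d : measure_display) (Om : measurableType d) (P : probability Om R)
 (W : R -> Xi -> Om -> R) (t T s : R)
 (HW : reference_space P W t T)
 (ts : t < s) (sT : s <= T)
 (v : nat -> V) (dv : dense_seq v) (f : R -> Om -> V)
 (pf : progressive P W t s f).
Local Notation tau N := (ugrid t s N.+1).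
Let ts' := ltW ts.

Lemma stripG_meas q : measurable (`[t, q] `*` setT : set (realM R * Gs P W t q)).
Proof. by apply: measurableX => //; exact: measurable_itv. Qed.

Definition sval (e : seq (set Om * nat)) w : V := \sum_(i <- e) \1_(i.1) w *: v i.2.

Definition sevents r (e : seq (set Om * nat)) := forall i, i \in e -> filt P W t r i.1.

Lemma sval_meas r e : r <= T -> sevents r e -> measT (sval e : Gs P W t r -> borel V).
Proof.
move=> rT; elim: e => [|i e IH] he.
 rewrite (_ : sval _ = fun=> 0); first exact: mcst.
 by apply/funext => w; rewrite /sval big_nil.
rewrite (_ : sval _ = fun w => \1_(i.1) w *: v i.2 + sval e w); last first.
 by apply/funext => w; rewrite /sval big_cons.
apply: (@borelD R _ (Gs P W t r) V v) => //; last first.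
 by apply: IH => j je; apply: he; rewrite inE je orbT.
apply: (@borelZ R _ (Gs P W t r) V v) => //.
by apply: measurable_indic; apply/measGs; apply: he; rewrite inE eqxx.
Qed.

Lemma prog_pow_pmeas n : pmeas t s (fun r w => `|f r w| ^+ n).
Proof.
apply: (Gs_pmeas HW sT); apply: measurable_funX.
apply: borel_norm0; first exact: stripG_meas.
by apply: pf; rewrite ts' lexx.
Qed.

Lemma EI_sum_cvg0 m (u : nat -> nat -> R -> Om -> R) :
 (forall j n, pmeas t s (u j n)) -> (forall j n r w, 0 <= u j n r w) ->
 (forall j, EI P t s (u j n) @[n --> \oo] --> 0%E) ->
 EI P t s (fun r w => \sum_(j < m) u j n r w) @[n --> \oo] --> 0%E.
Proof.
move=> leb u0 hu; elim: m => [|m IH].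
 apply: cvg_near_cst; near=> n.
 rewrite (_ : (fun _ _ => _) = fun _ _ => 0); first by rewrite EI_cst// mul0r.
 by apply/funext => r; apply/funext => w; rewrite big_ord0.
rewrite (_ : (fun _ => EI _ _ _ _) = fun n =>
  (EI P t s (fun r w => (\sum_(j < m) u j n r w)%R) + EI P t s (u m n))%E); last first.
 apply/funext => n; rewrite -EI_D.
 - by congr EI; apply/funext => r; apply/funext => w; rewrite big_ord_recr.
 - by apply: measurable_sum => j; exact: leb.
 - exact: leb.
 - by move=> r w; apply: sumr_ge0.
 - by move=> r w; exact: u0.
rewrite -[X in _ --> X]adde0; apply: cvgeD; [by []|exact: IH|exact: hu].
Unshelve. all: by end_near. Qed.

(** Two approximations: the values are replaced by their nearest candidates, with [m] large by
    dominated convergence, and then each of the finitely many 0-1 coefficients is replaced by events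
    on a grid. It is used for exponents 2 and 4. *)
Theorem density n (eps : R) : (0 < n)%N ->
 (EI P t s (fun r w => `|f r w| ^+ n)%R < +oo)%E -> 0 < eps ->
 exists N0, forall N, (N0 <= N)%N -> exists e : nat -> seq (set Om * nat),
  (forall k, sevents (tau N k) (e k)) /\
  (EI P t s (fun r w => `|f r w - gfun (tau N) N.+1 (fun k => sval (e k)) r w| ^+ n)%R <= eps%:E)%E.
Proof.
move=> n0 fi e0; have p0 : 0 < 2 ^+ n :> R by exact: exprn_gt0.
have pf' q : t <= q <= s -> measurable_fun (`[t, q] `*` setT)
  ((fun z => f z.1 z.2) : realM R * Gs P W t q -> borel V) := @pf q.
have mfp : measurable_fun (strip t s) ((fun z => f z.1 z.2) : realM R * Om -> borel V).
 apply: (borel_ballP dv) => [|j]; first exact: strip_meas.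
 apply: (@Gs_pmeas _ _ _ _ _ _ _ _ HW s (fun r w => `|f r w - v j|) sT).
 apply: borel_norm; first exact: stripG_meas. by apply: pf; rewrite ts' lexx.
pose dd m r w := `|f r w - nearest v m (f r w)| ^+ n.
have mdd m : pmeas t s (dd m).
 by apply: measurable_funX; apply: (dist_nearest_meas _ _ mfp); exact: strip_meas.
have dd0 m r w : 0 <= dd m r w by exact: exprn_ge0.
have mf0 := prog_pow_pmeas n.
have cdd : EI P t s (dd m) @[m --> \oo] --> 0%E.
 have mg : pmeas t s (fun r w => `|f r w| ^+ n + `|v 0%N| ^+ n).
  by apply: measurable_funD; [exact: mf0|exact: mcst].
 have g0 r w : 0 <= `|f r w| ^+ n + `|v 0%N| ^+ n by rewrite addr_ge0 ?exprn_ge0.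
 have v0 : 0 <= `|v 0%N| ^+ n by exact: exprn_ge0.
 apply: (@EI_dct _ _ _ P t s dd (fun r w => 2 ^+ n * (`|f r w| ^+ n + `|v 0%N| ^+ n))).
 - exact: mdd.
 - by apply: measurable_funM; [exact: mcst|exact: mg].
 - exact: dd0.
 - move=> k r w _; apply: le_trans (exprDn_le _ _ _); [|exact: normr_ge0|exact: normr_ge0].
  apply: lerXn2r; rewrite ?nnegrE ?addr_ge0//.
  exact: le_trans (nearest_le _ _ (leq0n k)) (ler_normB _ _).
 - rewrite EI_Z; [|exact: mg|exact: g0|exact: ltW].
  rewrite EI_D; [|exact: mf0|exact: mcst|by move=> r w; exact: exprn_ge0|by []].
  rewrite EI_cst//; apply: lte_mul_pinfty; [by rewrite lee_fin ltW|by []|].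
  by rewrite lte_add_pinfty ?ltry.
 - move=> r w _; rewrite -[X in _ --> X](_ : 0 ^+ n = 0); last by rewrite expr0n eqn0Ngt n0.
  exact: (cvg_comp _ _ (nearest_cvg (f r w) dv) (@exprn_continuous R n 0)).
have e1 : 0 < eps / (2 * 2 ^+ n) by rewrite divr_gt0// mulr_gt0.
have [m hm] := cvge0_le cdd e1.
pose K := 1 + \sum_(j < m.+1) `|v j|.
have K0 : 0 < K by rewrite ltr_pwDl// sumr_ge0.
pose a j r w := weight v m j (f r w).
have a01 j r w : a j r w = 0 \/ a j r w = 1 by exact: weight01.
have ma j q : t <= q <= s -> measurable_fun (`[t, q] `*` setT)
  (fun z : realM R * Gs P W t q => a j z.1 z.2).
 move=> tqs; exact: (@weight_meas R V v _ _ _ _ (@stripG_meas q) (pf' q tqs) m j).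
pose u j N r w := `|a j r w - rfun (tau N) N.+1 (fun k => \1_(ev t s (a j) N k)) r w|.
have cu j : EI P t s (u j N) @[N --> \oo] --> 0%E.
 exact: (indicator_density HW ts sT (a01 j) (ma j)).
have u0 j N r w : 0 <= u j N r w by exact: normr_ge0.
have FE j N k : filt P W t (tau N k) (ev t s (a j) N k).
 exact: (@ev_filt R Xi d Om P W t s ts (a j) (a01 j) (ma j) N k).
have tauS N : forall k, tau N k <= tau N k.+1 by exact: ugridS.
have u1 j N r w : u j N r w <= 1.
 rewrite /u; case: (cellP (tauS N) N.+1 r) => [h|[i iN [ir _ _]]].
  by rewrite rfun0// subr0; case: (a01 j r w) => ->; rewrite ?normr0 ?normr1.
 rewrite (rfun_cell _ _ (tauS N) iN ir) indicE. by case: (_ \in _); case: (a01 j r w) => ->;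
  rewrite /= ?subrr ?subr0 ?sub0r ?normrN ?normr0 ?normr1.
have leb j N : pmeas t s (u j N).
 apply: measurableT_comp => //; apply: measurable_funB.
  by apply: (Gs_pmeas HW sT); apply: ma; rewrite ts' lexx.
 apply: rfun_pmeas => k kN; apply: measurable_indic; apply: (@filt_meas _ _ _ _ _ _ _ _ HW _ _ _ (FE j N k)).
 by apply: le_trans sT; exact: ugrid_s.
pose U N r w := \sum_(j < m.+1) u j N r w.
have cU : EI P t s (U N) @[N --> \oo] --> 0%E by exact: EI_sum_cvg0.
have U0 N r w : 0 <= U N r w by exact: sumr_ge0.
have mU N : pmeas t s (U N) by apply: measurable_sum => j; exact: leb.
have Um N r w : U N r w <= m.+1%:R.
 rewrite -[m.+1 in leRHS]card_ord -sumr_const; apply: ler_sum => j _; exact: u1.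
(* Since [0 <= U <= m + 1], one has [U^n <= (m + 1)^(n - 1) U]; convergence in mean of the
   indicators is therefore enough for every exponent. *)
pose C0 := K ^+ n * m.+1%:R ^+ n.-1.
have C00 : 0 < C0 by rewrite mulr_gt0// exprn_gt0// ltr0n.
have e2 : 0 < eps / (2 * 2 ^+ n * C0) by rewrite divr_gt0// mulr_gt0// mulr_gt0.
have [N0 hN0] := cvge0_le cU e2.
exists N0 => N hN.
pose e k := [seq (ev t s (a (val j)) N k, val j) | j <- enum 'I_m.+1].
exists e; split; first by move=> k _ /mapP[j _ ->]; exact: FE.
have gE r w : gfun (tau N) N.+1 (fun k => sval (e k)) r w =
  \sum_(j < m.+1) rfun (tau N) N.+1 (fun k => \1_(ev t s (a j) N k)) r w *: v j.
 rewrite /gfun /rfun; under eq_bigr do rewrite /sval big_map big_enum scaler_sumr.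
 rewrite exchange_big /=; apply: eq_bigr => j _; rewrite scaler_suml.
 by apply: eq_bigr => k _; rewrite scalerA.
have bd r w : `|f r w - gfun (tau N) N.+1 (fun k => sval (e k)) r w| ^+ n <=
  2 ^+ n * (dd m r w + C0 * U N r w).
 have step1 : `|nearest v m (f r w) - gfun (tau N) N.+1 (fun k => sval (e k)) r w| <= K * U N r w.
  rewrite nearest_sum gE -sumrB; apply: le_trans (ler_norm_sum _ _ _) _.
  rewrite mulr_sumr; apply: ler_sum => j _; rewrite -scalerBl normrZ mulrC.
  apply: ler_wpM2r => //; rewrite /K (bigD1 j)//= addrCA lerDl. by rewrite addr_ge0// sumr_ge0.
 have step2 : (K * U N r w) ^+ n <= C0 * U N r w.
  rewrite exprMn -mulrA; apply: ler_wpM2l; first by rewrite exprn_ge0// ltW.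
  rewrite -(prednK n0) exprSr /=; apply: ler_wpM2r => //. by apply: lerXn2r; rewrite ?nnegrE// U0.
 have -> : f r w - gfun (tau N) N.+1 (fun k => sval (e k)) r w = (f r w - nearest v m (f r w)) +
   (nearest v m (f r w) - gfun (tau N) N.+1 (fun k => sval (e k)) r w).
  by rewrite addrA subrK.
 apply: le_trans (_ : (`|f r w - nearest v m (f r w)| + K * U N r w) ^+ n <= _).
  apply: lerXn2r; rewrite ?nnegrE ?addr_ge0 ?mulr_ge0 ?(ltW K0)//.
  by apply: le_trans (ler_normD _ _) _; rewrite lerD2l.
 apply: le_trans (exprDn_le _ _ _) _ => //; first by rewrite mulr_ge0 ?(ltW K0).
 by apply: ler_wpM2l; [exact: ltW|rewrite lerD2l].
apply: le_trans (_ : (2 ^+ n)%:E * (EI P t s (dd m) + C0%:E * EI P t s (U N)) <= _)%E.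
 rewrite -[X in (_ + X)%E]EI_Z; [|exact: mU|exact: U0|exact: ltW].
 rewrite -EI_D; [|exact: mdd| |exact: dd0|].
 - rewrite -EI_Z; [| | |exact: ltW].
  + by apply: EI_le => r w _; rewrite exprn_ge0//= bd.
  + apply: measurable_funD; first exact: mdd.
   by apply: measurable_funM; [exact: mcst|exact: mU].
  + by move=> r w; rewrite addr_ge0// mulr_ge0 ?(ltW C00).
 - by apply: measurable_funM; [exact: mcst|exact: mU].
 - by move=> r w; rewrite mulr_ge0 ?(ltW C00).
apply: le_trans (_ : (2 ^+ n)%:E * ((eps / (2 * 2 ^+ n))%:E +
  C0%:E * (eps / (2 * 2 ^+ n * C0))%:E) <= _)%E.
 apply: lee_wpmul2l; first by rewrite lee_fin ltW. apply: leeD; first exact: hm.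
 by apply: lee_wpmul2l; [rewrite lee_fin ltW|exact: hN0].
rewrite -[leLHS]/((2 ^+ n * (eps / (2 * 2 ^+ n) + C0 * (eps / (2 * 2 ^+ n * C0))))%:E).
rewrite lee_fin le_eqVlt; apply/orP; left; apply/eqP.
by field; rewrite !gt_eqF.
Qed.

End Density.

Lemma int_le2 R d (T : measurableType d) (P : probability T R)
  (h f g : T -> R) (a b : R) : measT f -> measT g ->
 (forall w, 0 <= f w) -> (forall w, 0 <= g w) -> 0 <= a -> 0 <= b ->
 (forall w, 0 <= h w <= a * f w + b * g w) ->
 (\int[P]_w (h w)%:E <= a%:E * \int[P]_w (f w)%:E + b%:E * \int[P]_w (g w)%:E)%E.
Proof.
move=> mf mg f0 g0 a0 b0 hfg.
rewrite -!intZ//; rewrite -intD; [|by []| | | |].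
- apply: le_int => [//|w _|w _]; rewrite lee_fin; by case/andP: (hfg w).
- by apply: measurable_funM; [exact: mcst|].
- by apply: measurable_funM; [exact: mcst|].
- by move=> w; rewrite mulr_ge0.
- by move=> w; rewrite mulr_ge0.
Qed.

Lemma EI_le2 R d (Om : measurableType d) (P : probability Om R) (t s : R)
  (h f g : R -> Om -> R) (a b : R) : pmeas t s f -> pmeas t s g ->
 (forall r w, 0 <= f r w) -> (forall r w, 0 <= g r w) -> 0 <= a -> 0 <= b ->
 (forall r w, t <= r <= s -> 0 <= h r w <= a * f r w + b * g r w) ->
 (EI P t s h <= a%:E * EI P t s f + b%:E * EI P t s g)%E.
Proof.
move=> mf mg f0 g0 a0 b0 hfg.
rewrite -!EI_Z//; rewrite -EI_D; [| | | |].
- by apply: EI_le.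
- by apply: measurable_funM; [exact: mcst|].
- by apply: measurable_funM; [exact: mcst|].
- by move=> r w; rewrite mulr_ge0.
- by move=> r w; rewrite mulr_ge0.
Qed.

Lemma lee_comb2 R (a b x y c : R) (X Y : \bar R) : 0 <= a -> 0 <= b ->
 (X <= x%:E)%E -> (Y <= y%:E)%E -> a * x + b * y <= c ->
 (a%:E * X + b%:E * Y <= c%:E)%E.
Proof.
move=> a0 b0 Xx Yy h; apply: le_trans (_ : (a * x + b * y)%:E <= _)%E; last by rewrite lee_fin.
rewrite (EFinD (a * x)) (EFinM a) (EFinM b).
by apply: leeD; apply: lee_wpmul2l => //; rewrite lee_fin.
Qed.

Lemma norm_sqrD R (V : normedModType R) (x y : V) : `|x + y| ^+ 2 <= 2 * `|x| ^+ 2 + 2 * `|y| ^+ 2.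
Proof.
apply: le_trans (_ : (`|x| + `|y|) ^+ 2 <= _).
 by apply: lerXn2r; rewrite ?nnegrE ?addr_ge0//; exact: ler_normD.
by have := sqr_ge0 (`|x| - `|y|); move: `|x| `|y| => a b; nra.
Qed.

Section Progressive.
Variables (R : realType) (Xi : hilbertType R) (V : normedModType R)
 (d : measure_display) (Om : measurableType d) (P : probability Om R)
 (W : R -> Xi -> Om -> R) (t T : R)
 (HW : reference_space P W t T)
 (v : nat -> V) (dv : dense_seq v).
Implicit Types f g : R -> Om -> V.

Lemma prog_le s q f : q <= s -> progressive P W t s f -> progressive P W t q f.
Proof. by move=> qs pf r /andP[tr rq]; apply: pf; rewrite tr (le_trans rq). Qed.

Lemma progD s f g : progressive P W t s f -> progressive P W t s g ->
 progressive P W t s (fun r w => f r w + g r w).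
Proof.
move=> pf pg q tqs; apply: (borelD dv) => //; first exact: stripG_meas.
 exact: pf.
exact: pg.
Qed.

Lemma progZ s (c : R -> Om -> R) f : (forall q, t <= q <= s -> measurable_fun (`[t, q] `*` setT)
  (fun z : realM R * Gs P W t q => c z.1 z.2)) ->
 progressive P W t s f -> progressive P W t s (fun r w => c r w *: f r w).
Proof.
move=> mc pf q tqs; apply: (borelZ dv) => //; first exact: stripG_meas.
 exact: mc.
exact: pf.
Qed.

Lemma prog_cst s (x : V) : progressive P W t s (fun _ _ => x).
Proof. by move=> q _; exact: mcst. Qed.

Lemma progZc s (c : R) f : progressive P W t s f -> progressive P W t s (fun r w => c *: f r w).
Proof. by apply: progZ => q _; exact: mcst. Qed.

Lemma progB s f g : progressive P W t s f -> progressive P W t s g ->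
 progressive P W t s (fun r w => f r w - g r w).
Proof.
move=> pf pg; rewrite (_ : (fun _ _ => _) = fun r w => f r w + (-1) *: g r w).
 by apply: progD => //; exact: progZc.
by apply/funext => r; apply/funext => w; rewrite scaleN1r.
Qed.

Lemma prog_pow s f n : t <= s <= T -> progressive P W t s f -> pmeas t s (fun r w => `|f r w| ^+ n).
Proof.
move=> /andP[ts sT] pf; apply: (Gs_pmeas HW sT); apply: measurable_funX.
apply: borel_norm0; first exact: stripG_meas.
by apply: pf; rewrite ts lexx.
Qed.

Lemma prog_adapted s f : t <= s <= T -> progressive P W t T f ->
 measT (f s : Gs P W t s -> borel V).
Proof.
move=> /andP[ts sT] pf.
have h := pf s; rewrite ts sT in h; have {}h := h isT.
move=> _ B mB; have := h (@stripG_meas R Xi d Om P W t s) B mB => hB.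
have mp : measT (fun w : Gs P W t s => ((s : realM R), w)).
 exact: measurable_pair1.
have := mp measurableT _ hB; rewrite !setTI => h1.
suff -> : f s @^-1` B = (fun w => ((s : realM R), w)) @^-1` (`[t, s] `*` setT
  `&` (fun z : realM R * g_sigma_algebraType (wiener_filtration P W t s) =>
  f z.1 z.2) @^-1` B) by exact: h1.
by apply/seteqP; split => w /=; rewrite in_itv/= ts lexx//=; case.
Qed.

End Progressive.

(** * The stochastic integral: linearity and mean square bounds *)

Section Ito.
Variables (R : realType) (Xi H : hilbertType R)
 (d : measure_display) (Om : measurableType d) (P : probability Om R)
 (W : R -> Xi -> Om -> R) (t T s : R)
 (HW : reference_space P W t T)
 (vH : nat -> H)
 (dvH : dense_seq vH)
 (ch : nat -> seq (Xi * H))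
 (dch : dense_seq (fun n => rk (ch n)))
 (tsT : t <= s <= T).
Local Notation ito := (@is_ito_integral R Xi d Om P W t H s).
Implicit Types D : seq (R * R * (set Om * Xi * H)).
Implicit Types (Phi : R -> Om -> hs Xi H) (y : Om -> H).

Let ts : t <= s. Proof. by case/andP: tsT. Qed.
Let sT : s <= T. Proof. by case/andP: tsT. Qed.

Lemma efun_prog D : eon P W t s D -> progressive P W t s (efun D).
Proof.
move=> + q /andP[tq qs]; elim: D => [|x D IH] hD.
 rewrite (_ : (fun _ => _) = fun=> 0); first exact: mcst.
 by apply/funext => z; rewrite /efun big_nil.
have [x1 x2 x3 x4] : [/\ t <= x.1.1, x.1.1 <= x.1.2, x.1.2 <= s & filt P W t x.1.1 x.2.1.1].
 by apply: hD; rewrite inE eqxx.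
rewrite (_ : (fun _ => _) = fun z => (\1_(`]x.1.1, x.1.2]) z.1 * \1_(x.2.1.1) z.2) *:
  rank1 x.2.1.2 x.2.2 + efun D z.1 z.2); last first.
 by apply/funext => z; rewrite /efun big_cons.
apply: (borelD dch); first exact: stripG_meas; last first.
 by apply: IH => y yD; apply: hD; rewrite inE yD orbT.
apply: (borelZ dch); [exact: stripG_meas| |exact: mcst].
have m1 : measurable_fun (`[t, q] `*` setT) (fun z : realM R * Gs P W t q =>
  \1_(`]x.1.1, x.1.2]) z.1 : R).
 apply: measurable_funTS; apply: measurableT_comp measurable_fst.
 by apply: measurable_indic; exact: measurable_itv.
have [xq|qx] := leP x.1.1 q.
 apply: measurable_funM => //; apply: measurable_funTS.
 apply: measurableT_comp measurable_snd; apply: measurable_indic.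
 by apply/measGs; exact: (@filt_mono _ _ _ _ _ _ _ _ _ _ xq x4).
have m0 : measurable_fun (`[t, q] `*` setT)
 (fun _ : realM R * Gs P W t q => 0 : R) by exact: mcst.
move: m0; apply: eq_measurable_fun => z /set_mem[/= + _]; rewrite in_itv => /andP[_ zq].
by rewrite [\1_(`]_, _]) _]indicE memNset ?mul0r//= in_itv/= => /andP[h _];
 have := lt_trans (le_lt_trans zq qx) h; rewrite ltxx.
Qed.

Lemma eint_meas D : eon P W t s D -> measT (eint W D : Om -> borel H).
Proof.
elim: D => [|x D IH] hD.
 rewrite (_ : eint W [::] = fun=> 0); first exact: mcst.
 by apply/funext => w; rewrite /eint big_nil.
have [x1 x2 x3 x4] : [/\ t <= x.1.1, x.1.1 <= x.1.2, x.1.2 <= s & filt P W t x.1.1 x.2.1.1].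
 by apply: hD; rewrite inE eqxx.
rewrite (_ : eint W _ = fun w => (\1_(x.2.1.1) w * dW W x.1.1 x.1.2 x.2.1.2 w) *: x.2.2 +
  eint W D w); last first.
 by apply/funext => w; rewrite /eint big_cons.
apply: (borelD dvH) => //; last by apply: IH => y yD; apply: hD; rewrite inE yD orbT.
apply: (borelZ dvH) => //.
apply: measurable_funM.
 by apply: measurable_indic; apply: (filt_meas HW _ x4); rewrite (le_trans x2)// (le_trans x3).
by apply: (dW_meas HW) => //; exact: le_trans sT.
Qed.

Lemma elist_funE (x : elementary Xi Om H) : elementary_fun x = efun (elist x).
Proof. by apply/funext => r; apply/funext => w; exact: elist_fun. Qed.

Lemma elist_intE (x : elementary Xi Om H) : elementary_integral W x = eint W (elist x).
Proof. by apply/funext => w; exact: elist_int. Qed.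

Lemma list_elem_funE D : elementary_fun (list_elem D) = efun D.
Proof. by apply/funext => r; apply/funext => w; exact: list_elem_fun. Qed.

Lemma list_elem_intE D : elementary_integral W (list_elem D) = eint W D.
Proof. by apply/funext => w; exact: list_elem_int. Qed.

(** The limit along a sequence is restated with a tolerance, so that two integrals can be combined
    without matching their approximating sequences. *)
Lemma itoP Phi y : ito Phi y <-> [/\ progressive P W t s Phi, measT (y : Om -> borel H) &
 forall eps, 0 < eps -> exists D, [/\ eon P W t s D,
  (EI P t s (fun r w => `|Phi r w - efun D r w| ^+ 2)%R <= eps%:E)%E &
  (\int[P]_w (`|y w - eint W D w| ^+ 2)%:E <= eps%:E)%E]].
Proof.
split=> [[pPhi my [e [he c1 c2]]]|[pPhi my h]]; split => //.
 move=> eps e0; have [N1 h1] := cvge0_le c1 e0; have [N2 h2] := cvge0_le c2 e0.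
 exists (elist (e (maxn N1 N2))); split; first exact: elist_on.
 - by rewrite -elist_funE; exact: h1 _ (leq_maxl _ _).
 - by rewrite -elist_intE; exact: h2 _ (leq_maxr _ _).
have h' n := h n.+1%:R^-1 (ltac:(by rewrite invr_gt0 ltr0n)).
have [D hD] := choice h'; exists (fun n => list_elem (D n)); split.
- by move=> n; apply: list_elem_on; have [] := hD n.
- apply: (@squeeze_cvge _ _ _ _ (cst 0%E) _ (fun n => (n.+1%:R^-1)%:E)).
 + near=> n; apply/andP; split.
   apply: integral_ge0 => w _; apply: integral_ge0 => r _. by rewrite lee_fin sqr_ge0.
  by rewrite list_elem_funE; have [_ + _] := hD n.
 + exact: cvg_cst.
 + by apply/cvg_EFin; [near=> n|exact: cvg_harmonic].
- apply: (@squeeze_cvge _ _ _ _ (cst 0%E) _ (fun n => (n.+1%:R^-1)%:E)).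
 + near=> n; apply/andP; split.
   by apply: integral_ge0 => w _; rewrite lee_fin sqr_ge0.
  by rewrite list_elem_intE; have [_ _ +] := hD n.
 + exact: cvg_cst.
 + by apply/cvg_EFin; [near=> n|exact: cvg_harmonic].
Unshelve. all: by end_near. Qed.

Lemma ito_elem D : eon P W t s D -> ito (efun D) (eint W D).
Proof.
move=> hD; apply/itoP; split; [exact: efun_prog|exact: eint_meas|].
move=> eps e0; exists D; split => //.
 rewrite (_ : (fun _ _ => _) = fun _ _ => 0); first by rewrite EI_cst// mul0r lee_fin ltW.
 by apply/funext => r; apply/funext => w; rewrite subrr normr0 expr0n.
under eq_integral do rewrite subrr normr0 expr0n.
by rewrite integral0 lee_fin ltW.
Qed.

Lemma sub_pow_pmeas Phi D : progressive P W t s Phi -> eon P W t s D ->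
 pmeas t s (fun r w => `|Phi r w - efun D r w| ^+ 2).
Proof.
move=> pP hD; apply: (prog_pow HW 2 tsT); apply: (progB dch) => //.
exact: efun_prog.
Qed.

Lemma sub_pow_meas y D : measT (y : Om -> borel H) -> eon P W t s D ->
 measT (fun w => `|y w - eint W D w| ^+ 2).
Proof.
move=> my hD; apply: borel_normX => //.
by apply: (borelB dvH) => //; exact: eint_meas.
Qed.

Lemma ito_lin Phi Phi' y y' (c : R) : ito Phi y -> ito Phi' y' ->
 ito (fun r w => c *: Phi r w + Phi' r w) (fun w => c *: y w + y' w).
Proof.
move=> /itoP[p1 m1 h1] /itoP[p2 m2 h2]; apply/itoP; split.
- by apply: (progD dch) => //; exact: (progZc dch).
- by apply: (borelD dvH) => //; exact: (borelZ dvH).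
move=> eps e0; have c0 : 0 < 2 * c ^+ 2 + 2 by rewrite ltr_wpDl// mulr_ge0// sqr_ge0.
have e1 : 0 < eps / (2 * c ^+ 2 + 2) by rewrite divr_gt0.
have [D1 [hD1 f1 i1]] := h1 _ e1; have [D2 [hD2 f2 i2]] := h2 _ e1.
have eE : eps = 2 * c ^+ 2 * (eps / (2 * c ^+ 2 + 2)) + 2 * (eps / (2 * c ^+ 2 + 2)).
 by field; rewrite gt_eqF.
have c20 : 0 <= 2 * c ^+ 2 by rewrite mulr_ge0// sqr_ge0.
exists (eneg c D1 ++ D2); split; first by apply: ecat_on => //; exact: eneg_on.
- apply: le_trans (_ : ((2 * c ^+ 2)%:E * EI P t s (fun r w => `|Phi r w - efun D1 r w| ^+ 2)%R +
   2%:E * EI P t s (fun r w => `|Phi' r w - efun D2 r w| ^+ 2)%R)%E <= _)%E.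
  apply: EI_le2; [exact: sub_pow_pmeas|exact: sub_pow_pmeas|by move=> r w; exact: sqr_ge0|
   by move=> r w; exact: sqr_ge0|by []|by []|].
  move=> r w _; rewrite sqr_ge0 /= ecat_fun eneg_fun.
  rewrite (_ : _ - _ = c *: (Phi r w - efun D1 r w) + (Phi' r w - efun D2 r w)).
   apply: le_trans (norm_sqrD _ _) _; rewrite normrZ exprMn mulrA. by rewrite real_normK ?num_real.
  by rewrite scalerBr opprD addrACA.
 by apply: (lee_comb2 c20 _ f1 f2) => //; rewrite -eE.
- apply: le_trans (_ : ((2 * c ^+ 2)%:E * \int[P]_w (`|y w - eint W D1 w| ^+ 2)%:E +
   2%:E * \int[P]_w (`|y' w - eint W D2 w| ^+ 2)%:E)%E <= _)%E.
  apply: int_le2; [exact: sub_pow_meas|exact: sub_pow_meas|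
   by move=> w; exact: sqr_ge0|by move=> w; exact: sqr_ge0|by []|by []|].
  move=> w; rewrite sqr_ge0 /= ecat_int eneg_int.
  rewrite (_ : _ - _ = c *: (y w - eint W D1 w) + (y' w - eint W D2 w)).
   apply: le_trans (norm_sqrD _ _) _; rewrite normrZ exprMn mulrA. by rewrite real_normK ?num_real.
  by rewrite scalerBr opprD addrACA.
 by apply: (lee_comb2 c20 _ i1 i2) => //; rewrite -eE.
Qed.

Section Local.
Variables (G : R -> set Om) (FG : forall r, t <= r <= s -> filt P W t r (G r))
 (Gle : forall q r, t <= q -> q <= r -> G r `<=` G q)
 (Glc : forall r w, t < r <= s -> (forall q, t <= q < r -> G q w) -> G r w).

(** The bound for elementary processes passes to the limit. Two applications of
    [(x + y)^2 <= 2 x^2 + 2 y^2] turn 8 into 32; the errors add up to 34 tolerances, hence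
    [eps / 34]. *)
Lemma ito_local Phi y : ito Phi y -> (\int[P]_w (\1_(G s) w * `|y w| ^+ 2)%:E <=
  32%:E * EI P t s (fun r w => gind t G r w * `|Phi r w| ^+ 2)%R)%E.
Proof.
move=> /itoP[pP my h].
have mG : pmeas t s (gind t G).
 apply: (Gs_pmeas HW sT); apply: (@gind_prog R Xi d Om P W t s G FG Gle Glc s). by rewrite ts lexx.
have mGs : measT (\1_(G s) : Om -> R).
 by apply: measurable_indic; apply: (filt_meas HW sT); apply: FG; rewrite ts lexx.
have g0 r w : 0 <= gind t G r w by exact: gind_ge0.
have g1 r w : gind t G r w <= 1 by exact: gind_le1.
apply/lee_addgt0Pr => eps e0; have e1 : 0 < eps / 34 by rewrite divr_gt0.
have [D [hD f1 i1]] := h _ e1.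
have mD : pmeas t s (fun r w => `|efun D r w| ^+ 2) by exact: (efun_pow_pmeas HW tsT).
have mI : measT (fun w => `|eint W D w| ^+ 2).
 by apply: borel_normX => //; exact: eint_meas.
apply: le_trans (_ : (2%:E * \int[P]_w (`|y w - eint W D w| ^+ 2)%:E +
  2%:E * \int[P]_w (\1_(G s) w * `|eint W D w| ^+ 2)%:E <= _)%E).
 apply: int_le2; [exact: sub_pow_meas|by apply: measurable_funM|by move=> w; exact: sqr_ge0|
  by move=> w; rewrite mulr_ge0 ?sqr_ge0|by []|by []|].
 move=> w; rewrite mulr_ge0 ?sqr_ge0//= indicE.
 case: (_ \in _); rewrite /= ?mul1r ?mul0r ?mulr0 ?addr0 ?mulr_ge0 ?sqr_ge0//.
 by rewrite -{1}(subrK (eint W D w) (y w)); exact: norm_sqrD.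
apply: le_trans (leeD2l _ (lee_wpmul2l _ (localization HW dvH tsT FG Gle Glc hD))) _ => //.
apply: le_trans (_ : ((2 * (eps / 34))%:E + 2%:E * (8%:E *
  (2%:E * EI P t s (fun r w => gind t G r w * `|Phi r w| ^+ 2)%R + (2 * (eps / 34))%:E)) <= _)%E).
 apply: leeD; first by rewrite EFinM; apply: lee_wpmul2l.
 apply: lee_wpmul2l => //; apply: lee_wpmul2l => //.
 apply: le_trans (_ : (2%:E * EI P t s (fun r w => gind t G r w * `|Phi r w| ^+ 2)%R +
   2%:E * EI P t s (fun r w => `|Phi r w - efun D r w| ^+ 2)%R <= _)%E).
  apply: EI_le2; [by apply: measurable_funM => //; exact: (prog_pow HW 2 tsT)|exact: sub_pow_pmeas|
   by move=> r w; rewrite mulr_ge0 ?sqr_ge0|by move=> r w; exact: sqr_ge0|by []|by []|].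
  move=> r w _; rewrite mulr_ge0 ?sqr_ge0//=.
  apply: le_trans (_ : gind t G r w * (2 * `|Phi r w| ^+ 2 + 2 * `|Phi r w - efun D r w| ^+ 2) <= _).
   apply: ler_wpM2l => //; rewrite -[`|_ - efun _ _ _|]normrN.
   rewrite -{1}(subKr (Phi r w) (efun D r w)); exact: norm_sqrD.
  rewrite mulrDr mulrCA lerD2l mulrCA ler_wpM2l//.
  by rewrite -[leRHS]mul1r; apply: ler_wpM2r => //; exact: sqr_ge0.
 by apply: leeD => //; rewrite EFinM; apply: lee_wpmul2l.
have := @EI_ge0 _ _ _ P t s (fun r w => gind t G r w * `|Phi r w| ^+ 2)
 (fun r w _ => mulr_ge0 (g0 r w) (sqr_ge0 _)).
case: (EI _ _ _ _) => [u u0| |//]; last first.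
 have -> : (32%:E * +oo = +oo :> \bar R)%E by rewrite gt0_muley// lte_fin ltr0n.
 by rewrite addye ?leey.
rewrite -[X in (_ <= X)%E]/((32 * u + eps)%:E).
rewrite -[X in (X <= _)%E]/((2 * (eps / 34) + 2 * (8 * (2 * u + 2 * (eps / 34))))%:E) lee_fin.
by lra.
Qed.

End Local.

Lemma ito_L2 Phi y : ito Phi y ->
 (\int[P]_w (`|y w| ^+ 2)%:E <= 32%:E * EI P t s (fun r w => `|Phi r w| ^+ 2)%R)%E.
Proof.
move=> h; have FT r : t <= r <= s -> filt P W t r setT by move=> _; exact: filt_setT.
have := ito_local (G := fun=> setT) FT (fun _ _ _ _ _ h => h) (fun _ _ _ _ => I) h.
under eq_integral do rewrite indicT mul1r.
move=> /le_trans; apply; apply: lee_wpmul2l => //; apply: EI_le => r w _.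
rewrite mulr_ge0 ?sqr_ge0 ?gind_ge0//= -[leRHS]mul1r.
by apply: ler_wpM2r; [exact: sqr_ge0|exact: gind_le1].
Qed.

End Ito.

Lemma fatou_ae R d (T : measurableType d) (P : probability T R)
  (f : nat -> T -> R) (g : T -> R) (B : R) :
 (forall n, measT (f n)) -> (forall n w, 0 <= f n w) ->
 measT g -> (forall w, 0 <= g w) ->
 {ae P, forall w, f n w @[n --> \oo] --> g w} ->
 (forall n, (\int[P]_w (f n w)%:E <= B%:E)%E) -> (\int[P]_w (g w)%:E <= B%:E)%E.
Proof.
move=> mf f0 mg g0 fg fB.
have mf' n : measT (fun w => (f n w)%:E) by exact/mEFinP.
have f0' n w : setT w -> (0 <= (f n w)%:E)%E by rewrite lee_fin.
apply: le_trans (_ : \int[P]_w limn_einf (fun n => (f n w)%:E) <= _)%E.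
 apply: le_ae_int => [//|w _|w _|].
 - by rewrite lee_fin.
 - rewrite limn_einf_lim; apply: lime_ge; first exact: is_cvg_einfs.
  near=> n; apply: le_ereal_inf_tmp => _ [k _ <-]; by rewrite lee_fin.
 apply: ae_imp fg => w h _.
 have h' : (f n w)%:E @[n --> \oo] --> (g w)%:E by apply/cvg_EFin; [near=> n|exact: h].
 by rewrite is_cvg_limn_einfE ?(cvg_lim _ h')//; apply/cvg_ex; eexists; exact: h'.
apply: le_trans (fatou P measurableT mf' f0') _.
rewrite limn_einf_lim; apply: lime_le; first exact: is_cvg_einfs.
near=> n; apply: ereal_inf_le; exists (\int[P]_w (f n w)%:E)%E; last exact: fB.
by exists n => //=; exact: leqnn.
Unshelve. all: by end_near. Qed.

Lemma geo_sum_le R n : \sum_(k < n) (2^-1 : R) ^+ k <= 2.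
Proof.
suff -> : \sum_(k < n) (2^-1 : R) ^+ k = 2 - 2 * 2^-1 ^+ n.
 by rewrite gerBl mulr_ge0// exprn_ge0// invr_ge0.
elim: n => [|n IH]; first by rewrite big_ord0 expr0 mulr1 subrr.
by rewrite big_ord_recr /= IH exprS; field.
Qed.

(** The expectations are summable, so the series converges almost surely and its terms tend to zero.
    This plays the part of Borel-Cantelli in the sequel. *)
Lemma ae_cvg0 R d (T : measurableType d) (P : probability T R)
  (f : nat -> T -> R) : (forall n, measT (f n)) -> (forall n w, 0 <= f n w) ->
 (forall n, (\int[P]_w (f n w)%:E <= (2^-1 ^+ n)%:E)%E) ->
 {ae P, forall w, f n w @[n --> \oo] --> 0}.
Proof.
move=> mf f0 fB; pose F w : \bar R := (\sum_(0 <= n <oo) (f n w)%:E)%E.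
have mf' n : measT (fun w => (f n w)%:E) by exact/mEFinP.
have f0' n w : (0 <= (f n w)%:E)%E by rewrite lee_fin.
have F0 w : (0 <= F w)%E by apply: nneseries_ge0 => n _ _.
have mF : measT F by apply: ge0_emeasurable_sum.
have intF : (\int[P]_w F w <= 2%:E)%E.
 rewrite integral_nneseries//; apply: lime_le.
  by apply: is_cvg_nneseries => n _ _; apply: integral_ge0.
 near=> n; rewrite big_mkord; apply: le_trans (_ : (\sum_(k < n) (2^-1 ^+ k)%:E)%E <= _)%E.
  by apply: lee_sum => k _; exact: fB.
 by rewrite sumEFin lee_fin geo_sum_le.
have iF : P.-integrable setT F.
 apply/integrableP; split => //; under eq_integral do rewrite gee0_abs//.
 by apply: le_lt_trans intF _; rewrite ltry.
have := integrable_ae measurableT iF; apply: ae_imp => w /(_ I) Fw.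
apply: cvg_series_cvg_0; apply: nondecreasing_is_cvgn.
 by apply: nondecreasing_series => n _ _; exact: f0.
exists (fine (F w)) => _ [n _ <-]; rewrite -lee_fin fineK// /series /= -sumEFin.
exact: nneseries_lim_ge.
Unshelve. all: by end_near. Qed.

(** The integral of the weight is the weight divided by its rate: a large rate makes the integral
    terms small, whatever the length of the interval. *)
Lemma int_expR R (c t s : R) : 0 < c -> t <= s ->
 (\int[leb]_(r in `[t, s]) (expR (c * (r - t)))%:E <= (expR (c * (s - t)) / c)%:E)%E.
Proof.
move=> c0; rewrite le_eqVlt => /predU1P[<-|ts].
 rewrite set_itv1 integral_set1 lee_fin divr_ge0 ?expR_ge0// ltW//.
pose F : R -> R := c^-1 *: (expR \o (c *: (id - cst t))).
have dF (r : R) : is_derive r (1 : R) F (expR (c * (r - t))).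
 apply: is_derive_eq; rewrite /= /GRing.scale /= subr0 mulr1.
 by rewrite [_ * c]mulrC mulrA mulVf ?mul1r// gt_eqF.
have cF (r : R) : {for r, continuous F}.
 by apply/differentiable_continuous/derivable1_diffP; case: (dF r).
have FE r : F r = expR (c * (r - t)) / c by rewrite /F /= mulrC.
have cE : continuous (fun r : R => expR (c * (r - t))).
 move=> r; apply: continuous_comp; last exact: continuous_expR.
 by apply: cvgM; [exact: cvg_cst|apply: cvgB; [exact: cvg_id|exact: cvg_cst]].
rewrite (@continuous_FTC2 _ _ F)//.
- by rewrite -EFinB lee_fin !FE gerBl divr_ge0 ?expR_ge0// ltW.
- exact: continuous_subspaceT.
- split; [by move=> r _; case: (dF r)| |].
 + by apply: cvg_at_right_filter; exact: cF.
 + by apply: cvg_at_left_filter; exact: cF.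
- by move=> r _; rewrite derive1E; case: (dF r).
Qed.

(** * Fourth moments of stochastic integrals *)

Section L4.
Variables (R : realType) (Xi H : hilbertType R)
 (d : measure_display) (Om : measurableType d) (P : probability Om R)
 (W : R -> Xi -> Om -> R) (t T s : R)
 (HW : reference_space P W t T)
 (vH : nat -> H)
 (dvH : dense_seq vH)
 (ch : nat -> seq (Xi * H))
 (dch : dense_seq (fun n => rk (ch n)))
 (ts : t < s) (sT : s <= T).
Local Notation ito := (@is_ito_integral R Xi d Om P W t H s).
Implicit Types (Phi : R -> Om -> hs Xi H) (y : Om -> H).

Let ts' := ltW ts.
Let tsT : t <= s <= T. Proof. by rewrite ts'. Qed.

(** A simple process has values among the finite rank operators [rk (ch n)]; here each value is
    expanded into items of rank one, on which [W] acts. *)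
Definition hitems (e : seq (set Om * nat)) : seq (set Om * Xi * H) :=
 flatten [seq [seq (i.1, x.1, x.2) | x <- ch i.2] | i <- e].

Lemma hitems_val e w : ival (hitems e) w = sval (fun n => rk (ch n)) e w.
Proof.
rewrite ivalE /hitems big_flatten big_map /sval; apply: eq_bigr => i _.
by rewrite big_map /rk scaler_sumr.
Qed.

Lemma hitems_at r e : sevents P W t r e -> events_at P W t r (hitems e).
Proof. by move=> h i /flattenP[_ /mapP[j je ->] /mapP[x _ ->]]; exact: h. Qed.

Definition glist (tau : nat -> R) N (e : nat -> seq (set Om * Xi * H)) :
  seq (R * R * (set Om * Xi * H)) :=
 flatten [seq [seq (tau (val k), tau (val k).+1, i) | i <- e (val k)] | k <- enum 'I_N].

Lemma glist_fun tau N e : efun (glist tau N e) = gfun tau N (fun k => ival (e k)).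
Proof.
apply/funext => r; apply/funext => w; rewrite /efun /glist big_flatten big_map big_enum /=.
apply: eq_bigr => k _; rewrite big_map ivalE scaler_sumr; apply: eq_bigr => i _ /=.
by rewrite scalerA /cell indicE mem_setE in_itv.
Qed.

Lemma glist_int tau N e w : eint W (glist tau N e) w =
 \sum_(k < N) iinc W (tau k) (tau k.+1) (e k) w.
Proof.
rewrite /eint /glist big_flatten big_map big_enum /=.
by apply: eq_bigr => k _; rewrite big_map iincE.
Qed.

Lemma glist_on tau N e : (forall k, t <= tau k) -> (forall k, tau k <= tau k.+1) ->
 (forall k, tau k <= s) -> (forall k, events_at P W t (tau k) (e k)) ->
 eon P W t s (glist tau N e).
Proof.
by move=> h1 h2 h3 h4 _ /flattenP[_ /mapP[k _ ->] /mapP[i ie ->]]; split => //=; exact: h4.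
Qed.

(** A Riemann sum with weights at right end points. For [z = c (tau k.+1 - tau k)] in the unit
    interval, [z exp z <= e (exp z - 1)], and the right side telescopes; this is the origin of
    [expR 1] in the constants. *)
Lemma sum_weight (N : nat) (tau : nat -> R) (c : R) : 0 < c ->
 (forall k, tau k <= tau k.+1) -> (forall k, c * (tau k.+1 - tau k) <= 1) ->
 tau 0%N = t -> tau N = s ->
 \sum_(k < N) (tau k.+1 - tau k) * expR (c * (tau k.+1 - t)) <=
 expR 1 * (expR (c * (s - t)) / c).
Proof.
move=> c0 tauS hc t0 tN.
apply: le_trans (_ : \sum_(k < N) expR 1 / c * (expR (c * (tau k.+1 - t)) - expR (c * (tau k - t))) <= _).
 apply: ler_sum => k _.
 have -> : c * (tau k.+1 - t) = c * (tau k.+1 - tau k) + c * (tau k - t) by ring.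
 rewrite expRD; have [z [z0 z1 ->]] : exists z, [/\ 0 <= z, z <= 1 & tau k.+1 - tau k = z / c].
  exists (c * (tau k.+1 - tau k)); split; [|exact: hc|by field; rewrite gt_eqF].
  by rewrite mulr_ge0 ?subr_ge0// ltW.
 have -> : c * (z / c) = z by field; rewrite gt_eqF.
 have h1 := expR_ge1Dx z; have h2 : expR z <= expR 1 by rewrite ler_expR.
 have h3 := expR_ge0 (c * (tau k - t)); have h4 := expR_gt0 z.
 move: (expR z) (expR 1) (expR (c * _)) h1 h2 h3 h4 => Z e E h1 h2 h3 h4.
 rewrite [leRHS](_ : _ = e * (Z * E - E) / c); last by field; rewrite gt_eqF.
 rewrite [leLHS](_ : _ = z * (Z * E) / c); last by field; rewrite gt_eqF.
 rewrite ler_pM2r ?invr_gt0//. have h5 : z * Z <= e * (Z - 1) by nra.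
 rewrite mulrA [leRHS](_ : _ = e * (Z - 1) * E); last by ring. exact: ler_wpM2r.
rewrite -mulr_sumr (_ : \sum_(k < N) _ = expR (c * (tau N - t)) - expR (c * (tau 0%N - t))).
 rewrite tN mulrAC mulrA ler_pM2r ?invr_gt0// ler_pM2l ?expR_gt0//. by rewrite gerBl expR_ge0.
by rewrite -(telescope_sumr (fun k => expR (c * (tau k - t))))// big_mkord.
Qed.

(* Cauchy-Schwarz with an exponential weight avoids powers of [s - t] in the
  fourth moment of a simple stochastic integral. *)
Lemma grid_L4 N (e : nat -> seq (set Om * Xi * H)) (c Z : R) :
 0 < c -> 0 < Z -> (0 < N)%N -> c * ((s - t) / N%:R) <= 1 ->
 (forall k, events_at P W t (ugrid t s N k) (e k)) ->
 (EI P t s (rfun (ugrid t s N) N (fun k w =>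
   (expR (c * (ugrid t s N k.+1 - t)))^-1 * `|ival (e k) w| ^+ 4)%R) <= (32 * Z)%:E)%E ->
 (\int[P]_w (`|eint W (glist (ugrid t s N) N e) w| ^+ 4)%:E <=
  (7 * 10 ^+ 4 * expR 1 * (expR (c * (s - t)) / c) * Z)%:E)%E.
Proof.
move=> c0 Z0 N0 hc ee; pose tau := ugrid t s N.
have tauS : forall k, tau k <= tau k.+1 by exact: ugridS.
have taut : forall k, t <= tau k by exact: ugrid_t.
have taus : forall k, tau k <= s by move=> k; exact: ugrid_s.
have tauT k : tau k <= T by exact: le_trans (taus k) sT.
pose om k := expR (c * (tau k.+1 - t)); have om0 k : 0 < om k by exact: expR_gt0.
pose a k := fine (\int[P]_w (`|ival (e k) w| ^+ 4)%:E)%E.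
have aE k : (\int[P]_w (`|ival (e k) w| ^+ 4)%:E)%E = (a k)%:E.
 rewrite /a fineK// ge0_fin_numE; first exact: ival_pow_lty.
 by apply: integral_ge0 => w _; rewrite lee_fin exprn_ge0.
have a0 k : 0 <= a k.
 by rewrite -lee_fin -aE; apply: integral_ge0 => w _; rewrite lee_fin exprn_ge0.
have mi k : measT (fun w => `|ival (e k) w| ^+ 4).
 by apply: measurable_funX; exact: (ival_norm_meas HW (tauT k)).
have mi' k : measT (fun w => (om k)^-1 * `|ival (e k) w| ^+ 4).
 by apply: measurable_funM; [exact: mcst|exact: mi].
rewrite EI_rfun; [|exact: tauS|by move=> k; rewrite taut taus|by move=> k _; exact: mi'|
 by move=> k w; rewrite mulr_ge0 ?invr_ge0 ?exprn_ge0// ltW].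
have E1 k : (\int[P]_w ((om k)^-1 * `|ival (e k) w| ^+ 4)%:E = ((om k)^-1 * a k)%:E)%E.
 rewrite intZ//; last by rewrite invr_ge0 ltW. by rewrite aE -EFinM.
under eq_bigr do rewrite E1 -EFinM.
rewrite sumEFin lee_fin => hA.
(* [chain4] needs positive bounds, while some [a k] may vanish. Over the whole interval the extra
   [eta] costs just one more [Z]. *)
pose eta := Z / (s - t); have st0 : 0 < s - t by rewrite subr_gt0.
have eta0 : 0 < eta by rewrite divr_gt0.
pose b k := Num.sqrt (a k + eta).
have b2 k : b k ^+ 2 = a k + eta by rewrite sqr_sqrtr// addr_ge0// ltW.
have b0 k : 0 < b k by rewrite sqrtr_gt0 ltr_wpDl.
pose Ec := expR (c * (s - t)) / c; have Ec0 : 0 < Ec by rewrite divr_gt0// expR_gt0.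
pose eps := Num.sqrt (Ec * Z); have eps0 : 0 < eps by rewrite sqrtr_gt0 mulr_gt0.
pose Q := \sum_(k < N) (tau k.+1 - tau k) * b k.
have Dl k : 0 <= tau k.+1 - tau k by rewrite subr_ge0.
have om1 k : (om k)^-1 <= 1.
 rewrite invf_le1// -expR0 ler_expR mulr_ge0 ?subr_ge0//; exact: ltW.
have Q2 : Q ^+ 2 <= expR 1 * Ec * (33 * Z).
 have -> : Q = \sum_(k < N) Num.sqrt ((tau k.+1 - tau k) * om k) *
   (Num.sqrt ((tau k.+1 - tau k) / om k) * b k).
  apply: eq_bigr => k _; rewrite mulrA -sqrtrM ?mulr_ge0 ?(ltW (om0 k))//.
  rewrite mulrACA divff ?gt_eqF// mulr1 -expr2 sqrtr_sqr ger0_norm//.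
 apply: le_trans (sum_CS _ _) _; apply: ler_pM.
 - by apply: sumr_ge0 => k _; exact: sqr_ge0.
 - by apply: sumr_ge0 => k _; exact: sqr_ge0.
 - under eq_bigr do rewrite sqr_sqrtr ?mulr_ge0 ?(ltW (om0 _))//.
  apply: (sum_weight c0 tauS); rewrite /tau ?ugrid0 ?ugridN// => k.
  by apply: le_trans hc; rewrite ler_wpM2l ?(ltW c0)//; exact: ugrid_mesh.
 under eq_bigr do rewrite exprMn sqr_sqrtr ?mulr_ge0 ?invr_ge0 ?(ltW (om0 _))// b2 mulrDr.
 rewrite big_split /= (_ : 33 * Z = 32 * Z + Z); last by ring.
 apply: lerD; first by under eq_bigr do rewrite -mulrA.
 apply: le_trans (_ : \sum_(k < N) (tau k.+1 - tau k) * eta <= _).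
  apply: ler_sum => k _; apply: ler_wpM2r; first exact: ltW.
  by rewrite -[leRHS]mulr1; apply: ler_wpM2l.
 rewrite -mulr_suml -(big_mkord xpredT (fun k => tau k.+1 - tau k)) telescope_sumr//.
 by rewrite /tau ugrid0 ugridN// /eta mulrCA divff ?mulr1// gt_eqF.
pose C := (fun _ x => x) : nat -> H -> H.
have mC k : measT (C k : borel H -> borel H) by exact: measurable_id.
have Cc k x : `|C k x| <= `|x| by [].
have h4b j : (\int[P]_w (`|ival (e j) w| ^+ 4)%:E <= (b j ^+ 2)%:E)%E.
 by rewrite aE b2 lee_fin lerDl ltW.
have := chain4 HW dvH taut tauS tauT ee mC N (fun _ _ => erefl) eps0 b0 h4b.
rewrite -/Q => h4.
have E2 w : eint W (glist tau N e) w = chain W tau e C N w.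
 rewrite glist_int; elim: (N) => [|k IH] /=; first by rewrite big_ord0.
 by rewrite big_ord_recr /= IH.
under eq_integral do rewrite E2.
apply: le_trans h4 _; rewrite lee_fin.
(* The constant is [2 + 2 * 1024 * 33 = 67586], rounded up to 70000. *)
apply: le_trans (_ : 2 * eps ^+ 2 + 2 * (1024 * Q ^+ 2) <= _).
 by have := sqr_ge0 (eps - 32 * Q); lra.
have -> : eps ^+ 2 = Ec * Z by rewrite sqr_sqrtr// mulr_ge0 ?ltW.
have e1 : 1 <= expR 1 :> R by rewrite -expR0 ler_expR.
have EZ : 0 <= Ec * Z by rewrite mulr_ge0 ?ltW.
rewrite (_ : expR 1 * Ec * (33 * Z) = 33 * (expR 1 * (Ec * Z))) in Q2; last by ring.
rewrite -/Ec (_ : _ * Ec * Z = 7 * 10 ^+ 4 * (expR 1 * (Ec * Z))); last by ring.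
have : Ec * Z <= expR 1 * (Ec * Z) by rewrite -[leLHS]mul1r; apply: ler_wpM2r.
by move: Q2; move: (Q ^+ 2) (expR 1 * (Ec * Z)) (Ec * Z) EZ => q x z z0 *; lra.
Qed.

Section Local.
Variables (G : R -> set Om) (FG : forall r, t <= r <= s -> filt P W t r (G r))
 (Gle : forall q r, t <= q -> q <= r -> G r `<=` G q)
 (Glc : forall r w, t < r <= s -> (forall q, t <= q < r -> G q w) -> G r w).

(** Simple approximations of the truncated integrand obey [grid_L4] with a common bound. A fast
    sequence of them has integrals that converge almost surely to [y] on [G s], and Fatou transfers
    the bound. *)
Lemma ito_L4 Phi y (c U : R) : ito Phi y -> 0 < c -> 0 < U ->
 (forall r, t <= r <= s -> (\int[P]_w (gind t G r w * `|Phi r w| ^+ 4)%:E <=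
   (U * expR (c * (r - t)) ^+ 2)%:E)%E) ->
 (\int[P]_w (\1_(G s) w * `|y w| ^+ 4)%:E <=
  (7 * 10 ^+ 4 * expR 1 * U * (expR (c * (s - t)) / c) ^+ 2)%:E)%E.
Proof.
move=> hI c0 U0 hU; have [pP my _] := hI.
have st0 : 0 < s - t by rewrite subr_gt0.
have pG q : t <= q <= s -> measurable_fun (`[t, q] `*` setT)
  (fun z : realM R * Gs P W t q => gind t G z.1 z.2).
 exact: (@gind_prog R Xi d Om P W t s G FG Gle Glc q).
pose Phi' r w := gind t G r w *: Phi r w.
have pP' : progressive P W t s Phi' by apply: (progZ dch).
have m4 : pmeas t s (fun r w => `|Phi' r w| ^+ 4) by exact: (prog_pow HW 4 tsT).
have Phi'4 r w : `|Phi' r w| ^+ 4 = gind t G r w * `|Phi r w| ^+ 4.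
 rewrite /Phi' normrZ exprMn.
 by case: (gind01 t G r w) => [->|[-> _]]; rewrite ?normr0 ?normr1 ?expr0n ?expr1n.
pose om r := expR (c * (r - t)).
have om1 r : t <= r -> 1 <= om r.
 by move=> tr; rewrite -expR0 ler_expR mulr_ge0 ?subr_ge0// ltW.
have om0 r : 0 < om r by exact: expR_gt0.
have com : continuous om.
 move=> r; apply: continuous_comp; last exact: continuous_expR.
 by apply: cvgM; [exact: cvg_cst|apply: cvgB; [exact: cvg_id|exact: cvg_cst]].
have mom : pmeas t s (fun r (_ : Om) => (om r)^-1).
 have mi : measT (fun r : R => (om r)^-1); last first.
  apply: measurable_funTS; exact: (measurableT_comp mi measurable_fst).
 apply: continuous_measurable_fun => r; apply: cvgV; [by rewrite gt_eqF|exact: com].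
have momf : pmeas t s (fun r w => (om r)^-1 * `|Phi' r w| ^+ 4) by exact: measurable_funM.
pose Z := U * (om s / c); have Z0 : 0 < Z by rewrite mulr_gt0// divr_gt0.
have hZ : (EI P t s (fun r w => (om r)^-1 * `|Phi' r w| ^+ 4)%R <= Z%:E)%E.
 rewrite EI_swap//; last by move=> r w _; rewrite mulr_ge0 ?invr_ge0 ?exprn_ge0// ltW.
 apply: le_trans (_ : \int[leb]_(r in `[t, s]) (U * om r)%:E <= _)%E.
  apply: le_int; first exact: measurable_itv.
   move=> r _; apply: integral_ge0 => w _. by rewrite lee_fin mulr_ge0 ?invr_ge0 ?exprn_ge0// ltW.
  move=> r /=; rewrite in_itv/= => trs. rewrite intZ//; last 2 first.
  - exact: (EI_section2 trs m4).
  - by rewrite invr_ge0 ltW.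
  under eq_integral do rewrite Phi'4.
  apply: le_trans (lee_wpmul2l _ (hU r trs)) _; first by rewrite lee_fin invr_ge0 ltW.
  rewrite -EFinM lee_fin -/(om r) le_eqVlt; apply/orP; left; apply/eqP. by field; rewrite gt_eqF.
 rewrite intZ ?(ltW U0)//; last 2 first.
 - by apply: measurable_funTS; exact: continuous_measurable_fun.
 - by move=> r; exact: ltW.
 rewrite EFinM; apply: lee_wpmul2l; first by rewrite lee_fin ltW. exact: int_expR.
have fin4 : (EI P t s (fun r w => `|Phi' r w| ^+ 4)%R < +oo)%E.
 apply: le_lt_trans (_ : ((om s)%:E * Z%:E < +oo)%E); last by rewrite -EFinM ltry.
 apply: le_trans (lee_wpmul2l _ hZ); last by rewrite lee_fin ltW.
 rewrite -EI_Z; [|exact: momf| |exact: ltW]; last first.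
  by move=> r w; rewrite mulr_ge0 ?invr_ge0 ?exprn_ge0// ltW.
 apply: EI_le => r w /andP[tr rs]; rewrite exprn_ge0//= mulrA -[leLHS]mul1r.
 apply: ler_wpM2r; first exact: exprn_ge0. rewrite ler_pdivlMr// mul1r ler_expR ler_pM2l// lerD2r//.
pose Kb := 7 * 10 ^+ 4 * expR 1 * (om s / c) * Z.
have main dl : 0 < dl -> exists D, [/\ eon P W t s D,
  (EI P t s (fun r w => `|Phi' r w - efun D r w| ^+ 2)%R <= dl%:E)%E &
  (\int[P]_w (`|eint W D w| ^+ 4)%:E <= Kb%:E)%E].
 (* By [x <= eta + x^2 / (4 eta)], closeness in fourth moment gives closeness in mean square, with
    half of [dl] for each term. *)
 move=> dl0; pose eta := dl / (2 * (s - t)). have eta0 : 0 < eta by rewrite divr_gt0// mulr_gt0.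
 have e0 : 0 < Num.min Z (2 * eta * dl) by rewrite lt_min Z0 mulr_gt0// mulr_gt0.
 have [N0 hN0] := density HW ts sT dch pP' (n := 4) isT fin4 e0.
 pose N := maxn N0 (Num.truncn (c * (s - t))). have [e [he hd]] := hN0 N (leq_maxl _ _).
 pose e' k := hitems (e k); pose tau := ugrid t s N.+1.
 have tauS : forall k, tau k <= tau k.+1 by exact: ugridS.
 have e'at k : events_at P W t (tau k) (e' k) by apply: hitems_at; exact: he.
 have hD : eon P W t s (glist tau N.+1 e').
  by apply: glist_on => // k; [exact: ugrid_t|exact: ugrid_s].
 have DE : efun (glist tau N.+1 e') = gfun tau N.+1 (fun k => sval (fun n => rk (ch n)) (e k)).
  rewrite glist_fun; congr gfun; apply/funext => k; apply/funext => w; exact: hitems_val.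
 have md : pmeas t s (fun r w => `|Phi' r w - efun (glist tau N.+1 e') r w| ^+ 4).
  by apply: (prog_pow HW 4 tsT); apply: (progB dch) => //; exact: (efun_prog dch).
 have hd' : (EI P t s (fun r w => `|Phi' r w - efun (glist tau N.+1 e') r w| ^+ 4)%R <=
   (Num.min Z (2 * eta * dl))%:E)%E by rewrite DE.
 have hcN : c * ((s - t) / N.+1%:R) <= 1.
  rewrite mulrA ler_pdivrMr ?ltr0n// mul1r.
  apply: le_trans (ltW (truncnS_gt _)) _; rewrite ler_nat ltnS; exact: leq_maxr.
 exists (glist tau N.+1 e'); split => //.
  have -> : dl%:E = (eta%:E * (s - t)%:E + (4 * eta)^-1%:E * (2 * eta * dl)%:E)%E.
   rewrite -!EFinM -EFinD; congr (_%:E); rewrite /eta; field. by rewrite !gt_eqF.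
  apply: le_trans (_ : (eta%:E * EI P t s (fun _ _ => 1%R) + (4 * eta)^-1%:E *
    EI P t s (fun r w => `|Phi' r w - efun (glist tau N.+1 e') r w| ^+ 4)%R <= _)%E).
   apply: EI_le2; [exact: mcst|exact: md|by []|by move=> r w; exact: exprn_ge0|
    exact: ltW|by rewrite invr_ge0 mulr_ge0// ltW|].
   move=> r w _; rewrite sqr_ge0/= mulr1 (exprM _ 2 2); move: (`|_ - _| ^+ 2) => x.
   rewrite -subr_ge0 (_ : _ - _ = (2 * eta - x) ^+ 2 / (4 * eta)).
    by rewrite divr_ge0 ?sqr_ge0// mulr_ge0// ltW.
   by field; rewrite gt_eqF.
  rewrite EI_cst// mul1r; apply: leeD => //.
  apply: lee_wpmul2l; first by rewrite lee_fin invr_ge0 mulr_ge0// ltW.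
  by apply: le_trans hd' _; rewrite lee_fin ge_min lexx orbT.
 apply: grid_L4 => //. have -> : (32 * Z)%:E = (16%:E * Z%:E + 16%:E * Z%:E)%E.
  by rewrite -!EFinM -EFinD; congr (_%:E); ring.
 apply: le_trans (_ : (16%:E * EI P t s (fun r w => (om r)^-1 * `|Phi' r w| ^+ 4)%R + 16%:E *
    EI P t s (fun r w => `|Phi' r w - efun (glist tau N.+1 e') r w| ^+ 4)%R <= _)%E).
  apply: EI_le2; [exact: momf|exact: md|by move=> r w; rewrite mulr_ge0 ?invr_ge0 ?exprn_ge0// ltW|
   by move=> r w; exact: exprn_ge0|by []|by []|].
  move=> r w /andP[tr rs]; rewrite glist_fun. have om_inv0 : 0 <= (om r)^-1 by rewrite invr_ge0 ltW.
  case: (cellP tauS N.+1 r) => [h|[j jN [jr _ _]]].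
   by rewrite rfun0// lexx/= addr_ge0// mulr_ge0// ?mulr_ge0// exprn_ge0.
  rewrite (rfun_cell _ _ tauS jN jr) (gfun_cell tauS _ _ jN jr).
  rewrite mulr_ge0 ?invr_ge0 ?expR_ge0 ?exprn_ge0//=.
  have oj : (expR (c * (ugrid t s N.+1 j.+1 - t)))^-1 <= (om r)^-1.
   rewrite lef_pV2 ?posrE ?expR_gt0// ler_expR ler_pM2l// lerD2r. by case/andP: jr.
  have oj1 : (om r)^-1 <= 1 by rewrite invf_le1// om1.
  apply: le_trans (_ : (om r)^-1 * (2 ^+ 4 * (`|Phi' r w| ^+ 4 + `|Phi' r w - ival (e' j) w| ^+ 4)) <= _).
   apply: ler_pM; [by rewrite invr_ge0 expR_ge0|exact: exprn_ge0|exact: oj|].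
   apply: le_trans (exprDn_le _ _ _) => //; apply: lerXn2r; rewrite ?nnegrE ?addr_ge0//.
   by rewrite -{1}(subKr (Phi' r w) (ival (e' j) w)); exact: ler_normB.
  have n0 : 0 <= `|Phi' r w| ^+ 4 by exact: exprn_ge0.
  have n1 : 0 <= `|Phi' r w - ival (e' j) w| ^+ 4 by exact: exprn_ge0.
  move: (`|Phi' r w| ^+ 4) (`|Phi' r w - _| ^+ 4) (om r)^-1 n0 n1 om_inv0 oj1 => x y' o x0 y0 o0 o1.
  have -> : (2 : R) ^+ 4 = 16 by ring. by nra.
 apply: leeD; (apply: lee_wpmul2l; first by rewrite lee_fin ler0n); first exact: hZ.
 by apply: le_trans hd' _; rewrite lee_fin ge_min lexx.
(* The factor 32 of [ito_local] is compensated in advance, so that the errors are at most [2^-m] and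
   summable. *)
have dl0 m : 0 < 2^-1 ^+ m / 32 :> R by rewrite divr_gt0// exprn_gt0// invr_gt0.
have [D hD] := choice (fun m => main _ (dl0 m)).
have mGs : measT (\1_(G s) : Om -> R).
 by apply: measurable_indic; apply: (filt_meas HW sT); apply: FG; rewrite ts' lexx.
have eD m : eon P W t s (D m) by have [] := hD m.
have mI m : measT (eint W (D m) : Om -> borel H) by exact: (eint_meas HW dvH tsT).
have myI m : measT (fun w => \1_(G s) w * `|y w - eint W (D m) w| ^+ 2 : R).
 by apply: measurable_funM => //; exact: (sub_pow_meas HW dvH tsT).
have cv : {ae P, forall w, \1_(G s) w * `|y w - eint W (D m) w| ^+ 2 @[m --> \oo] --> (0 : R)}.
 apply: ae_cvg0; [exact: myI|by move=> m w; rewrite mulr_ge0// sqr_ge0|move=> m].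
 have iD := ito_lin HW dvH dch tsT (-1) (ito_elem HW dvH dch tsT (eD m)) hI.
 have := ito_local HW dvH dch tsT FG Gle Glc iD. under eq_integral do rewrite scaleN1r addrC.
 move=> /le_trans; apply; rewrite (_ : 2^-1 ^+ m = 32 * (2^-1 ^+ m / 32)); last by field.
 rewrite EFinM; apply: lee_wpmul2l; first by rewrite lee_fin ler0n.
 have [_ h _] := hD m; apply: le_trans h; apply: EI_le => r w _.
 rewrite mulr_ge0 ?sqr_ge0 ?gind_ge0//= scaleN1r addrC /Phi'.
 by case: (gind01 t G r w) => [->|[-> _]]; rewrite ?mul0r ?sqr_ge0// mul1r scale1r.
rewrite (_ : _ * U * _ = Kb); last by rewrite /Kb /Z -/(om s); ring.
apply: (@fatou_ae _ _ _ P (fun m w => \1_(G s) w * `|eint W (D m) w| ^+ 4)).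
- by move=> m; apply: measurable_funM => //; exact: borel_normX.
- by move=> m w; rewrite mulr_ge0// exprn_ge0.
- by apply: measurable_funM => //; exact: borel_normX.
- by move=> w; rewrite mulr_ge0// exprn_ge0.
- apply: ae_imp cv => w; rewrite indicE; case: (w \in G s) => /= h; last first.
  by apply: cvg_near_cst; near=> m; rewrite !mul0r.
 have h1 : `|y w - eint W (D m) w| @[m --> \oo] --> (0 : R).
  have := cvg_comp _ _ h (@sqrt_continuous R 0); rewrite sqrtr0.
  apply: cvg_trans; apply: near_eq_cvg; near=> m. by rewrite /= mul1r sqrtr_sqr normr_id.
 have h2 : eint W (D m) w @[m --> \oo] --> y w.
  have /norm_cvg0P h3 := h1.
  rewrite (_ : (fun m => eint W (D m) w) = fun m => y w - (y w - eint W (D m) w)).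
   by rewrite -[X in _ --> X]subr0; apply: cvgB; [exact: cvg_cst|exact: h3].
  by apply/funext => m; rewrite subKr.
 rewrite mul1r; under eq_fun do rewrite mul1r.
 exact: (cvg_comp _ _ (cvg_norm h2) (@exprn_continuous R 4 _)).
- move=> m; have [_ _ h] := hD m; apply: le_trans h; apply: le_int => // w _.
 rewrite lee_fin -[leRHS]mul1r; apply: ler_wpM2r; first exact: exprn_ge0.
 by rewrite indicE; case: (_ \in _).
Unshelve. all: by end_near. Qed.

End Local.
End L4.

(** * Continuous processes and limits in the sense of uniform convergence *)

Section Dyadic.
Variables (R : realType) (t T : R) (tT : t <= T).

Definition dg m k : R := ugrid t T (2 ^ m) k.

Definition dyadic (q : R) := exists m k, q = dg m k.

Lemma dg_bound m k : t <= dg m k <= T.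
Proof. by rewrite ugrid_t// ugrid_s// expn_gt0. Qed.

Lemma dgS m k : dg m k <= dg m k.+1.
Proof. exact: ugridS. Qed.

Lemma dg_lift m b k : dg (m + b) (k * 2 ^ b) = dg m k.
Proof.
rewrite /dg /ugrid expnD -minnMl !natrM invfM; congr (_ + _ * _).
by rewrite mulrACA divff ?mulr1// pnatr_eq0 -lt0n expn_gt0.
Qed.

Lemma dg_level q m : dyadic q -> exists b, exists2 k, (k <= 2 ^ (m + b))%N & q = dg (m + b) k.
Proof.
move=> [m' [k ->]]; exists m'; pose j := minn k (2 ^ m').
have -> : dg m' k = dg m' j by rewrite /dg /ugrid /j -minnA minnn.
exists (j * 2 ^ m)%N; last by rewrite addnC dg_lift.
by rewrite addnC expnD leq_mul2r geq_minr orbT.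
Qed.

Lemma dg_near s e : t <= s <= T -> 0 < e -> exists2 q, dyadic q & t <= q <= T /\ `|s - q| < e.
Proof.
move=> /andP[]; rewrite le_eqVlt => /predU1P[<- _ e0|ts sT e0].
 exists t; [by exists 0%N, 0%N; rewrite /dg ugrid0|by rewrite lexx subrr normr0].
have [|N0 hN] := @ugrid_dense _ _ _ tT (s - e) s _ (ltac:(by rewrite ltrBlDr ltrDl)).
 by rewrite ts.
have [||j jN /andP[h1 h2]] := hN (2 ^ N0)%N.
- by rewrite ltnW// ltn_expl.
- by rewrite expn_gt0.
exists (dg N0 j); [by exists N0, j|split; first exact: dg_bound].
rewrite gtr0_norm ?subr_gt0//; have : s - e < dg N0 j by [].
by lra.
Qed.

Lemma dyadic_le (V : normedModType R) (f : R -> V) (l : R) :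
 {within `[t, T], continuous f} -> (forall q, dyadic q -> `|f q| <= l) ->
 forall s, t <= s <= T -> `|f s| <= l.
Proof.
move=> cf hq s ts; apply/ler_addgt0Pr => e e0.
have /subspace_continuousP/(_ s) := cf; rewrite /= in_itv/= => /(_ ts).
move=> /cvgrPdist_lt/(_ _ e0); rewrite /prop_near1 /= => /nbhs_ballP[dl /= dl0 hd].
have [q dq [tq sq]] := dg_near ts dl0.
have := hd q sq; rewrite in_itv/= => /(_ tq) h.
rewrite -[f s](subrK (f q)); apply: le_trans (ler_normD _ _) _.
by rewrite addrC; apply: lerD; [exact: hq|exact: ltW].
Qed.

End Dyadic.

Section Processes.
Variables (R : realType) (Xi : hilbertType R) (V : completeNormedModType R)
 (d : measure_display) (Om : measurableType d) (P : probability Om R)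
 (W : R -> Xi -> Om -> R) (t T : R)
 (HW : reference_space P W t T)
 (v : nat -> V) (dv : dense_seq v)
 (tT : t <= T).
Local Notation dy := (dyadic t T).

(** On each cell the process is frozen at the left grid point, which is known in time; continuity
    gives convergence. The point [t] lies in no cell and has its own term. *)
Lemma continuous_prog (f : R -> Om -> V) :
 (forall s, t <= s <= T -> measT (f s : Gs P W t s -> borel V)) ->
 (forall w, {within `[t, T], continuous (fun s => f s w)}) -> progressive P W t T f.
Proof.
move=> af cf q /andP[tq qT].
pose h N (z : realM R * Gs P W t q) : V :=
 \sum_(k < N.+1) cell (ugrid t q N.+1) k z.1 *: f (ugrid t q N.+1 k) z.2 +
 \1_[set t] z.1 *: f t z.2.
have ub N k : t <= ugrid t q N.+1 k <= q by rewrite ugrid_t// ugrid_s.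
have maf s : t <= s <= q -> measurable_fun (`[t, q] `*` setT)
  ((fun z => f s z.2) : realM R * Gs P W t q -> borel V).
 move=> /andP[ts sq]; apply: measurable_funTS. have m1 : measT (f s : Gs P W t q -> borel V).
  by apply: (Gs_fun_mono sq); apply: af; rewrite ts (le_trans sq).
 exact: (measurableT_comp m1 measurable_snd).
apply: (@borel_cvg _ _ _ V v _ h) => //; first exact: stripG_meas.
 move=> N; apply: (borelD dv); first exact: stripG_meas.
  apply: (@borel_sum _ _ _ _ v _ _ (index_enum _) (fun (k : 'I_N.+1)
   (z : realM R * Gs P W t q) => cell (ugrid t q N.+1) k z.1 *: f (ugrid t q N.+1 k) z.2) dv).
   exact: stripG_meas.
  move=> k; apply: (borelZ dv); [exact: stripG_meas| |exact: maf].
  by apply: measurable_funTS; apply: measurableT_comp measurable_fst; exact: cell_meas.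
 apply: (borelZ dv); [exact: stripG_meas| |by apply: maf; rewrite lexx].
 apply: measurable_funTS; apply: measurableT_comp measurable_fst.
 by apply: measurable_indic; exact: measurable_set1.
move=> [r w] [/= + _]; rewrite in_itv/= => /andP[]; rewrite le_eqVlt => /predU1P[<- _|tr rq].
 apply: cvg_near_cst; near=> N; rewrite /h/= indicE mem_set// scale1r big1 ?add0r// => k _.
 by rewrite /cell ltNge; case/andP: (ub N k) => -> _; rewrite scale0r.
have trT : t <= r <= T by rewrite (ltW tr) (le_trans rq).
apply/cvgrPdist_lt => e e0.
have /subspace_continuousP/(_ r) := cf w; rewrite /= in_itv/= => /(_ trT).
move=> /cvgrPdist_lt/(_ _ e0); rewrite /prop_near1 /= => /nbhs_ballP[dl /= dl0 hd].
have [|N0 hN] := @ugrid_dense _ t q tq (r - dl) r _ (ltac:(by rewrite ltrBlDr ltrDl)).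
 by rewrite tr.
near=> N.
have [||j0 j0N /andP[g1 g2]] := hN N.+1 => //.
 by apply: leqW; near: N; exists N0.
have [j jN jr] : exists2 j, (j < N.+1)%N & ugrid t q N.+1 j < r <= ugrid t q N.+1 j.+1.
 by apply: cell_exists; rewrite ugrid0 ugridN// tr.
have tauS := ugridS tq N.+1.
have jj : ugrid t q N.+1 j0 <= ugrid t q N.+1 j.
 apply: (grid_mono tauS); rewrite leqNgt; apply/negP => h'; have /andP[_ h2] := jr.
 by have := lt_le_trans g2 (le_trans h2 (grid_mono tauS h')); rewrite ltxx.
have -> : h N (r, w) = f (ugrid t q N.+1 j) w.
 rewrite /h /= indicE memNset ?scale0r ?addr0; last by move=> /= rt; rewrite rt ltxx in tr.
 exact: (gfun_cell tauS (fun k => f (ugrid t q N.+1 k)) w jN jr).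
apply: hd.
 rewrite /ball /= gtr0_norm ?subr_gt0; last by case/andP: jr. by have := lt_le_trans g1 jj; lra.
by rewrite in_itv/=; case/andP: (ub N j) => -> hq; rewrite (le_trans hq).
Unshelve. all: by end_near. Qed.

(** For continuous paths this stands for the event that the supremum is at least [l]; restriction to
    dyadic times keeps it measurable. *)
Definition far (l : R) (X : R -> Om -> V) : set Om := [set w | exists2 q, dy q & l <= `|X q w|].

Lemma far_meas l X : (forall s, t <= s <= T -> measT (X s : Om -> borel V)) -> measurable (far l X).
Proof.
move=> mX; rewrite (_ : far l X = \bigcup_m \bigcup_k [set w | l <= `|X (dg t T m k) w|]).
 apply: bigcupT_measurable => m; apply: bigcupT_measurable => k.
 have := @borel_norm0 R _ Om V setT _ measurableT (mX _ (dg_bound tT m k)).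
 move=> /(_ measurableT `[l, +oo[%classic (measurable_itv _)); rewrite setTI.
 by congr measurable; apply/seteqP; split => w /=; rewrite in_itv/= andbT.
apply/seteqP; split => w; first by move=> [_ [m [k ->]] h]; exists m => //; exists k.
by move=> [m _ [k _ h]]; exists (dg t T m k) => //; exists m, k.
Qed.

(** Almost surely only finitely many of the events [E n] occur, so the paths converge uniformly at a
    geometric rate. *)
Lemma limit_process (X : nat -> R -> Om -> V) :
 (forall n s, t <= s <= T -> measT (X n s : Gs P W t s -> borel V)) ->
 (forall n, {ae P, forall w, {within `[t, T], continuous (fun s => X n s w)}}) ->
 (forall n, (P (far (2^-1 ^+ n) (fun s w => X n.+1 s w - X n s w)%R) <= (2^-1 ^+ n)%:E)%E) ->
 exists M : R -> Om -> V, [/\ progressive P W t T M,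
  forall w, {within `[t, T], continuous (fun s => M s w)} &
  {ae P, forall w, forall s, t <= s <= T -> X n s w @[n --> \oo] --> M s w}].
Proof.
move=> aX cX pX; pose E n := far (2^-1 ^+ n) (fun s w => X n.+1 s w - X n s w).
have mX n s : t <= s <= T -> measT (X n s : Om -> borel V).
 by move=> tsT; apply: (@Gs_fun _ _ _ _ _ _ _ _ HW s); [case/andP: tsT|exact: aX].
have mE n : measurable (E n).
 by apply: far_meas => s tsT; apply: (borelB dv) => //; exact: mX.
have bc : {ae P, forall w, \1_(E n) w @[n --> \oo] --> (0 : R)}.
 apply: ae_cvg0 => [n|n w|n]; [exact: measurable_indic|by []|].
 by rewrite integral_indic ?setIT//; exact: pX.
have cX' : {ae P, forall w, forall n, {within `[t, T], continuous (fun s => X n s w)}}.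
 by apply: ae_foralln.
have [N [mN N0 hN]] := ae_imp2 (fun w a b => conj a b) bc cX'.
have good w : ~ N w -> (\1_(E n) w @[n --> \oo] --> (0 : R)) /\
  forall n, {within `[t, T], continuous (fun s => X n s w)}.
 by move=> nN; apply: contrapT => h; apply: nN; exact: hN.
have step w : ~ N w -> exists n0, forall n s, (n0 <= n)%N -> t <= s <= T ->
  `|X n.+1 s w - X n s w| <= 2^-1 ^+ n.
 move=> /good[/cvgr0Pnorm_lt/(_ 1 ltr01) [n0 _ h] cw]. exists n0 => n s n0n tsT.
 apply: (@dyadic_le R t T tT V (fun s => X n.+1 s w - X n s w) _ _ _ s tsT).
  move=> x; apply: cvgB; exact: cw.
 move=> q dq; have := h n n0n; rewrite /= indicE; case: (boolP (w \in E n)) => /=.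
  by rewrite normr1 ltxx.
 by move=> /negP nE _; rewrite leNgt; apply/negP => /ltW ?; apply: nE; rewrite inE; exists q.
have tail w n0 : ~ N w -> (forall n s, (n0 <= n)%N -> t <= s <= T ->
  `|X n.+1 s w - X n s w| <= 2^-1 ^+ n) ->
  forall n m s, (n0 <= n)%N -> t <= s <= T -> `|X (n + m)%N s w - X n s w| <= 2 * 2^-1 ^+ n.
 move=> _ h n m s n0n tsT.
 suff : `|X (n + m)%N s w - X n s w| <= 2 * 2^-1 ^+ n - 2 * 2^-1 ^+ (n + m).
  by move=> /le_trans; apply; rewrite gerBl mulr_ge0// exprn_ge0// invr_ge0.
 elim: m => [|m IH]; first by rewrite addn0 !subrr normr0.
 rewrite addnS -[X (n + m).+1 s w](subrK (X (n + m)%N s w)) -addrA.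
 apply: le_trans (ler_normD _ _) _.
 apply: le_trans (lerD (h _ _ (leq_trans n0n (leq_addr _ _)) tsT) IH) _.
 by rewrite exprS le_eqVlt; apply/orP; left; apply/eqP; field.
have half0 : 2 * (2^-1 : R) ^+ n @[n --> \oo] --> (0 : R).
 rewrite -[X in _ --> X](mulr0 2); apply: cvgM; first exact: cvg_cst.
 by apply: cvg_expr; rewrite ger0_norm// invf_lt1// ltr1n.
have small e : 0 < e -> exists n1, forall n, (n1 <= n)%N -> 2 * (2^-1 : R) ^+ n < e.
 move=> e0; have /cvgr0Pnorm_lt/(_ e e0) [n1 _ hn1] := half0; exists n1 => n /hn1 /=.
 by rewrite ger0_norm// mulr_ge0// exprn_ge0// invr_ge0.
(* The limit is set to 0 on the null set [N]. This makes every path continuous, and it stays adapted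
   because the filtration contains the negligible sets. *)
pose M s w : V := if `[< N w >] then 0 else lim (X n s w @[n --> \oo]).
have cvM w s : ~ N w -> t <= s <= T -> X n s w @[n --> \oo] --> M s w.
 move=> nN tsT; rewrite /M; case: asboolP => // _; apply: cauchy_cvg.
 have [n0 h] := step _ nN; apply/cauchy_exP => e e0. have [n1 hn1] := small _ e0.
 exists (X (maxn n0 n1) s w); exists (maxn n0 n1) => // m /= hm.
 rewrite -ball_normE /= distrC -(subnKC hm).
 apply: le_lt_trans (tail w n0 nN h _ _ _ (leq_maxl _ _) tsT) _. exact: hn1 (leq_maxr n0 n1).
have unif w n0 : ~ N w -> (forall n s, (n0 <= n)%N -> t <= s <= T ->
  `|X n.+1 s w - X n s w| <= 2^-1 ^+ n) ->
  forall n s, (n0 <= n)%N -> t <= s <= T -> `|M s w - X n s w| <= 2 * 2^-1 ^+ n.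
 move=> nN h n s n0n tsT.
 have cv : `|X (n + m)%N s w - X n s w| @[m --> \oo] --> `|M s w - X n s w|.
  apply: cvg_norm; apply: cvgB; last exact: cvg_cst.
  have := cvM w s nN tsT; rewrite -(cvg_shiftn n). by under eq_fun do rewrite addnC.
 rewrite -(cvg_lim _ cv)//; apply: limr_le; first by apply/cvg_ex; eexists; exact: cv.
 by near=> m; exact: (tail w n0 nN h).
have cM w : {within `[t, T], continuous (fun s => M s w)}.
 have [Nw|nN] := pselect (N w).
  rewrite (_ : (fun s => M s w) = fun=> 0); first by move=> x; exact: cvg_cst.
  by apply/funext => s; rewrite /M asboolT.
 have [n0 h] := step _ nN; have [_ cXw] := good w nN.
 apply/subspace_continuousP => s ts; apply/cvgrPdist_lt => e e0.
 have tsT : t <= s <= T by move: ts; rewrite /= in_itv. have e3 : 0 < e / 3 by rewrite divr_gt0.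
 have [n1 hn1] := small _ e3.
 pose n := maxn n0 n1; have hn : 2 * (2^-1 : R) ^+ n < e / 3 := hn1 n (leq_maxr n0 n1).
 have /subspace_continuousP/(_ s ts)/cvgrPdist_lt/(_ _ e3) := cXw n.
 rewrite /prop_near1 /= => /nbhs_ballP[dl /= dl0 hd]. apply/nbhs_ballP; exists dl => // r /= sr tr.
 have trT : t <= r <= T by move: tr; rewrite /= in_itv.
 have a1 := unif w n0 nN h n s (leq_maxl _ _) tsT. have a2 := unif w n0 nN h n r (leq_maxl _ _) trT.
 have a3 := hd r sr tr.
 have -> : M s w - M r w = (M s w - X n s w) + (X n s w - X n r w) - (M r w - X n r w).
  by abel.
 apply: le_lt_trans (ler_normB _ _) _.
 by have := ler_normD (M s w - X n s w) (X n s w - X n r w); lra.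
exists M; split => //; last first.
 exists N; split => // w h; apply: contrapT => nN; apply: h => s tsT; exact: cvM.
apply: continuous_prog => // s tsT.
have sT : s <= T by case/andP: tsT.
have gN : (measurable : set (set (Gs P W t s))) N.
 by apply/measGs; apply: filt_negl; exists N; split.
pose h n w : V := \1_(~` N) w *: X n s w.
apply: (@borel_cvg _ _ (Gs P W t s) V v setT h) => //.
 move=> n; apply: (borelZ dv) => //; last exact: aX. by apply: measurable_indic; exact: measurableC.
move=> w _; have [Nw|nN] := pselect (N w).
 apply: cvg_near_cst; near=> n. by rewrite /h indicE memNset//= ?scale0r /M ?asboolT.
under eq_fun do rewrite /h indicE mem_set//= scale1r.
exact: cvM.
Unshelve. all: by end_near. Qed.

End Processes.

Lemma max0_lip R (s r : R) : `|Num.max s 0 - Num.max r 0| <= `|s - r|.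
Proof.
have h1 := ler_norm (s - r); have h2 := ler_norm (r - s); rewrite distrC in h2.
rewrite ler_norml; apply/andP.
by case: (leP s 0) => ?; case: (leP r 0) => ?; split; lra.
Qed.

Lemma min_lip R (a s r : R) : `|Num.min a s - Num.min a r| <= `|s - r|.
Proof.
have h1 := ler_norm (s - r); have h2 := ler_norm (r - s); rewrite distrC in h2.
rewrite ler_norml; apply/andP.
by case: (leP a s) => ?; case: (leP a r) => ?; split; lra.
Qed.

Lemma cvg_seq_sum R (T : Type) (F : set_system T) (FF : Filter F)
  (V : normedModType R) (J : eqType) (l : seq J) (f : J -> T -> V) (a : J -> V) :
 (forall j, j \in l -> f j x @[x --> F] --> a j) ->
 \sum_(j <- l) f j x @[x --> F] --> \sum_(j <- l) a j.
Proof.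
elim: l => [|j l IH] h.
 by rewrite big_nil; under eq_fun do rewrite big_nil; exact: cvg_cst.
rewrite big_cons; under eq_fun do rewrite big_cons.
apply: cvgD; first by apply: h; rewrite inE eqxx.
by apply: IH => i il; apply: h; rewrite inE il orbT.
Qed.

(** * Convolutions with the semigroup, for an abstract integrator *)

Section Convolution.
Variables (R : realType) (H : hilbertType R) (V : normedModType R) (I : eqType)
 (d : measure_display) (Om : measurableType d)
 (S : R -> bounded_op H H) (hS : contraction_semigroup S)
 (U : R -> V -> V) (atom : I -> H -> V) (B : R -> I -> Om -> R)
 (U0 : forall x, U 0 x = x)
 (Uadd : forall s r x, 0 <= s -> 0 <= r -> U (s + r) x = U s (U r x))
 (UD : forall s x y, U s (x + y) = U s x + U s y)
 (UZ : forall s k x, U s (k *: x) = k *: U s x)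
 (Uc : forall s x, 0 <= s -> `|U s x| <= `|x|)
 (Ur : forall x e, 0 < e -> exists2 dl, 0 < dl & forall s, 0 <= s < dl -> `|U s x - x| < e)
 (Uatom : forall s i h, U s (atom i h) = atom i (S s h))
 (atomZ : forall k i h, atom i (k *: h) = k *: atom i h).
Implicit Types (e : seq (set Om * I * H)) (E : nat -> seq (set Om * I * H)).

Definition einc s r e w : H := \sum_(x <- e) (\1_(x.1.1) w * (B r x.1.2 w - B s x.1.2 w)) *: x.2.

Definition eval e w : V := \sum_(x <- e) \1_(x.1.1) w *: atom x.1.2 x.2.

(** [B] will be the Wiener process or time itself. Cells after [s] contribute zero increments, since
    both ends are cut at [s]; the outer maximum only keeps the argument of [S] nonnegative. *)
Definition conv (tau : nat -> R) N E s w : H := \sum_(k < N)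
 S (Num.max (s - tau k) 0) (einc (Num.min (tau k) s) (Num.min (tau k.+1) s) (E k) w).

(** On each cell the integrand is carried along by the semigroup rather than kept constant. Since
    [S (s - tau k) = S (s - r) S (r - tau k)], the sum [conv] is then exactly the convolution of
    [gfunU], at every [s] at once. *)
Definition gfunU (tau : nat -> R) N E r w : V :=
 \sum_(k < N) cell tau k r *: U (r - tau k) (eval (E k) w).

Definition shift q e : seq (set Om * I * H) := [seq (x.1, S q x.2) | x <- e].

Definition escale k e : seq (set Om * I * H) := [seq (x.1, k *: x.2) | x <- e].

Lemma Usum s (J : Type) (l : seq J) (F : J -> V) :
 U s (\sum_(j <- l) F j) = \sum_(j <- l) U s (F j).
Proof.
elim: l => [|j l IH]; last by rewrite !big_cons UD IH.
by rewrite !big_nil -(scale0r 0) UZ !scale0r.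
Qed.

Lemma Ssum s (J : Type) (l : seq J) (F : J -> H) :
 S s (\sum_(j <- l) F j) = \sum_(j <- l) S s (F j).
Proof. exact: linear_sum. Qed.

Lemma UB s x y : U s (x - y) = U s x - U s y.
Proof. by rewrite -scaleN1r UD UZ scaleN1r. Qed.

Lemma shift_val q e w : eval (shift q e) w = U q (eval e w).
Proof.
rewrite /eval /shift big_map Usum; apply: eq_bigr => x _ /=.
by rewrite UZ Uatom.
Qed.

Lemma shift_inc q e s r w : einc s r (shift q e) w = S q (einc s r e w).
Proof.
rewrite /einc /shift big_map Ssum; apply: eq_bigr => x _ /=.
by rewrite linearZ.
Qed.

Lemma escale_val k e w : eval (escale k e) w = k *: eval e w.
Proof.
rewrite /eval /escale big_map scaler_sumr; apply: eq_bigr => x _ /=.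
by rewrite atomZ !scalerA mulrC.
Qed.

Lemma escale_inc k e s r w : einc s r (escale k e) w = k *: einc s r e w.
Proof.
rewrite /einc /escale big_map scaler_sumr; apply: eq_bigr => x _ /=.
by rewrite !scalerA mulrC.
Qed.

Lemma ecat_val e e' w : eval (e ++ e') w = eval e w + eval e' w.
Proof. by rewrite /eval big_cat. Qed.

Lemma ecat_inc e e' s r w : einc s r (e ++ e') w = einc s r e w + einc s r e' w.
Proof. by rewrite /einc big_cat. Qed.

Lemma einc_refl s e w : einc s s e w = 0.
Proof. by rewrite /einc big1// => x _; rewrite subrr mulr0 scale0r. Qed.

Lemma einc_add s r q e w : einc s r e w + einc r q e w = einc s q e w.
Proof.
rewrite /einc -big_split /=; apply: eq_bigr => x _.
by rewrite -scalerDl -mulrDr; congr (_ * _ *: _); rewrite addrC addrA subrK.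
Qed.

Lemma conv_lin tau N E E' k s w :
 conv tau N (fun j => escale k (E j) ++ E' j) s w = k *: conv tau N E s w + conv tau N E' s w.
Proof.
rewrite /conv scaler_sumr -big_split /=; apply: eq_bigr => j _.
by rewrite ecat_inc escale_inc linearP.
Qed.

Lemma gfunU_lin tau N E E' k r w :
 gfunU tau N (fun j => escale k (E j) ++ E' j) r w = k *: gfunU tau N E r w + gfunU tau N E' r w.
Proof.
rewrite /gfunU scaler_sumr -big_split /=; apply: eq_bigr => j _.
by rewrite ecat_val escale_val UD UZ scalerDr !scalerA mulrC.
Qed.

Lemma gfunU_cell tau N E r w j : (forall k, tau k <= tau k.+1) -> (j < N)%N ->
 tau j < r <= tau j.+1 -> gfunU tau N E r w = U (r - tau j) (eval (E j) w).
Proof. by move=> h; exact: (@gfun_cell R tau h V N Om (fun k w => U (r - tau k) (eval (E k) w))). Qed.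

Lemma gfunU0 tau N E r w : (forall k, (k < N)%N -> cell tau k r = 0) -> gfunU tau N E r w = 0.
Proof. exact: (@gfun0 R tau V N Om (fun k w => U (r - tau k) (eval (E k) w))). Qed.

Section Lift.
Variables (tau sig : nat -> R) (N K : nat) (E : nat -> seq (set Om * I * H))
 (K0 : (0 < K)%N) (sigS : forall k, sig k <= sig k.+1)
 (sigK : forall k, sig (k * K)%N = tau k).

(** Passage to a finer grid: a fine cell receives the data of its coarse cell, advanced by the
    semigroup to the start of the fine cell. Neither [conv] nor [gfunU] changes. *)
Definition lift j : seq (set Om * I * H) := shift (sig j - tau (j %/ K)) (E (j %/ K)).

Let tauS k : tau k <= tau k.+1.
Proof. by rewrite -!sigK; apply: (grid_mono sigS); rewrite leq_mul2r leqnSn orbT. Qed.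

Lemma lift_cell j r : sig j < r <= sig j.+1 -> tau (j %/ K) < r <= tau (j %/ K).+1.
Proof.
move=> /andP[h1 h2]; rewrite -!sigK; apply/andP; split.
 by apply: le_lt_trans h1; apply: (grid_mono sigS); exact: leq_trunc_div.
by apply: le_trans h2 _; apply: (grid_mono sigS); exact: ltn_ceil.
Qed.

Lemma lift_ge j : tau (j %/ K) <= sig j.
Proof. by rewrite -sigK; apply: (grid_mono sigS); exact: leq_trunc_div. Qed.

Lemma lift_gfunU r w : gfunU sig (N * K) lift r w = gfunU tau N E r w.
Proof.
have dv j : (j < N * K)%N -> (j %/ K < N)%N by move=> h; rewrite ltn_divLR.
case: (cellP sigS (N * K) r) => [h|[j jN [jr _ _]]].
 rewrite gfunU0//; case: (cellP tauS N r) => [h'|[i iN [ir _ _]]]; first by rewrite gfunU0.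
 have [|j jN jr] := @cell_exists _ sig (N * K) r.
  rewrite -(mul0n K) !sigK; case/andP: ir => i1 i2; apply/andP; split.
   by apply: le_lt_trans i1; exact: (grid_mono tauS).
  by apply: le_trans i2 _; exact: (grid_mono tauS).
 by have := h j jN; rewrite /cell jr => /eqP; rewrite oner_eq0.
rewrite (gfunU_cell _ _ sigS jN jr) (gfunU_cell _ _ tauS (dv _ jN) (lift_cell jr)).
rewrite shift_val -Uadd; last 2 first.
- by rewrite subr_ge0 ltW//; case/andP: jr.
- by rewrite subr_ge0; exact: lift_ge.
by rewrite addrA subrK.
Qed.

Lemma lift_sum (F : nat -> H) : \sum_(j < N * K) F j = \sum_(k < N) \sum_(i < K) F (k * K + i)%N.
Proof.
elim: N => [|n IH]; first by rewrite mul0n !big_ord0.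
rewrite mulSnr big_ord_recr /= -IH.
rewrite -(big_mkord xpredT F) (@big_cat_nat _ _ _ (n * K)%N) ?leq_addr//= big_mkord.
congr (_ + _); rewrite -{1}[(n * K)%N]add0n big_addn addKn big_mkord.
by apply: eq_bigr => i _; rewrite addnC.
Qed.

Lemma lift_conv s w : conv sig (N * K) lift s w = conv tau N E s w.
Proof.
rewrite /conv (lift_sum (fun j => S (Num.max (s - sig j) 0)
 (einc (Num.min (sig j) s) (Num.min (sig j.+1) s) (lift j) w))); apply: eq_bigr => k _.
have E1 (i : 'I_K) : lift (k * K + i)%N = shift (sig (k * K + i)%N - tau k) (E k).
 by rewrite /lift divnMDl// divn_small// addn0.
transitivity (\sum_(i < K) S (Num.max (s - tau k) 0)
  (einc (Num.min (sig (k * K + i)%N) s) (Num.min (sig (k * K + i).+1) s) (E k) w)).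
 apply: eq_bigr => i _; rewrite E1 shift_inc; set q := sig (k * K + i)%N.
 have qk : tau k <= q by rewrite -sigK; apply: (grid_mono sigS); exact: leq_addr.
 have [sq|qs] := leP s q.
  rewrite (min_idPr (le_trans sq (sigS _))) einc_refl; by rewrite !linear0.
 rewrite !max_l ?subr_ge0 ?(ltW qs)//; last by rewrite (le_trans qk)// ltW.
 rewrite -(sg_add hS) ?subr_ge0 ?(ltW qs)//; congr (S _ _). by rewrite addrA subrK.
rewrite -linear_sum; congr (S _ _).
suff h n : (n <= K)%N -> \sum_(i < n)
  einc (Num.min (sig (k * K + i)%N) s) (Num.min (sig (k * K + i).+1) s) (E k) w =
  einc (Num.min (sig (k * K)%N) s) (Num.min (sig (k * K + n)%N) s) (E k) w.
 by rewrite h// -mulSnr !sigK.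
elim: n => [|n IH] nK; first by rewrite big_ord0 addn0 einc_refl.
by rewrite big_ord_recr /= IH ?(ltnW nK)// einc_add addnS.
Qed.

End Lift.

Lemma conv_start tau N E w : (forall k, tau k <= tau k.+1) -> conv tau N E (tau 0%N) w = 0.
Proof.
move=> tauS; rewrite /conv big1// => k _.
by rewrite !(min_idPr _) ?einc_refl ?linear0// (grid_mono tauS).
Qed.

(** The values of the convolution at grid points form a chain whose contractions are semigroup
    steps; the maximal inequality for chains therefore applies to convolutions. *)
Lemma conv_step tau N E j w : (forall k, tau k <= tau k.+1) -> (j < N)%N ->
 conv tau N E (tau j.+1) w =
 S (tau j.+1 - tau j) (conv tau N E (tau j) w + einc (tau j) (tau j.+1) (E j) w).
Proof.
move=> tauS jN; rewrite linearD /= /conv Ssum (bigD1 (Ordinal jN))//=.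
rewrite [X in _ = X + _](bigD1 (Ordinal jN))//=.
rewrite !minxx (min_idPl (tauS j)) max_l ?subr_ge0// (min_idPr (tauS j)) einc_refl.
rewrite [X in _ = X + _ + _](_ : _ = 0) ?add0r; last by rewrite !linear0.
rewrite [RHS]addrC; congr (_ + _); apply: eq_bigr => k kj.
have {}kj : (k : nat) != j by apply: contra kj => /eqP kj; apply/eqP/val_inj.
move: kj; rewrite neq_lt => /orP[kj|jk].
 have h1 : tau k.+1 <= tau j := grid_mono tauS kj. have h0 : tau k <= tau j := le_trans (tauS k) h1.
 have hj : tau k <= tau j.+1 := le_trans h0 (tauS j).
 rewrite (min_idPl hj) (min_idPl (le_trans h1 (tauS j))) (min_idPl h0) (min_idPl h1).
 rewrite !max_l ?subr_ge0// -(sg_add hS) ?subr_ge0//. by congr (S _ _); rewrite addrA subrK.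
have h1 : tau j.+1 <= tau k := grid_mono tauS jk.
have h2 := le_trans h1 (tauS k).
rewrite (min_idPr h1) (min_idPr h2) einc_refl.
rewrite (min_idPr (le_trans (tauS j) h1)) (min_idPr (le_trans (tauS j) h2)) einc_refl.
by rewrite !linear0.
Qed.

Lemma S_orbit_cont h : continuous (fun s : R => S (Num.max s 0) h).
Proof.
move=> s; apply/cvgrPdist_lt => e e0.
have [dl dl0 hd] := sg_right hS h e0.
apply/nbhs_ballP; exists dl => //= r; rewrite /ball /= => sr.
have p0 (x : R) : 0 <= Num.max x 0 by rewrite le_max lexx orbT.
apply: le_lt_trans (@semigroup_dist R H (fun q x => S q x) (sg_add hS)
 (fun q x y => linearB (S q) x y) (sg_contr hS) _ _ h h (p0 s) (p0 r)) _.
rewrite subrr normr0 addr0; apply: hd; rewrite normr_ge0/=; apply: le_lt_trans sr.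
exact: max0_lip.
Qed.

Lemma conv_cont tau N E (t T : R) w : (forall k, t <= tau k <= T) ->
 (forall k x, x \in E k -> {within `[t, T], continuous (fun s => B s x.1.2 w)}) ->
 {within `[t, T], continuous (fun s => conv tau N E s w)}.
Proof.
move=> tb cB; rewrite (_ : (fun s => _) = fun s => \sum_(k < N) \sum_(x <- E k)
  (\1_(x.1.1) w * (B (Num.min (tau k.+1) s) x.1.2 w - B (Num.min (tau k) s) x.1.2 w)) *:
   S (Num.max (s - tau k) 0) x.2); last first.
 apply/funext => s; apply: eq_bigr => k _; rewrite /einc Ssum.
 by apply: eq_bigr => x _; rewrite linearZ.
have cmin k x : x \in E k -> forall j,
  {within `[t, T], continuous (fun s => B (Num.min (tau j) s) x.1.2 w)}.
 move=> xE j; apply/subspace_continuousP => s ts; apply/cvgrPdist_lt => e e0.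
 have tsT : t <= s <= T by move: ts; rewrite /= in_itv.
 have /andP[b1 b2] := tb j; have /andP[b3 b4] := tsT.
 have hm r : t <= r <= T -> `[t, T]%classic (Num.min (tau j) r).
  move=> /andP[r1 r2]; rewrite /= in_itv/= le_min b1 r1/= ge_min b2. by [].
 have /subspace_continuousP/(_ _ (hm s tsT))/cvgrPdist_lt/(_ _ e0) := cB k x xE.
 rewrite /prop_near1 /= => /nbhs_ballP[dl /= dl0 hd].
 apply/nbhs_ballP; exists dl => //= r; rewrite /ball /= => sr tr.
 apply: hd; last by apply: hm; move: tr; rewrite /= in_itv. rewrite /ball /=; apply: le_lt_trans sr.
 exact: min_lip.
move=> s; apply: cvg_seq_sum => k _; apply: cvg_seq_sum => x xE.
apply: cvgZ.
 apply: cvgM; first exact: cvg_cst. by apply: cvgB; apply: (cmin k x xE).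
have cS : continuous (fun s : R => S (Num.max (s - tau k) 0) x.2).
 move=> r; apply: (@continuous_comp _ _ _ (fun s => s - tau k) (fun s => S (Num.max s 0) x.2)).
  by apply: cvgB; [exact: cvg_id|exact: cvg_cst].
 exact: S_orbit_cont.
exact: (continuous_subspaceT cS).
Qed.

End Convolution.

Lemma borel_cont R (V : normedModType R) (f : R -> V) : continuous f ->
 measT (f : realM R -> borel V).
Proof.
move=> /continuousP cf; apply: (@measurability _ _ _ (borel V) setT _ (@open V)) => //.
by move=> _ [A oA <-]; rewrite setTI; apply: open_measurable; exact: cf.
Qed.

Lemma EI_point R d (Om : measurableType d) (P : probability Om R) (t : R)
  (f : R -> Om -> R) : EI P t t f = 0%E.
Proof.
rewrite /EI -(integral0 P setT); apply: eq_integral => w _.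
by rewrite set_itv1 integral_set1.
Qed.

(** * Maximal inequality and existence of convolutions *)

Section Integrator.
Variables (R : realType) (Xi H : hilbertType R) (V : normedModType R) (I : eqType)
 (d : measure_display) (Om : measurableType d) (P : probability Om R)
 (W : R -> Xi -> Om -> R) (t T : R)
 (HW : reference_space P W t T)
 (tT : t <= T)
 (S : R -> bounded_op H H) (hS : contraction_semigroup S)
 (U : R -> V -> V) (atom : I -> H -> V) (B : R -> I -> Om -> R)
 (U0 : forall x, U 0 x = x)
 (Uadd : forall s r x, 0 <= s -> 0 <= r -> U (s + r) x = U s (U r x))
 (UD : forall s x y, U s (x + y) = U s x + U s y)
 (UZ : forall s k x, U s (k *: x) = k *: U s x)
 (Uc : forall s x, 0 <= s -> `|U s x| <= `|x|)
 (Ur : forall x e, 0 < e -> exists2 dl, 0 < dl & forall s, 0 <= s < dl -> `|U s x - x| < e)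
 (Uatom : forall s i h, U s (atom i h) = atom i (S s h))
 (atomZ : forall k i h, atom i (k *: h) = k *: atom i h)
 (vH : nat -> H) (dvH : dense_seq vH)
 (vl : nat -> seq (I * H))
 (dv : dense_seq (fun n => \sum_(x <- vl n) atom x.1 x.2))
 (aB : forall s i, t <= s <= T -> measT (B s i : Gs P W t s -> R))
 (cB : forall i, {ae P, forall w, {within `[t, T], continuous (fun s => B s i w)}}).
Local Notation conv m := (conv S B (dg t T m) (2 ^ m)).
Local Notation gfunU m := (gfunU U atom (dg t T m) (2 ^ m)).
Local Notation eval := (eval atom).
Local Notation lift m b := (lift S (dg t T m) (dg t T (m + b)) (2 ^ b)).
Implicit Types (e : seq (set Om * I * H)) (E : nat -> seq (set Om * I * H)).

Definition evs r e := forall x, x \in e -> filt P W t r x.1.1.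

Definition lev m E := forall k, evs (dg t T m k) (E k).
Variables (Kmax : R) (Kmax0 : 0 <= Kmax) (Hmax : forall m E (l : R), lev m E -> 0 < l ->
 ((l ^+ 2)%:E * P [set w | exists2 i, (i <= 2 ^ m)%N & (l <= `|conv m E (dg t T m i) w|)%R] <=
  Kmax%:E * \sum_(k < 2 ^ m) (dg t T m k.+1 - dg t T m k)%:E * \int[P]_w (`|eval (E k) w| ^+ 2)%:E)%E).

Let dS m k : dg t T m k <= dg t T m k.+1. Proof. exact: dgS. Qed.
Let db m k : t <= dg t T m k <= T. Proof. exact: dg_bound. Qed.

Lemma lift_lev m b E : lev m E -> lev (m + b) (lift m b E).
Proof.
move=> hE j _ /mapP[x xE ->] /=; apply: (@filt_mono _ _ _ _ _ _ _ (dg t T m (j %/ 2 ^ b))).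
 by apply: lift_ge => [k|k]; [exact: dS|exact: dg_lift].
exact: hE xE.
Qed.

Lemma conv_lift m b E : conv (m + b) (lift m b E) = conv m E.
Proof.
apply/funext => s; apply/funext => w; rewrite expnD.
by apply: lift_conv => [|||k]; rewrite ?expn_gt0 ?dg_lift.
Qed.

Lemma gfunU_lift m b E : gfunU (m + b) (lift m b E) = gfunU m E.
Proof.
apply/funext => s; apply/funext => w; rewrite expnD.
by apply: lift_gfunU => // [|k]; rewrite ?expn_gt0 ?dg_lift.
Qed.

Lemma lev_lin m E E' k : lev m E -> lev m E' -> lev m (fun j => escale k (E j) ++ E' j).
Proof.
move=> h h' j x; rewrite mem_cat => /orP[/mapP[y yE ->]|]; last exact: h'.
exact: h yE.
Qed.

Lemma eval_meas r e : r <= T -> evs r e -> measT (eval e : Gs P W t r -> borel V).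
Proof.
move=> rT; elim: e => [|i e IH] he.
 rewrite (_ : eval _ = fun=> 0); first exact: mcst.
 by apply/funext => w; rewrite /eval big_nil.
rewrite (_ : eval _ = fun w => \1_(i.1.1) w *: atom i.1.2 i.2 + eval e w); last first.
 by apply/funext => w; rewrite /eval big_cons.
apply: (@borelD R _ (Gs P W t r) V _ _ _ _ dv) => //; last first.
 by apply: IH => j je; apply: he; rewrite inE je orbT.
apply: (@borelZ R _ (Gs P W t r) V _ _ _ _ dv) => //.
by apply: measurable_indic; apply/measGs; apply: he; rewrite inE eqxx.
Qed.

Lemma einc_adapted s r q e : t <= s -> s <= r -> r <= q -> q <= T -> evs s e ->
 measT (einc B s r e : Gs P W t q -> borel H).
Proof.
move=> ts sr rq qT; elim: e => [|i e IH] he.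
 rewrite (_ : einc B s r _ = fun=> 0); first exact: mcst.
 by apply/funext => w; rewrite /einc big_nil.
rewrite (_ : einc B s r _ = fun w => (\1_(i.1.1) w * (B r i.1.2 w - B s i.1.2 w)) *: i.2 +
 einc B s r e w); last by apply/funext => w; rewrite /einc big_cons.
apply: (@borelD R _ (Gs P W t q) H _ _ _ _ dvH) => //; last first.
 by apply: IH => j je; apply: he; rewrite inE je orbT.
apply: (@borelZ R _ (Gs P W t q) H _ _ _ _ dvH) => //.
apply: measurable_funM.
 apply: measurable_indic; apply/measGs; apply: (filt_mono (le_trans sr rq)).
 by apply: he; rewrite inE eqxx.
apply: measurable_funB.
 by apply: (Gs_fun_mono rq); apply: aB; rewrite (le_trans ts sr) (le_trans rq).
apply: (Gs_fun_mono (le_trans sr rq)); apply: aB; rewrite ts.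
by rewrite (le_trans sr)// (le_trans rq).
Qed.

Lemma conv_adapted m E s : lev m E -> t <= s <= T -> measT (conv m E s : Gs P W t s -> borel H).
Proof.
move=> hE /andP[ts sT].
apply: (@borel_sum _ _ (Gs P W t s) H vH _ _ (index_enum _) (fun (k : 'I_(2 ^ m)) w =>
 S (Num.max (s - dg t T m k) 0) (einc B (Num.min (dg t T m k) s) (Num.min (dg t T m k.+1) s) (E k) w))) => //.
move=> k; have cS : continuous (S (Num.max (s - dg t T m k) 0)) by exact: bounded_op_continuous.
have mS : measT (S (Num.max (s - dg t T m k) 0) : borel H -> borel H).
 move/continuousP: cS => cS. apply: (@measurability _ _ _ (borel H) setT _ (@open H)) => //.
 by move=> _ [A oA <-]; rewrite setTI; apply: sub_sigma_algebra; exact: cS.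
apply: (measurableT_comp mS).
have [ks|sk] := leP (dg t T m k) s.
 apply: (@einc_adapted (dg t T m k) (Num.min (dg t T m k.+1) s) s (E k)) => //.
 - by case/andP: (db m k).
 - by rewrite le_min ks dS.
 - by rewrite ge_min lexx orbT.
rewrite (min_idPr (le_trans (ltW sk) (dS m k))).
rewrite (_ : einc _ _ _ _ = fun=> 0); first exact: mcst.
by apply/funext => w; exact: einc_refl.
Qed.

Lemma conv_meas m E s : lev m E -> t <= s <= T -> measT (conv m E s : Om -> borel H).
Proof.
by move=> hE tsT; apply: (@Gs_fun _ _ _ _ _ _ _ _ HW s); [case/andP: tsT|exact: conv_adapted].
Qed.

Lemma conv_ae_cont m E : {ae P, forall w, {within `[t, T], continuous (fun s => conv m E s w)}}.
Proof.
have h : {ae P, forall w, forall k n, {within `[t, T], continuous (fun s =>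
  if onth (E k) n is Some x then B s x.1.2 w else 0)}}.
 apply: ae_foralln => k; apply: ae_foralln => n. case: (onth (E k) n) => [x|]; first exact: cB.
 by apply: aeW => w s; exact: cvg_cst.
apply: ae_imp h => w h; apply: (conv_cont hS) => // k x xE.
have := h k (index x (E k)).
by rewrite onthE (nth_map x) ?index_mem// nth_index.
Qed.

Lemma U_orbit x : continuous (fun s : R => U (Num.max s 0) x).
Proof.
move=> s; apply/cvgrPdist_lt => e e0; have [dl dl0 hd] := Ur x e0.
apply/nbhs_ballP; exists dl => //= r; rewrite /ball /= => sr.
have p0 (y : R) : 0 <= Num.max y 0 by rewrite le_max lexx orbT.
apply: le_lt_trans (@semigroup_dist R V U Uadd (UB UD UZ) Uc _ _ x x (p0 s) (p0 r)) _.
rewrite subrr normr0 addr0; apply: hd; rewrite normr_ge0/=; apply: le_lt_trans sr.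
exact: max0_lip.
Qed.

Lemma gfunU_prog m E : lev m E -> progressive P W t T (gfunU m E).
Proof.
move=> hE q /andP[tq qT].
have -> : (fun z => gfunU m E z.1 z.2 : borel V) = fun z => \sum_(k < 2 ^ m)
  cell (dg t T m) k z.1 *: \sum_(x <- E k) (cell (dg t T m) k z.1 * \1_(x.1.1) z.2) *:
   U (Num.max (z.1 - dg t T m k) 0) (atom x.1.2 x.2).
 apply/funext => -[r w] /=; apply: eq_bigr => k _; rewrite /cell.
 case: (boolP (dg t T m k < r <= dg t T m k.+1)) => [/andP[h1 _]|_]; last by rewrite !scale0r.
 rewrite max_l ?subr_ge0 ?ltW// /eval (Usum UD UZ); congr (_ *: _).
 by apply: eq_bigr => x _; rewrite UZ mul1r.
apply: (@borel_sum _ _ _ _ _ _ _ (index_enum _) (fun (k : 'I_(2 ^ m))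
 (z : realM R * Gs P W t q) => cell (dg t T m) k z.1 *: \sum_(x <- E k)
  (cell (dg t T m) k z.1 * \1_(x.1.1) z.2) *:
   U (Num.max (z.1 - dg t T m k) 0) (atom x.1.2 x.2)) dv).
 exact: stripG_meas.
move=> k; have mc : measurable_fun (`[t, q] `*` setT)
  (fun z : realM R * Gs P W t q => cell (dg t T m) k z.1).
 by apply: measurable_funTS; apply: measurableT_comp measurable_fst; exact: cell_meas.
apply: (borelZ dv); [exact: stripG_meas|exact: mc|].
elim: (E k) (hE k) => [|x e IH] he.
 rewrite (_ : (fun z => _) = fun=> 0); first exact: mcst.
 by apply/funext => z; rewrite big_nil.
rewrite (_ : (fun z => _) = fun z : realM R * Gs P W t q =>
 (cell (dg t T m) k z.1 * \1_(x.1.1) z.2) *: U (Num.max (z.1 - dg t T m k) 0) (atom x.1.2 x.2) +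
 \sum_(x <- e) (cell (dg t T m) k z.1 * \1_(x.1.1) z.2) *:
   U (Num.max (z.1 - dg t T m k) 0) (atom x.1.2 x.2)); last first.
 by apply/funext => z; rewrite big_cons.
apply: (borelD dv); first exact: stripG_meas; last first.
 by apply: IH => y yE; apply: he; rewrite inE yE orbT.
apply: (borelZ dv); first exact: stripG_meas.
 have [kq|qk] := leP (dg t T m k) q.
  apply: measurable_funM => //; apply: measurable_funTS.
  apply: measurableT_comp measurable_snd; apply: measurable_indic.
  apply/measGs; apply: (@filt_mono _ _ _ _ _ _ _ _ _ _ kq). by apply: he; rewrite inE eqxx.
 have m0 : measurable_fun (`[t, q] `*` setT)
  (fun _ : realM R * Gs P W t q => 0 : R) by exact: mcst.
 move: m0; apply: eq_measurable_fun => z /set_mem[/= + _]; rewrite in_itv => /andP[_ zq].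
 by rewrite /cell ltNge (le_trans zq (ltW qk)) mul0r.
apply: measurable_funTS.
have mU : measT ((fun r => U (Num.max (r - dg t T m k) 0) (atom x.1.2 x.2)) : realM R -> borel V).
 apply: borel_cont => r.
 apply: (@continuous_comp _ _ _ (fun s => s - dg t T m k) (fun s => U (Num.max s 0) (atom x.1.2 x.2))).
  by apply: cvgB; [exact: cvg_id|exact: cvg_cst].
 exact: U_orbit.
exact: (measurableT_comp mU measurable_fst).
Qed.

Let tTT : t <= T <= T. Proof. by rewrite tT lexx. Qed.

Lemma gfunU_pmeas m E : lev m E -> pmeas t T (fun r w => `|gfunU m E r w| ^+ 2).
Proof. by move=> hE; apply: (prog_pow HW 2 tTT); exact: gfunU_prog. Qed.

Lemma sub_gfunU_pmeas Phi m E : progressive P W t T Phi -> lev m E ->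
 pmeas t T (fun r w => `|Phi r w - gfunU m E r w| ^+ 2).
Proof.
move=> pP hE; apply: (prog_pow HW 2 tTT); apply: (progB dv) => //; exact: gfunU_prog.
Qed.

Lemma eval_osc e eps : 0 < eps -> exists2 dl, 0 < dl &
 forall q w, 0 <= q < dl -> `|U q (eval e w) - eval e w| <= eps.
Proof.
move=> e0; elim: e eps e0 => [|x e IH] eps e0.
 exists 1 => // q w _; rewrite /eval big_nil.
 have -> : U q 0 = 0 by rewrite -(scale0r 0) UZ !scale0r. by rewrite subrr normr0 ltW.
have e2 : 0 < eps / 2 by rewrite divr_gt0.
have [d1 d10 h1] := IH _ e2; have [d2 d20 h2] := Ur (atom x.1.2 x.2) e2.
exists (Num.min d1 d2); first by rewrite lt_min d10.
move=> q w /andP[q0]; rewrite lt_min => /andP[q1 q2].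
rewrite /eval big_cons UD UZ -/(eval e w).
have -> : forall a b c d' : V, a + b - (c + d') = (a - c) + (b - d') by move=> *; abel.
apply: le_trans (ler_normD _ _) _; rewrite [leRHS]splitr; apply: lerD; last by apply: h1; rewrite q0.
rewrite -scalerBr normrZ; apply: le_trans (ltW (h2 q _)); last by rewrite q0.
rewrite -[leRHS]mul1r; apply: ler_wpM2r => //.
by rewrite indicE; case: (_ \in _); rewrite ?normr1 ?normr0.
Qed.

Lemma eval_osc_all N E eps : 0 < eps -> exists2 dl, 0 < dl &
 forall k q w, (k < N)%N -> 0 <= q < dl -> `|U q (eval (E k) w) - eval (E k) w| <= eps.
Proof.
move=> e0; elim: N => [|N [d1 d10 h1]]; first by exists 1.
have [d2 d20 h2] := eval_osc (E N) e0.
exists (Num.min d1 d2); first by rewrite lt_min d10.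
move=> k q w; rewrite ltnS leq_eqVlt lt_min => /orP[/eqP ->|kN] /and3P[q0 q1 q2].
 by apply: h2; rewrite q0.
by apply: h1 => //; rewrite q0.
Qed.

Lemma dg_mesh m dl : 0 < dl -> exists b0, forall b k, (b0 <= b)%N ->
 dg t T (m + b) k.+1 - dg t T (m + b) k < dl.
Proof.
move=> d0; exists (Num.truncn ((T - t) / dl)).+1 => b k hb.
apply: le_lt_trans (ugrid_mesh tT _ _) _.
rewrite ltr_pdivrMr ?ltr0n ?expn_gt0// mulrC -ltr_pdivrMr//.
apply: lt_le_trans (truncnS_gt _) _; rewrite ler_nat; apply: leq_trans hb _.
apply: leq_trans (ltnW (ltn_expl b (ltnSn 1))) _.
by rewrite leq_exp2l// leq_addl.
Qed.

Lemma lift_close m E eps : 0 < eps -> exists b0, forall b r w, (b0 <= b)%N ->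
 `|gfun (dg t T (m + b)) (2 ^ (m + b)) (fun k => eval (lift m b E k)) r w - gfunU m E r w| <= eps.
Proof.
move=> e0; have [dl dl0 hd] := eval_osc_all (2 ^ m) E e0.
have [b0 hb] := dg_mesh m dl0; exists b0 => b r w bb.
rewrite -(gfunU_lift m b); have tS := dS (m + b).
case: (cellP tS (2 ^ (m + b)) r) => [h|[j jN [jr _ _]]].
 by rewrite gfun0// gfunU0// subrr normr0 ltW.
rewrite (gfun_cell tS _ _ jN jr) (gfunU_cell U atom _ _ tS jN jr) (shift_val UD UZ Uatom).
set q := _ - dg t T m _; have q0 : 0 <= q.
 by rewrite subr_ge0; apply: lift_ge => [k|k]; [exact: dS|exact: dg_lift].
have [j1 j2] := andP jr.
have r0 : 0 <= r - dg t T (m + b) j by rewrite subr_ge0 ltW.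
rewrite -(Uadd _ r0 q0) [_ - _ + q]addrC (Uadd _ q0 r0) -(UB UD UZ).
apply: le_trans (Uc _ q0) _; rewrite -normrN opprB; apply: hd.
 by rewrite ltn_divLR ?expn_gt0// -expnD.
by rewrite r0 /=; apply: le_lt_trans (hb b j bb); rewrite lerD2r.
Qed.

(** The assumption [Hmax] concerns a single grid. Refining by [lift] keeps the process fixed while
    its grids exhaust all dyadic times, so the events increase to [far]; on fine cells the semigroup
    hardly moves the integrand. The factor 2 is lost to that oscillation. *)
Lemma max1 m E l : lev m E -> 0 < l -> ((l ^+ 2)%:E * P (far t T l (conv m E)) <=
  (2 * Kmax)%:E * EI P t T (fun r w => `|gfunU m E r w| ^+ 2)%R)%E.
Proof.
move=> hE l0; pose X := conv m E.
pose A b := [set w | exists2 i, (i <= 2 ^ (m + b))%N & l <= `|X (dg t T (m + b) i) w|].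
have mA b : measurable (A b).
 rewrite (_ : A b = \bigcup_(i in [set i | (i <= 2 ^ (m + b))%N]) [set w | l <= `|X (dg t T (m + b) i) w|]).
  apply: bigcup_measurable => i _.
  have := @borel_norm0 R _ Om H setT _ measurableT (conv_meas hE (db (m + b) i)).
  move=> /(_ measurableT `[l, +oo[%classic (measurable_itv _)); rewrite setTI.
  by congr measurable; apply/seteqP; split => w /=; rewrite in_itv/= andbT.
 by apply/seteqP; split => w; [move=> [i iN h]; exists i|move=> [i iN h]; exists i].
have ndA : nondecreasing_seq A.
 apply/nondecreasing_seqP => b; apply/subsetPset => w [i iN h].
 exists (i * 2)%N; first by rewrite addnS expnSr leq_mul2r iN.
 have -> : (i * 2 = i * 2 ^ 1)%N by rewrite expn1. by rewrite addnS -addn1 dg_lift.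
have farE : far t T l X = \bigcup_b A b.
 apply/seteqP; split => w; last first.
  by move=> [b _ [i _ h]]; exists (dg t T (m + b) i) => //; exists (m + b)%N, i.
 move=> [q dq h]; have [b [k kN qE]] := dg_level m dq. by exists b => //; exists k; rewrite -?qE.
have cvA : ((l ^+ 2)%:E * P (A b))%E @[b --> \oo] --> ((l ^+ 2)%:E * P (far t T l X))%E.
 apply: cvgeZl => //; rewrite farE; apply: nondecreasing_cvg_mu => //. exact: bigcupT_measurable.
apply/lee_addgt0Pr => eps e0.
pose c := 2 * Kmax * (T - t) + 1; have c0 : 0 < c.
 by rewrite ltr_wpDl// mulr_ge0 ?subr_ge0// mulr_ge0.
pose de := Num.sqrt (eps / c); have de0 : 0 < de by rewrite sqrtr_gt0 divr_gt0.
have [b0 hb] := lift_close m E de0.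
rewrite -(cvg_lim _ cvA)//; apply: lime_le; first by apply/cvg_ex; eexists; exact: cvA.
near=> b; have bb : (b0 <= b)%N by near: b; exists b0.
have hL := lift_lev (b := b) hE.
have := Hmax hL l0; rewrite conv_lift -/(A b) => /le_trans; apply.
have mi k : measT (fun w => `|eval (lift m b E k) w| ^+ 2).
 apply: borel_normX => //.
 apply: (@Gs_fun _ _ _ _ _ _ _ _ HW (dg t T (m + b) k)); first by case/andP: (db (m + b) k).
 by apply: eval_meas; [case/andP: (db (m + b) k)|exact: hL].
rewrite -(EI_rfun P (dS (m + b)) (db (m + b)) (fun k _ => mi k) (fun k w => sqr_ge0 _)).
have -> : rfun (dg t T (m + b)) (2 ^ (m + b)) (fun k w => `|eval (lift m b E k) w| ^+ 2) =
  fun r w => `|gfun (dg t T (m + b)) (2 ^ (m + b)) (fun k => eval (lift m b E k)) r w| ^+ 2.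
 apply/funext => r; apply/funext => w.
 rewrite (@gfun_real R _ Om _ (dS (m + b)) V _ (fun x => `|x| ^+ 2))//. by rewrite normr0 expr0n.
apply: le_trans (_ : Kmax%:E * (2%:E * EI P t T (fun r w => `|gfunU m E r w| ^+ 2)%R +
  (2 * de ^+ 2)%:E * EI P t T (fun _ _ => 1%R)) <= _)%E.
 apply: lee_wpmul2l => //.
 apply: EI_le2; [exact: gfunU_pmeas|exact: mcst|by move=> r w; exact: sqr_ge0|by []|by []|
  by rewrite mulr_ge0// sqr_ge0|].
 move=> r w _; rewrite sqr_ge0/= mulr1.
 set g := gfun _ _ _ r w; rewrite -(subrK (gfunU m E r w) g) addrC.
 apply: le_trans (norm_sqrD _ _) _; rewrite lerD2l ler_pM2l//.
 by apply: lerXn2r; rewrite ?nnegrE ?(ltW de0)//; exact: hb.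
rewrite EI_cst// mul1r ge0_muleDr//; last 2 first.
- apply: mule_ge0 => //; apply: EI_ge0 => r w _; exact: sqr_ge0.
- by rewrite -EFinM lee_fin mulr_ge0 ?subr_ge0// mulr_ge0// sqr_ge0.
rewrite muleA -EFinM (mulrC Kmax); apply: leeD2l.
rewrite -!EFinM lee_fin sqr_sqrtr ?divr_ge0 ?ltW//.
have -> : Kmax * (2 * (eps / c) * (T - t)) = 2 * Kmax * (T - t) / c * eps by ring.
by rewrite -[ltRHS]mul1r ltr_pM2r// ltr_pdivrMr// mul1r /c ltrDl.
Unshelve. all: by end_near. Qed.

Lemma lift_pair m E m' E' : lev m E -> lev m' E' -> exists n F F', [/\ lev n F, lev n F',
 conv n F = conv m E /\ conv n F' = conv m' E' & gfunU n F = gfunU m E /\ gfunU n F' = gfunU m' E'].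
Proof.
move=> hE hE'; exists (m + m')%N, (lift m m' E), (lift m' m E').
rewrite conv_lift gfunU_lift; split => //; first exact: lift_lev.
- by rewrite addnC; exact: lift_lev.
- by rewrite addnC conv_lift.
- by rewrite addnC gfunU_lift.
Qed.

Lemma max_diff m E m' E' l : lev m E -> lev m' E' -> 0 < l ->
 ((l ^+ 2)%:E * P (far t T l (fun s w => conv m E s w - conv m' E' s w)%R) <=
  (2 * Kmax)%:E * EI P t T (fun r w => `|gfunU m E r w - gfunU m' E' r w| ^+ 2)%R)%E.
Proof.
move=> hE hE' l0; have [n [F [F' [hF hF' [<- <-] [<- <-]]]]] := lift_pair hE hE'.
have := max1 (lev_lin (k := -1) hF' hF) l0.
have -> : conv n (fun j => escale (-1) (F' j) ++ F j) = fun s w => conv n F s w - conv n F' s w.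
 by apply/funext => s; apply/funext => w; rewrite conv_lin// scaleN1r addrC.
have -> // : gfunU n (fun j => escale (-1) (F' j) ++ F j) = fun s w => gfunU n F s w - gfunU n F' s w.
by apply/funext => s; apply/funext => w; rewrite (gfunU_lin UD UZ atomZ) scaleN1r addrC.
Qed.

(** [M] is a continuous adapted version of the convolution of [Phi]: one process for all times,
    unlike the integrals in the definition of mild solution, which are taken separately at each
    time. *)
Definition isconv (Phi : R -> Om -> V) (M : R -> Om -> H) := [/\ progressive P W t T M,
 forall w, {within `[t, T], continuous (fun s => M s w)} &
 exists (m : nat -> nat) (E : nat -> nat -> seq (set Om * I * H)), [/\ forall n : nat, lev (m n) (E n),
  EI P t T (fun r w => `|Phi r w - gfunU (m n) (E n) r w| ^+ 2)%R @[n --> \oo] --> 0%E &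
  {ae P, forall w, forall s, t <= s <= T -> conv (m n) (E n) s w @[n --> \oo] --> M s w}]].

(** A limit of norm at least [l] forces norms above [l / 2] eventually, so Fatou applies to events
    at half the level: this costs 4, and splitting the squares costs 2, which with the factor of
    [max_diff] makes 16. *)
Lemma max2 Phi Phi' M M' (l r : R) : isconv Phi M -> isconv Phi' M' -> 0 < l -> 0 <= r ->
 progressive P W t T Phi -> progressive P W t T Phi' ->
 (EI P t T (fun r w => `|Phi r w - Phi' r w| ^+ 2)%R <= r%:E)%E ->
 ((l ^+ 2)%:E * P (far t T l (fun s w => M s w - M' s w)%R) <= (16 * Kmax * r)%:E)%E.
Proof.
move=> [pM cM [m [E [hE eE aE]]]] [pM' cM' [m' [E' [hE' eE' aE']]]] l0 r0 pP pP' hr.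
have l20 : 0 < l / 2 by rewrite divr_gt0.
pose X n s w := conv (m n) (E n) s w - conv (m' n) (E' n) s w.
pose A n := far t T (l / 2) (X n); pose A' := far t T l (fun s w => M s w - M' s w).
have mM N s : progressive P W t T N -> t <= s <= T -> measT (N s : Om -> borel H).
 move=> pN tsT; have /andP[ts _] := tsT.
 apply: (@Gs_fun _ _ _ _ _ _ _ _ HW s); first by case/andP: tsT.
 exact: (@prog_adapted _ _ _ _ _ P W t T s N tsT pN).
have mA n : measurable (A n).
 by apply: (far_meas tT) => s tsT; apply: (borelB dvH) => //; exact: conv_meas.
have mA' : measurable A'.
 by apply: (far_meas tT) => s tsT; apply: (borelB dvH) => //; exact: mM.
apply/lee_addgt0Pr => eps e0.
pose de := eps / (64 * (Kmax + 1)); have K1 : 0 < Kmax + 1 by rewrite ltr_wpDl.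
have de0 : 0 < de by rewrite divr_gt0// mulr_gt0.
have [N1 h1] := cvge0_le eE de0; have [N2 h2] := cvge0_le eE' de0.
pose Q := (16 * Kmax * r + eps) / l ^+ 2.
have PA n : (P (A (n + (N1 + N2))%N) <= Q%:E)%E.
 move: (n + _)%N (leq_addl n (N1 + N2)%N) => k kN. have := max_diff (hE k) (hE' k) l20.
 rewrite -/(A k) => hk.
 have {}hk : (((l / 2) ^+ 2)%:E * P (A k) <= (2 * Kmax * (2 * r + 8 * de))%:E)%E.
  apply: le_trans hk _; rewrite (EFinM (2 * Kmax)); apply: lee_wpmul2l; first by rewrite lee_fin mulr_ge0.
  apply: le_trans (_ : 2%:E * EI P t T (fun r w => `|Phi r w - Phi' r w| ^+ 2)%R +
   2%:E * (2%:E * EI P t T (fun r w => `|Phi r w - gfunU (m k) (E k) r w| ^+ 2)%R +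
    2%:E * EI P t T (fun r w => `|Phi' r w - gfunU (m' k) (E' k) r w| ^+ 2)%R) <= _)%E.
   pose f3 r w := 2 * `|Phi r w - gfunU (m k) (E k) r w| ^+ 2 +
    2 * `|Phi' r w - gfunU (m' k) (E' k) r w| ^+ 2.
   have p1 : pmeas t T (fun r w => `|Phi r w - gfunU (m k) (E k) r w| ^+ 2) by exact: sub_gfunU_pmeas.
   have p2 : pmeas t T (fun r w => `|Phi' r w - gfunU (m' k) (E' k) r w| ^+ 2) by exact: sub_gfunU_pmeas.
   have p3 : pmeas t T f3.
    by apply: measurable_funD; (apply: measurable_funM; [exact: mcst|]).
   have f30 q w : 0 <= f3 q w by rewrite addr_ge0// mulr_ge0// sqr_ge0.
   apply: (@le_trans _ _ (2%:E * EI P t T (fun r w => `|Phi r w - Phi' r w| ^+ 2)%R + 2%:E * EI P t T f3)%E).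
    apply: EI_le2 => [|||||| q w _]; rewrite ?sqr_ge0//.
    - by apply: (prog_pow HW 2 tTT); exact: (progB dv).
    - rewrite /f3.
     have -> : gfunU (m k) (E k) q w - gfunU (m' k) (E' k) q w = (Phi q w - Phi' q w) +
      ((Phi' q w - gfunU (m' k) (E' k) q w) - (Phi q w - gfunU (m k) (E k) q w)) by abel.
     apply: le_trans (norm_sqrD _ _) _; rewrite lerD2l ler_pM2l// addrC.
     by rewrite -[X in _ <= 2 * X ^+ 2 + _]normrN; exact: norm_sqrD.
   apply: leeD2l; apply: lee_wpmul2l => //.
   by apply: EI_le2 => // q w _; rewrite addr_ge0/= ?mulr_ge0 ?sqr_ge0.
  have -> : (2 * r + 8 * de)%:E = (2%:E * r%:E + 2%:E * (2%:E * de%:E + 2%:E * (de%:E)))%E.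
   by transitivity (2 * r + 2 * (2 * de + 2 * de))%:E => //; congr EFin; ring.
  apply: leeD; first exact: lee_wpmul2l.
  apply: lee_wpmul2l => //; apply: leeD; apply: lee_wpmul2l => //.
   by apply: h1; apply: leq_trans kN; exact: leq_addr.
  by apply: h2; apply: leq_trans kN; exact: leq_addl.
 have Pf : P (A k) \is a fin_num by exact: fin_num_measure.
 move: hk; rewrite -(fineK Pf) -EFinM !lee_fin; move: (fine _) => x hx.
 rewrite /Q ler_pdivlMr ?exprn_gt0//. have h4 : 16 * Kmax * de <= eps / 4.
  rewrite /de mulrA ler_pdivrMr ?mulr_gt0//; move: Kmax0 e0 => a b; nra.
 have : (l / 2) ^+ 2 = l ^+ 2 / 4 by field.
 move=> hl; rewrite hl in hx; move: (l ^+ 2) hx => y; lra.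
have cv : {ae P, forall w, \1_A' w * \1_(A (n + (N1 + N2))%N) w @[n --> \oo] --> (\1_A' w : R)}.
 apply: (ae_imp2 _ aE aE') => w h h'; rewrite indicE; case: (boolP (w \in A')) => [wA|_]; last first.
  by under eq_fun do rewrite mul0r; exact: cvg_cst.
 under eq_fun do rewrite mul1r. have [q dq hq] := set_mem wA.
 have tq : t <= q <= T by case: dq => [m0 [k ->]]; exact: db.
 have hX : `|X n q w| @[n --> \oo] --> `|M q w - M' q w|.
  by apply: cvg_norm; apply: cvgB; [exact: h|exact: h'].
 apply: cvg_near_cst.
 have hl : l / 2 < `|M q w - M' q w| by apply: lt_le_trans hq; rewrite ltr_pdivrMr// ltr_pMr// ltr1n.
 have [N3 _ h3] : \forall n \near \oo, l / 2 < `|X n q w| by exact: (cvgr_gt _ hX).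
 exists N3 => // n /= nN; rewrite indicE mem_set//; exists q => //; apply: ltW; apply: h3.
 by apply: leq_trans nN _; exact: leq_addr.
have := @fatou_ae R _ Om P (fun n w => \1_A' w * \1_(A (n + (N1 + N2))%N) w) (\1_A') Q.
have hP (Y : set Om) : measurable Y -> (\int[P]_w (\1_Y w)%:E = P Y)%E by move=> mY; rewrite integral_indic// setIT.
rewrite hP// => /(_ _ _ _ _ cv _)/= F.
have {}F : (P A' <= Q%:E)%E.
 apply: F => [n|n w||w|n]; rewrite ?mulr_ge0//.
 - by apply: measurable_funM; exact: measurable_indic.
 - apply: le_trans (PA n); rewrite -hP//; apply: le_int => [||w _].
  + by [].
  + by move=> w _; rewrite lee_fin mulr_ge0.
  + by rewrite lee_fin -[leRHS]mul1r; apply: ler_wpM2r.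
have -> : ((16 * Kmax * r)%:E + eps%:E)%E = ((l ^+ 2)%:E * Q%:E)%E.
 rewrite -EFinM -EFinD /Q; congr EFin; field; by rewrite gt_eqF.
by apply: lee_wpmul2l => //; rewrite lee_fin sqr_ge0.
Qed.

Lemma gfun_prog m (a : nat -> Om -> V) :
 (forall k, measT (a k : Gs P W t (dg t T m k) -> borel V)) ->
 progressive P W t T (gfun (dg t T m) (2 ^ m) a).
Proof.
move=> ma q /andP[tq qT].
apply: (@borel_sum _ _ _ _ _ _ _ (index_enum _) (fun (k : 'I_(2 ^ m))
 (z : realM R * Gs P W t q) => cell (dg t T m) k z.1 *: a k z.2) dv). exact: stripG_meas.
move=> k; have [kq|qk] := leP (dg t T m k) q.
 apply: (borelZ dv); first exact: stripG_meas.
  by apply: measurable_funTS; apply: measurableT_comp measurable_fst; exact: cell_meas.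
 apply: measurable_funTS; apply: measurableT_comp measurable_snd. exact: Gs_fun_mono kq _.
have m0 : measurable_fun (`[t, q] `*` setT)
 ((fun _ : realM R * Gs P W t q => 0) : _ -> borel V) by exact: mcst.
move: m0; apply: eq_measurable_fun => z /set_mem[/= + _]; rewrite in_itv => /andP[_ zq].
by rewrite /cell ltNge (le_trans zq (ltW qk)) scale0r.
Qed.

(** [density] gives processes that are constant on dyadic cells. On a grid finer by [b] levels these
    differ little from processes moved by the semigroup, which is the form required for [conv]. *)
Lemma approx Phi eps : progressive P W t T Phi ->
 (EI P t T (fun r w => `|Phi r w| ^+ 2)%R < +oo)%E -> 0 < eps ->
 exists m E, lev m E /\ (EI P t T (fun r w => `|Phi r w - gfunU m E r w| ^+ 2)%R <= eps%:E)%E.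
Proof.
move=> pP fP e0; move: tT; rewrite le_eqVlt => /predU1P[tT'|tT'].
 exists 0%N, (fun=> [::]); split; first by move=> k x; rewrite in_nil.
 by rewrite -tT' EI_point lee_fin ltW.
have e4 : 0 < eps / 4 by rewrite divr_gt0.
have [N0 hN] := density HW tT' (lexx T) dv pP (isT : (0 < 2)%N) fP e4.
pose m := N0.+1; pose N := (2 ^ m).-1; have NE : N.+1 = (2 ^ m)%N by rewrite prednK// expn_gt0.
have [|e [he hN']] := hN N.
 by rewrite -ltnS NE; apply: leq_trans (ltnW (ltn_expl _ (ltnSn 1))) _; rewrite leq_exp2l.
rewrite NE -/(dg t T m) in he hN'.
pose v0 j := \sum_(x <- vl j) atom x.1 x.2.
pose E0 k : seq (set Om * I * H) := [seq (y.1, x.1, x.2) | y <- e k, x <- vl y.2].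
have E0v k w : eval (E0 k) w = sval v0 (e k) w.
 rewrite /eval /E0 big_allpairs_dep /=; apply: eq_bigr => y _. by rewrite /v0 scaler_sumr.
have hE0 : lev m E0.
 move=> k x /allpairsPdep[y [z [ye _ ->]]] /=; exact: he ye.
pose c := 4 * (T - t) + 1; have c0 : 0 < c by rewrite ltr_wpDl// mulr_ge0// subr_ge0.
pose de := Num.sqrt (eps / c); have de0 : 0 < de by rewrite sqrtr_gt0 divr_gt0.
have [dl dl0 hd] := eval_osc_all (2 ^ m) E0 de0.
have [b hb] := dg_mesh m dl0; have {}hb := hb b _ (leqnn b).
have dL k : dg t T (m + b) (k * 2 ^ b) = dg t T m k by exact: dg_lift.
(* Unlike in [lift], the data are not advanced: the semigroup restarts on each fine cell and acts
   for less than [dl]. *)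
exists (m + b)%N, (fun j => E0 (j %/ 2 ^ b)%N); split.
 move=> j x /hE0; apply: filt_mono. by apply: (lift_ge (dS (m + b)) dL).
have hE1 : lev (m + b) (fun j => E0 (j %/ 2 ^ b)%N).
 move=> j x /hE0; apply: filt_mono. by apply: (lift_ge (dS (m + b)) dL).
pose G := gfun (dg t T m) (2 ^ m) (fun k => sval v0 (e k)).
have pG : progressive P W t T G.
 apply: gfun_prog => k; apply: (@sval_meas R Xi V d Om P W t T _ dv).
  by case/andP: (db m k).
 exact: he.
have GE r w : t < r -> r <= T -> `|G r w - gfunU (m + b) (fun j => E0 (j %/ 2 ^ b)%N) r w| <= de.
 move=> tr rT; have K0 : (0 < 2 ^ b)%N by rewrite expn_gt0.
 have [|j jN jr] := @cell_exists R (dg t T (m + b)) (2 ^ (m + b)) r.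
  by rewrite /dg ugrid0 ugridN ?expn_gt0// tr.
 have jN' : (j %/ 2 ^ b < 2 ^ m)%N by rewrite ltn_divLR ?expn_gt0// -expnD.
 have jr' := lift_cell K0 (dS (m + b)) dL jr.
 rewrite /G (gfun_cell (dS m) _ _ jN' jr') (gfunU_cell U atom _ _ (dS (m + b)) jN jr) -E0v.
 rewrite -normrN opprB; apply: hd => //; case/andP: jr => j1 j2.
 by rewrite subr_ge0 ltW//=; apply: le_lt_trans (hb j); rewrite lerD2r.
have p1 : pmeas t T (fun r w => `|Phi r w - G r w| ^+ 2).
 by apply: (prog_pow HW 2 tTT); exact: (progB dv).
apply: (@le_trans _ _ (2%:E * EI P t T (fun r w => `|Phi r w - G r w| ^+ 2)%R +
  (2 * de ^+ 2)%:E * EI P t T (fun _ _ => 1%R))%E); last first.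
 rewrite EI_cst// mul1r; apply: le_trans (_ : 2%:E * (eps / 4)%:E + _ <= _)%E.
  by apply: leeD2r; apply: lee_wpmul2l.
 have ec0 : 0 <= eps / c by rewrite divr_ge0// ltW. rewrite -!EFinM -EFinD lee_fin sqr_sqrtr//.
 have -> : 2 * (eps / 4) + 2 * (eps / c) * (T - t) = eps * (1 / 2 + 2 * (T - t) / c) by field; rewrite gt_eqF.
 rewrite -[leRHS]mulr1 ler_pM2l//. have : 2 * (T - t) / c <= 1 / 2.
  by rewrite ler_pdivrMr// /c; lra.
 by move: (_ / c) => h; lra.
apply: EI_le2 => [||r w|r w|||r w]; [exact: p1|exact: mcst|exact: sqr_ge0|by []|by []|by rewrite mulr_ge0// sqr_ge0|].
move=> /andP[]; rewrite le_eqVlt => /predU1P[<- _|tr rT].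
 have z (tau : nat -> R) k : t <= tau k -> cell tau k t = 0.
  by move=> h; rewrite /cell ltNge h.
 rewrite gfunU0 => [|k _]; last by apply: z; case/andP: (db (m + b) k).
 rewrite /G gfun0 => [|k _]; last by apply: z; case/andP: (db m k).
 rewrite sqr_ge0/= mulr1; have := sqr_ge0 `|Phi t w - 0|; have := sqr_ge0 de.
 by move: (_ ^+ 2) (_ ^+ 2) => x y; lra.
rewrite sqr_ge0/= mulr1.
have -> : Phi r w - gfunU (m + b) (fun j => E0 (j %/ 2 ^ b)%N) r w =
 (Phi r w - G r w) + (G r w - gfunU (m + b) (fun j => E0 (j %/ 2 ^ b)%N) r w) by abel.
apply: le_trans (norm_sqrD _ _) _; rewrite lerD2l ler_pM2l//.
by apply: lerXn2r; rewrite ?nnegrE ?(ltW de0)//; exact: GE.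
Qed.

Lemma exconv Phi : progressive P W t T Phi ->
 (EI P t T (fun r w => `|Phi r w| ^+ 2)%R < +oo)%E -> exists M, isconv Phi M.
Proof.
(* Two consecutive errors [ep] bound the event at level [2^-n] by [4^n * 8^-n = 2^-n]; the
   denominator absorbs the constant of [max_diff]. *)
move=> pP fP; pose ep n : R := 8^-1 ^+ n / (8 * Kmax + 1).
have K1 : 0 < 8 * Kmax + 1 by rewrite ltr_wpDl// mulr_ge0.
have ep0 n : 0 < ep n by rewrite divr_gt0// exprn_gt0// invr_gt0.
have hA n : exists mE : nat * (nat -> seq (set Om * I * H)), lev mE.1 mE.2 /\
  (EI P t T (fun r w => `|Phi r w - gfunU mE.1 mE.2 r w| ^+ 2)%R <= (ep n)%:E)%E.
 by have [m [E h]] := approx pP fP (ep0 n); exists (m, E).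
have [mE hE] := choice hA.
have hl n := (hE n).1; have he n := (hE n).2.
pose X n := conv (mE n).1 (mE n).2.
have [||n|M [pM cM aM]] := @limit_process R Xi H d Om P W t T HW vH dvH tT X.
- by move=> n s; exact: conv_adapted.
- by move=> n; exact: conv_ae_cont.
- have l0 : 0 < (2^-1 : R) ^+ n by rewrite exprn_gt0// invr_gt0.
 have := max_diff (hl n.+1) (hl n) l0; rewrite -/(X n) -/(X n.+1).
 set Pn := P _; set EE := EI _ _ _ _ => h. have hEE : (EE <= (4 * ep n)%:E)%E.
  apply: (@le_trans _ _ (2%:E * EI P t T (fun r w => `|Phi r w - gfunU (mE n).1 (mE n).2 r w| ^+ 2)%R +
   2%:E * EI P t T (fun r w => `|Phi r w - gfunU (mE n.+1).1 (mE n.+1).2 r w| ^+ 2)%R)%E).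
   apply: EI_le2 => [|||||| r w _]; rewrite ?sqr_ge0//; [exact: sub_gfunU_pmeas|exact: sub_gfunU_pmeas|].
   rewrite /= -[X in _ <= _ + 2 * X ^+ 2]normrN.
   apply: le_trans (norm_sqrD _ _); rewrite opprB [X in _ <= `|X| ^+ 2](_ : _ =
    gfunU (mE n.+1).1 (mE n.+1).2 r w - gfunU (mE n).1 (mE n).2 r w)//.
   by abel.
  apply: le_trans (_ : 2%:E * (ep n)%:E + 2%:E * (ep n.+1)%:E <= _)%E.
   by apply: leeD; apply: lee_wpmul2l.
  rewrite -!EFinM -EFinD lee_fin; have : ep n.+1 <= ep n.
   rewrite /ep ler_pM2r ?invr_gt0// exprS -[leRHS]mul1r ler_pM2r ?exprn_gt0 ?invr_gt0//.
   by rewrite invf_le1// ler1n.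
  by move: (ep n) (ep n.+1) => x y; lra.
 have Pf : Pn \is a fin_num.
  by apply: fin_num_measure; apply: (far_meas tT) => s tsT;
   apply: (borelB dvH) => //; exact: conv_meas.
 have : (((2^-1 ^+ n) ^+ 2)%R%:E * Pn <= (2 * Kmax)%:E * (4 * ep n)%:E)%E.
  by apply: le_trans h _; apply: lee_wpmul2l => //; rewrite lee_fin mulr_ge0.
 rewrite -(fineK Pf) -!EFinM !lee_fin; move: (fine Pn) => x hx.
 rewrite -(ler_pM2l (exprn_gt0 2 l0)); apply: le_trans hx _.
 have -> : (2^-1 ^+ n) ^+ 2 * 2^-1 ^+ n = (8^-1 : R) ^+ n.
  by rewrite -exprSr -exprM mulnC exprM; congr (_ ^+ n); field.
 rewrite /ep [leLHS](_ : _ = 8 * Kmax / (8 * Kmax + 1) * 8^-1 ^+ n); last by ring.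
 rewrite -[leRHS]mul1r; apply: ler_wpM2r; first by rewrite exprn_ge0// invr_ge0.
 by rewrite ler_pdivrMr// mul1r lerDl.
exists M; split => //; exists (fun n => (mE n).1), (fun n => (mE n).2); split => //.
apply: (@squeeze_cvge _ _ _ _ (fun=> 0%E) _ (fun n => (ep n)%:E)).
- near=> n; rewrite he andbT; apply: EI_ge0 => r w _; exact: sqr_ge0.
- exact: cvg_cst.
- apply/fine_cvgP; split; first by near=> n.
 have : (8^-1 : R) ^+ n / (8 * Kmax + 1) @[n --> \oo] --> 0 / (8 * Kmax + 1).
  apply: cvgMl; apply: cvg_expr; rewrite ger0_norm ?invr_ge0// invf_lt1// ltr1n. by [].
 by rewrite mul0r.
Unshelve. all: by end_near. Qed.

End Integrator.

(** * Norm bounds for Bochner integrals in a Hilbert space *)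

Section BochnerNorm.
Variables (R : realType) (H : hilbertType R) (vH : nat -> H) (dvH : dense_seq vH).
Variables (D : set (realM R)) (mD : measurable D).

Definition bl (L : seq (set (realM R) * H)) := forall x, x \in L ->
 [/\ measurable x.1, x.1 `<=` D & (leb x.1 < +oo)%E].

Definition bfun (L : seq (set (realM R) * H)) r : H := \sum_(x <- L) \1_(x.1) r *: x.2.

Definition bint (L : seq (set (realM R) * H)) : H := \sum_(x <- L) fine (leb x.1) *: x.2.

Lemma bfun_inner L y : bl L -> leb.-integrable D (fun r => (inner y (bfun L r))%:E) /\
 (\int[leb]_(r in D) (inner y (bfun L r))%:E = (inner y (bint L))%:E)%E.
Proof.
elim: L => [|x L IH] hL.
 have z r : inner y (bfun [::] r) = 0 by rewrite /bfun big_nil innerC inner0l.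
 split; first by under eq_fun do rewrite z; exact: integrable0.
 by under eq_integral do rewrite z; rewrite integral0 /bint big_nil innerC inner0l.
have [mx xD fx] := hL x (mem_head _ _).
have [i1 e1] : leb.-integrable D (fun r => (inner y (bfun L r))%:E) /\
 (\int[leb]_(r in D) (inner y (bfun L r))%:E = (inner y (bint L))%:E)%E.
 by apply: IH => z zL; apply: hL; rewrite inE zL orbT.
have E r : (inner y (bfun (x :: L) r))%:E =
  ((inner y x.2)%:E * (\1_(x.1) r)%:E + (inner y (bfun L r))%:E)%E.
 by rewrite /bfun big_cons innerDr innerZr EFinD EFinM muleC.
have i2 : leb.-integrable D (fun r => ((inner y x.2)%:E * (\1_(x.1) r)%:E)%E).
 apply: integrableZl => //; apply/integrableP; split.
  by apply/mEFinP; exact: measurable_indic.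
 under eq_integral do rewrite /= ger0_norm//. by rewrite integral_indic// (setIidl xD).
split.
 by under eq_fun do rewrite E; exact: integrableD.
under eq_integral do rewrite E.
rewrite integralD// e1 integralZl//; last first.
 apply/integrableP; split; first by apply/mEFinP; exact: measurable_indic.
 under eq_integral do rewrite /= ger0_norm//. by rewrite integral_indic// (setIidl xD).
rewrite integral_indic// (setIidl xD) /bint big_cons innerDr innerZr EFinD; congr (_ + _)%E.
by rewrite EFinM fineK ?ge0_fin_numE// muleC.
Qed.

Lemma bfun_meas L : bl L -> measurable_fun D (bfun L : realM R -> borel H).
Proof.
elim: L => [|x L IH] hL.
 rewrite (_ : bfun _ = fun=> 0); first exact: mcst.
 by apply/funext => r; rewrite /bfun big_nil.
rewrite (_ : bfun _ = fun r => \1_(x.1) r *: x.2 + bfun L r); last first.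
 by apply/funext => r; rewrite /bfun big_cons.
apply: (borelD dvH) => //; last by apply: IH => z zL; apply: hL; rewrite inE zL orbT.
apply: (borelZ dvH) => //; apply: measurable_indic.
by case: (hL x (mem_head _ _)).
Qed.

Lemma bint_le L : bl L -> (`|bint L|%:E <= \int[leb]_(r in D) `|bfun L r|%:E)%E.
Proof.
move=> hL; have [->|y0] := eqVneq (bint L) 0; first by rewrite normr0; exact: integral_ge0.
have [ii e] := bfun_inner (bint L) hL.
have y0' : 0 < `|bint L| by rewrite normr_gt0.
rewrite -(@lee_pmul2l _ `|bint L|%:E)// -EFinM -expr2 -innerxx -e.
have mn : measurable_fun D (fun r => `|bfun L r|) by apply: borel_norm0 => //; exact: bfun_meas.
rewrite -intZ//.
apply: le_trans (lee_abs _) _; apply: le_trans (le_abse_integral _ _ _) _ => //.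
 by case/integrableP: ii.
apply: le_int => // r _; rewrite lee_fin /=; exact: inner_le.
Qed.

Lemma bochner_sub (f : R -> H) y (f' : R -> H) y' : is_bochner_integral D f y -> is_bochner_integral D f' y' ->
 (`|y - y'|%:E <= \int[leb]_(r in D) `|f r - f' r|%:E)%E.
Proof.
move=> [mf [u [hu cu iu]]] [mf' [u' [hu' cu' iu']]].
pose L n : seq (set (realM R) * H) :=
 [seq (@step_set _ _ (u n) i, @step_val _ _ (u n) i) | i <- index_enum 'I_(step_size (u n))] ++
 [seq (@step_set _ _ (u' n) i, - @step_val _ _ (u' n) i) | i <- index_enum 'I_(step_size (u' n))].
have hL n : bl (L n).
 by move=> x; rewrite mem_cat => /orP[] /mapP[i _ ->] /=; [exact: hu|exact: hu'].
have fL n r : bfun (L n) r = step_fun (u n) r - step_fun (u' n) r.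
 rewrite /bfun big_cat !big_map /=; congr (_ + _).
 by rewrite -sumrN; apply: eq_bigr => i _; rewrite scalerN.
have iL n : bint (L n) = step_integral (u n) - step_integral (u' n).
 rewrite /bint big_cat !big_map /=; congr (_ + _).
 by rewrite -sumrN; apply: eq_bigr => i _; rewrite scalerN.
have ms n : measurable_fun D ((step_fun (u n)) : realM R -> borel H).
 have : measurable_fun D (bfun [seq (@step_set _ _ (u n) i, @step_val _ _ (u n) i) |
   i <- index_enum 'I_(step_size (u n))] : realM R -> borel H).
  by apply: bfun_meas => x /mapP[i _ ->]; exact: hu.
 by apply: eq_measurable_fun => r _; rewrite /bfun big_map.
have ms' n : measurable_fun D ((step_fun (u' n)) : realM R -> borel H).
 have : measurable_fun D (bfun [seq (@step_set _ _ (u' n) i, @step_val _ _ (u' n) i) |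
   i <- index_enum 'I_(step_size (u' n))] : realM R -> borel H).
  by apply: bfun_meas => x /mapP[i _ ->]; exact: hu'.
 by apply: eq_measurable_fun => r _; rewrite /bfun big_map.
have nB (g h : R -> H) : measurable_fun D (g : realM R -> borel H) ->
  measurable_fun D (h : realM R -> borel H) -> measurable_fun D (fun r => `|g r - h r|).
 by move=> mg mh; apply: borel_norm0 => //; exact: (borelB dvH).
have ci : `|step_integral (u n) - step_integral (u' n)| @[n --> \oo] --> `|y - y'|.
 by apply: cvg_norm; exact: cvgB.
apply/lee_addgt0Pr => e e0; have e3 : 0 < e / 3 by rewrite divr_gt0.
have [N1 h1] := cvge0_le cu e3; have [N2 h2] := cvge0_le cu' e3.
have [N3 _ h3] : \forall n \near \oo, `|y - y'| - e / 3 < `|step_integral (u n) - step_integral (u' n)|.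
 by apply: (cvgr_gt _ ci); rewrite ltrBlDr ltrDl.
pose n := maxn N1 (maxn N2 N3).
have := bint_le (hL n); rewrite iL.
have : (\int[leb]_(r in D) `|bfun (L n) r|%:E <= \int[leb]_(r in D) `|f r - f' r|%:E + (e / 3 + e / 3)%:E)%E.
 apply: (@le_trans _ _ (\int[leb]_(r in D) `|f r - f' r|%:E + (\int[leb]_(r in D) `|f r - step_fun (u n) r|%:E +
   \int[leb]_(r in D) `|f' r - step_fun (u' n) r|%:E))%E); last first.
  rewrite EFinD; apply: leeD2l; apply: leeD; first by apply: h1; rewrite leq_max leqnn.
  by apply: h2; rewrite !leq_max leqnn orbT.
 rewrite -[X in (_ <= _ + X)%E]intD//; [|exact: nB|exact: nB].
 rewrite -intD//; [|exact: nB|by apply: measurable_funD; exact: nB].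
 apply: le_int => // r _; rewrite lee_fin fL. have -> : step_fun (u n) r - step_fun (u' n) r =
  (f r - f' r) + ((f' r - step_fun (u' n) r) - (f r - step_fun (u n) r)) by abel.
 apply: le_trans (ler_normD _ _) _; rewrite lerD2l addrC.
 by apply: le_trans (ler_normD _ _) _; rewrite normrN.
move=> k1 k2; have := le_trans k2 k1.
have : `|y - y'| - e / 3 < `|step_integral (u n) - step_integral (u' n)|.
 by apply: h3; rewrite /= !leq_max leqnn !orbT.
move: (`|_ - _|) (`|_ - _|) => a b ab.
case: (\int[leb]_(r in D) `|f r - f' r|%:E)%E => [z| |] //=.
 by rewrite -!EFinD !lee_fin; lra.
by move=> _; exact: leey.
Qed.

Lemma bochner0 : is_bochner_integral D (fun=> 0 : H) 0.
Proof.
split; first exact: mcst.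
exists (fun=> @Step R H 0 (fun=> set0) (fun=> 0)); split.
- by move=> n [].
- rewrite (_ : (fun _ => _) = fun=> 0%E); first exact: cvg_cst.
 apply/funext => n; under eq_integral do rewrite /step_fun big_ord0 subrr normr0.
 by rewrite integral0.
- rewrite (_ : (fun _ => _) = fun=> 0); first exact: cvg_cst.
 by apply/funext => n; rewrite /step_integral big_ord0.
Qed.

Lemma bochner_le (f : R -> H) y : is_bochner_integral D f y -> (`|y|%:E <= \int[leb]_(r in D) `|f r|%:E)%E.
Proof.
move=> h; have := bochner_sub h bochner0; rewrite subr0.
by under eq_integral do rewrite subr0.
Qed.

Lemma bochner_lim f y (L : nat -> seq (set (realM R) * H)) :
 measurable_fun D (f : realM R -> borel H) -> (forall n, bl (L n)) ->
 (\int[leb]_(r in D) `|f r - bfun (L n) r|%:E)%E @[n --> \oo] --> 0%E ->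
 bint (L n) @[n --> \oo] --> y -> is_bochner_integral D f y.
Proof.
move=> mf hL c1 c2; split => //.
exists (fun n => @Step R H (size (L n)) (fun i => (nth (set0, 0) (L n) i).1)
 (fun i => (nth (set0, 0) (L n) i).2)); split.
- by move=> n i /=; apply: hL; exact: mem_nth.
- apply: cvg_trans c1; apply: near_eq_cvg; near=> n.
 apply: eq_integral => r _; rewrite /bfun /step_fun /= (big_nth (set0, 0)) big_mkord. by [].
- apply: cvg_trans c2; apply: near_eq_cvg; near=> n.
 by rewrite /bint /step_integral /= (big_nth (set0, 0)) big_mkord.
Unshelve. all: by end_near. Qed.

End BochnerNorm.

Section ProgSemigroup.
Variables (R : realType) (Xi : hilbertType R) (V : normedModType R)
 (d : measure_display) (Om : measurableType d) (P : probability Om R)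
 (W : R -> Xi -> Om -> R) (t T : R)
 (HW : reference_space P W t T)
 (v : nat -> V) (dv : dense_seq v) (U : R -> V -> V)
 (U0 : forall x, U 0 x = x)
 (Uadd : forall s r x, 0 <= s -> 0 <= r -> U (s + r) x = U s (U r x))
 (UB : forall s x y, U s (x - y) = U s x - U s y)
 (Uc : forall s x, 0 <= s -> `|U s x| <= `|x|)
 (Ur : forall x e, 0 < e -> exists2 dl, 0 < dl & forall s, 0 <= s < dl -> `|U s x - x| < e).

(** The pair [(Phi r w, r)] is composed with a map that is jointly continuous on the set where
    [r <= s]. *)
Lemma prog_semigroup s (Phi : R -> Om -> V) : t <= s <= T -> progressive P W t T Phi ->
 progressive P W t s (fun r w => U (s - r) (Phi r w)).
Proof.
move=> /andP[ts sT] pP q /andP[tq qs]; have [w0 dw0] := dense_seq_real R.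
have mX := pP q; rewrite tq (le_trans qs sT) in mX; have {}mX := mX isT.
have mY : measurable_fun (`[t, q] `*` setT) ((fun z : realM R * Gs P W t q => z.1) : _ -> borel R).
 by apply/borel_real; [exact: stripG_meas|exact: measurable_funTS measurable_fst].
pose D := `[t, q]%classic `*` [set: Gs P W t q].
have h := @borel_comp2 R _ (realM R * Gs P W t q)%type V R V v w0 D
 (fun z => Phi z.1 z.2) (fun z => z.1) [set z : V * R | z.2 <= s]
 (fun z => U (s - z.2) z.1) dv dw0 (@stripG_meas R Xi d Om P W t q) mX mY.
apply: h; last exact: semigroup_cont.
by move=> z [/= + _]; rewrite in_itv => /andP[_ /le_trans]; exact.
Qed.

End ProgSemigroup.

Lemma EI_sub R d (Om : measurableType d) (P : probability Om R) (t s T : R)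
  (f : R -> Om -> R) : s <= T -> pmeas t T f -> (forall r w, 0 <= f r w) ->
 (EI P t s f <= EI P t T f)%E.
Proof.
move=> sT mf f0; apply: le_int => // w _.
 by apply: integral_ge0 => r _; rewrite lee_fin.
apply: ge0_subset_integral; [exact: measurable_itv|exact: measurable_itv| | |].
- by apply/mEFinP; exact: EI_section.
- by move=> r _; rewrite lee_fin.
- by move=> r /=; rewrite !in_itv/= => /andP[-> /le_trans]; exact.
Qed.

(** The inner integral may be infinite on some paths, so its minimum with 1 is used; once the limit
    falls below 1 the truncation is inactive. *)
Lemma EI_ae_cvg0 R d (Om : measurableType d) (P : probability Om R) (t s : R)
  (h : nat -> R -> Om -> R) : (forall j, pmeas t s (h j)) -> (forall j r w, 0 <= h j r w) ->
 (forall j, (EI P t s (h j) <= (2^-1 ^+ j)%:E)%E) ->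
 {ae P, forall w, (\int[leb]_(r in `[t, s]) (h j r w)%:E)%E @[j --> \oo] --> 0%E}.
Proof.
move=> mh h0 hE; pose I j w := (\int[leb]_(r in `[t, s]) (h j r w)%:E)%E.
have I0 j w : (0 <= I j w)%E by apply: integral_ge0 => r _; rewrite lee_fin.
have mI j : measT (I j) by apply: EI_inner_meas => //; move=> r w _.
pose f j w := fine (mine 1%E (I j w)).
have fE j w : (f j w)%:E = mine 1%E (I j w).
 rewrite fineK// ge0_fin_numE; last by rewrite le_min lee_fin ler01 I0. by rewrite gt_min ltry.
have f0 j w : 0 <= f j w by rewrite -lee_fin fE le_min lee_fin ler01 I0.
have mf j : measT (f j).
 apply/mEFinP; rewrite (_ : EFin \o f j = fun w => mine 1%E (I j w)).
  by apply: measurable_mine => //; exact: mcst.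
 by apply/funext => w /=; rewrite fE.
have fB j : (\int[P]_w (f j w)%:E <= (2^-1 ^+ j)%:E)%E.
 apply: le_trans (hE j); apply: le_int => // w _; first by rewrite lee_fin.
 by rewrite fE ge_min lexx orbT.
apply: ae_imp (ae_cvg0 mf f0 fB) => w fw.
apply: (@cvg_trans _ (((f j w)%:E @[j --> \oo])%E)); last by apply/fine_cvgP; split; [near=> j|].
apply: near_eq_cvg; near=> j; rewrite fE -/(I j w).
have : f j w < 1 by near: j; apply: (cvgr_lt _ fw).
rewrite -lte_fin fE gt_min ltxx/= => /ltW /min_idPr; by [].
Unshelve. all: by end_near. Qed.

(** * Stochastic and drift convolutions *)

Section StochasticConvolution.
Variables (R : realType) (Xi H : hilbertType R)
 (d : measure_display) (Om : measurableType d) (P : probability Om R)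
 (W : R -> Xi -> Om -> R) (t T : R)
 (HW : reference_space P W t T)
 (tT : t <= T)
 (S : R -> bounded_op H H) (hS : contraction_semigroup S)
 (vH : nat -> H) (dvH : dense_seq vH).

Section Noise.
Variables (ch : nat -> seq (Xi * H)) (dch : dense_seq (fun n => rk (ch n))).
Implicit Types (E : nat -> seq (set Om * Xi * H)).

Lemma Sc_cont q : continuous (S q). Proof. exact: bounded_op_continuous. Qed.

Lemma S_meas q : measT (S q : borel H -> borel H).
Proof.
move/continuousP: (@Sc_cont q) => cS.
apply: (@measurability _ _ _ (borel H) setT _ (@open H)) => //.
by move=> _ [A oA <-]; rewrite setTI; apply: sub_sigma_algebra; exact: cS.
Qed.

(** The weak type bound of [chain_max] with the semigroup steps as contractions, read on the grid
    values of the convolution. *)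
Lemma noise_max m E (l : R) : lev P W t T m E -> 0 < l ->
 ((l ^+ 2)%:E * P [set w | exists2 i, (i <= 2 ^ m)%N &
   (l <= `|conv S W (dg t T m) (2 ^ m) E (dg t T m i) w|)%R] <=
  8%:E * \sum_(k < 2 ^ m) (dg t T m k.+1 - dg t T m k)%:E *
   \int[P]_w (`|eval (@rank1 R Xi H) (E k) w| ^+ 2)%:E)%E.
Proof.
move=> hE l0; pose C k := S (dg t T m k.+1 - dg t T m k).
have tauS k : dg t T m k <= dg t T m k.+1 by exact: dgS.
have taut k : t <= dg t T m k by case/andP: (dg_bound tT m k).
have tauT k : dg t T m k <= T by case/andP: (dg_bound tT m k).
have mC k : measT (C k : borel H -> borel H) by exact: S_meas.
have Cc k x : `|C k x| <= `|x| by apply: (sg_contr hS); rewrite subr_ge0.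
have ee k : events_at P W t (dg t T m k) (E k) by exact: hE.
have cE i w : (i <= 2 ^ m)%N ->
  conv S W (dg t T m) (2 ^ m) E (dg t T m i) w = chain W (dg t T m) E C i w.
 elim: i => [|i IH] iN; first by rewrite /= conv_start.
 by rewrite (conv_step hS)//= -IH ?(ltnW iN)// iincE.
have := chain_max HW dvH taut tauS tauT ee mC Cc (2 ^ m) l0.
have -> : [set w | exists2 i, (i <= 2 ^ m)%N &
   l <= `|conv S W (dg t T m) (2 ^ m) E (dg t T m i) w|] = ~` below W (dg t T m) E C l (2 ^ m).
 apply/seteqP; split => w /=.
  by move=> [i iN +] h; rewrite cE// leNgt h.
 move=> h; apply: contrapT => h'; apply: h => i iN; rewrite ltNge; apply/negP => h2.
 by apply: h'; exists i => //; rewrite cE.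
move=> /le_trans; apply; rewrite /energy ge0_sume_distrr => [|k _]; last first.
 by rewrite mule_ge0 ?lee_fin ?subr_ge0//; apply: integral_ge0 => w _; rewrite lee_fin sqr_ge0.
apply: lee_sum => k _; rewrite muleA -EFinM; apply: lee_wpmul2l.
 by rewrite lee_fin mulr_ge0// subr_ge0.
by apply: le_int => [//|w _|w _]; rewrite lee_fin ?sqr_ge0// ivalE.
Qed.

Definition nconv (Phi : R -> Om -> hs Xi H) (M : R -> Om -> H) :=
 isconv P W t T S (fun q => hs_comp (S q)) (@rank1 R Xi H) W Phi M.

Let aB s i : t <= s <= T -> measT (W s i : Gs P W t s -> R).
Proof. by case/andP => ts _; exact: W_adapted. Qed.

Let cB i : {ae P, forall w, {within `[t, T], continuous (fun s => W s i w)}}.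
Proof. by case: HW => _ h; exact: (wiener_continuous h). Qed.

Let rZ k (i : Xi) (h : H) : rank1 i (k *: h) = k *: rank1 i h.
Proof.
apply: (@val_inj _ _ (hs Xi H)); apply/funext => y /=.
by rewrite -[RHS]/(k *: (inner _ y *: _)) !scalerA mulrC.
Qed.

Lemma nconv_ex Phi : progressive P W t T Phi ->
 (EI P t T (fun r w => `|Phi r w| ^+ 2)%R < +oo)%E -> exists M, nconv Phi M.
Proof.
apply: (@exconv R Xi H (hs Xi H) Xi d Om P W t T HW tT S hS (fun q => hs_comp (S q)) (@rank1 R Xi H) W
 (hs_comp_add hS) (@hs_compD _ _ _ S) (@hs_compZ _ _ _ S)
 (fun s x => @hs_comp_contr _ _ _ S hS s x) (fun f e => @hs_comp_right _ _ _ S hS f e)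
 (@hs_comp_rank1 _ _ _ S) rZ vH dvH ch dch aB cB 8 (ler0n _ 8) noise_max).
Qed.

Lemma nconv_max Phi Phi' M M' (l r : R) : nconv Phi M -> nconv Phi' M' -> 0 < l -> 0 <= r ->
 progressive P W t T Phi -> progressive P W t T Phi' ->
 (EI P t T (fun r w => `|Phi r w - Phi' r w| ^+ 2)%R <= r%:E)%E ->
 ((l ^+ 2)%:E * P (far t T l (fun s w => M s w - M' s w)%R) <= (16 * 8 * r)%:E)%E.
Proof.
apply: (@max2 R Xi H (hs Xi H) Xi d Om P W t T HW tT S hS (fun q => hs_comp (S q)) (@rank1 R Xi H) W
 (hs_comp_add hS) (@hs_compD _ _ _ S) (@hs_compZ _ _ _ S)
 (fun s x => @hs_comp_contr _ _ _ S hS s x) (fun f e => @hs_comp_right _ _ _ S hS f e)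
 (@hs_comp_rank1 _ _ _ S) rZ vH dvH ch dch aB 8 (ler0n _ 8) noise_max).
Qed.

Section AtTime.
Variables (s : R) (tsT : t <= s <= T).
Local Notation tau m := (dg t T m).

(** For a fixed [s] the convolution is a plain elementary integral whose operators have been moved
    by [S]. Cells that start after [s] are dropped, so every start stays a grid point and its event
    stays adapted. *)
Definition nitems m E : seq (R * R * (set Om * Xi * H)) :=
 [seq (Num.min (tau m (val k)) s, Num.min (tau m (val k).+1) s,
    (x.1, S (Num.max (s - tau m (val k)) 0) x.2)) |
   k <- [seq k <- index_enum 'I_(2 ^ m) | tau m (val k) <= s], x <- E (val k)].

Lemma nitems_on m E : lev P W t T m E -> eon P W t s (nitems m E).
Proof.
move=> hE _ /allpairsPdep[k [x [+ xE ->]]]; rewrite mem_filter => /andP[ks _] /=.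
have /andP[t1 _] := dg_bound tT m (val k).
rewrite (min_idPl ks); split => //.
- by rewrite le_min ks dgS.
- by rewrite ge_min lexx orbT.
- exact: hE xE.
Qed.

Lemma nitems_int m E w : eint W (nitems m E) w = conv S W (tau m) (2 ^ m) E s w.
Proof.
rewrite /eint /nitems big_allpairs_dep /= big_filter big_mkcond /=.
apply: eq_bigr => k _; case: leP => [ks|sk].
 rewrite /einc (Ssum S); apply: eq_bigr => x _ /=. by rewrite linearZ.
rewrite (min_idPr (le_trans (ltW sk) (dgS tT m k))) einc_refl.
by rewrite linear0.
Qed.

Lemma nitems_fun m E r w : t <= r <= s -> efun (nitems m E) r w = hs_comp (S (s - r))
  (gfunU (fun q => hs_comp (S q)) (@rank1 R Xi H) (tau m) (2 ^ m) E r w).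
Proof.
move=> /andP[tr rs]; rewrite /efun /nitems big_allpairs_dep /= big_filter big_mkcond /=.
rewrite /gfunU hs_comp_sum; apply: eq_bigr => k _; rewrite hs_compZ /cell.
case: (leP (tau m k) s) => [ks|sk]; last by rewrite ltNge (le_trans rs (ltW sk)) scale0r.
have -> : (\1_(`]tau m k, Num.min (tau m k.+1) s]) r : R) = (tau m k < r <= tau m k.+1)%R%:R.
 by rewrite indicE mem_setE in_itv /= le_min rs andbT.
case: (boolP (tau m k < r <= tau m k.+1)) => [/andP[kr _]|_]; last first.
 by rewrite scale0r big1// => x _; rewrite mul0r scale0r.
rewrite scale1r -(hs_comp_add hS) ?subr_ge0 ?(ltW kr)// addrA subrK.
rewrite /eval hs_comp_sum; apply: eq_bigr => x _.
by rewrite mul1r hs_compZ hs_comp_rank1 max_l// subr_ge0.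
Qed.

(** The approximations converge to [M s] almost surely, whereas the stochastic integral is defined
    by mean square limits: Fatou along the Cauchy sequence bridges the two. The tolerance
    [eps / 128] allows for a factor 4 and the factor 32 of [ito_L2]. *)
Lemma nconv_ito Phi M : nconv Phi M -> progressive P W t T Phi ->
 is_ito_integral P W t s (fun r w => hs_comp (S (s - r)) (Phi r w)) (M s).
Proof.
move=> [pM cM [m [E [hE eE aE]]]] pP; have /andP[ts sT] := tsT.
pose Ps r w := hs_comp (S (s - r)) (Phi r w).
have pPs : progressive P W t s Ps.
 exact: (@prog_semigroup R Xi (hs Xi H) d Om P W t T _ dch (fun q => hs_comp (S q))
  (hs_comp_add hS) (@hs_compB _ _ _ S)
  (fun s x => @hs_comp_contr _ _ _ S hS s x) (fun f e => @hs_comp_right _ _ _ S hS f e) s Phi tsT pP).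
have mM : measT (M s : Om -> borel H).
 apply: (@Gs_fun _ _ _ _ _ _ _ _ HW s) => //. exact: (@prog_adapted _ _ _ _ _ P W t T s M tsT pM).
pose D n := nitems (m n) (E n).
have hD n : eon P W t s (D n) by exact: nitems_on.
have pm n : pmeas t T (fun r w => `|Phi r w - gfunU (fun q => hs_comp (S q)) (@rank1 R Xi H)
  (tau (m n)) (2 ^ m n) (E n) r w| ^+ 2).
 exact: (@sub_gfunU_pmeas R Xi H (hs Xi H) Xi d Om P W t T HW tT (fun q => hs_comp (S q)) (@rank1 R Xi H)
  (hs_comp_add hS) (@hs_compD _ _ _ S) (@hs_compZ _ _ _ S)
 (fun s x => @hs_comp_contr _ _ _ S hS s x) (fun f e => @hs_comp_right _ _ _ S hS f e) ch dch Phi (m n) (E n) pP (hE n)).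
have dD n : (EI P t s (fun r w => `|Ps r w - efun (D n) r w| ^+ 2)%R <=
  EI P t T (fun r w => `|Phi r w - gfunU (fun q => hs_comp (S q)) (@rank1 R Xi H)
  (tau (m n)) (2 ^ m n) (E n) r w| ^+ 2)%R)%E.
 apply: le_trans (EI_sub _ sT (pm n) _); last by move=> r w; exact: sqr_ge0.
 apply: EI_le => r w tr; rewrite sqr_ge0/= nitems_fun// -hs_compB.
 by apply: lerXn2r; rewrite ?nnegrE//; apply: hs_comp_contr; rewrite ?subr_ge0//; case/andP: tr.
have iD n : is_ito_integral P W t s (efun (D n)) (eint W (D n)).
 exact: (ito_elem HW dvH dch tsT).
have [_] := itoP P W t s Ps (M s); apply; split => // eps e0.
have e1 : 0 < eps / 128 by rewrite divr_gt0.
have [N hN] := cvge0_le eE e1.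
have dN n : (N <= n)%N -> (EI P t s (fun r w => `|Ps r w - efun (D n) r w| ^+ 2)%R <= (eps / 128)%:E)%E.
 by move=> /hN; apply: le_trans (dD n).
exists (D N); split => //.
 by apply: le_trans (dN N (leqnn N)) _; rewrite lee_fin ler_pdivrMr// ler_pMr// ler1n.
have mD n := eint_meas HW dvH tsT (hD n).
apply: (@fatou_ae _ _ _ P (fun n w => `|eint W (D (n + N)%N) w - eint W (D N) w| ^+ 2)).
- by move=> n; apply: borel_normX => //; apply: (borelB dvH) => //; exact: mD.
- by move=> n w; exact: sqr_ge0.
- by apply: borel_normX => //; apply: (borelB dvH) => //; exact: mD.
- by move=> w; exact: sqr_ge0.
- apply: ae_imp aE => w /(_ s tsT) h.
 have h2 : `|eint W (D (n + N)%N) w - eint W (D N) w| @[n --> \oo] --> `|M s w - eint W (D N) w|.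
  apply: cvg_norm; apply: cvgB; last exact: cvg_cst.
  rewrite (cvg_shiftn N (fun n => eint W (D n) w)).
  by apply: cvg_trans h; apply: near_eq_cvg; near=> n; rewrite nitems_int.
 exact: cvg_comp _ _ h2 (@exprn_continuous R 2 _).
move=> n.
have := ito_lin HW dvH dch tsT (-1) (iD N) (iD (n + N)%N).
move=> /(ito_L2 HW dvH dch tsT) h.
apply: le_trans (_ : \int[P]_w (`|(-1) *: eint W (D N) w + eint W (D (n + N)%N) w| ^+ 2)%:E <= _)%E.
 by apply: le_int => [//|w _|w _]; rewrite lee_fin ?sqr_ge0// scaleN1r addrC.
apply: le_trans h _.
have pD k : pmeas t s (fun r w => `|Ps r w - efun (D k) r w| ^+ 2).
 exact: (sub_pow_pmeas HW dch tsT).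
have h2 : (EI P t s (fun r w => `|(-1) *: efun (D N) r w + efun (D (n + N)%N) r w| ^+ 2)%R <=
  (eps / 32)%:E)%E.
 apply: (@le_trans _ _ (2%:E * EI P t s (fun r w => `|Ps r w - efun (D N) r w| ^+ 2)%R +
  2%:E * EI P t s (fun r w => `|Ps r w - efun (D (n + N)%N) r w| ^+ 2)%R)%E).
  apply: EI_le2 => [|||||| r w _]; [exact: pD|exact: pD|by move=> r w; exact: sqr_ge0|
   by move=> r w; exact: sqr_ge0|by []|by []|].
  rewrite sqr_ge0/= -[X in _ <= _ + 2 * X ^+ 2]normrN.
  apply: le_trans (norm_sqrD _ _); rewrite opprB [X in _ <= `|X| ^+ 2](_ : _ =
   (-1) *: efun (D N) r w + efun (D (n + N)%N) r w)// scaleN1r.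
  by abel.
 apply: (lee_comb2 _ _ (dN N (leqnn N)) (dN _ (leq_addl _ _))) => //. by lra.
apply: le_trans (_ : 32%:E * (eps / 32)%:E <= _)%E; first exact: lee_wpmul2l.
by rewrite -EFinM lee_fin mulrC divfK.
Unshelve. all: by end_near. Qed.

End AtTime.

End Noise.

Section Drift.
Local Notation atom := (fun (_ : unit) (h : H) => h).
Local Notation B := (fun (s : R) (_ : unit) (_ : Om) => s).
Local Notation U := (fun q (x : H) => S q x).
Implicit Types (E : nat -> seq (set Om * unit * H)).
Let leb := @lebesgue_measure R.

Let vl n : seq (unit * H) := [:: (tt, vH n)].

Let dvl : dense_seq (fun n => \sum_(x <- vl n) atom x.1 x.2).
Proof.
by rewrite (_ : (fun n => _) = vH)//; apply/funext => n; rewrite /vl big_seq1.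
Qed.

Let aB s (i : unit) : t <= s <= T -> measT (B s i : Gs P W t s -> R).
Proof. by move=> _; exact: mcst. Qed.

Let cB (i : unit) : {ae P, forall w, {within `[t, T], continuous (fun s => B s i w)}}.
Proof. by apply: aeW => w; apply: continuous_subspaceT => x; exact: cvg_id. Qed.

Let UD s x y : U s (x + y) = U s x + U s y. Proof. exact: linearD. Qed.
Let UZ s (k : R) x : U s (k *: x) = k *: U s x. Proof. exact: linearZZ. Qed.
Let UB s x y : U s (x - y) = U s x - U s y. Proof. exact: linearB. Qed.
Let Uatom s (i : unit) h : U s (atom i h) = atom i (S s h). Proof. by []. Qed.
Let aZ (k : R) (i : unit) h : atom i (k *: h) = k *: atom i h. Proof. by []. Qed.

Lemma drift_inc s r e w : einc B s r e w = (r - s) *: eval atom e w.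
Proof.
rewrite /einc /eval scaler_sumr; apply: eq_bigr => x _ /=.
by rewrite scalerA mulrC.
Qed.

(** For the drift a pathwise estimate suffices: contractivity bounds the convolution by a sum over
    cells, and Cauchy-Schwarz in time gives the constant [T - t]. *)
Lemma drift_max m E (l : R) : lev P W t T m E -> 0 < l ->
 ((l ^+ 2)%:E * P [set w | exists2 i, (i <= 2 ^ m)%N &
   (l <= `|conv S B (dg t T m) (2 ^ m) E (dg t T m i) w|)%R] <=
  (T - t)%:E * \sum_(k < 2 ^ m) (dg t T m k.+1 - dg t T m k)%:E *
   \int[P]_w (`|eval atom (E k) w| ^+ 2)%:E)%E.
Proof.
move=> hE l0; set A := [set w | _].
pose X := conv S B (dg t T m) (2 ^ m) E; pose de k := dg t T m k.+1 - dg t T m k.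
have de0 k : 0 <= de k by rewrite subr_ge0; exact: dgS.
have tauS k : dg t T m k <= dg t T m k.+1 by exact: dgS.
have mX i : measT (X (dg t T m i) : Om -> borel H).
 exact: (@conv_meas R Xi H unit d Om P W t T HW tT S B vH dvH aB m E _ hE (dg_bound tT m i)).
have mA : measurable A.
 rewrite (_ : A = \bigcup_(i in [set i | (i <= 2 ^ m)%N]) [set w | l <= `|X (dg t T m i) w|]).
  apply: bigcup_measurable => i _. have := @borel_norm0 R _ Om H setT _ measurableT (mX i).
  move=> /(_ measurableT `[l, +oo[%classic (measurable_itv _)); rewrite setTI.
  by congr measurable; apply/seteqP; split => w /=; rewrite in_itv/= andbT.
 by apply/seteqP; split => w; [move=> [i iN h]; exists i|move=> [i iN h]; exists i].
have me k : measT (fun w => `|eval atom (E k) w| ^+ 2).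
 apply: borel_normX => //; have /andP[_ kT] := dg_bound tT m k.
 apply: (@Gs_fun _ _ _ _ _ _ _ _ HW (dg t T m k)) => //.
 exact: (@eval_meas R Xi H H unit d Om P W t T atom vl dvl _ _ kT (hE k)).
have Xb i w : (i <= 2 ^ m)%N -> `|X (dg t T m i) w| <= \sum_(k < i) de k * `|eval atom (E k) w|.
 elim: i => [|i IH] iN; first by rewrite /X conv_start// normr0 big_ord0.
 rewrite /X (conv_step hS)// big_ord_recr /=.
 apply: le_trans (sg_contr hS _ (de0 i)) _; apply: le_trans (ler_normD _ _) _.
 apply: lerD; first exact: IH (ltnW iN). by rewrite drift_inc normrZ (ger0_norm (de0 i)).
have sde n : \sum_(k < n) de k = dg t T m n - t.
 elim: n => [|n IH]; first by rewrite big_ord0 /dg ugrid0 subrr.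
 by rewrite big_ord_recr /= IH /de addrC addrA subrK.
pose Y w := \sum_(k < 2 ^ m) de k * `|eval atom (E k) w| ^+ 2.
have AY w : l ^+ 2 * \1_A w <= (T - t) * Y w.
 have Y0 : 0 <= Y w by apply: sumr_ge0 => k _; rewrite mulr_ge0// sqr_ge0.
 rewrite indicE; case: (boolP (w \in A)) => [/set_mem[i iN li]|_]; last first.
  by rewrite mulr0 mulr_ge0// subr_ge0.
 rewrite mulr1; apply: (@le_trans _ _ ((\sum_(k < 2 ^ m) de k * `|eval atom (E k) w|) ^+ 2)).
  apply: lerXn2r; rewrite ?nnegrE ?(ltW l0)//.
   by apply: sumr_ge0 => k _; rewrite mulr_ge0.
  apply: le_trans li _; apply: le_trans (Xb i w iN) _.
  rewrite -(big_mkord xpredT (fun k => de k * `|eval atom (E k) w|)).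
  rewrite -[leRHS](big_mkord xpredT (fun k => de k * `|eval atom (E k) w|)).
  rewrite [leRHS](@big_cat_nat _ _ _ i)//= lerDl; apply: sumr_ge0 => k _. by rewrite mulr_ge0.
 have := sum_CS (fun k : 'I_(2 ^ m) => Num.sqrt (de k)) (fun k => Num.sqrt (de k) * `|eval atom (E k) w|).
 under eq_bigr do rewrite mulrA -expr2 sqr_sqrtr//.
 under [X in _ <= X * _]eq_bigr do rewrite sqr_sqrtr//.
 under [X in _ <= _ * X]eq_bigr do rewrite exprMn sqr_sqrtr//.
 move=> /le_trans; apply; apply: ler_wpM2r => //.
 by rewrite sde lerD2r; case/andP: (dg_bound tT m (2 ^ m)).
rewrite -(setIT A) -(integral_indic P measurableT mA).
rewrite -intZ//; last exact: sqr_ge0.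
apply: (@le_trans _ _ (\int[P]_w ((T - t) * Y w)%:E)%E).
 apply: le_int => // w _; rewrite lee_fin; last exact: AY. by rewrite mulr_ge0// sqr_ge0.
have mY : measT Y.
 by apply: measurable_sum => k; apply: measurable_funM => //; exact: mcst.
rewrite intZ ?subr_ge0//; last by move=> w; apply: sumr_ge0 => k _; rewrite mulr_ge0// sqr_ge0.
apply: lee_wpmul2l; first by rewrite lee_fin subr_ge0.
under eq_integral do rewrite -sumEFin.
rewrite ge0_integral_sum//; last 2 first.
- by move=> k; apply/mEFinP; apply: measurable_funM => //; exact: mcst.
- by move=> k w _; rewrite lee_fin mulr_ge0// sqr_ge0.
by apply: lee_sum => k _; rewrite intZ// => w; exact: sqr_ge0.
Qed.

Definition dconv (Phi : R -> Om -> H) (M : R -> Om -> H) := isconv P W t T S U atom B Phi M.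

Lemma dconv_ex Phi : progressive P W t T Phi ->
 (EI P t T (fun r w => `|Phi r w| ^+ 2)%R < +oo)%E -> exists M, dconv Phi M.
Proof.
apply: (@exconv R Xi H H unit d Om P W t T HW tT S hS U atom B
 (sg_add hS) UD UZ (sg_contr hS) (sg_right hS) Uatom aZ vH dvH vl dvl aB cB (T - t) _ drift_max).
by rewrite subr_ge0.
Qed.

Lemma dconv_max Phi Phi' M M' (l r : R) : dconv Phi M -> dconv Phi' M' -> 0 < l -> 0 <= r ->
 progressive P W t T Phi -> progressive P W t T Phi' ->
 (EI P t T (fun r w => `|Phi r w - Phi' r w| ^+ 2)%R <= r%:E)%E ->
 ((l ^+ 2)%:E * P (far t T l (fun s w => M s w - M' s w)%R) <= (16 * (T - t) * r)%:E)%E.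
Proof.
apply: (@max2 R Xi H H unit d Om P W t T HW tT S hS U atom B
 (sg_add hS) UD UZ (sg_contr hS) (sg_right hS) Uatom aZ vH dvH vl dvl aB (T - t) _ drift_max).
by rewrite subr_ge0.
Qed.

Section AtTime.
Variables (s : R) (tsT : t <= s <= T).
Local Notation tau m := (dg t T m).

Definition ditems m E w : seq (set (realM R) * H) :=
 [seq (`]Num.min (tau m (val k)) s, Num.min (tau m (val k).+1) s]%classic : set (realM R),
    \1_(x.1.1) w *: S (Num.max (s - tau m (val k)) 0) x.2) |
   k <- index_enum 'I_(2 ^ m), x <- E (val k)].

Lemma ditems_bl m E w : bl `[t, s] (ditems m E w).
Proof.
move=> _ /allpairsPdep[k [x [_ xE ->]]] /=; have /andP[t1 _] := dg_bound tT m (val k).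
have ts : t <= s by case/andP: tsT.
split; first exact: measurable_itv.
 move=> r /=; rewrite !in_itv/= => /andP[h1 h2]; apply/andP; split.
  by apply: ltW; apply: le_lt_trans h1; rewrite le_min t1.
 by apply: le_trans h2 _; rewrite ge_min lexx orbT.
rewrite lebesgue_measure_itv /=; case: ifP => _; last by rewrite ltry.
by rewrite -EFinB ltry.
Qed.

Lemma ditems_int m E w : bint (ditems m E w) = conv S B (tau m) (2 ^ m) E s w.
Proof.
rewrite /bint /ditems big_allpairs_dep /=; apply: eq_bigr => k _.
rewrite drift_inc linearZ /= /eval (Ssum S) scaler_sumr; apply: eq_bigr => x _ /=.
transitivity ((Num.min (tau m k.+1) s - Num.min (tau m k) s) *:
 (\1_(x.1.1) w *: S (Num.max (s - tau m k) 0) x.2)); last by rewrite (linearZZ (S _)).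
congr (_ *: _); have h : Num.min (tau m k) s <= Num.min (tau m k.+1) s.
 by rewrite le_min !ge_min lexx orbT dgS.
rewrite lebesgue_measure_itv /= lte_fin; case: ltP => // h'.
by apply/esym/eqP; rewrite subr_eq0 eq_le h h'.
Qed.

Lemma ditems_fun m E r w : t <= r <= s ->
 bfun (ditems m E w) r = S (s - r) (gfunU U atom (tau m) (2 ^ m) E r w).
Proof.
move=> /andP[tr rs]; rewrite /bfun /ditems big_allpairs_dep /= /gfunU (Ssum S).
apply: eq_bigr => k _; rewrite linearZ /= /cell.
have -> : (tau m k < r <= tau m k.+1)%R%:R =
  (\1_(`]Num.min (tau m k) s, Num.min (tau m k.+1) s]) r : R).
 rewrite indicE mem_setE in_itv /= le_min rs andbT gt_min [s < r]ltNge rs/= orbF. by [].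
rewrite indicE; case: (boolP (_ \in _)) => [|_]; last first.
 by rewrite scale0r big1// => x _; rewrite scale0r.
rewrite mem_setE in_itv /= => /andP[+ _]; rewrite gt_min [s < r]ltNge rs orbF => kr.
rewrite scale1r -(sg_add hS) ?subr_ge0 ?(ltW kr)// addrA subrK.
rewrite /eval (Ssum S); apply: eq_bigr => x _.
rewrite scale1r linearZ /= max_l// subr_ge0; exact: le_trans (ltW kr) rs.
Qed.

(** The Bochner integral is a pathwise notion, so a subsequence with mean errors [2^-j] is
    extracted, along which the errors vanish on almost every path. The bound [a <= a^2 / de + de]
    passes from mean square to mean. *)
Lemma dconv_bochner Phi M : dconv Phi M -> progressive P W t T Phi ->
 {ae P, forall w, is_bochner_integral `[t, s] (fun r => S (s - r) (Phi r w)) (M s w)}.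
Proof.
move=> [pM cM [m [E [hE eE aE]]]] pP; have /andP[ts sT] := tsT.
have sss : t <= s <= s by rewrite ts lexx.
pose Ps r w := S (s - r) (Phi r w).
have pPs : progressive P W t s Ps.
 exact: (@prog_semigroup R Xi H d Om P W t T _ dvH U (sg_add hS) UB (sg_contr hS) (sg_right hS) s Phi tsT pP).
have mPs w : measurable_fun `[t, s] (Ps ^~ w : realM R -> borel H).
 apply: (borel_ballP dvH) => [|n]; first exact: measurable_itv.
 have pn : progressive P W t s (fun r w => Ps r w - vH n) by apply: (progB dvH) => //; exact: prog_cst.
 have := @EI_section R d Om t s _ w (prog_pow HW 1 tsT pn).
 by apply: eq_measurable_fun => r _; rewrite expr1.
pose G n := gfunU U atom (tau (m n)) (2 ^ m n) (E n).
have p2 n : pmeas t T (fun r w => `|Phi r w - G n r w| ^+ 2).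
 exact: (@sub_gfunU_pmeas R Xi H H unit d Om P W t T HW tT U atom
  (sg_add hS) UD UZ (sg_contr hS) (sg_right hS) vl dvl Phi (m n) (E n) pP (hE n)).
have p1 n : pmeas t T (fun r w => `|Phi r w - G n r w|).
 have pG := @gfunU_prog R Xi H H unit d Om P W t T U atom
  (sg_add hS) UD UZ (sg_contr hS) (sg_right hS) vl dvl (m n) (E n) (hE n).
 have := prog_pow HW 1 (_ : t <= T <= T) (progB dvH pP pG); rewrite tT lexx => /(_ isT).
 by rewrite /pmeas; under eq_fun do rewrite expr1.
pose q j : R := 2^-1 ^+ j; have q0 j : 0 < q j by rewrite exprn_gt0// invr_gt0.
pose de j := q j / (2 * (T - t + 1)).
have T0 : 0 < T - t + 1 by rewrite ltr_wpDl// subr_ge0.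
have de0 j : 0 < de j by rewrite divr_gt0// mulr_gt0.
have hk j : exists k, (j <= k)%N /\
  (EI P t T (fun r w => `|Phi r w - G k r w| ^+ 2)%R <= (de j * q j / 2)%:E)%E.
 have e0 : 0 < de j * q j / 2 by rewrite divr_gt0// mulr_gt0.
 by have [N hN] := cvge0_le eE e0; exists (maxn j N); rewrite leq_maxl; split => //; apply: hN; rewrite leq_maxr.
have [k hkj] := choice hk.
have hI j : (EI P t s (fun r w => `|Phi r w - G (k j) r w|)%R <= (q j)%:E)%E.
 apply: le_trans (EI_sub _ sT (p1 (k j)) _) _; first by move=> r w.
 apply: (@le_trans _ _ ((de j)^-1%:E * EI P t T (fun r w => `|Phi r w - G (k j) r w| ^+ 2)%R +
  (de j)%:E * EI P t T (fun _ _ => 1%R))%E).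
  apply: EI_le2 => [|||||| r w _]; [exact: p2|exact: mcst|by move=> r w; exact: sqr_ge0|
   by []|by rewrite invr_ge0 ltW|exact: ltW|].
  rewrite normr_ge0/= mulr1; move: `|_| (normr_ge0 (Phi r w - G (k j) r w)) => a a0.
  have h : a * de j <= a ^+ 2 + de j ^+ 2.
   by have := sqr_ge0 (a - de j); have := de0 j; move: (de j) => z; nra.
  rewrite -(ler_pM2r (de0 j)) (le_trans h)// mulrDl mulrC mulrA divff ?gt_eqF// mul1r.
  by rewrite expr2.
 apply: (lee_comb2 _ _ (hkj j).2); [by rewrite invr_ge0 ltW|exact: ltW|by rewrite EI_cst// mul1r|].
 have -> : (de j)^-1 * (de j * q j / 2) = q j / 2 by field; rewrite gt_eqF.
 have : de j * (T - t) <= q j / 2.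
  rewrite /de [leLHS](_ : _ = q j / 2 * ((T - t) / (T - t + 1))); last by field; rewrite gt_eqF.
  rewrite -[leRHS]mulr1; apply: ler_wpM2l; first by rewrite divr_ge0// ltW.
  by rewrite ler_pdivrMr// mul1r lerDl.
 by rewrite mul1r; move: (de j * _) (q j) => x y; lra.
have p1s j : pmeas t s (fun r w => `|Phi r w - G (k j) r w|).
 have -> : pmeas t s = fun f : R -> Om -> R => measurable_fun (strip t s)
  (fun z : realM R * Om => f z.1 z.2) by [].
 apply: measurable_funS (p1 (k j)); first exact: strip_meas.
 move=> z [/= + _]; rewrite in_itv/= => /andP[z1 z2]; split => //=.
 by rewrite in_itv/= z1 (le_trans z2).
have cI := EI_ae_cvg0 p1s (fun j r w => normr_ge0 _) hI.
apply: (ae_imp2 _ aE cI) => w hM hw.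
apply: (@bochner_lim R H _ _ _ (fun j => ditems (m (k j)) (E (k j)) w)) => //; first exact: mPs.
- by move=> j; exact: ditems_bl.
- apply: (@squeeze_cvge _ _ _ _ (fun=> 0%E) _ (fun j => \int[leb]_(r in `[t, s]) `|Phi r w - G (k j) r w|%:E)%E) => //.
  near=> j; apply/andP; split; first by apply: integral_ge0 => r _; rewrite lee_fin.
  apply: le_int => [|r _|r]; [exact: measurable_itv|by rewrite lee_fin|].
  rewrite /= in_itv/= => rs; rewrite lee_fin ditems_fun// -linearB.
  by apply: (sg_contr hS); rewrite subr_ge0; case/andP: rs.
 exact: cvg_cst.
under eq_fun do rewrite ditems_int.
have h := hM s tsT; apply/cvgrPdist_lt => e e0.
have /cvgrPdist_lt/(_ e e0)[N _ hN] := h; exists N => // j /= jN; apply: hN.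
by apply: leq_trans jN _; exact: (hkj j).1.
Unshelve. all: by end_near. Qed.

End AtTime.

End Drift.
End StochasticConvolution.

(** * Exponentially weighted estimates for the mild equation *)

Lemma int_jensen R (n : nat) (D : set (realM R)) (rho h : R -> R) (y B : R) :
 (forall u v : R, 0 <= u -> 0 <= v -> n.+1%:R * u * v ^+ n <= u ^+ n.+1 + n%:R * v ^+ n.+1) ->
 measurable D -> measurable_fun D rho -> measurable_fun D (fun r => (rho r)^-1) ->
 measurable_fun D h ->
 (forall r, 0 < rho r) -> (forall r, 0 <= h r) -> 0 <= y -> 0 < B ->
 (y%:E <= \int[leb]_(r in D) (h r)%:E)%E ->
 (\int[leb]_(r in D) (rho r)%:E <= B%:E)%E ->
 ((y ^+ n.+1)%:E <= (B ^+ n)%:E * \int[leb]_(r in D) (h r ^+ n.+1 / rho r ^+ n)%:E)%E.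
Proof.
move=> amgm mD mr mri mh r0 h0 y0 B0 yh rB; set A := (\int[_]_(_ in _) (_ / _)%:E)%E.
have q0 r : 0 <= h r ^+ n.+1 / rho r ^+ n by rewrite divr_ge0// exprn_ge0// ltW.
have A0 : (0 <= A)%E by apply: integral_ge0 => r _; rewrite lee_fin.
move: y0; rewrite le_eqVlt => /predU1P[<-|y0].
 by rewrite expr0n; apply: mule_ge0 => //; rewrite lee_fin exprn_ge0// ltW.
(* Young's inequality is integrated with this parameter, the optimal one when [y] and [B] are
   attained. It stands for Holder's inequality with weight [rho]. *)
pose la := y / B; have la0 : 0 < la by rewrite divr_gt0.
have mq : measurable_fun D (fun r => h r ^+ n.+1 / rho r ^+ n).
 apply: measurable_funM; first exact: measurable_funX.
 by under eq_fun do rewrite -exprVn; exact: measurable_funX.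
have key : ((n.+1%:R * la ^+ n * y)%:E <= A + (n%:R * la ^+ n.+1 * B)%:E)%E.
 rewrite EFinM; apply: le_trans (_ : (n.+1%:R * la ^+ n)%:E * \int[leb]_(r in D) (h r)%:E <= _)%E.
  by apply: lee_wpmul2l => //; rewrite lee_fin mulr_ge0// exprn_ge0// ltW.
 rewrite -intZ//; last by rewrite mulr_ge0// exprn_ge0// ltW.
 apply: le_trans (_ : A + (n%:R * la ^+ n.+1)%:E * \int[leb]_(r in D) (rho r)%:E <= _)%E; last first.
  rewrite (EFinM (n%:R * la ^+ n.+1)); apply: leeD2l; apply: lee_wpmul2l => //.
  by rewrite lee_fin mulr_ge0// exprn_ge0// ltW.
 rewrite -intZ//; [|by move=> r; exact: ltW|by rewrite mulr_ge0// exprn_ge0// ltW].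
 rewrite -intD//; [|by apply: measurable_funM => //; exact: mcst|
  by move=> r; rewrite !mulr_ge0// ?exprn_ge0// ltW].
 apply: le_int => // r _; rewrite lee_fin; first by rewrite mulr_ge0// mulr_ge0// exprn_ge0// ltW.
 have rn : 0 < rho r ^+ n by rewrite exprn_gt0.
 have := ler_wpM2l (ltW (r0 r)) (amgm (h r / rho r) la (divr_ge0 (h0 r) (ltW (r0 r))) (ltW la0)).
 have -> : rho r * (n.+1%:R * (h r / rho r) * la ^+ n) = n.+1%:R * la ^+ n * h r.
  by field; rewrite gt_eqF.
 move=> /le_trans; apply; rewrite expr_div_n mulrDr (exprS (rho r)).
 by rewrite invfM !mulrA [rho r * _ / _]mulrAC -!mulrA mulVKf ?gt_eqF// mulrCA (mulrC (rho r)) !mulrA.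
have laB : la * B = y by rewrite /la divfK// gt_eqF.
clearbody la.
move: A0 key; case: A => [a| |]//=.
 rewrite -EFinM -EFinD !lee_fin => a0 k. have : la ^+ n * y <= a.
  have kB : n%:R * la ^+ n.+1 * B = n%:R * (la ^+ n * y) by rewrite exprSr -!mulrA laB.
  by move: k; rewrite kB -natr1 -mulrA mulrDl mul1r; move: (la ^+ n * y) (n%:R * _) => z m; lra.
 move=> /(ler_wpM2l (ltW (exprn_gt0 n B0))) k2; apply: le_trans k2.
 by rewrite mulrA -exprMn mulrC [B * la]mulrC laB exprS mulrC.
by move=> _ _; rewrite gt0_muley ?lte_fin ?exprn_gt0// leey.
Qed.

Lemma amgm2 R (u v : R) : 0 <= u -> 0 <= v -> 2 * u * v ^+ 1 <= u ^+ 2 + 1 * v ^+ 2.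
Proof. by move=> _ _; have := sqr_ge0 (u - v); nra. Qed.

Lemma amgm4 R (u v : R) : 0 <= u -> 0 <= v -> 4 * u * v ^+ 3 <= u ^+ 4 + 3 * v ^+ 4.
Proof.
move=> u0 v0; rewrite -subr_ge0 [X in 0 <= X](_ : _ = (u - v) ^+ 2 * (u ^+ 2 + 2 * u * v + 3 * v ^+ 2)).
 by rewrite mulr_ge0 ?sqr_ge0// !addr_ge0 ?mulr_ge0 ?sqr_ge0.
by ring.
Qed.

Lemma norm3_sqr R (V : normedModType R) (x y z : V) :
 `|x + y + z| ^+ 2 <= 3 * `|x| ^+ 2 + 3 * `|y| ^+ 2 + 3 * `|z| ^+ 2.
Proof.
apply: le_trans (_ : (`|x| + `|y| + `|z|) ^+ 2 <= _).
 apply: lerXn2r; rewrite ?nnegrE ?addr_ge0//.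
 by apply: le_trans (ler_normD _ _) _; rewrite lerD2r ler_normD.
move: `|x| `|y| `|z| => a b c; have := sqr_ge0 (a - b); have := sqr_ge0 (b - c); have := sqr_ge0 (a - c).
by nra.
Qed.

Lemma norm3_4 R (V : normedModType R) (x y z : V) :
 `|x + y + z| ^+ 4 <= 27 * `|x| ^+ 4 + 27 * `|y| ^+ 4 + 27 * `|z| ^+ 4.
Proof.
have := norm3_sqr x y z; rewrite !(exprM _ 2 2).
move: (_ ^+ 2) (sqr_ge0 `|x + y + z|) (sqr_ge0 `|x|) (sqr_ge0 `|y|) (sqr_ge0 `|z|) => m.
move: (`|x| ^+ 2) (`|y| ^+ 2) (`|z| ^+ 2) => a b c m0 a0 b0 c0 h.
apply: le_trans (_ : (3 * a + 3 * b + 3 * c) ^+ 2 <= _).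
 by apply: lerXn2r; rewrite ?nnegrE// !addr_ge0// mulr_ge0.
have := sqr_ge0 (a - b); have := sqr_ge0 (b - c); have := sqr_ge0 (a - c).
by nra.
Qed.

Section BochnerLin.
Variables (R : realType) (H : hilbertType R) (vH : nat -> H) (dvH : dense_seq vH).
Variables (D : set (realM R)) (mD : measurable D).

Lemma bochner_lists (f : R -> H) y : is_bochner_integral D f y ->
 exists L : nat -> seq (set (realM R) * H), [/\ forall n, bl D (L n),
  (\int[leb]_(r in D) `|f r - bfun (L n) r|%:E)%E @[n --> \oo] --> 0%E &
  bint (L n) @[n --> \oo] --> y].
Proof.
move=> [mf [u [hu cu iu]]].
exists (fun n => [seq (@step_set _ _ (u n) i, @step_val _ _ (u n) i) | i <- index_enum 'I_(step_size (u n))]).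
split.
- by move=> n x /mapP[i _ ->]; exact: hu.
- apply: cvg_trans cu; apply: near_eq_cvg; near=> n.
 by apply: eq_integral => r _; rewrite /bfun big_map.
- by apply: cvg_trans iu; apply: near_eq_cvg; near=> n; rewrite /bint big_map.
Unshelve. all: by end_near. Qed.

Lemma bochner_lin (c : R) (f f' : R -> H) y y' : is_bochner_integral D f y ->
 is_bochner_integral D f' y' ->
 is_bochner_integral D (fun r => c *: f r + f' r) (c *: y + y').
Proof.
move=> h h'; have [mf _] := h; have [mf' _] := h'.
have [l [hl c1 c2]] := bochner_lists h; have [l' [hl' c1' c2']] := bochner_lists h'.
pose L n := [seq (x.1, c *: x.2) | x <- l n] ++ l' n.
have fL n r : bfun (L n) r = c *: bfun (l n) r + bfun (l' n) r.
 rewrite /bfun big_cat big_map /= scaler_sumr; congr (_ + _).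
 by apply: eq_bigr => x _; rewrite !scalerA mulrC.
have iL n : bint (L n) = c *: bint (l n) + bint (l' n).
 rewrite /bint big_cat big_map /= scaler_sumr; congr (_ + _).
 by apply: eq_bigr => x _; rewrite !scalerA mulrC.
apply: (@bochner_lim R H D _ _ L).
- by apply: (borelD dvH) => //; exact: (borelZ dvH).
- move=> n x; rewrite mem_cat => /orP[/mapP[z zl ->]|]; last exact: hl'.
 exact: hl zl.
- have mn g k : measurable_fun D (g : realM R -> borel H) -> bl D k ->
   measurable_fun D (fun r => `|g r - bfun k r|).
  by move=> mg hk; apply: borel_norm0 => //; apply: (borelB dvH) => //; exact: (bfun_meas dvH).
 apply: (@squeeze_cvge _ _ _ _ (fun=> 0%E) _ (fun n => `|c|%:E * \int[leb]_(r in D) `|f r - bfun (l n) r|%:E +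
   \int[leb]_(r in D) `|f' r - bfun (l' n) r|%:E)%E).
 + near=> n; apply/andP; split; first by apply: integral_ge0 => r _; rewrite lee_fin.
  rewrite -intZ//; last exact: mn.
  rewrite -intD//; [|by apply: measurable_funM; [exact: mcst|exact: mn]|exact: mn].
  apply: le_int => // r _; rewrite lee_fin fL.
  have -> : c *: f r + f' r - (c *: bfun (l n) r + bfun (l' n) r) =
   c *: (f r - bfun (l n) r) + (f' r - bfun (l' n) r) by rewrite scalerBr opprD addrACA.
  by apply: le_trans (ler_normD _ _) _; rewrite normrZ.
 + exact: cvg_cst.
 + rewrite -[X in _ --> X](_ : `|c|%:E * 0 + 0 = 0)%E; last by rewrite mule0 adde0.
  by apply: cvgeD => //; apply: cvgeZl.
- under eq_fun do rewrite iL; apply: cvgD => //; exact: cvgZr.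
Unshelve. all: by end_near. Qed.

End BochnerLin.

Lemma EI_exp R d (Om : measurableType d) (P : probability Om R) (t s K c : R)
  (g : R -> Om -> R) : t <= s -> 0 < c -> 0 <= K -> pmeas t s g -> (forall r w, 0 <= g r w) ->
 (forall r, t <= r <= s -> (\int[P]_w (g r w)%:E <= (K * expR (c * (r - t)))%:E)%E) ->
 (EI P t s g <= (K * (expR (c * (s - t)) / c))%:E)%E.
Proof.
move=> ts c0 K0 mg g0 hg; rewrite EI_swap//.
have mE : measurable_fun `[t, s] (fun r : R => expR (c * (r - t))).
 apply: measurable_funTS; apply: measurableT_comp => //.
 by apply: measurable_funM => //; exact: measurable_funB.
apply: (@le_trans _ _ (\int[leb]_(r in `[t, s]) (K * expR (c * (r - t)))%:E)%E).
 apply: le_int => [|r _|r]; [exact: measurable_itv|by apply: integral_ge0 => w _; rewrite lee_fin|].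
 by rewrite /= in_itv/= => rs; exact: hg.
rewrite intZ//.
rewrite (EFinM K); apply: lee_wpmul2l => //; exact: int_expR.
Qed.

Section Rep.
Variables (R : realType) (Xi H : hilbertType R)
 (d : measure_display) (Om : measurableType d) (P : probability Om R)
 (W : R -> Xi -> Om -> R) (t T : R)
 (HW : reference_space P W t T)
 (S : R -> bounded_op H H) (hS : contraction_semigroup S)
 (vH : nat -> H) (dvH : dense_seq vH)
 (ch : nat -> seq (Xi * H)) (dch : dense_seq (fun n => rk (ch n))).
Implicit Types (f : R -> Om -> H) (Phi : R -> Om -> hs Xi H) (y : Om -> H).

(** The mild equation at a single time, with coefficients forgotten to be functions of the solution.
    In this form it is linear, so differences and second differences of solutions satisfy it as
    well. *)
Definition rep s (x : H) f Phi y := exists Ib Is : Om -> H,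
 [/\ {ae P, forall w, is_bochner_integral `[t, s] (fun r => S (s - r) (f r w)) (Ib w)},
   is_ito_integral P W t s (fun r w => hs_comp (S (s - r)) (Phi r w)) Is &
   {ae P, forall w, y w = S (s - t) x + Ib w + Is w}].

Lemma rep_lin s (c : R) x f Phi y x' f' Phi' y' : t <= s <= T ->
 rep s x f Phi y -> rep s x' f' Phi' y' ->
 rep s (c *: x + x') (fun r w => c *: f r w + f' r w)
  (fun r w => c *: Phi r w + Phi' r w) (fun w => c *: y w + y' w).
Proof.
move=> tsT [Ib [Is [hb hs hy]]] [Ib' [Is' [hb' hs' hy']]].
exists (fun w => c *: Ib w + Ib' w), (fun w => c *: Is w + Is' w); split.
- apply: (ae_imp2 _ hb hb') => w b1 b2.
 have := bochner_lin dvH (measurable_itv _) c b1 b2.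
 have -> // : (fun r => S (s - r) (c *: f r w + f' r w)) =
  fun r => c *: S (s - r) (f r w) + S (s - r) (f' r w).
 by apply/funext => r; rewrite linearP.
- have := ito_lin HW dvH dch tsT c hs hs'.
 congr (is_ito_integral _ _ _ _ _ _); apply/funext => r; apply/funext => w.
 by rewrite hs_compD hs_compZ.
- apply: (ae_imp2 _ hy hy') => w -> ->; rewrite linearP !scalerDr.
 by rewrite addrACA [X in X + _]addrACA.
Qed.

Lemma exp_meas (c : R) (D : set (realM R)) : measurable_fun D (fun r : R => expR (c * (r - t))).
Proof.
apply: measurable_funTS; apply: measurableT_comp => //.
by apply: measurable_funM => //; exact: measurable_funB.
Qed.

Lemma expI_meas (c : R) (D : set (realM R)) :
 measurable_fun D (fun r : R => (expR (c * (r - t)))^-1).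
Proof.
have -> : (fun r : R => (expR (c * (r - t)))^-1) = fun r => expR ((- c) * (r - t)).
 by apply/funext => r; rewrite mulNr expRN.
exact: exp_meas.
Qed.

Lemma pmeas_time (D : R -> R) g s : measT (D : realM R -> R) ->
 pmeas t s g -> pmeas t s (fun r (w : Om) => g r w * D r).
Proof.
move=> mD mg; apply: measurable_funM => //; apply: measurable_funTS.
exact: measurableT_comp mD measurable_fst.
Qed.

(** Three terms give the factor 3; the drift is handled by [int_jensen] with weight [rho] and the
    noise by [ito_L2], whence [96 = 3 * 32]. *)
Lemma rep_core2 s x f Phi y (rho : R -> R) (B : R) : t <= s <= T -> rep s x f Phi y ->
 progressive P W t T f -> progressive P W t T Phi ->
 measT (rho : realM R -> R) ->
 measT ((fun r => (rho r)^-1) : realM R -> R) ->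
 (forall r, 0 < rho r) -> 0 < B -> (\int[leb]_(r in `[t, s]) (rho r)%:E <= B%:E)%E ->
 (\int[P]_w (`|y w| ^+ 2)%:E <= (3 * `|x| ^+ 2)%:E +
  ((3 * B)%:E * EI P t s (fun r w => `|f r w| ^+ 2 / rho r)%R +
   96%:E * EI P t s (fun r w => `|Phi r w| ^+ 2)%R))%E.
Proof.
move=> tsT [Ib [Is [hb hs hy]]] pf pP mr mri r0 B0 hB; have /andP[ts sT] := tsT.
have pfs := prog_le sT pf; have pPs := prog_le sT pP.
have mf : pmeas t s (fun r w => `|f r w| ^+ 2 / rho r).
 by apply: pmeas_time => //; exact: (prog_pow HW 2 tsT).
have f0 r w : 0 <= `|f r w| ^+ 2 / rho r by rewrite divr_ge0 ?sqr_ge0// ltW.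
pose Z w := (\int[leb]_(r in `[t, s]) (`|f r w| ^+ 2 / rho r)%:E)%E.
have mZ : measT Z by apply: EI_inner_meas => // r w _.
have Z0 w : (0 <= Z w)%E by apply: integral_ge0 => r _; rewrite lee_fin.
have [_ mIs _] := hs.
have m2 : measT (fun w => `|Is w| ^+ 2) by exact: borel_normX.
have hae : {ae P, forall w, ((`|y w| ^+ 2)%:E <= (3 * `|x| ^+ 2)%:E + ((3 * B)%:E * Z w +
  (3 * `|Is w| ^+ 2)%:E))%E}.
 apply: (ae_imp2 _ hb hy) => w hI ->.
 have h1 : (`|Ib w|%:E <= \int[leb]_(r in `[t, s]) `|f r w|%:E)%E.
  apply: le_trans (bochner_le dvH (measurable_itv _) hI) _.
  apply: le_int => [|r _|r]; [exact: measurable_itv|by rewrite lee_fin|].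
  rewrite /= in_itv/= => rs; rewrite lee_fin; apply: (sg_contr hS).
  by rewrite subr_ge0; case/andP: rs.
 have mfw : measurable_fun `[t, s] (fun r => `|f r w|).
  have := EI_section w (prog_pow HW 1 tsT pfs). by apply: eq_measurable_fun => r _; rewrite expr1.
 have h2 := int_jensen (n := 1) (@amgm2 R) (measurable_itv _) (measurable_funTS mr) (measurable_funTS mri)
  mfw r0 (fun r => normr_ge0 _) (normr_ge0 (Ib w)) B0 h1 hB.
 apply: le_trans (_ : (3 * `|x| ^+ 2 + (3 * `|Ib w| ^+ 2 + 3 * `|Is w| ^+ 2))%:E <= _)%E.
  rewrite lee_fin addrA; apply: le_trans (norm3_sqr _ _ _) _; rewrite !lerD2r ler_pM2l//.
  by apply: lerXn2r; rewrite ?nnegrE//; apply: (sg_contr hS); rewrite subr_ge0.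
 rewrite EFinD EFinD; apply: leeD2l; apply: leeD2r; rewrite !EFinM -muleA; apply: lee_wpmul2l => //.
pose Q w := ((3 * `|x| ^+ 2)%:E + ((3 * B)%:E * Z w + (3 * `|Is w| ^+ 2)%:E))%E.
have B30 : 0 <= 3 * B by rewrite mulr_ge0// ltW.
have x0 : 0 <= 3 * `|x| ^+ 2 by rewrite mulr_ge0// sqr_ge0.
have i0 w : 0 <= 3 * `|Is w| ^+ 2 by rewrite mulr_ge0// sqr_ge0.
have ZB w : (0 <= (3 * B)%:E * Z w)%E by exact: mule_ge0.
have mi : measT (fun w => (3 * `|Is w| ^+ 2)%:E).
 by apply/mEFinP; apply: measurable_funM => //; exact: mcst.
have mz : measT (fun w => (3 * B)%:E * Z w)%E by exact: measurable_funeM.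
apply: (@le_trans _ _ (\int[P]_w Q w)%E).
 apply: le_ae_int => [//|w _|w _|].
 - by rewrite lee_fin sqr_ge0.
 - by rewrite /Q !adde_ge0 ?lee_fin.
 - by apply: ae_imp hae => w h _; exact: h.
rewrite /Q ge0_integralD//; [|by move=> w _; exact: adde_ge0|exact: emeasurable_funD].
rewrite integral_cst//= probability_setT mule1; apply: leeD2l.
rewrite ge0_integralD// ge0_integralZl//; apply: leeD2l; rewrite intZ//.
have -> : (96%:E = 3%:E * 32%:E :> \bar R)%E by rewrite -EFinM; congr EFin; ring.
rewrite -muleA; apply: lee_wpmul2l => //.
have hE : (EI P t s (fun r w => `|hs_comp (S (s - r)) (Phi r w)| ^+ 2)%R <=
  EI P t s (fun r w => `|Phi r w| ^+ 2)%R)%E.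
 apply: EI_le => r w rs; rewrite sqr_ge0/=; apply: lerXn2r; rewrite ?nnegrE//.
 by apply: hs_comp_contr => //; rewrite subr_ge0; case/andP: rs.
have p32 : (0 <= 32%:E :> \bar R)%E by rewrite lee_fin ler0n.
exact: (le_trans (ito_L2 HW dvH dch tsT hs) (lee_wpmul2l p32 hE)).
Qed.

Lemma rep_L2 s x f Phi y : t <= s <= T -> rep s x f Phi y ->
 progressive P W t T f -> progressive P W t T Phi ->
 (\int[P]_w (`|y w| ^+ 2)%:E <= (3 * `|x| ^+ 2)%:E +
  ((3 * (s - t + 1))%:E * EI P t s (fun r w => `|f r w| ^+ 2)%R +
   96%:E * EI P t s (fun r w => `|Phi r w| ^+ 2)%R))%E.
Proof.
move=> tsT hr pf pP; have /andP[ts sT] := tsT.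
have B0 : 0 < s - t + 1 by rewrite ltr_wpDl// subr_ge0.
have := rep_core2 (rho := fun=> 1) (B := s - t + 1) tsT hr pf pP.
have -> : (fun r w => `|f r w| ^+ 2 / (1 : R)) = fun r w => `|f r w| ^+ 2.
 by apply/funext => r; apply/funext => w; rewrite divr1.
apply=> //.
rewrite integral_cst//=.
rewrite lebesgue_measure_itv/= lte_fin; case: ifP => _; last by rewrite mule0 lee_fin ltW.
by rewrite mul1e -EFinB lee_fin lerDl.
Qed.

(** The weight with half the rate is used for the drift: its integral is at most [2 / la] times its
    final value and enters twice, so [3 * 4 = 12] appears over [la^2]. The point is that the whole
    factor becomes small for large [la]. *)
Lemma rep_L2w s x f Phi y (K la : R) : t <= s <= T -> rep s x f Phi y ->
 progressive P W t T f -> progressive P W t T Phi -> 0 < la -> 0 <= K ->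
 (forall r, t <= r <= s -> (\int[P]_w (`|f r w| ^+ 2)%:E <= (K * expR (la * (r - t)))%:E)%E) ->
 (forall r, t <= r <= s -> (\int[P]_w (`|Phi r w| ^+ 2)%:E <= (K * expR (la * (r - t)))%:E)%E) ->
 (\int[P]_w (`|y w| ^+ 2)%:E <=
  (3 * `|x| ^+ 2 + K * (12 / la ^+ 2 + 96 / la) * expR (la * (s - t)))%:E)%E.
Proof.
move=> tsT hr pf pP la0 K0 hf hP; have /andP[ts sT] := tsT.
have pfs := prog_le sT pf; have pPs := prog_le sT pP.
have la2 : 0 < la / 2 by rewrite divr_gt0.
pose rho r := expR (la / 2 * (r - t)); pose B := expR (la / 2 * (s - t)) / (la / 2).
have B0 : 0 < B by rewrite divr_gt0// expR_gt0.
have EE q : expR (la * (q - t)) = rho q ^+ 2.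
 by rewrite /rho -expRM_natl; congr expR; field.
have := rep_core2 (rho := rho) (B := B) tsT hr pf pP (@exp_meas (la / 2) setT)
 (@expI_meas (la / 2) setT)
 (fun r => expR_gt0 _) B0 (int_expR la2 ts).
move=> /le_trans; apply.
have h1 : (EI P t s (fun r w => `|f r w| ^+ 2 / rho r)%R <= (K * B)%:E)%E.
 apply: EI_exp => //.
 - by apply: pmeas_time; [exact: (@expI_meas _ setT)|exact: (prog_pow HW 2 tsT)].
 - by move=> r w; rewrite divr_ge0 ?sqr_ge0 ?expR_ge0.
 - move=> r rs; under eq_integral do rewrite mulrC.
  have m2r : measT (fun w => `|f r w| ^+ 2) := EI_section2 rs (prog_pow HW 2 tsT pfs).
  have i0 : 0 <= (rho r)^-1 by rewrite invr_ge0 expR_ge0. rewrite intZ//.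
  apply: le_trans (lee_wpmul2l _ (hf r rs)) _; first by rewrite lee_fin invr_ge0 expR_ge0.
  rewrite -EFinM lee_fin EE -/(rho r) mulrCA expr2 mulKf//. by rewrite gt_eqF// expR_gt0.
have h2 : (EI P t s (fun r w => `|Phi r w| ^+ 2)%R <= (K * (expR (la * (s - t)) / la))%:E)%E.
 by apply: EI_exp => //; exact: (prog_pow HW 2 tsT).
rewrite [(3 * `|x| ^+ 2 + _)%:E]EFinD; apply: leeD2l.
apply: (lee_comb2 _ _ h1 h2) => //; first by rewrite mulr_ge0// ltW.
rewrite /B -/(rho s) !EE.
apply: ler_eq; field; by rewrite gt_eqF.
Qed.

(** At the initial time both integrals vanish. The case is separate because the fourth moment bound
    is proved for [t < s]. *)
Lemma rep_start x f Phi y : t <= T -> rep t x f Phi y -> {ae P, forall w, y w = x}.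
Proof.
move=> tT [Ib [Is [hb hs hy]]]; have ttT : t <= t <= T by rewrite lexx.
have [_ mIs _] := hs.
have m2 : measT (fun w => `|Is w| ^+ 2) by exact: borel_normX.
have hIs : {ae P, forall w, `|Is w| ^+ 2 @[n --> \oo] --> (0 : R)}.
 apply: (@ae_cvg0 _ _ _ P (fun _ w => `|Is w| ^+ 2)) => [//|n w|n]; first exact: sqr_ge0.
 apply: le_trans (ito_L2 HW dvH dch ttT hs) _; rewrite EI_point mule0 lee_fin.
 by rewrite exprn_ge0// invr_ge0.
have hb' := ae_imp2 (C := fun w => Ib w = 0 /\ Is w = 0) _ hb hIs.
apply: (ae_imp2 _ (hb' _) hy) => [w [-> ->] ->|w h1 h2].
 by rewrite subrr (sg0 hS) !addr0.
split.
 have := bochner_le dvH (measurable_itv _) h1.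
 rewrite set_itv1 integral_set1 lee_fin normr_le0 => /eqP; exact.
have : (0 : R) = `|Is w| ^+ 2.
 by apply: (@cvg_unique _ (@norm_hausdorff _ _) ((fun _ : nat => `|Is w| ^+ 2) @ \oo)) => //; exact: cvg_cst.
move=> /esym/eqP; by rewrite sqrf_eq0 normr_eq0 => /eqP.
Qed.

Section Local.
Variables (s : R) (tsT : t <= s <= T) (G : R -> set Om)
 (FG : forall r, t <= r <= s -> filt P W t r (G r))
 (Gle : forall q r, t <= q -> q <= r -> G r `<=` G q)
 (Glc : forall r w, t < r <= s -> (forall q, t <= q < r -> G q w) -> G r w).

(** The localized counterpart in fourth moment: [27 = 3^3] comes from three terms, the drift uses
    [int_jensen] with exponent 4 and weight of rate [c], and the noise uses [ito_L4] at rate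
    [2 c]. *)
Lemma rep_L4 x f Phi y (K c : R) : rep s x f Phi y ->
 progressive P W t T f -> progressive P W t T Phi -> 0 < c -> 0 < K ->
 (forall r, t <= r <= s -> (\int[P]_w (gind t G r w * `|f r w| ^+ 4)%:E <=
   (K * expR (4 * c * (r - t)))%:E)%E) ->
 (forall r, t <= r <= s -> (\int[P]_w (gind t G r w * `|Phi r w| ^+ 4)%:E <=
   (K * expR (4 * c * (r - t)))%:E)%E) ->
 (\int[P]_w (\1_(G s) w * `|y w| ^+ 4)%:E <=
  (27 * `|x| ^+ 4 + K * (27 / c ^+ 4 + 27 * (7 * 10 ^+ 4 * expR 1 / (2 * c) ^+ 2)) *
    expR (4 * c * (s - t)))%:E)%E.
Proof.
move=> hr pf pP c0 K0 hf hP; have /andP[ts sT] := tsT.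
have K00 := ltW K0; have c00 := ltW c0; have E0 : 0 < expR (4 * c * (s - t)) by exact: expR_gt0.
have G01 w : \1_(G s) w = 0 :> R \/ \1_(G s) w = 1 :> R.
 by rewrite indicE; case: (_ \in _); [right|left].
have mGs : measurable (G s) by apply: (filt_meas HW sT); apply: FG; rewrite ts lexx.
move: ts; rewrite le_eqVlt => /predU1P[tsE|ts].
 have hs : {ae P, forall w, y w = x}.
  by apply: (@rep_start x f Phi y); [rewrite (le_trans _ sT)// tsE|rewrite [X in rep X]tsE].
 apply: (@le_trans _ _ (\int[P]_w (`|x| ^+ 4)%:E)%E).
  apply: le_ae_int => [//|w _|w _|]; rewrite ?lee_fin ?mulr_ge0 ?exprn_ge0//.
  apply: ae_imp hs => w -> _; rewrite lee_fin -[leRHS]mul1r; apply: ler_wpM2r; first exact: exprn_ge0.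
  by case: (G01 w) => ->.
 rewrite integral_cst//= probability_setT mule1 lee_fin ler_wpDr//.
  rewrite mulr_ge0 ?expR_ge0// mulr_ge0// addr_ge0//; first by rewrite divr_ge0// exprn_ge0.
  rewrite mulr_ge0// divr_ge0//; last by rewrite exprn_ge0// mulr_ge0.
 by rewrite ler_peMl ?exprn_ge0// ler1n.
have [Ib [Is [hb hs hy]]] := hr.
have pfs := prog_le sT pf; have pPs := prog_le sT pP.
have tss : t <= s <= s by rewrite (ltW ts) lexx.
have mG : pmeas t s (gind t G).
 by apply: (Gs_pmeas HW sT); exact: (@gind_prog R Xi d Om P W t s G FG Gle Glc s tss).
pose rho r := expR (c * (r - t)); pose B := expR (c * (s - t)) / c.
have rho0 r : 0 < rho r by exact: expR_gt0.
have B0 : 0 < B by rewrite divr_gt0// expR_gt0.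
have EE q : expR (4 * c * (q - t)) = rho q ^+ 4.
 by rewrite /rho -expRM_natl; congr expR; rewrite mulrA.
have mf4 : pmeas t s (fun r w => gind t G r w * `|f r w| ^+ 4).
 by apply: measurable_funM => //; exact: (prog_pow HW 4 tsT).
have mri3 : measT ((fun r => (rho r ^+ 3)^-1) : realM R -> R).
 by under eq_fun do rewrite -exprVn; apply: measurable_funX; exact: (@expI_meas _ setT).
have mf : pmeas t s (fun r w => gind t G r w * `|f r w| ^+ 4 / rho r ^+ 3) by exact: pmeas_time.
have f0 r w : 0 <= gind t G r w * `|f r w| ^+ 4 / rho r ^+ 3.
 by rewrite divr_ge0 ?exprn_ge0 ?(ltW (rho0 r))// mulr_ge0 ?gind_ge0 ?exprn_ge0.
pose Z w := (\int[leb]_(r in `[t, s]) (gind t G r w * `|f r w| ^+ 4 / rho r ^+ 3)%:E)%E.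
have mZ : measT Z by apply: EI_inner_meas => // r w _.
have Z0 w : (0 <= Z w)%E by apply: integral_ge0 => r _; rewrite lee_fin.
have [_ mIs _] := hs.
have m4 : measT (fun w => \1_(G s) w * `|Is w| ^+ 4).
 by apply: measurable_funM; [exact: measurable_indic|exact: borel_normX].
have hae : {ae P, forall w, ((\1_(G s) w * `|y w| ^+ 4)%:E <= (27 * `|x| ^+ 4)%:E +
  ((27 * B ^+ 3)%:E * Z w + (27 * (\1_(G s) w * `|Is w| ^+ 4))%:E))%E}.
 apply: (ae_imp2 _ hb hy) => w hI ->; case: (G01 w) => Gw; rewrite Gw; rewrite ?mul0r ?mul1r.
  rewrite mulr0 adde0; apply: adde_ge0; first by rewrite lee_fin mulr_ge0// exprn_ge0.
  by apply: mule_ge0 => //; rewrite lee_fin mulr_ge0// exprn_ge0// (ltW B0).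
 have h1 : (`|Ib w|%:E <= \int[leb]_(r in `[t, s]) (gind t G r w * `|f r w|)%:E)%E.
  apply: le_trans (bochner_le dvH (measurable_itv _) hI) _. apply: le_ae_int => [|r _|r _|].
  - exact: measurable_itv.
  - by rewrite lee_fin.
  - by rewrite lee_fin mulr_ge0// gind_ge0.
  (* At time [t] the function [gind] vanishes by convention; a single time is negligible. *)
  exists [set t]; split; [exact: measurable_set1|exact: lebesgue_measure_set1|].
  move=> r /= h; apply: contrapT => rt; apply: h; rewrite /= in_itv/= => /andP[tr rs].
  have {}tr : t < r by rewrite lt_neqAle tr andbT; apply/eqP => /esym.
  rewrite lee_fin /gind tr mul1r indicE mem_set ?mul1r.
   by apply: (sg_contr hS); rewrite subr_ge0.
  apply: (Gle (ltW tr) rs); apply: contrapT => nG; move: Gw.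
  by rewrite indicE memNset// => /esym/eqP; rewrite oner_eq0.
 have mfw : measurable_fun `[t, s] (fun r => gind t G r w * `|f r w|).
  apply: measurable_funM; first exact: EI_section. have := EI_section w (prog_pow HW 1 tsT pfs).
  by apply: eq_measurable_fun => r _; rewrite expr1.
 have h2 := int_jensen (n := 3) (@amgm4 R) (measurable_itv _) (@exp_meas c _) (@expI_meas c _)
  mfw rho0 (fun r => mulr_ge0 (gind_ge0 _ _ _ _) (normr_ge0 _)) (normr_ge0 (Ib w)) B0 h1 (int_expR c0 (ltW ts)).
 apply: le_trans (_ : (27 * `|x| ^+ 4 + (27 * `|Ib w| ^+ 4 + 27 * `|Is w| ^+ 4))%:E <= _)%E.
  rewrite lee_fin addrA; apply: le_trans (norm3_4 _ _ _) _; rewrite !lerD2r ler_pM2l//.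
  by apply: lerXn2r; rewrite ?nnegrE//; apply: (sg_contr hS); rewrite subr_ge0 ltW.
 rewrite EFinD EFinD; apply: leeD2l; apply: leeD2r; rewrite !(EFinM 27) -muleA; apply: lee_wpmul2l => //.
 apply: le_trans h2 _; apply: lee_wpmul2l; first by rewrite lee_fin exprn_ge0// ltW.
 apply: le_int => // [r _|r _]; rewrite lee_fin.
  by rewrite divr_ge0 ?exprn_ge0 ?(ltW (rho0 r))// mulr_ge0// gind_ge0.
 rewrite exprMn; apply: ler_wpM2r; first by rewrite invr_ge0 exprn_ge0// ltW.
 apply: ler_wpM2r; first exact: exprn_ge0.
 by case: (gind01 t G r w) => [->|[-> _]]; rewrite ?expr1n// expr0n.
have hZ : (\int[P]_w Z w <= (K * B)%:E)%E.
 apply: (@EI_exp _ _ _ P t s K c) => //; first exact: ltW.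
 move=> r rs; under eq_integral do rewrite mulrC.
 have i0 : 0 <= (rho r ^+ 3)^-1 by rewrite invr_ge0 exprn_ge0// ltW.
 have m2r : measT (fun w => gind t G r w * `|f r w| ^+ 4) := EI_section2 rs mf4.
 have g0 w : 0 <= gind t G r w * `|f r w| ^+ 4 by rewrite mulr_ge0 ?gind_ge0 ?exprn_ge0.
 rewrite intZ//. apply: le_trans (lee_wpmul2l _ (hf r rs)) _; first by rewrite lee_fin.
 rewrite -EFinM lee_fin EE -/(rho r) mulrCA ler_pM2l// (exprS _ 3) mulrCA mulVf ?mulr1//.
 by rewrite gt_eqF// exprn_gt0.
have hN : (\int[P]_w (\1_(G s) w * `|Is w| ^+ 4)%:E <=
  (7 * 10 ^+ 4 * expR 1 * K * (expR (2 * c * (s - t)) / (2 * c)) ^+ 2)%:E)%E.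
 apply: (ito_L4 HW dvH dch ts sT FG Gle Glc hs) => //; first by rewrite mulr_gt0.
 move=> r rs; have EE2 : expR (2 * c * (r - t)) ^+ 2 = expR (4 * c * (r - t)).
  by rewrite -expRM_natl; congr expR; ring.
 rewrite EE2; apply: le_trans (hP r rs).
 apply: le_int => // w _; rewrite lee_fin ?mulr_ge0 ?gind_ge0 ?exprn_ge0//.
 apply: ler_wpM2l; first exact: gind_ge0.
 apply: lerXn2r; rewrite ?nnegrE//; apply: hs_comp_contr => //. by rewrite subr_ge0; case/andP: rs.
pose Q w := ((27 * `|x| ^+ 4)%:E + ((27 * B ^+ 3)%:E * Z w + (27 * (\1_(G s) w * `|Is w| ^+ 4))%:E))%E.
have B30 : 0 <= 27 * B ^+ 3 by rewrite mulr_ge0// exprn_ge0// ltW.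
have x0 : 0 <= 27 * `|x| ^+ 4 by rewrite mulr_ge0// exprn_ge0.
have i1 w : 0 <= \1_(G s) w * `|Is w| ^+ 4 by rewrite mulr_ge0// exprn_ge0.
have i0 w : 0 <= 27 * (\1_(G s) w * `|Is w| ^+ 4) by rewrite mulr_ge0.
have ZB w : (0 <= (27 * B ^+ 3)%:E * Z w)%E by exact: mule_ge0.
have mi : measT (fun w => (27 * (\1_(G s) w * `|Is w| ^+ 4))%:E).
 by apply/mEFinP; apply: measurable_funM => //; exact: mcst.
have mz : measT (fun w => (27 * B ^+ 3)%:E * Z w)%E by exact: measurable_funeM.
apply: (@le_trans _ _ (\int[P]_w Q w)%E).
 apply: le_ae_int => [//|w _|w _|].
 - by rewrite lee_fin mulr_ge0// exprn_ge0.
 - by rewrite /Q !adde_ge0 ?lee_fin.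
 - by apply: ae_imp hae => w h _; exact: h.
rewrite /Q ge0_integralD//; [|by move=> w _; exact: adde_ge0|exact: emeasurable_funD].
rewrite integral_cst//= probability_setT mule1 EFinD; apply: leeD2l.
rewrite ge0_integralD// ge0_integralZl// intZ//.
apply: (lee_comb2 _ _ hZ hN) => //.
have -> : expR (2 * c * (s - t)) = rho s ^+ 2 by rewrite /rho -expRM_natl; congr expR; ring.
rewrite EE /B -/(rho s).
move: (expR 1) (rho s) (10 ^+ 4 : R) => e z u.
apply: ler_eq; field; by rewrite gt_eqF.
Qed.

End Local.

End Rep.

(** * Absorption and the choice of rates *)

Lemma sup_trick R (I : Type) (D : I -> Prop) (v : I -> \bar R) (e : I -> R) (A U : R) :
 (forall s, D s -> 0 <= e s) -> 0 < U -> 0 <= A ->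
 (forall B, 0 < B -> (forall s, D s -> (v s <= (B * e s)%:E)%E) ->
  forall s, D s -> (v s <= ((A + B / 2) * e s)%:E)%E) ->
 (forall s, D s -> (v s <= (U * e s)%:E)%E) ->
 forall s, D s -> (v s <= (2 * A * e s)%:E)%E.
Proof.
move=> e0 U0 A0 step h0.
(* The argument that stands for Gronwall: a bound [B] improves to [A + B / 2], so starting from any
   finite bound [U] the excess over [2 A] is halved each time. A finite starting bound is
   indispensable, and supplying it is the task of localization. *)
have hn n : forall s, D s -> (v s <= ((2 * A + U * 2^-1 ^+ n) * e s)%:E)%E.
 elim: n => [|n IH] s Ds.
  apply: le_trans (h0 s Ds) _; rewrite lee_fin expr0 mulr1; apply: ler_wpM2r; first exact: e0.
  by rewrite lerDr mulr_ge0.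
 have B0 : 0 < 2 * A + U * 2^-1 ^+ n.
  by rewrite ltr_wpDl ?mulr_ge0// mulr_gt0// exprn_gt0// invr_gt0.
 apply: le_trans (step _ B0 IH s Ds) _; rewrite lee_fin le_eqVlt; apply/orP; left; apply/eqP.
 by rewrite exprS; field.
move=> s Ds.
have cv : ((2 * A + U * 2^-1 ^+ n) * e s)%:E @[n --> \oo] --> ((2 * A + U * 0) * e s)%:E.
 apply/fine_cvgP; split; first by near=> n. apply: cvgMl; apply: cvgD; first exact: cvg_cst.
 by apply: cvgMr; apply: cvg_expr; rewrite ger0_norm ?invr_ge0// invf_lt1// ltr1n.
rewrite (_ : 2 * A * e s = (2 * A + U * 0) * e s); last by rewrite mulr0 addr0.
rewrite -(cvg_lim _ cv)//.
apply: lime_ge; first by apply/cvg_ex; eexists; exact: cv.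
by near=> n; exact: hn.
Unshelve. all: by end_near. Qed.

(** For rates above 1 both terms are at most a constant over the rate, and [16 k + 1] beats that
    constant. This rate drives the Picard iteration. *)
Lemma rate_exists R (C : R) : exists2 la, 0 < la & C ^+ 2 * (12 / la ^+ 2 + 96 / la) <= 16^-1.
Proof.
pose k := 108 * C ^+ 2; have k0 : 0 <= k by rewrite mulr_ge0// sqr_ge0.
exists (16 * k + 1); first by rewrite ltr_wpDl// mulr_ge0.
set l := _ + 1; have l1 : 1 <= l by rewrite lerDr mulr_ge0.
have l0 : 0 < l by apply: lt_le_trans l1.
have hl : 12 / l ^+ 2 <= 12 / l.
 by rewrite ler_pM2l// lef_pV2 ?posrE ?exprn_gt0// expr2 ler_peMl// ltW.
apply: le_trans (_ : C ^+ 2 * (12 / l + 96 / l) <= _).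
 by apply: ler_wpM2l; [exact: sqr_ge0|rewrite lerD2r].
have -> : C ^+ 2 * (12 / l + 96 / l) = k / l by rewrite /k; field; rewrite gt_eqF.
rewrite ler_pdivrMr//; have -> : 16^-1 * l = k + 16^-1 by rewrite /l; field.
by rewrite lerDl invr_ge0.
Qed.

(** One rate meets two demands: the first absorbs half of the fourth moment of a difference, the
    second half of the mean square of a second difference, measured at rate [4 c]. It depends on [C]
    alone, so the final constants do not see [t] and [T]. *)
Lemma const_exists R (C : R) : exists c : R, [/\ 0 < c,
 C ^+ 4 * (27 / c ^+ 4 + 27 * (7 * 10 ^+ 4 * expR 1 / (2 * c) ^+ 2)) <= 2^-1 &
 2 * C ^+ 2 * (12 / (4 * c) ^+ 2 + 96 / (4 * c)) <= 2^-1].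
Proof.
pose u : R := 7 * 10 ^+ 4 * expR 1.
have u0 : 0 <= u by rewrite !mulr_ge0 ?expR_ge0// exprn_ge0.
rewrite -/u; clearbody u.
pose k := 27 * C ^+ 4 * (1 + u) + 216 * C ^+ 2.
have C4 : 0 <= C ^+ 4 by rewrite (exprM _ 2 2) sqr_ge0.
have C2 : 0 <= C ^+ 2 by exact: sqr_ge0.
have k0 : 0 <= k.
 apply: addr_ge0; last exact: mulr_ge0. by apply: mulr_ge0; [exact: mulr_ge0|exact: addr_ge0].
pose c := 2 * k + 1; have c1 : 1 <= c by rewrite lerDr mulr_ge0.
have c0 : 0 < c by apply: lt_le_trans c1.
have kc : k / c <= 2^-1.
 rewrite ler_pdivrMr//; have -> : 2^-1 * c = k + 2^-1 by rewrite /c; field.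
 by rewrite lerDl invr_ge0.
have ci0 : 0 <= c^-1 by rewrite invr_ge0 ltW.
have cc n : (0 < n)%N -> (c ^+ n)^-1 <= c^-1.
 move=> n0; rewrite lef_pV2 ?posrE ?exprn_gt0//; exact: ler_eXnr.
have c2 m : 1 <= m -> ((m * c) ^+ 2)^-1 <= c^-1.
 move=> m1; rewrite lef_pV2 ?posrE ?exprn_gt0 ?mulr_gt0 ?(lt_le_trans ltr01 m1)//.
 have cm : c <= m * c by rewrite ler_peMl// ltW.
 exact: (le_trans cm (ler_eXnr (isT : (0 < 2)%N) (le_trans c1 cm))).
exists c; split => //.
 apply: le_trans kc; apply: (@le_trans _ _ (C ^+ 4 * (27 / c + 27 * (u / c)))).
  apply: ler_wpM2l => //; apply: lerD; first by apply: ler_wpM2l => //; exact: cc.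
  by apply: ler_wpM2l => //; apply: ler_wpM2l => //; apply: c2; rewrite ler1n.
 have -> : C ^+ 4 * (27 / c + 27 * (u / c)) = 27 * C ^+ 4 * (1 + u) / c by ring.
 by apply: ler_wpM2r => //; rewrite lerDl mulr_ge0.
apply: le_trans kc; apply: (@le_trans _ _ (2 * C ^+ 2 * (12 / c + 96 / c))).
 apply: ler_wpM2l; first by rewrite mulr_ge0.
 apply: lerD; first by apply: ler_wpM2l => //; apply: c2; rewrite ler1n.
 apply: ler_wpM2l => //; rewrite lef_pV2 ?posrE ?mulr_gt0//. by rewrite ler_peMl ?ltW// ltr1n.
have -> : 2 * C ^+ 2 * (12 / c + 96 / c) = 216 * C ^+ 2 / c by ring.
apply: ler_wpM2r => //; rewrite lerDr.
by apply: mulr_ge0; [exact: mulr_ge0|exact: addr_ge0].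
Qed.

(** Jensen's inequality by completing the square; [e] keeps the divisor positive when [m = 0]. *)
Lemma int_sqrt R d (T : measurableType d) (P : probability T R) (f : T -> R) (m : R) :
 measT f -> (forall w, 0 <= f w) -> 0 <= m ->
 (\int[P]_w (f w ^+ 2)%:E <= (m ^+ 2)%:E)%E -> (\int[P]_w (f w)%:E <= m%:E)%E.
Proof.
move=> mf f0 m0 h; apply/lee_addgt0Pr => e e0; rewrite -EFinD.
have me : 0 < m + e by rewrite ltr_wpDl.
have cst1 : (\int[P]_w (1 : R)%:E <= 1%:E)%E by rewrite integral_cst//= probability_setT mule1.
apply: (@le_trans _ _ ((2 * (m + e))^-1%:E * \int[P]_w (f w ^+ 2)%:E +
 ((m + e) / 2)%:E * \int[P]_w (1 : R)%:E)%E).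
 apply: int_le2 => //; [exact: measurable_funX|by move=> w; exact: sqr_ge0|
  by rewrite invr_ge0 mulr_ge0// ltW|by rewrite divr_ge0// ltW|].
 move=> w; rewrite f0/= mulr1 invfM -subr_ge0.
 have -> : 2^-1 / (m + e) * f w ^+ 2 + (m + e) / 2 - f w = (f w - (m + e)) ^+ 2 / (2 * (m + e)).
  by field; rewrite gt_eqF.
 by rewrite divr_ge0 ?sqr_ge0// mulr_ge0// ltW.
apply: (lee_comb2 _ _ h cst1); [by rewrite invr_ge0 mulr_ge0// ltW|by rewrite divr_ge0// ltW|].
rewrite mulr1 invfM; have hm : 2^-1 / (m + e) * m ^+ 2 <= (m + e) / 2.
 rewrite mulrAC ler_pdivrMr//; have -> : (m + e) / 2 * (m + e) = 2^-1 * (m + e) ^+ 2 by ring.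
 apply: ler_wpM2l => //; apply: lerXn2r; rewrite ?nnegrE ?(ltW me)//. by rewrite lerDl ltW.
by move: hm; move: (_ * m ^+ 2) => z; lra.
Qed.

(** Puts the second difference into nested differences of the shape [c *: y + y'], to which
    [rep_lin] applies. *)
Lemma comb_eq R (V : lmodType R) (k : R) (x x' z : V) :
 k *: ((-1) *: x' + x) + ((-1) *: z + x') = k *: x + (1 - k) *: x' - z.
Proof.
rewrite !scaleN1r scalerDr scalerN scalerBl scale1r [- _ + k *: x]addrC -!addrA.
by congr (_ + _); rewrite [RHS]addrC -addrA.
Qed.

(** * Events on which a continuous process has stayed bounded *)

Section LocalSets.
Variables (R : realType) (H Xi : hilbertType R)
 (d : measure_display) (Om : measurableType d) (P : probability Om R)
 (W : R -> Xi -> Om -> R) (t T : R)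
 (D : R -> Om -> H) (pD : progressive P W t T D)
 (cD : forall w, {within `[t, T], continuous (fun s => D s w)})
 (N : R).

(** Equivalent to saying that the path has not exceeded [N] up to time [r]. Continuity of paths
    gives the left continuity that localization asks for, and reduces the condition to countably
    many dyadic times, so the event is adapted. *)
Definition Gset r : set Om := [set w | forall q, t <= q <= r -> `|D q w| <= N].

Lemma Gset_le q r : t <= q -> q <= r -> Gset r `<=` Gset q.
Proof. by move=> _ qr w h u /andP[tu uq]; apply: h; rewrite tu (le_trans uq). Qed.

Lemma D_far w q e : t <= q <= T -> 0 < e -> exists2 dl, 0 < dl &
 forall u, t <= u <= T -> `|q - u| < dl -> `|D q w| - e < `|D u w|.
Proof.
move=> tq e0; have tq' : `[t, T]%classic q by rewrite /= in_itv.
have /subspace_continuousP/(_ _ tq')/cvgrPdist_lt/(_ _ e0) := @cD w.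
rewrite /prop_near1 /= => /nbhs_ballP[dl /= dl0 hd]; exists dl => // u tu qu.
have {}hd : `|D q w - D u w| < e by apply: hd => //; rewrite /= in_itv.
have := ler_normD (D q w - D u w) (D u w); rewrite subrK.
by move: hd; move: `|_| `|_| `|_| => x y z; lra.
Qed.

Lemma Gset_left r w : t < r <= T -> (forall q, t <= q < r -> Gset q w) -> Gset r w.
Proof.
move=> /andP[tr rT] h q /andP[tq]; rewrite le_eqVlt => /predU1P[->|qr]; last first.
 by apply: (h q); rewrite ?tq//= ?lexx ?tq.
rewrite leNgt; apply/negP => hN; have e0 : 0 < `|D r w| - N by rewrite subr_gt0.
have tr' : t <= r <= T by rewrite (ltW tr).
have [dl dl0 hd] := D_far w tr' e0.
pose u := Num.max t (r - dl / 2).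
have ur : u < r by rewrite gt_max tr ltrBlDr ltrDl divr_gt0.
have tu : t <= u by rewrite le_max lexx.
have : `|D u w| <= N by apply: (h u); rewrite ?tu ?ur ?lexx.
have : N < `|D u w|.
 have := hd u; rewrite tu (le_trans (ltW ur) rT) subKr; apply => //.
 rewrite ger0_norm ?subr_ge0 ?(ltW ur)//. have : r - dl / 2 <= u by rewrite le_max lexx orbT.
 by move: dl0 => d0 hu; lra.
by move=> h1 h2; have := lt_le_trans h1 h2; rewrite ltxx.
Qed.

Lemma Gset_filt r : t <= r <= T -> filt P W t r (Gset r).
Proof.
move=> trT; have /andP[tr rT] := trT; apply/measGs.
rewrite (_ : Gset r = \bigcap_m \bigcap_k [set w | `|D (dg t r m k) w| <= N]); last first.
 apply/seteqP; split => w.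
  by move=> h m _ k _; apply: h; exact: dg_bound.
 move=> h q /andP[tq qr]; rewrite leNgt; apply/negP => hN.
 have e0 : 0 < `|D q w| - N by rewrite subr_gt0. have tqT : t <= q <= T by rewrite tq (le_trans qr).
 have [dl dl0 hd] := D_far w tqT e0. have tqr : t <= q <= r by rewrite tq.
 have [u [m [k uE]] [/andP[tu ur] qu]] := dg_near tr tqr dl0.
 have := hd u; rewrite tu (le_trans ur rT) subKr => /(_ isT qu). by rewrite ltNge uE (h m I k I).
apply: bigcapT_measurable => m; apply: bigcapT_measurable => k.
have /andP[tu ur] := dg_bound tr m k.
have mD : measT (D (dg t r m k) : Gs P W t r -> borel H).
 apply: (Gs_fun_mono ur); apply: (@prog_adapted _ _ _ _ _ P W t T _ D _ pD).
 by rewrite tu (le_trans ur).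
have := @borel_norm0 R _ (Gs P W t r) H setT _ measurableT mD.
move=> /(_ measurableT `]-oo, N]%classic (measurable_itv _)); rewrite setTI.
by congr measurable; apply/seteqP; split => w /=; rewrite in_itv.
Qed.

End LocalSets.

(* A mean value inequality that needs no functionals: the set of the points up to
  which the Lipschitz bound holds contains its supremum, which is then 1. *)
Lemma local_lip R (V : normedModType R) (G : R -> V) (K : R) :
 (forall s, 0 <= s <= 1 -> exists2 dl, 0 < dl & forall u, 0 <= u <= 1 -> `|u - s| < dl ->
  `|G u - G s| <= K * `|u - s|) -> `|G 1 - G 0| <= K.
Proof.
move=> hG; pose A := [set s : R | 0 <= s <= 1 /\ `|G s - G 0| <= K * s].
have A0 : A 0 by rewrite /A /= lexx ler01 subrr normr0 mulr0.
have sA : has_sup A by split; [exists 0|exists 1 => s [/andP[]]].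
pose m := sup A.
have m0 : 0 <= m by apply: ub_le_sup => //; exists 1 => s [/andP[]].
have m1 : m <= 1 by apply: ge_sup; [exists 0|move=> s [/andP[]]].
have m01 : 0 <= m <= 1 by rewrite m0.
have [dl dl0 hd] := hG m m01.
have Am : A m.
 split=> //; have [s [s01 hs] sm] := sup_adherent dl0 sA.
 have sm' : s <= m by apply: ub_le_sup; [exists 1 => u [/andP[]]|].
 have := hd s s01; rewrite distrC ger0_norm ?subr_ge0//.
 have -> : m - s < dl by rewrite ltrBlDr -ltrBlDl. move=> /(_ isT); rewrite distrC => h.
 rewrite -(subrK (G s) (G m)) -addrA; apply: le_trans (ler_normD _ _) _.
 have -> : K * m = K * (m - s) + K * s by ring. exact: lerD.
have [m11|m11] := eqVneq m 1; first by case: Am => _; rewrite m11 mulr1.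
have {m11}m1' : m < 1 by rewrite lt_neqAle m11.
pose u := Num.min 1 (m + dl / 2).
have leb : m < u by rewrite lt_min m1' ltrDl divr_gt0.
have u1 : u <= 1 by rewrite ge_min lexx.
have u01 : 0 <= u <= 1 by rewrite u1 (le_trans m0 (ltW leb)).
have : A u.
 split=> //; have := hd u u01; rewrite ger0_norm ?subr_ge0 ?(ltW leb)//. have -> : u - m < dl.
  rewrite ltrBlDl; apply: (@le_lt_trans _ _ (m + dl / 2)); first by rewrite ge_min lexx orbT.
  by rewrite ltrD2l ltr_pdivrMr// ltr_pMr// ltr1n.
 move=> /(_ isT) h; rewrite -(subrK (G m) (G u)) -addrA; apply: le_trans (ler_normD _ _) _.
 have -> : K * u = K * (u - m) + K * m by ring. by apply: lerD => //; case: Am.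
move=> Au; have : u <= m by apply: ub_le_sup => //; exists 1 => s [/andP[]].
by rewrite leNgt leb.
Qed.

Lemma diff_eps R (V W : normedModType R) (f : V -> W) x e :
 differentiable f x -> 0 < e -> exists2 dl, 0 < dl &
 forall h, `|h| < dl -> `|f (h + x) - f x - 'd f x h| <= e * `|h|.
Proof.
move=> df e0; have /eqaddoP/(_ e e0) := diff_locally df.
move=> /nbhs_ballP[dl /= dl0 hd]; exists dl => // h hh.
have := hd h; rewrite -ball_normE /= sub0r normrN => /(_ hh).
by rewrite -[(_ - _) h]/(f (h + x) - (f x + 'd f x h)) opprD addrA.
Qed.

Lemma opnorm_le R (V W : normedModType R) (g : {linear V -> W}) (g' : {linear V -> W})
  (K : R) h : (opnorm (fun h => g h - g' h)%R <= K%:E)%E -> `|g h - g' h| <= K * `|h|.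
Proof.
move=> hK; have [->|h0] := eqVneq h 0; first by rewrite (linear0 g) (linear0 g') subrr !normr0 mulr0.
have n0 : 0 < `|h| by rewrite normr_gt0.
pose v := `|h|^-1 *: h.
have : (`|g v - g' v|%:E <= K%:E)%E.
 apply: le_trans hK; apply: ereal_sup_ubound; exists v => //=.
 by rewrite /v normrZ normfV normr_id mulVf ?gt_eqF.
have ev (f : {linear V -> W}) : f v = `|h|^-1 *: f h by rewrite /v linearZ.
rewrite lee_fin !ev -scalerBr normrZ normfV normr_id.
by rewrite ler_pdivrMl// mulrC.
Qed.

(** Along [G], the two points leave [z] in opposite directions with speeds [1 - k] and [k], so the
    first order terms cancel up to [k (1 - k)] times a difference of derivatives at points [s h]
    apart. The Lipschitz bound for the derivative and the mean value inequality conclude. *)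
Lemma taylor2 R (H V : normedModType R) (f : H -> V) (C : R) : 0 <= C ->
 (forall x, differentiable f x) ->
 (forall x x', (opnorm (fun h => 'd f x h - 'd f x' h)%R <= (C * `|x - x'|)%:E)%E) ->
 forall k x x', 0 <= k <= 1 ->
 `|k *: f x + (1 - k) *: f x' - f (k *: x + (1 - k) *: x')| <= C * (k * (1 - k) * `|x - x'| ^+ 2).
Proof.
move=> C0 df hC k x x' /andP[k0 k1].
have l0 : 0 <= 1 - k by rewrite subr_ge0.
have m0 : 0 <= k * (1 - k) by rewrite mulr_ge0.
pose h := x - x'; pose z := k *: x + (1 - k) *: x'.
have zx : z + (1 - k) *: h = x.
 by rewrite /z /h scalerBr [X in _ + X]addrC addrA addrK -scalerDl addrC subrK scale1r.
have zx' : z - k *: h = x'.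
 by rewrite /z /h scalerBr opprB addrC addrA subrK -scalerDl addrC subrK scale1r.
pose y1 s := z + (s * (1 - k)) *: h; pose y2 s := z - (s * k) *: h.
pose G s := k *: f (y1 s) + (1 - k) *: f (y2 s).
have G1 : G 1 = k *: f x + (1 - k) *: f x' by rewrite /G /y1 /y2 !mul1r zx zx'.
have G0 : G 0 = f z.
 by rewrite /G /y1 /y2 !mul0r scale0r subr0 addr0 -scalerDl addrC subrK scale1r.
rewrite -/z -/h -G1 -G0; apply/ler_addgt0Pr => e e0.
(* The remainders of differentiability cost an arbitrary [e]; the extra 1 avoids division by zero
   when [h = 0]. *)
have hK : 0 < `|h| + 1 by rewrite ltr_wpDl.
apply: local_lip => s /andP[s0 s1].
pose ep := e / (`|h| + 1); have ep0 : 0 < ep by rewrite divr_gt0.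
have [d1 d10 h1] := diff_eps (df (y1 s)) ep0.
have [d2 d20 h2] := diff_eps (df (y2 s)) ep0.
exists (Num.min d1 d2 / (`|h| + 1)); first by rewrite divr_gt0// lt_min d10.
move=> u /andP[u0 u1]; set q := u - s; rewrite ltr_pdivlMr// lt_min => /andP[q1 q2].
have nq (c : R) : 0 <= c <= 1 -> `|(q * c) *: h| <= `|q| * `|h|.
 move=> /andP[c0 c1]; rewrite normrZ normrM (ger0_norm c0); apply: ler_wpM2r => //.
 by rewrite ler_piMr.
have qh : `|q| * `|h| <= `|q| * (`|h| + 1) by apply: ler_wpM2l => //; rewrite lerDl.
have k01 : 0 <= k <= 1 by rewrite k0. have l01 : 0 <= 1 - k <= 1 by rewrite l0 gerBl.
have b1 := h1 ((q * (1 - k)) *: h) (le_lt_trans (le_trans (nq _ l01) qh) q1).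
have b2 := h2 (- ((q * k) *: h)) _; rewrite normrN in b2.
have {}b2 := b2 (le_lt_trans (le_trans (nq _ k01) qh) q2).
have e1 : (q * (1 - k)) *: h + y1 s = y1 u.
 by rewrite /y1 addrCA -scalerDl -mulrDl /q subrK.
have e2 : - ((q * k) *: h) + y2 s = y2 u.
 by rewrite /y2 addrCA -opprD -scalerDl -mulrDl /q subrK.
rewrite e1 in b1; rewrite e2 in b2.
set r1 := f (y1 u) - _ - _ in b1; set r2 := f (y2 u) - _ - _ in b2.
have sub3 (A B D : V) : A = B + D + (A - B - D) by rewrite -[A - B - D]addrA -opprD addrCA subrr addr0.
have f1 : f (y1 u) = f (y1 s) + (q * (1 - k)) *: 'd f (y1 s) h + r1.
 have ez : 'd f (y1 s) ((q * (1 - k)) *: h) = (q * (1 - k)) *: 'd f (y1 s) h by rewrite linearZ.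
 by rewrite /r1 ez; exact: sub3.
have f2 : f (y2 u) = f (y2 s) - (q * k) *: 'd f (y2 s) h + r2.
 have ez : 'd f (y2 s) (- ((q * k) *: h)) = - ((q * k) *: 'd f (y2 s) h).
  by rewrite linearN; congr (- _); rewrite linearZ.
 by rewrite /r2 ez; exact: sub3.
clearbody h r1 r2.
have -> : G u - G s = (q * (k * (1 - k))) *: ('d f (y1 s) h - 'd f (y2 s) h) +
  (k *: r1 + (1 - k) *: r2).
 rewrite /G f1 f2 !scalerDr !scalerN !scalerA.
 have -> : k * (q * (1 - k)) = q * (k * (1 - k)) by ring.
 have -> : (1 - k) * (q * k) = q * (k * (1 - k)) by ring.
 move: (k *: f _) ((1 - k) *: f _) (k *: r1) ((1 - k) *: r2) => A B r r'.
 move: (_ *: 'd f (y1 s) h) (_ *: 'd f (y2 s) h) => D D'. by abel.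
apply: le_trans (ler_normD _ _) _; rewrite [leRHS]mulrDl; apply: lerD.
 rewrite normrZ normrM (ger0_norm m0) -[leLHS]mulrA (mulrC _ `|q|). apply: ler_wpM2l => //.
 have := opnorm_le h (hC (y1 s) (y2 s)). have -> : y1 s - y2 s = s *: h.
  rewrite /y1 /y2 opprD opprK addrACA subrr add0r -scalerDl -mulrDr subrK mulr1//.
 move=> hh; have := ler_wpM2l m0 hh; move=> /le_trans; apply. rewrite normrZ (ger0_norm s0).
 have -> : C * (k * (1 - k) * `|h| ^+ 2) = k * (1 - k) * (C * (1 * `|h|) * `|h|) by ring.
 apply: ler_wpM2l => //; apply: ler_wpM2r => //; apply: ler_wpM2l => //; exact: ler_wpM2r.
apply: le_trans (ler_normD _ _) _; rewrite !normrZ (ger0_norm k0) (ger0_norm l0).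
have w1 : `|r1| <= e * `|q|.
 apply: le_trans b1 _; apply: le_trans (ler_wpM2l (ltW ep0) (le_trans (nq _ l01) qh)) _.
 by rewrite /ep mulrCA divfK ?gt_eqF// mulrC.
have w2 : `|r2| <= e * `|q|.
 apply: le_trans b2 _; apply: le_trans (ler_wpM2l (ltW ep0) (le_trans (nq _ k01) qh)) _.
 by rewrite /ep mulrCA divfK ?gt_eqF// mulrC.
apply: le_trans (lerD (ler_wpM2l k0 w1) (ler_wpM2l l0 w2)) _.
by rewrite -mulrDl addrC subrK mul1r.
Qed.

(** * Signed integrals for the cost *)

Section SignedIntegral.
Variables (R : realType).

(** Compares a combination of integrals of signed functions with the integral of a nonnegative
    bound. If the latter is infinite there is nothing to prove, so its integrability need not be
    known beforehand. *)
Lemma comb_le d (T : measurableType d) (m : {measure set T -> \bar R}) (D : set T)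
  (f1 f2 f3 h : T -> R) (k : R) : measurable D ->
 m.-integrable D (EFin \o f1) -> m.-integrable D (EFin \o f2) -> m.-integrable D (EFin \o f3) ->
 measurable_fun D h -> (forall z, D z -> 0 <= h z) ->
 (forall z, D z -> k * f1 z + (1 - k) * f2 z - f3 z <= h z) ->
 ((k * fine (\int[m]_(z in D) (f1 z)%:E) + (1 - k) * fine (\int[m]_(z in D) (f2 z)%:E) -
  fine (\int[m]_(z in D) (f3 z)%:E))%:E <= \int[m]_(z in D) (h z)%:E)%E.
Proof.
move=> mD i1 i2 i3 mh h0 hle.
have z1 := integrableZl mD k i1; have z2 := integrableZl mD (1 - k) i2.
have z12 := integrableD mD z1 z2; have z123 := integrableB mD z12 i3.
have F1 := integrable_fin_num mD i1; have F2 := integrable_fin_num mD i2.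
have F3 := integrable_fin_num mD i3.
have E : (\int[m]_(z in D) (k * f1 z + (1 - k) * f2 z - f3 z)%:E =
 (k * fine (\int[m]_(z in D) (f1 z)%:E) + (1 - k) * fine (\int[m]_(z in D) (f2 z)%:E) -
  fine (\int[m]_(z in D) (f3 z)%:E))%:E)%E.
 transitivity (\int[m]_(z in D) ((k%:E * (f1 z)%:E + (1 - k)%:E * (f2 z)%:E) - (f3 z)%:E))%E.
  by apply: eq_integral => z _.
 rewrite (integralB mD z12 i3) (integralD mD z1 z2) (integralZl mD i1) (integralZl mD i2).
 by rewrite -(fineK F1) -(fineK F2) -(fineK F3).
rewrite -E.
have [hoo|hoo] := ltP (\int[m]_(z in D) (h z)%:E)%E +oo%E; last first.
 by move: hoo; rewrite leye_eq => /eqP ->; exact: leey.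
have ih : m.-integrable D (EFin \o h).
 apply/integrableP; split; first exact/mEFinP.
 rewrite (eq_integral (fun z => (h z)%:E))// => z; rewrite inE => Dz. by rewrite /= ger0_norm// h0.
by apply: (le_integral mD z123 ih) => z; rewrite inE => Dz; rewrite lee_fin; exact: hle.
Qed.

(** The cost integrates a pathwise real integral, which is 0 by convention on paths without
    integrability. These form a null set, so Fubini identifies the cost with an integral over the
    strip. *)
Lemma strip_fubini d (Om : measurableType d) (P : probability Om R) (t T : R) (f : R -> Om -> R) :
 pmeas t T f -> (EI P t T (fun r w => `|f r w|)%R < +oo)%E ->
 let F w := (\int[leb]_(r in `[t, T]) f r w)%R in
 [/\ (leb \x P)%E.-integrable (strip t T) (fun z => (f z.1 z.2)%:E), P.-integrable setT (EFin \o F) &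
   (\int[P]_w (F w)%:E = \int[(leb \x P)%E]_(z in strip t T) (f z.1 z.2)%:E)%E].
Proof.
move=> mf fin F.
have mf' : pmeas t T (fun r w => `|f r w|) by exact: measurableT_comp.
have eN := EI_prod P mf' (fun r w _ => normr_ge0 _).
have i0 : (leb \x P)%E.-integrable (strip t T) (fun z => (f z.1 z.2)%:E).
 by apply/integrableP; split; [exact/mEFinP|rewrite -eN].
have mS : measurable (strip t T : set (realM R * Om)) by exact: strip_meas.
have i1 : (leb \x P)%E.-integrable setT ((fun z => (f z.1 z.2)%:E) \_ (strip t T)).
 exact/(integrable_mkcond _ mS).
pose G := fubini_G leb ((fun z : realM R * Om => (f z.1 z.2)%:E) \_ (strip t T)).
have GE w : G w = (\int[leb]_(r in `[t, T]) (f r w)%:E)%E by rewrite /G /fubini_G patchedE.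
have mG : measT G by exact: measurable_fubini_G i1.
have iG : P.-integrable setT G.
 apply/integrableP; split => //; apply: le_lt_trans fin.
 apply: le_int => [//|w _|w _]; first exact: abse_ge0.
 rewrite GE; apply: le_abse_integral; first exact: measurable_itv.
 by apply/mEFinP; exact: (EI_section w mf).
have mF : measT (EFin \o F).
 have -> : EFin \o F = EFin \o (fine \o G) by apply/funext => w; rewrite /= GE.
 by apply/mEFinP; exact: measurableT_comp.
have FG : {ae P, forall w, setT w -> G w = (F w)%:E}.
 apply: (ae_imp _ (integrable_ae measurableT iG)) => w /(_ I) h _.
 by rewrite /F /Rintegral -GE fineK.
split => //.
 apply/integrableP; split => //; have /integrableP[_] := iG.
 rewrite (ae_eq_integral (abse \o (EFin \o F)))//; [exact: measurableT_comp|exact: measurableT_comp|].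
 by apply: (ae_imp _ FG) => w h _; rewrite /= h.
rewrite -(ae_eq_integral (EFin \o F) G measurableT mG mF FG).
by rewrite integral21_prod_meas1// [RHS]integral_mkcond.
Qed.

End SignedIntegral.

Lemma int_affine R d (Om : measurableType d) (P : probability Om R)
  (f : Om -> R) (al be U : R) : measT f -> (forall w, 0 <= f w) -> 0 <= al ->
 0 <= be -> (\int[P]_w (f w)%:E <= U%:E)%E ->
 (\int[P]_w (al + be * f w)%:E <= (al + be * U)%:E)%E.
Proof.
move=> mf f0 al0 be0 hU.
have mb : measT (fun w => be * f w) by exact: measurable_funM.
have -> : (\int[P]_w (al + be * f w)%:E = \int[P]_w al%:E + \int[P]_w (be * f w)%:E)%E.
 by apply: intD => // w; exact: mulr_ge0.
have -> : (\int[P]_w (be * f w)%:E = be%:E * \int[P]_w (f w)%:E)%E by apply: intZ.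
have -> : (\int[P]_w al%:E = al%:E)%E by rewrite integral_cst//= probability_setT mule1.
rewrite EFinD (EFinM be).
by apply: leeD => //; apply: lee_wpmul2l.
Qed.

(** Semiconcavity along the two outer points, then the Lipschitz bound from their combination to
    [z]. The constant [K] may be negative, hence [|K|]. *)
Lemma semi_lip R (V : normedModType R) (f : V -> R) (K Cl : R) : semiconcave K f ->
 (forall y y', `|f y - f y'| <= Cl * `|y - y'|) -> forall k y y' z, 0 <= k <= 1 ->
 k * f y + (1 - k) * f y' - f z <=
 `|K| * (k * (1 - k)) * `|y - y'| ^+ 2 + Cl * `|k *: y + (1 - k) *: y' - z|.
Proof.
move=> hK hl k y y' z k01; have := hK k y y' k01.
have := le_trans (ler_norm _) (hl (k *: y + (1 - k) *: y') z).
have : K * (k * (1 - k) * `|y - y'| ^+ 2) <= `|K| * (k * (1 - k) * `|y - y'| ^+ 2).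
 apply: ler_wpM2r; last exact: ler_norm.
 by case/andP: k01 => k0 k1; rewrite mulr_ge0 ?sqr_ge0// mulr_ge0// subr_ge0.
by rewrite !mulrA; lra.
Qed.

Lemma neg_le R d (T : measurableType d) (m : {measure set T -> \bar R}) (D : set T)
  (f h : T -> R) : measurable D -> m.-integrable D (EFin \o f) ->
 measurable_fun D h -> (forall z, D z -> 0 <= h z) -> (forall z, D z -> - f z <= h z) ->
 ((- fine (\int[m]_(z in D) (f z)%:E))%:E <= \int[m]_(z in D) (h z)%:E)%E.
Proof.
move=> mD jf mh h0 hle; have j0 : m.-integrable D (EFin \o (fun _ : T => 0)) by exact: integrable0.
have := @comb_le R d T m D (fun _ => 0) (fun _ => 0) f h 0 mD j0 j0 jf mh h0.
rewrite integral0 /= !mulr0 !add0r; apply => z Dz.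
by rewrite sub0r; exact: hle.
Qed.

Lemma sqr_le_powR R (y p : R) : 0 <= y -> 2 < p -> y ^+ 2 <= 1 + y `^ p.
Proof.
move=> y0 p2; have [y1|y1] := leP y 1.
 by apply: (@le_trans _ _ 1); [exact: exprn_ile1|rewrite lerDl powR_ge0].
apply: (@le_trans _ _ (y `^ p)); last by rewrite lerDr.
by rewrite -powR_mulrn//; apply: ler_powR; exact: ltW.
Qed.

(** * Mild solutions for a fixed control *)

Section Mild.
Variables (R : realType) (H Xi : hilbertType R) (L : completeNormedModType R) (L0 : set L)
 (b : H -> L -> H) (sigma : H -> L -> hs Xi H)
 (d : measure_display) (Om : measurableType d) (P : probability Om R)
 (W : R -> Xi -> Om -> R) (t T : R)
 (HW : reference_space P W t T)
 (tT : t <= T)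
 (S : R -> bounded_op H H) (hS : contraction_semigroup S)
 (vH : nat -> H) (dvH : dense_seq vH) (vL : nat -> L) (dvL : dense_seq vL)
 (ch : nat -> seq (Xi * H)) (dch : dense_seq (fun n => rk (ch n)))
 (b_cont : {within [set: H] `*` L0, continuous (fun z => b z.1 z.2)})
 (sigma_cont : {within [set: H] `*` L0, continuous (fun z => sigma z.1 z.2)})
 (C : R) (C0 : 0 < C)
 (hC : forall x x' a, L0 a -> [/\ `|b x a - b x' a| <= C * `|x - x'|,
      `|sigma x a - sigma x' a| <= C * `|x - x'|,
      `|b x a| <= C * (1 + `|x| + `|a|) &
      `|sigma x a| <= C * (1 + `|x| + `|a|)])
 (c : R) (c0 : 0 < c)
 (c4 : C ^+ 4 * (27 / c ^+ 4 + 27 * (7 * 10 ^+ 4 * expR 1 / (2 * c) ^+ 2)) <= 2^-1)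
 (c2 : 2 * C ^+ 2 * (12 / (4 * c) ^+ 2 + 96 / (4 * c)) <= 2^-1)
 (la : R) (la_gt0 : 0 < la)
 (la_small : C ^+ 2 * (12 / la ^+ 2 + 96 / la) <= 16^-1).
Local Notation prog := (progressive P W t T).
Local Notation cont X := (forall w, {within `[t, T], continuous (fun s => X s w)}).
Let tTT : t <= T <= T. Proof. by rewrite tT lexx. Qed.

Local Notation almost_affine := (forall (k : R) x x' l, L0 l -> 0 <= k <= 1 ->
 `|k *: b x l + (1 - k) *: b x' l - b (k *: x + (1 - k) *: x') l| <= C * (k * (1 - k) * `|x - x'| ^+ 2) /\
 `|k *: sigma x l + (1 - k) *: sigma x' l - sigma (k *: x + (1 - k) *: x') l| <=
  C * (k * (1 - k) * `|x - x'| ^+ 2)).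
Local Notation cost_lip l g Cl := (forall x x' a, L0 a -> [/\ `|l x a - l x' a| <= Cl * `|x - x'|,
 `|l x a| <= Cl * (1 + `|x| + `|a| ^+ 2) & `|g x - g x'| <= Cl * `|x - x'|]).

Section FixedControl.
Variables (a : R -> Om -> L)
 (La : forall s w, t <= s <= T -> L0 (a s w)) (pa : progressive P W t T a)
 (a2 : (EI P t T (fun r w => `|a r w| ^+ 2)%R < +oo)%E).
Implicit Types (X Y : R -> Om -> H).
Local Notation bX X := (fun r w => b (X r w) (a r w)).
Local Notation sX X := (fun r w => sigma (X r w) (a r w)).

Lemma coef_prog (V : normedModType R) (f : H -> L -> V) X :
 {within [set: H] `*` L0, continuous (fun z => f z.1 z.2)} -> prog X ->
 prog (fun r w => f (X r w) (a r w)).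
Proof.
move=> fc pX q tqT; have /andP[tq qT] := tqT.
pose D := `[t, q]%classic `*` [set: Gs P W t q].
have h := @borel_comp2 R _ (realM R * Gs P W t q)%type H L V vH vL D
 (fun z => X z.1 z.2) (fun z => a z.1 z.2) ([set: H] `*` L0)
 (fun z => f z.1 z.2) dvH dvL (@stripG_meas R Xi d Om P W t q) (pX q tqT) (pa tqT).
apply: h => // z [/= + _]; rewrite in_itv /= => /andP[z1 z2].
by split => //; apply: La; rewrite z1 (le_trans z2).
Qed.

(** One step of Picard iteration, with coefficients evaluated along [X] and values [Y]. A mild
    solution is a fixed point, [mild x X X]. *)
Definition mild x X Y := forall s, t <= s <= T -> rep P W t S s x (bX X) (sX X) (Y s).

Definition grow X := (fun r w => 1 + `|X r w| ^+ 2 + `|a r w| ^+ 2).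

Lemma grow_pmeas X : prog X -> pmeas t T (grow X).
Proof.
move=> pX; apply: measurable_funD; last exact: (prog_pow HW 2 tTT).
by apply: measurable_funD; [exact: mcst|exact: (prog_pow HW 2 tTT)].
Qed.

Lemma grow_ge0 X r w : 0 <= grow X r w.
Proof. by rewrite !addr_ge0 ?sqr_ge0. Qed.

Lemma grow_bound X r w : t <= r <= T -> `|b (X r w) (a r w)| ^+ 2 <= 3 * C ^+ 2 * grow X r w /\
 `|sigma (X r w) (a r w)| ^+ 2 <= 3 * C ^+ 2 * grow X r w.
Proof.
move=> rT; have [_ _ h1 h2] := hC (X r w) 0 (La w rT).
have k : (C * (1 + `|X r w| + `|a r w|)) ^+ 2 <= 3 * C ^+ 2 * grow X r w.
 have -> : 3 * C ^+ 2 * grow X r w = C ^+ 2 * (3 * grow X r w) by ring.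
 rewrite exprMn; apply: ler_wpM2l; first exact: sqr_ge0.
 rewrite /grow; move: `|X r w| `|a r w| => y z.
 by have := sqr_ge0 (1 - y); have := sqr_ge0 (1 - z); have := sqr_ge0 (y - z); nra.
have C00 : 0 <= C * (1 + `|X r w| + `|a r w|) by rewrite mulr_ge0 ?(ltW C0)// !addr_ge0.
by split; apply: le_trans k; apply: lerXn2r; rewrite ?nnegrE.
Qed.

Lemma EI_grow X : prog X -> EI P t T (grow X) =
 ((T - t)%:E + EI P t T (fun r w => `|X r w| ^+ 2)%R + EI P t T (fun r w => `|a r w| ^+ 2)%R)%E.
Proof.
move=> pX; have m1 : pmeas t T (fun r w => `|X r w| ^+ 2) by exact: (prog_pow HW 2 tTT).
have m2 : pmeas t T (fun r w => `|a r w| ^+ 2) by exact: (prog_pow HW 2 tTT).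
have m0 : pmeas t T (fun (_ : R) (_ : Om) => 1 : R) by exact: mcst.
have m01 : pmeas t T (fun r w => 1 + `|X r w| ^+ 2) := measurable_funD m0 m1.
have p2 (r : R) w : 0 <= `|a r w| ^+ 2 by exact: sqr_ge0.
have p1 (r : R) w : 0 <= `|X r w| ^+ 2 by exact: sqr_ge0.
have p01 (r : R) w : 0 <= 1 + `|X r w| ^+ 2 by rewrite addr_ge0.
by rewrite /grow (EI_D P m01 m2 p01 p2) (EI_D P m0 m1 (fun _ _ => ler01) p1) EI_cst// mul1r.
Qed.

Lemma coef_L2 X : prog X ->
 (EI P t T (fun r w => `|b (X r w) (a r w)| ^+ 2)%R <= (3 * C ^+ 2)%:E * EI P t T (grow X))%E /\
 (EI P t T (fun r w => `|sigma (X r w) (a r w)| ^+ 2)%R <= (3 * C ^+ 2)%:E * EI P t T (grow X))%E.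
Proof.
move=> pX; have C3 : 0 <= 3 * C ^+ 2 by rewrite mulr_ge0// sqr_ge0.
rewrite -(EI_Z P (grow_pmeas pX) (@grow_ge0 X) C3).
by split; apply: EI_le => r w rT; rewrite sqr_ge0/=; case: (grow_bound X w rT).
Qed.

(** A stronger form of [mild]: here [Y] is built from continuous versions of the two convolutions,
    to which the maximal inequality applies. *)
Definition link x X Y := exists M N, [/\ dconv P W t T S (bX X) M, nconv P W t T S (sX X) N &
 forall s w, Y s w = S (Num.max (s - t) 0) x + M s w + N s w].

Definition L2p X := (EI P t T (fun r w => `|X r w| ^+ 2)%R < +oo)%E.

Lemma grow_lty X : prog X -> L2p X -> (EI P t T (grow X) < +oo)%E.
Proof. move=> pX hX; rewrite EI_grow//.
by apply: lte_add_pinfty; [apply: lte_add_pinfty; [exact: ltry|exact: hX]|exact: a2]. Qed.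

Lemma link_ex x X : prog X -> L2p X -> exists Y, link x X Y.
Proof.
move=> pX hX; have [h1 h2] := coef_L2 pX.
have C3 : 0 <= 3 * C ^+ 2 by rewrite mulr_ge0// sqr_ge0.
have fin : ((3 * C ^+ 2)%:E * EI P t T (grow X) < +oo)%E.
 by apply: (lte_mul_pinfty _ _ (grow_lty pX hX)); [rewrite lee_fin|].
have [M hM] := dconv_ex HW tT hS dvH (coef_prog b_cont pX) (le_lt_trans h1 fin).
have [N hN] := nconv_ex HW tT hS dvH dch (coef_prog sigma_cont pX) (le_lt_trans h2 fin).
by exists (fun s w => S (Num.max (s - t) 0) x + M s w + N s w), M, N.
Qed.

Lemma link_mild x X Y : prog X -> link x X Y -> mild x X Y.
Proof.
move=> pX [M [N [hM hN hY]]] s tsT; exists (M s), (N s); split.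
- exact: (dconv_bochner HW tT hS dvH tsT hM (coef_prog b_cont pX)).
- exact: (nconv_ito HW tT hS dvH dch tsT hN (coef_prog sigma_cont pX)).
- by apply: aeW => w; rewrite hY max_l// subr_ge0; case/andP: tsT.
Qed.

Lemma orbit_prog x : prog (fun s _ => S (Num.max (s - t) 0) x).
Proof.
move=> q _; apply: measurable_funTS.
have mU : measT ((fun r => S (Num.max (r - t) 0) x) : realM R -> borel H).
 apply: borel_cont => r.
 apply: (@continuous_comp _ _ _ (fun s => s - t) (fun s => S (Num.max s 0) x)).
  by apply: cvgB; [exact: cvg_id|exact: cvg_cst].
 exact: S_orbit_cont.
exact: (measurableT_comp mU measurable_fst).
Qed.

Lemma link_prog x X Y : link x X Y ->
 prog Y /\ forall w, {within `[t, T], continuous (fun s => Y s w)}.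
Proof.
move=> [M [N [[pM cM _] [pN cN _] hY]]].
have -> : Y = fun s w => S (Num.max (s - t) 0) x + M s w + N s w.
 by apply/funext => s; apply/funext => w; rewrite hY.
split.
 by apply: (progD dvH) => //; apply: (progD dvH) => //; exact: orbit_prog.
move=> w s; apply: cvgD; last exact: cN; apply: cvgD; last exact: cM.
have cS : continuous (fun s : R => S (Num.max (s - t) 0) x).
 move=> r; apply: (@continuous_comp _ _ _ (fun s => s - t) (fun s => S (Num.max s 0) x)).
  by apply: cvgB; [exact: cvg_id|exact: cvg_cst].
 exact: S_orbit_cont.
exact: (continuous_subspaceT cS).
Qed.

(** By linearity the difference of two images satisfies the mild equation with differences of
    coefficients. In the weighted norm the Lipschitz bound and the choice of [la] leave the factor
    [1/16]. *)
Lemma mild_diff x X Y x' X' Y' (U : R) s : prog X -> prog X' -> mild x X Y -> mild x' X' Y' ->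
 0 <= U -> t <= s <= T ->
 (forall r, t <= r <= s -> (\int[P]_w (`|X r w - X' r w| ^+ 2)%:E <= (U * expR (la * (r - t)))%:E)%E) ->
 (\int[P]_w (`|Y s w - Y' s w| ^+ 2)%:E <=
  (3 * `|x - x'| ^+ 2 + U / 16 * expR (la * (s - t)))%:E)%E.
Proof.
move=> pX pX' hY hY' U0 tsT hU; have /andP[ts sT] := tsT.
have hr := rep_lin HW dvH dch (-1) tsT (hY' s tsT) (hY s tsT).
have K0 : 0 <= C ^+ 2 * U by rewrite mulr_ge0// sqr_ge0.
have mXX r : t <= r <= s -> measT (fun w => `|X r w - X' r w| ^+ 2).
 move=> /andP[tr rs]; have rT : t <= r <= T by rewrite tr (le_trans rs).
 exact: (EI_section2 rT (prog_pow HW 2 tTT (progB dvH pX pX'))).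
have C20 : 0 <= C ^+ 2 by exact: sqr_ge0.
have bd r (e : Om -> R) : t <= r <= s -> (forall w, 0 <= e w <= C * `|X r w - X' r w|) ->
  (\int[P]_w (e w ^+ 2)%:E <= (C ^+ 2 * U * expR (la * (r - t)))%:E)%E.
 move=> rs he; apply: (@le_trans _ _ (\int[P]_w (C ^+ 2 * `|X r w - X' r w| ^+ 2)%:E)%E).
  apply: le_int => // w _; rewrite lee_fin; first exact: sqr_ge0.
  have /andP[e0 eC] := he w; rewrite -exprMn; apply: lerXn2r; rewrite ?nnegrE//.
  by rewrite mulr_ge0// ltW.
 rewrite intZ//; last exact: mXX.
 by rewrite -mulrA (EFinM (C ^+ 2)); apply: lee_wpmul2l => //; exact: hU.
have := rep_L2w HW hS dvH dch tsT hr _ _ la_gt0 K0 _ _.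
have -> : (-1) *: x' + x = x - x' by rewrite scaleN1r addrC.
have -> : (\int[P]_w (`|Y s w - Y' s w| ^+ 2)%:E = \int[P]_w (`|(-1) *: Y' s w + Y s w| ^+ 2)%:E)%E.
 by apply: eq_integral => w _; rewrite scaleN1r [in RHS]addrC.
move=> F; apply: le_trans (F _ _ _ _) _.
- by apply: (progD dvH); [apply: (progZc dvH)|]; exact: coef_prog.
- by apply: (progD dch); [apply: (progZc dch)|]; exact: coef_prog.
- move=> r rs; apply: bd => // w; rewrite normr_ge0/= scaleN1r addrC.
 have rT : t <= r <= T by case/andP: rs => -> /le_trans; exact.
 by case: (hC (X r w) (X' r w) (La w rT)).
- move=> r rs; apply: bd => // w; rewrite normr_ge0/= scaleN1r addrC.
 have rT : t <= r <= T by case/andP: rs => -> /le_trans; exact.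
 by case: (hC (X r w) (X' r w) (La w rT)).
rewrite lee_fin lerD2l; apply: ler_wpM2r; first exact: expR_ge0.
by rewrite (mulrC (C ^+ 2)) -mulrA; apply: ler_wpM2l => //; exact: la_small.
Qed.

Definition M0 (x : H) (E : \bar R) : \bar R := ((3 * `|x| ^+ 2)%:E +
 (9 * C ^+ 2 * (T - t + 33))%:E * E)%E.

Lemma mild_L2 x X Y s : prog X -> mild x X Y -> t <= s <= T ->
 (\int[P]_w (`|Y s w| ^+ 2)%:E <= M0 x (EI P t T (grow X)))%E.
Proof.
move=> pX hY tsT; have /andP[ts sT] := tsT.
have [h1 h2] := coef_L2 pX.
apply: le_trans (rep_L2 HW hS dvH dch tsT (hY s tsT) (coef_prog b_cont pX) (coef_prog sigma_cont pX)) _.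
apply: leeD2l.
have g0 : (0 <= EI P t T (grow X))%E by apply: EI_ge0 => r w _; exact: grow_ge0.
have k1 := le_trans (EI_sub P sT (prog_pow HW 2 tTT (coef_prog b_cont pX)) (fun r w => sqr_ge0 _)) h1.
have k2 := le_trans (EI_sub P sT (prog_pow HW 2 tTT (coef_prog sigma_cont pX)) (fun r w => sqr_ge0 _)) h2.
have T1 : 0 <= T - t + 1 by rewrite addr_ge0 ?subr_ge0.
have C3 : 0 <= 3 * C ^+ 2 by rewrite mulr_ge0 ?sqr_ge0.
have -> : ((9 * C ^+ 2 * (T - t + 33))%:E * EI P t T (grow X) =
 (3 * (T - t + 1))%:E * ((3 * C ^+ 2)%:E * EI P t T (grow X)) +
 96%:E * ((3 * C ^+ 2)%:E * EI P t T (grow X)))%E. rewrite !muleA -!EFinM -ge0_muleDl ?lee_fin.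
 - by congr (_ * _)%E; rewrite -EFinD; congr EFin; ring.
 - by rewrite mulr_ge0// mulr_ge0.
 - by rewrite mulr_ge0.
apply: leeD; last first.
 by have p96 : (0 <= 96%:E :> \bar R)%E; [rewrite lee_fin ler0n|exact: (lee_wpmul2l p96 k2)].
apply: le_trans (lee_wpmul2l _ k1) _; first by rewrite lee_fin mulr_ge0// addr_ge0 ?subr_ge0.
apply: lee_wpmul2r; first by apply: mule_ge0 => //; rewrite lee_fin.
by rewrite lee_fin ler_pM2l// lerD2r lerD2r.
Qed.

Lemma rep_ae s x f Phi y y' : {ae P, forall w, y w = y' w} ->
 rep P W t S s x f Phi y -> rep P W t S s x f Phi y'.
Proof.
move=> yy [Ib [Is [h1 h2 h3]]]; exists Ib, Is; split => //.
by apply: (ae_imp2 _ yy h3) => w <-.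
Qed.

Lemma ae_eq_L2 (y y' : Om -> H) : measT (y : Om -> borel H) -> measT (y' : Om -> borel H) ->
 (\int[P]_w (`|y w - y' w| ^+ 2)%:E <= 0)%E -> {ae P, forall w, y w = y' w}.
Proof.
move=> my my' h; have m : measT (fun w => `|y w - y' w| ^+ 2).
 by apply: borel_normX => //; exact: (borelB dvH).
have hc : {ae P, forall w, `|y w - y' w| ^+ 2 @[n --> \oo] --> (0 : R)}.
 apply: (@ae_cvg0 _ _ _ P (fun _ w => `|y w - y' w| ^+ 2)) => [//|n w|n]; first exact: sqr_ge0.
 by apply: le_trans h _; rewrite lee_fin exprn_ge0// invr_ge0.
apply: ae_imp hc => w hw.
have : (0 : R) = `|y w - y' w| ^+ 2.
 by apply: (@cvg_unique _ (@norm_hausdorff _ _) ((fun _ : nat => `|y w - y' w| ^+ 2) @ \oo)) => //; exact: cvg_cst.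
by move=> /esym/eqP; rewrite sqrf_eq0 normr_eq0 subr_eq0 => /eqP.
Qed.

Lemma prog_meas X s : prog X -> t <= s <= T -> measT (X s : Om -> borel H).
Proof.
move=> pX tsT; apply: (@Gs_fun _ _ _ _ _ _ _ _ HW s); first by case/andP: tsT.
exact: (@prog_adapted _ _ _ _ _ P W t T s X tsT pX).
Qed.

Lemma L2_bound (x : H) X Y : prog X -> L2p X -> mild x X Y ->
 exists2 U : R, 0 < U & forall s, t <= s <= T -> (\int[P]_w (`|Y s w| ^+ 2)%:E <= U%:E)%E.
Proof.
move=> pX hX hY.
have f0 : (M0 x (EI P t T (grow X)) \is a fin_num)%E.
 have e1 : (EI P t T (grow X) \is a fin_num)%E.
  rewrite ge0_fin_numE; first exact: grow_lty. by apply: EI_ge0 => r w _; exact: grow_ge0.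
 by rewrite /M0 fin_numD fin_numM.
pose U := fine (M0 x (EI P t T (grow X))).
exists (`|U| + 1); first by rewrite ltr_wpDl.
move=> s tsT; apply: le_trans (mild_L2 pX hY tsT) _.
rewrite -(fineK f0) lee_fin -/U; apply: le_trans (ler_norm U) _.
by rewrite lerDl.
Qed.

Lemma L2_of_bound Y (U : R) : prog Y ->
 (forall s, t <= s <= T -> (\int[P]_w (`|Y s w| ^+ 2)%:E <= U%:E)%E) -> L2p Y.
Proof.
move=> pY hU; rewrite /L2p (EI_swap P (prog_pow HW 2 tTT pY) (fun r w _ => sqr_ge0 _)).
apply: (@le_lt_trans _ _ (\int[leb]_(r in `[t, T]) U%:E)%E).
 apply: le_int => [|r _|r]; [exact: measurable_itv|by apply: integral_ge0 => w _; rewrite lee_fin sqr_ge0|].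
 by rewrite /= in_itv/=; exact: hU.
rewrite integral_cst//=.
rewrite lebesgue_measure_itv/=; case: ifP => _; last by rewrite mule0 ltry.
by rewrite -EFinB -EFinM ltry.
Qed.

Definition good X := [/\ prog X, (forall w, {within `[t, T], continuous (fun s => X s w)}) & L2p X].

Lemma good_step (x : H) X : good X -> exists Y, good Y /\ link x X Y.
Proof.
move=> [pX cX hX]; have [Y hY] := link_ex x pX hX.
have [pY cY] := link_prog hY; exists Y; split; last exact: hY.
split; [exact: pY|exact: cY|].
have [U U0 hU] := L2_bound pX hX (link_mild pX hY).
exact: L2_of_bound hU.
Qed.

Lemma far_add (l : R) X Y : far t T l (fun s w => X s w + Y s w) `<=`
 far t T (l / 2) X `|` far t T (l / 2) Y.
Proof.
move=> w [q dq h]; have [h1|h1] := leP (l / 2) `|X q w|; first by left; exists q.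
right; exists q => //; have := ler_normD (X q w) (Y q w); move: h h1.
by move: `|_| `|_| `|_| => u v z; lra.
Qed.

Lemma coef_EI X X' (U : R) : prog X -> prog X' -> 0 <= U ->
 (forall r, t <= r <= T -> (\int[P]_w (`|X r w - X' r w| ^+ 2)%:E <= (U * expR (la * (r - t)))%:E)%E) ->
 (EI P t T (fun r w => `|b (X r w) (a r w) - b (X' r w) (a r w)| ^+ 2)%R <=
  (C ^+ 2 * (U * (expR (la * (T - t)) / la)))%:E)%E /\
 (EI P t T (fun r w => `|sigma (X r w) (a r w) - sigma (X' r w) (a r w)| ^+ 2)%R <=
  (C ^+ 2 * (U * (expR (la * (T - t)) / la)))%:E)%E.
Proof.
move=> pX pX' U0 hU; have mX := prog_pow HW 2 tTT (progB dvH pX pX').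
have C20 : 0 <= C ^+ 2 by exact: sqr_ge0.
have h := EI_exp tT la_gt0 U0 mX (fun r w => sqr_ge0 _) hU.
have k : (EI P t T (fun r w => C ^+ 2 * `|X r w - X' r w| ^+ 2)%R <=
  (C ^+ 2 * (U * (expR (la * (T - t)) / la)))%:E)%E.
 rewrite (EI_Z P mX (fun r w => sqr_ge0 _) C20) (EFinM (C ^+ 2)).
 by apply: lee_wpmul2l; [rewrite lee_fin|exact: h].
by split; (apply: le_trans k; apply: EI_le => r w rT; rewrite sqr_ge0/= -exprMn;
 have [h1 h2 _ _] := hC (X r w) (X' r w) (La w rT); apply: lerXn2r;
 rewrite ?nnegrE// mulr_ge0// ltW).
Qed.

Lemma link_far (x : H) X Y X' Y' (U l : R) : prog X -> prog X' -> link x X Y -> link x X' Y' ->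
 0 <= U -> 0 < l ->
 (forall r, t <= r <= T -> (\int[P]_w (`|X r w - X' r w| ^+ 2)%:E <= (U * expR (la * (r - t)))%:E)%E) ->
 ((l ^+ 2)%:E * P (far t T l (fun s w => Y s w - Y' s w)%R) <=
  (64 * (T - t + 8) * (C ^+ 2 * (U * (expR (la * (T - t)) / la))))%:E)%E.
Proof.
move=> pX pX' [M [N [hM hN hY]]] [M' [N' [hM' hN' hY']]] U0 l0 hU.
have [k1 k2] := coef_EI pX pX' U0 hU; set r := C ^+ 2 * _ in k1 k2 *.
have r0 : 0 <= r.
 by rewrite mulr_ge0 ?sqr_ge0// mulr_ge0// divr_ge0 ?expR_ge0// ltW.
have l2 : 0 < l / 2 by rewrite divr_gt0.
have f1 := dconv_max HW tT hS dvH hM hM' l2 r0 (coef_prog b_cont pX) (coef_prog b_cont pX') k1.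
have f2 := nconv_max HW tT hS dvH dch hN hN' l2 r0 (coef_prog sigma_cont pX) (coef_prog sigma_cont pX') k2.
have -> : (fun s w => Y s w - Y' s w) = fun s w => (M s w - M' s w) + (N s w - N' s w).
 apply/funext => s; apply/funext => w; rewrite hY hY'; set z := S _ x.
 by rewrite !opprD addrACA [X in X + _]addrACA subrr add0r.
have pB (Z Z' : R -> Om -> H) : prog Z -> prog Z' -> measurable (far t T (l / 2) (fun s w => Z s w - Z' s w)).
 move=> pZ pZ'; apply: (far_meas tT) => s tsT. exact: (prog_meas (progB dvH pZ pZ') tsT).
have [pM _ _] := hM; have [pM' _ _] := hM'; have [pN _ _] := hN; have [pN' _ _] := hN'.
set A := far t T (l / 2) _ in f1; set A' := far t T (l / 2) _ in f2.
have mA : measurable A by exact: pB. have mA' : measurable A' by exact: pB.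
have mF : measurable (far t T l (fun s w => (M s w - M' s w) + (N s w - N' s w))).
 apply: (far_meas tT) => s tsT.
 exact: (prog_meas (progD dvH (progB dvH pM pM') (progB dvH pN pN')) tsT).
have hle : (P (far t T l (fun s w => (M s w - M' s w) + (N s w - N' s w))%R) <= P A + P A')%E.
 apply: le_trans (measureU2 _ mA mA'); apply: le_measure; rewrite ?inE//; first exact: measurableU.
 exact: far_add.
have F1 : P A \is a fin_num by exact: fin_num_measure.
have F2 : P A' \is a fin_num by exact: fin_num_measure.
have F3 : P (far t T l (fun s w => (M s w - M' s w) + (N s w - N' s w))) \is a fin_num by exact: fin_num_measure.
move: f1 f2 hle; rewrite -(fineK F1) -(fineK F2) -(fineK F3) -!EFinM -EFinD !lee_fin.
move: (fine _) (fine _) (fine _) => u v z f1 f2 hle.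
have e4 : (l / 2) ^+ 2 = l ^+ 2 / 4 by field.
rewrite !e4 in f1 f2.
apply: le_trans (ler_wpM2l (sqr_ge0 l) hle) _.
have -> : 64 * (T - t + 8) * r = 4 * (16 * (T - t) * r + 16 * 8 * r) by ring.
by move: f1 f2; move: (16 * _ * r) (16 * 8 * r) (l ^+ 2) => q1 q2 q3; lra.
Qed.

(* Picard iteration: the weight exp (la (s - t)) makes the solution map a
  contraction by the factor 1/16, which beats the factor 4 lost in the maximal
  inequality at level 2^-n. *)
Theorem mild_exists (x : H) : exists X, [/\ good X, mild x X X &
 exists2 U : R, 0 < U & forall s, t <= s <= T -> (\int[P]_w (`|X s w| ^+ 2)%:E <= U%:E)%E].
Proof.
have g0 : good (fun _ _ => 0).
 split; [exact: prog_cst|by move=> w s; exact: cvg_cst|].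
 rewrite /L2p (_ : (fun _ _ => _) = fun _ _ => 0 : R); first by rewrite EI_cst// mul0r ltry.
 by apply/funext => r; apply/funext => w; rewrite normr0 expr0n.
have hF X : exists Y, good X -> good Y /\ link x X Y.
 have [gX|nX] := pselect (good X); last by exists X. by have [Y hY] := good_step x gX; exists Y.
have [F {}hF] := choice hF.
pose X n := iter n F (fun _ _ => 0 : H).
have gX n : good (X n) by elim: n => [|n IH]; [exact: g0|exact: (hF _ IH).1].
have lX n : link x (X n) (X n.+1) by case: (hF _ (gX n)).
have pX n : prog (X n) by case: (gX n).
have mX n : mild x (X n) (X n.+1) by exact: (link_mild (pX n) (lX n)).
have X00 r w : X 0%N r w = 0 by [].
clearbody X.
have [p0 _ h0] := gX 0%N.
have [U U0 hU] := L2_bound p0 h0 (mX 0%N).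
have E1 r : t <= r <= T -> 1 <= expR (la * (r - t)).
 move=> /andP[tr _]; rewrite -expR0 ler_expR mulr_ge0 ?(ltW la_gt0)//. by rewrite subr_ge0.
have E0 r : 0 <= expR (la * (r - t)) by exact: expR_ge0.
have Un n : 0 <= U * 16^-1 ^+ n by rewrite mulr_ge0 ?exprn_ge0 ?invr_ge0// ltW.
have dX n : forall r, t <= r <= T ->
  (\int[P]_w (`|X n.+1 r w - X n r w| ^+ 2)%:E <= (U * 16^-1 ^+ n * expR (la * (r - t)))%:E)%E.
 elim: n => [|n IH] r rT.
  apply: le_trans (_ : U%:E <= _)%E; last first.
   by rewrite lee_fin expr0 mulr1; apply: ler_peMr; [exact: ltW|exact: E1].
  apply: le_trans (hU r rT); apply: le_int => // w _; rewrite lee_fin ?sqr_ge0//.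
  by rewrite X00 subr0.
 have /andP[tr rTT] := rT.
 have IH' q : t <= q <= r -> (\int[P]_w (`|X n.+1 q w - X n q w| ^+ 2)%:E <=
   (U * 16^-1 ^+ n * expR (la * (q - t)))%:E)%E.
  by move=> /andP[tq qr]; apply: IH; rewrite tq (le_trans qr).
 apply: le_trans (mild_diff (pX n.+1) (pX n) (mX n.+1) (mX n) (Un n) rT IH') _.
 rewrite lee_fin subrr normr0 expr0n /= mulr0 add0r.
 by have -> : U * 16^-1 ^+ n.+1 = U * 16^-1 ^+ n / 16 by rewrite exprSr mulrA.
have mD k r : t <= r <= T -> measT (fun w => `|X k r w| ^+ 2).
 by move=> rT; apply: borel_normX => //; exact: prog_meas.
have mDD k j r : t <= r <= T -> measT (fun w => `|X k r w - X j r w| ^+ 2).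
 move=> rT; apply: borel_normX => //. by apply: (borelB dvH) => //; exact: prog_meas.
have ddX j n r : t <= r <= T -> (\int[P]_w (`|X (n + j)%N r w - X n r w| ^+ 2)%:E <=
  (4 * (U * 16^-1 ^+ n * expR (la * (r - t))))%:E)%E.
 move=> rT; elim: j n => [|j IH] n.
  under eq_integral do rewrite addn0 subrr normr0 expr0n.
  by rewrite integral0 lee_fin mulr_ge0// mulr_ge0.
 apply: (@le_trans _ _ (2%:E * \int[P]_w (`|X (n.+1 + j)%N r w - X n.+1 r w| ^+ 2)%:E +
  2%:E * \int[P]_w (`|X n.+1 r w - X n r w| ^+ 2)%:E)%E).
  apply: int_le2 => //; [exact: mDD|exact: mDD|] => w; rewrite sqr_ge0/=.
  rewrite addSnnS; apply: le_trans (norm_sqrD _ _); rewrite addrA subrK. by [].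
 apply: (lee_comb2 _ _ (IH n.+1) (dX n r rT)) => //. have := mulr_ge0 (Un n) (E0 r).
 have -> : U * 16^-1 ^+ n.+1 * expR (la * (r - t)) = (U * 16^-1 ^+ n * expR (la * (r - t))) / 16.
  by rewrite exprS; field.
 by move: (U * _ * _) => z z0; lra.
pose K := 64 * (T - t + 8) * (C ^+ 2 * (U * (expR (la * (T - t)) / la))).
have K0 : 0 <= K.
 apply: mulr_ge0; first by rewrite mulr_ge0// addr_ge0// subr_ge0.
 apply: mulr_ge0; first exact: sqr_ge0. apply: mulr_ge0; first exact: ltW.
 by rewrite divr_ge0 ?expR_ge0// ltW.
(* At level [2^-k] the maximal inequality leaves probability at most [K * 4^-k]; starting the
   sequence at [n0] absorbs [K]. *)
pose n0 := Num.truncn K.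
have hK : K <= 4 ^+ n0.
 have h1 : K < n0.+1%:R by exact: truncnS_gt. apply: le_trans (ltW h1) _; rewrite -natrX ler_nat.
 exact: ltn_expl.
have [|||M [pM cM aM]] := @limit_process R Xi H d Om P W t T HW vH dvH tT (fun n => X (n0 + n).+1).
- move=> n s tsT; exact: (@prog_adapted _ _ _ _ _ P W t T s _ tsT (pX _)).
- by move=> n; apply: aeW => w; case: (gX (n0 + n).+1).
- move=> n; rewrite addnS; set k := (n0 + n)%N.
 pose l : R := 2^-1 ^+ k; have l0 : 0 < l by rewrite exprn_gt0// invr_gt0.
 pose Z s w := X k.+2 s w - X k.+1 s w. have mF e : measurable (far t T e Z).
  by apply: (far_meas tT) => s tsT; apply: (borelB dvH) => //; exact: prog_meas.
 have hl : l <= 2^-1 ^+ n.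
  rewrite /l /k exprD ler_piMl ?exprn_ge0 ?invr_ge0// exprn_ile1 ?invr_ge0//.
  by rewrite invf_le1// ler1n.
 apply: (@le_trans _ _ (P (far t T l Z))).
  apply: le_measure; rewrite ?inE; [exact: mF|exact: mF|].
  by move=> w [q dq h]; exists q => //; exact: le_trans h.
 have := link_far (pX k.+1) (pX k) (lX k.+1) (lX k) (Un k) l0 (dX k).
 rewrite -/Z; have F1 : P (far t T l Z) \is a fin_num by exact: fin_num_measure.
 rewrite -(fineK F1) -EFinM !lee_fin; move: (fine _) => u.
 have -> : 64 * (T - t + 8) * (C ^+ 2 * (U * 16^-1 ^+ k * (expR (la * (T - t)) / la))) = K * 16^-1 ^+ k.
  by rewrite /K; ring.
 have -> : 16^-1 ^+ k = l ^+ 2 * (l ^+ 2) :> R.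
  rewrite /l -!exprM -exprD -mulnDr mulnC exprM; congr (_ ^+ k). by field.
 rewrite mulrCA ler_pM2l ?exprn_gt0// => h; apply: le_trans h _.
 have -> : l ^+ 2 = 4^-1 ^+ n0 * (2^-1 ^+ n) ^+ 2.
  rewrite /l /k exprD exprMn; congr (_ * _); rewrite -exprM mulnC exprM; congr (_ ^+ n0); by field.
 rewrite mulrA; apply: (@le_trans _ _ (1 * (2^-1 ^+ n) ^+ 2)).
  apply: ler_wpM2r; first exact: sqr_ge0. by rewrite exprVn ler_pdivrMr ?exprn_gt0// mul1r.
 rewrite mul1r expr2 ler_piMl ?exprn_ge0 ?invr_ge0// exprn_ile1 ?invr_ge0//.
 by rewrite invf_le1// ler1n.
have mM s : t <= s <= T -> measT (M s : Om -> borel H) by exact: prog_meas.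
have dM n s : t <= s <= T -> (\int[P]_w (`|M s w - X n s w| ^+ 2)%:E <=
  (4 * (U * 16^-1 ^+ n * expR (la * (s - t))))%:E)%E.
 move=> sT; apply: (@fatou_ae _ _ _ P (fun j w => `|X (n0 + (n + j)).+1 s w - X n s w| ^+ 2)).
 - by move=> j; exact: mDD.
 - by move=> j w; exact: sqr_ge0.
 - apply: borel_normX => //; apply: (borelB dvH) => //; first exact: mM.
  exact: prog_meas.
 - by move=> w; exact: sqr_ge0.
 - apply: ae_imp aM => w /(_ s sT) h.
  have h2 : `|X (n0 + (n + j)).+1 s w - X n s w| @[j --> \oo] --> `|M s w - X n s w|.
   apply: cvg_norm; apply: cvgB; last exact: cvg_cst.
   have := h; rewrite -(cvg_shiftn n (fun j => X (n0 + j).+1 s w)).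
   by apply: cvg_trans; apply: near_eq_cvg; near=> j; rewrite /= [(n + j)%N]addnC.
  exact: cvg_comp _ _ h2 (@exprn_continuous R 2 _).
 - move=> j; have -> : (n0 + (n + j)).+1 = (n + (n0 + j).+1)%N by rewrite addnCA addnS.
  exact: ddX.
pose V := 2 * U + 8 * (U * expR (la * (T - t))).
have EE s : t <= s <= T -> expR (la * (s - t)) <= expR (la * (T - t)).
 by move=> /andP[_ sT]; rewrite ler_expR ler_pM2l// lerD2r.
have MU s : t <= s <= T -> (\int[P]_w (`|M s w| ^+ 2)%:E <= V%:E)%E.
 move=> sT; apply: (@le_trans _ _ (2%:E * \int[P]_w (`|X 1%N s w| ^+ 2)%:E +
  2%:E * \int[P]_w (`|M s w - X 1%N s w| ^+ 2)%:E)%E).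
  apply: int_le2 => //; [exact: mD|by apply: borel_normX => //;
   apply: (borelB dvH) => //; [exact: mM|exact: prog_meas]|] => w; rewrite sqr_ge0/=.
  by apply: le_trans (norm_sqrD _ _); rewrite addrC subrK.
 apply: (lee_comb2 _ _ (hU s sT) (dM 1%N s sT)) => //.
 rewrite /V lerD2l mulrA; have -> : 2 * 4 = 8 :> R by ring.
 apply: ler_wpM2l => //; rewrite expr1 mulrAC -[leRHS]mulr1.
 apply: ler_pM; rewrite ?invr_ge0 ?mulr_ge0 ?(ltW U0)//.
  by apply: ler_wpM2l; [exact: ltW|exact: EE].
 by rewrite invf_le1// ler1n.
have V0 : 0 < V by rewrite addr_gt0 ?mulr_gt0// expR_gt0.
have LM : L2p M by exact: (L2_of_bound pM MU).
have gM : good M by split.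
exists M; split => //; last by exists V.
(* The limit [M] is compared with its own Picard image [Y]: both are mean square limits of the
   iterates, so [Y s = M s] almost surely at each [s], and [M] solves the equation while keeping its
   continuous paths. *)
have [Y [[pY _ _] lY]] := good_step x gM; have mY := link_mild pM lY.
move=> s sT; apply: (rep_ae _ (mY s sT)).
apply: ae_eq_L2; [exact: prog_meas|exact: mM|].
apply/lee_addgt0Pr => e e0; rewrite add0e.
pose z := U * expR (la * (T - t)); have z0 : 0 < z by rewrite mulr_gt0// expR_gt0.
have cz : 10 * z * 16^-1 ^+ n @[n --> \oo] --> 10 * z * 0.
 by apply: cvgMr; apply: cvg_expr; rewrite ger0_norm ?invr_ge0// invf_lt1// ltr1n.
have [n _ hn] : \forall n \near \oo, 10 * z * 16^-1 ^+ n < e.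
 by apply: (cvgr_lt _ cz); rewrite mulr0.
have {}hn := hn n (leqnn n).
have hd r : t <= r <= s -> (\int[P]_w (`|M r w - X n r w| ^+ 2)%:E <=
  (4 * (U * 16^-1 ^+ n) * expR (la * (r - t)))%:E)%E.
 move=> /andP[tr rs]; rewrite -mulrA; apply: dM; rewrite tr (le_trans rs)//. by case/andP: sT.
have U4 : 0 <= 4 * (U * 16^-1 ^+ n) by rewrite mulr_ge0.
have k1 := mild_diff pM (pX n) mY (mX n) U4 sT hd.
have k2 := dM n.+1 s sT.
apply: (@le_trans _ _ (2%:E * \int[P]_w (`|Y s w - X n.+1 s w| ^+ 2)%:E +
  2%:E * \int[P]_w (`|M s w - X n.+1 s w| ^+ 2)%:E)%E).
 apply: int_le2 => //; [by apply: borel_normX => //;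
   apply: (borelB dvH) => //; [exact: prog_meas|exact: prog_meas]|
   by apply: borel_normX => //;
   apply: (borelB dvH) => //; [exact: mM|exact: prog_meas]|] => w; rewrite sqr_ge0/=.
 rewrite -[X in _ <= _ + 2 * X ^+ 2]normrN.
 by apply: le_trans (norm_sqrD _ _); rewrite opprB addrA subrK.
apply: (lee_comb2 _ _ k1 k2) => //.
rewrite subrr normr0 expr0n /= mulr0 add0r; apply: le_trans (ltW hn).
have hz : U * expR (la * (s - t)) <= z by apply: ler_wpM2l; [exact: ltW|exact: EE].
have q0 : 0 <= 16^-1 ^+ n :> R by rewrite exprn_ge0// invr_ge0.
rewrite exprS; move: (expR (la * (s - t))) hz (16^-1 ^+ n) q0 => v hz q q0.
have h := ler_wpM2r q0 hz; rewrite -[10 * z * q]mulrA.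
have -> : 2 * (4 * (U * q) / 16 * v) + 2 * (4 * (U * (16^-1 * q) * v)) = U * v * q by field.
by apply: le_trans h _; rewrite ler_peMl ?ler1n// mulr_ge0// ltW.
Unshelve. all: by end_near. Qed.

(** * First and second differences in the initial state *)

Section Estimates.
Let e s := expR (4 * c * (s - t)).
Let e_ge0 s : 0 <= e s. Proof. exact: expR_ge0. Qed.
Let e_ge1 s : t <= s -> 1 <= e s.
Proof. by move=> ts; rewrite -expR0 ler_expR !mulr_ge0 ?subr_ge0// ltW. Qed.

Lemma coef_progB (V : normedModType R) (v : nat -> V) (f : H -> L -> V) X X' : dense_seq v ->
 {within [set: H] `*` L0, continuous (fun z => f z.1 z.2)} -> prog X -> prog X' ->
 prog (fun r w => (-1) *: f (X' r w) (a r w) + f (X r w) (a r w)).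
Proof.
move=> dv fc pX pX'; apply: (progD dv); [apply: (progZc dv)|].
 exact: (coef_prog fc pX').
exact: (coef_prog fc pX).
Qed.

(** No moments of [X] and [X'] are assumed. On the event that the difference stayed below [N] the a
    priori bound is [N^4], absorption replaces it by a bound free of [N], twice [27 |x - x'|^4], and
    [N] tends to infinity. *)
Lemma first_diff x x' X X' s : prog X -> cont X -> mild x X X -> prog X' -> cont X' ->
 mild x' X' X' -> t <= s <= T ->
 (\int[P]_w (`|X s w - X' s w| ^+ 4)%:E <= (54 * `|x - x'| ^+ 4 * e s)%:E)%E.
Proof.
move=> pX cX hX pX' cX' hX' tsT.
pose D r w := X r w - X' r w.
have pD : prog D by exact: (progB dvH).
have cD : cont D by move=> w u; apply: cvgB; [exact: cX|exact: cX'].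
have mD r : t <= r <= T -> measT (D r : Om -> borel H) by exact: (prog_meas pD).
have mD4 r : t <= r <= T -> measT (fun w => `|D r w| ^+ 4).
 by move=> rT; apply: borel_normX => //; exact: mD.
pose A := 27 * `|x - x'| ^+ 4; have A0 : 0 <= A by rewrite mulr_ge0// exprn_ge0.
have mG n r : t <= r <= T -> measurable (Gset t D n r).
 move=> rT; have /andP[_ rTT] := rT; exact: (filt_meas HW rTT (Gset_filt pD cD n rT)).
have key n : forall r, t <= r <= T -> (\int[P]_w (\1_(Gset t D n.+1%:R r) w * `|D r w| ^+ 4)%:E <=
  (2 * A * e r)%:E)%E.
 set N : R := n.+1%:R; have N0 : 0 < N by rewrite ltr0n.
 apply: (@sup_trick R R (fun r => t <= r <= T)
  (fun r => \int[P]_w (\1_(Gset t D N r) w * `|D r w| ^+ 4)%:E)%E e A (N ^+ 4)) => //.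
 - by rewrite exprn_gt0.
 - move=> B B0 hB r rT; have /andP[tr rTT] := rT.
  have hr := rep_lin HW dvH dch (-1) rT (hX' r rT) (hX r rT).
  have FG q : t <= q <= r -> filt P W t q (Gset t D N q).
   move=> /andP[tq qr]; have tqT : t <= q <= T by rewrite tq (le_trans qr).
   exact: (Gset_filt pD cD N tqT).
  have Glc q w : t < q <= r -> (forall u, t <= u < q -> Gset t D N u w) -> Gset t D N q w.
   by move=> /andP[tq qr]; apply: (Gset_left cD); rewrite tq (le_trans qr).
  have K0 : 0 < C ^+ 4 * B by rewrite mulr_gt0// exprn_gt0.
  have bd q (g : Om -> R) : t <= q <= r -> (forall w, 0 <= g w <= C * `|D q w|) ->
    (\int[P]_w (gind t (Gset t D N) q w * g w ^+ 4)%:E <= (C ^+ 4 * B * e q)%:E)%E.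
   move=> /andP[tq qr] hg; have qT : t <= q <= T by rewrite tq (le_trans qr).
   apply: (@le_trans _ _ (\int[P]_w (C ^+ 4 * (\1_(Gset t D N q) w * `|D q w| ^+ 4))%:E)%E).
    apply: le_int => // w _; have /andP[g0 gC] := hg w; rewrite lee_fin.
     by rewrite mulr_ge0 ?gind_ge0 ?exprn_ge0.
    have i0 : 0 <= \1_(Gset t D N q) w :> R by rewrite indicE.
    have gg : g w ^+ 4 <= C ^+ 4 * `|D q w| ^+ 4.
     by rewrite -exprMn; apply: lerXn2r; rewrite ?nnegrE// mulr_ge0// ltW.
    apply: (@le_trans _ _ (\1_(Gset t D N q) w * g w ^+ 4)).
     rewrite /gind; case: (t < q); rewrite ?mul1r// mul0r mul0r. by rewrite mulr_ge0// exprn_ge0.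
    by rewrite [leRHS]mulrCA; exact: ler_wpM2l.
   have mm : measT (fun w => \1_(Gset t D N q) w * `|D q w| ^+ 4).
    by apply: measurable_funM; [apply: measurable_indic; exact: mG|exact: mD4].
   have mm0 w : 0 <= \1_(Gset t D N q) w * `|D q w| ^+ 4 by rewrite mulr_ge0// exprn_ge0.
   have C40 : 0 <= C ^+ 4 by rewrite exprn_ge0// ltW.
   by rewrite intZ// -mulrA (EFinM (C ^+ 4)); apply: lee_wpmul2l => //; exact: hB.
  have := rep_L4 HW hS dvH dch rT FG (@Gset_le _ _ _ _ _ _ _) Glc hr
   (coef_progB dvH b_cont pX pX') (coef_progB dch sigma_cont pX pX') c0 K0 _ _.
  have -> : (\int[P]_w (\1_(Gset t D N r) w * `|(-1) *: X' r w + X r w| ^+ 4)%:E =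
   \int[P]_w (\1_(Gset t D N r) w * `|D r w| ^+ 4)%:E)%E.
   by apply: eq_integral => w _; rewrite scaleN1r addrC.
  have -> : (-1) *: x' + x = x - x' by rewrite scaleN1r addrC. move=> F; apply: le_trans (F _ _) _.
  + move=> q qr; apply: bd => // w; rewrite normr_ge0/= scaleN1r addrC.
   have qT : t <= q <= T by case/andP: qr => -> /le_trans; exact.
   by case: (hC (X q w) (X' q w) (La w qT)).
  + move=> q qr; apply: bd => // w; rewrite normr_ge0/= scaleN1r addrC.
   have qT : t <= q <= T by case/andP: qr => -> /le_trans; exact.
   by case: (hC (X q w) (X' q w) (La w qT)).
  rewrite lee_fin -/A -/(e r) [leRHS]mulrDl; apply: lerD; first by rewrite ler_peMr// e_ge1.
  apply: ler_wpM2r => //; move: c4; set z := (_ + _ * (_ / _)) => hz.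
  have -> : C ^+ 4 * B * z = B * (C ^+ 4 * z) by ring. by apply: ler_wpM2l => //; exact: ltW.
 - move=> r rT; have /andP[tr _] := rT.
  apply: (@le_trans _ _ (\int[P]_w (N ^+ 4)%:E)%E); last first.
   rewrite integral_cst//= probability_setT mule1 lee_fin ler_peMr ?e_ge1// exprn_ge0//.
  apply: le_int => // w _; rewrite lee_fin.
  rewrite indicE; case: (boolP (w \in _)) => [/set_mem h|_]; rewrite ?mul0r ?mul1r.
   by apply: lerXn2r; rewrite ?nnegrE ?(ltW N0)//; apply: h; rewrite tr lexx.
  by rewrite exprn_ge0// ltW.
have -> : 54 * `|x - x'| ^+ 4 * e s = 2 * A * e s by rewrite /A; ring.
(* A continuous path on a compact interval is bounded, so it belongs to the localizing event as soon
   as [N] is large. *)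
apply: (@fatou_ae _ _ _ P (fun n w => \1_(Gset t D n.+1%:R s) w * `|D s w| ^+ 4)).
- by move=> n; apply: measurable_funM; [apply: measurable_indic; exact: mG|exact: mD4].
- by move=> n w; rewrite mulr_ge0// exprn_ge0.
- exact: mD4.
- by move=> w; rewrite exprn_ge0.
- apply: aeW => w; apply: cvg_near_cst.
 have cn : {within `[t, T], continuous (fun u => `|D u w|)}.
  by move=> u; apply: cvg_norm; exact: cD.
 have [u _ hu] := EVT_max tT cn. near=> n; rewrite indicE mem_set ?mul1r// => q /andP[tq qs].
 apply: le_trans (hu q _) _.
  by rewrite in_itv/= tq (le_trans qs)//; case/andP: tsT.
 have : `|D u w| <= n%:R by near: n; exact: nbhs_infty_ger.
 by move=> /le_trans; apply; rewrite ler_nat.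
- by move=> n; exact: key.
Unshelve. all: by end_near. Qed.

Lemma first_diff2 x x' X X' s : prog X -> cont X -> mild x X X -> prog X' -> cont X' ->
 mild x' X' X' -> t <= s <= T ->
 (\int[P]_w (`|X s w - X' s w| ^+ 2)%:E <= (8 * `|x - x'| ^+ 2 * expR (2 * c * (s - t)))%:E)%E.
Proof.
move=> pX cX hX pX' cX' hX' tsT; have h := first_diff pX cX hX pX' cX' hX' tsT.
apply: int_sqrt.
- apply: borel_normX => //.
 exact: (prog_meas (progB dvH pX pX') tsT).
- by move=> w; exact: sqr_ge0.
- by rewrite mulr_ge0 ?expR_ge0// mulr_ge0// sqr_ge0.
under eq_integral do rewrite -exprM.
apply: le_trans h _; rewrite lee_fin.
have -> : e s = expR (2 * c * (s - t)) ^+ 2 by rewrite /e -expRM_natl; congr expR; ring.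
move: (expR _) `|x - x'| => E y; rewrite -subr_ge0.
have -> : (8 * y ^+ 2 * E) ^+ 2 - 54 * y ^+ 4 * E ^+ 2 = 10 * (y ^+ 2 * E) ^+ 2 by ring.
by rewrite mulr_ge0// sqr_ge0.
Qed.

Section Second.
Variables (hC2 : almost_affine).

(** The second difference starts from 0. Its coefficients are bounded by [C |Y|] plus
    [C k (1 - k) |X - X'|^2]; the mean square of the last term is a fourth moment, supplied by
    [first_diff]. The result is quadratic in [k (1 - k) |x - x'|^2], as semiconcavity requires. *)
Lemma second_diff k x x' X X' Z s : 0 <= k <= 1 ->
 prog X -> cont X -> mild x X X -> prog X' -> cont X' -> mild x' X' X' ->
 prog Z -> cont Z -> mild (k *: x + (1 - k) *: x') Z Z -> t <= s <= T ->
 (\int[P]_w (`|k *: X s w + (1 - k) *: X' s w - Z s w| ^+ 2)%:E <=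
  (54 * (k * (1 - k) * `|x - x'| ^+ 2) ^+ 2 * e s)%:E)%E.
Proof.
move=> k01 pX cX hX pX' cX' hX' pZ cZ hZ tsT; have /andP[k0 k1] := k01.
set z := k *: x + (1 - k) *: x' in hZ.
pose Y r w := k *: X r w + (1 - k) *: X' r w - Z r w.
have pY : prog Y.
 by apply: (progB dvH) => //; apply: (progD dvH); exact: (progZc dvH).
have mY2 r : t <= r <= T -> measT (fun w => `|Y r w| ^+ 2).
 by move=> rT; apply: borel_normX => //; exact: (prog_meas pY rT).
have mD n (Q Q' : R -> Om -> H) r : prog Q -> prog Q' -> t <= r <= T ->
  measT (fun w => `|Q r w - Q' r w| ^+ n).
 by move=> pQ pQ' rT; apply: borel_normX => //; exact: (prog_meas (progB dvH pQ pQ') rT).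
pose m := k * (1 - k); have m0 : 0 <= m by rewrite mulr_ge0// subr_ge0.
have c2m : 0 <= 2 * C ^+ 2 * m ^+ 2.
 by apply: mulr_ge0; [apply: mulr_ge0; [|exact: sqr_ge0]|exact: sqr_ge0].
pose A := 27 * (m * `|x - x'| ^+ 2) ^+ 2; have A0 : 0 <= A by rewrite mulr_ge0// sqr_ge0.
have -> : 54 * (k * (1 - k) * `|x - x'| ^+ 2) ^+ 2 * e s = 2 * A * e s by rewrite /A /m; ring.
pose u1 := 54 * `|x - x'| ^+ 4; pose u2 := 54 * `|x' - z| ^+ 4.
have u10 : 0 <= u1 by rewrite mulr_ge0// exprn_ge0.
have u20 : 0 <= u2 by rewrite mulr_ge0// exprn_ge0.
have c40 : 0 < 4 * c by rewrite mulr_gt0.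
have d4 r rT := first_diff (s := r) pX cX hX pX' cX' hX' rT.
have d4' r rT := first_diff (s := r) pX' cX' hX' pZ cZ hZ rT.
apply: (@sup_trick R R (fun r => t <= r <= T)
  (fun r => \int[P]_w (`|Y r w| ^+ 2)%:E)%E e A (4 + 2 * u1 + 2 * u2)) => //.
- by rewrite -addrA ltr_pwDl// addr_ge0// mulr_ge0.
- move=> B B0 hB r rT; have /andP[tr rTT] := rT.
 have h1 := rep_lin HW dvH dch (-1) rT (hX' r rT) (hX r rT).
 have h2 := rep_lin HW dvH dch (-1) rT (hZ r rT) (hX' r rT).
 have hr := rep_lin HW dvH dch k rT h1 h2. have z0 : k *: ((-1) *: x' + x) + ((-1) *: z + x') = 0.
  by rewrite comb_eq subrr.
 have K0 : 0 <= 2 * C ^+ 2 * (B + 2 * A).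
  apply: mulr_ge0; first by rewrite mulr_ge0 ?sqr_ge0.
  by apply: addr_ge0; [exact: ltW|exact: mulr_ge0].
 have bd q (g : Om -> R) : t <= q <= r ->
   (forall w, 0 <= g w <= C * (`|Y q w| + m * `|X q w - X' q w| ^+ 2)) ->
   (\int[P]_w (g w ^+ 2)%:E <= (2 * C ^+ 2 * (B + 2 * A) * e q)%:E)%E.
  move=> /andP[tq qr] hg; have qT : t <= q <= T by rewrite tq (le_trans qr).
  apply: (@le_trans _ _ ((2 * C ^+ 2)%:E * \int[P]_w (`|Y q w| ^+ 2)%:E +
   (2 * C ^+ 2 * m ^+ 2)%:E * \int[P]_w (`|X q w - X' q w| ^+ 4)%:E)%E). apply: int_le2.
   - exact: mY2.
   - exact: mD.
   - by move=> w; exact: sqr_ge0.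
   - by move=> w; rewrite exprn_ge0.
   - by rewrite mulr_ge0 ?sqr_ge0.
   - exact: c2m.
   move=> w; have /andP[g0 gC] := hg w; rewrite sqr_ge0/=.
   have gC2 : g w ^+ 2 <= (C * (`|Y q w| + m * `|X q w - X' q w| ^+ 2)) ^+ 2.
    by apply: lerXn2r; rewrite ?nnegrE// (le_trans g0).
   apply: le_trans gC2 _; rewrite (exprM _ 2 2) exprMn.
   have -> : 2 * C ^+ 2 * `|Y q w| ^+ 2 + 2 * C ^+ 2 * m ^+ 2 * (`|X q w - X' q w| ^+ 2) ^+ 2 =
    C ^+ 2 * (2 * `|Y q w| ^+ 2 + 2 * (m * `|X q w - X' q w| ^+ 2) ^+ 2) by ring.
   apply: ler_wpM2l; first exact: sqr_ge0.
   move: `|Y q w| (m * _) => y v; have := sqr_ge0 (y - v); by nra.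
  apply: (lee_comb2 _ _ (hB q qT) (d4 q qT)); [by rewrite mulr_ge0 ?sqr_ge0| exact: c2m|].
  rewrite -/(e q) /A (exprM _ 2 2). by apply: ler_eq; ring.
 have cf (V : normedModType R) (f : H -> L -> V) q w : t <= q <= T ->
   `|f (X q w) (a q w) - f (X' q w) (a q w)| <= C * `|X q w - X' q w| ->
   `|f (k *: X q w + (1 - k) *: X' q w) (a q w) - f (Z q w) (a q w)| <= C * `|Y q w| ->
   `|k *: f (X q w) (a q w) + (1 - k) *: f (X' q w) (a q w) -
     f (k *: X q w + (1 - k) *: X' q w) (a q w)| <= C * (m * `|X q w - X' q w| ^+ 2) ->
   `|k *: ((-1) *: f (X' q w) (a q w) + f (X q w) (a q w)) +
    ((-1) *: f (Z q w) (a q w) + f (X' q w) (a q w))| <=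
   C * (`|Y q w| + m * `|X q w - X' q w| ^+ 2).
  move=> qT _ g2 g3; rewrite mulrDr comb_eq.
  have -> : k *: f (X q w) (a q w) + (1 - k) *: f (X' q w) (a q w) - f (Z q w) (a q w) =
   (f (k *: X q w + (1 - k) *: X' q w) (a q w) - f (Z q w) (a q w)) +
   (k *: f (X q w) (a q w) + (1 - k) *: f (X' q w) (a q w) -
     f (k *: X q w + (1 - k) *: X' q w) (a q w)).
   by rewrite [RHS]addrC addrA subrK.
  by apply: le_trans (ler_normD _ _) _; exact: lerD.
 have := rep_L2w HW hS dvH dch rT hr _ _ c40 K0 _ _. rewrite z0 normr0 expr0n /= mulr0 add0r.
 have -> : (\int[P]_w (`|k *: ((-1) *: X' r w + X r w) + ((-1) *: Z r w + X' r w)| ^+ 2)%:E =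
   \int[P]_w (`|Y r w| ^+ 2)%:E)%E.
  by apply: eq_integral => w _; rewrite comb_eq.
 move=> F; apply: le_trans (F _ _ _ _) _.
 + apply: (progD dvH); last exact: (coef_progB dvH b_cont pX' pZ).
  by apply: (progZc dvH); exact: (coef_progB dvH b_cont pX pX').
 + apply: (progD dch); last exact: (coef_progB dch sigma_cont pX' pZ).
  by apply: (progZc dch); exact: (coef_progB dch sigma_cont pX pX').
 + move=> q qr; apply: bd => // w; rewrite normr_ge0/=.
  have qT : t <= q <= T by case/andP: qr => -> /le_trans; exact.
  have [g1 _ _ _] := hC (X q w) (X' q w) (La w qT).
  have [g2 _ _ _] := hC (k *: X q w + (1 - k) *: X' q w) (Z q w) (La w qT).
  have [g3 _] := hC2 (X q w) (X' q w) (La w qT) k01. exact: (cf _ b).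
 + move=> q qr; apply: bd => // w; rewrite normr_ge0/=.
  have qT : t <= q <= T by case/andP: qr => -> /le_trans; exact.
  have [_ g1 _ _] := hC (X q w) (X' q w) (La w qT).
  have [_ g2 _ _] := hC (k *: X q w + (1 - k) *: X' q w) (Z q w) (La w qT).
  have [_ g3] := hC2 (X q w) (X' q w) (La w qT) k01. exact: (cf _ sigma).
 (* [A] was chosen as half of the forcing bound, so that the condition on [c] yields exactly the
    form [A + B / 2] needed for absorption. *)
 rewrite lee_fin -/(e r); apply: ler_wpM2r => //. have -> : A + B / 2 = (B + 2 * A) * 2^-1 by field.
 rewrite [2 * C ^+ 2 * _]mulrC -mulrA; apply: ler_wpM2l => //.
 by apply: addr_ge0; [exact: ltW|exact: mulr_ge0].
(* The finite starting bound: [Y] is a combination of two first differences, whose fourth moments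
   are already controlled. *)
- move=> r rT; have /andP[tr _] := rT.
 have i1 : (\int[P]_w (1 + `|X r w - X' r w| ^+ 4)%:E <= (1 + u1 * e r)%:E)%E.
  rewrite intD//; last exact: mD.
  rewrite integral_cst//= probability_setT mule1 EFinD; apply: leeD2l; exact: d4.
 have i2 : (\int[P]_w (1 + `|X' r w - Z r w| ^+ 4)%:E <= (1 + u2 * e r)%:E)%E.
  rewrite intD//; last exact: mD.
  rewrite integral_cst//= probability_setT mule1 EFinD; apply: leeD2l; exact: d4'.
 have sq (v : R) : v ^+ 2 <= 1 + v ^+ 4.
  rewrite (exprM _ 2 2); move: (v ^+ 2) => y; have := sqr_ge0 (y - 1 / 2); by nra.
 apply: (@le_trans _ _ (2%:E * \int[P]_w (1 + `|X r w - X' r w| ^+ 4)%:E +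
   2%:E * \int[P]_w (1 + `|X' r w - Z r w| ^+ 4)%:E)%E).
  apply: int_le2 => //.
  + by apply: measurable_funD => //; exact: mD.
  + by apply: measurable_funD => //; exact: mD.
  move=> w; rewrite sqr_ge0/=. have -> : Y r w = k *: (X r w - X' r w) + (X' r w - Z r w).
   by rewrite /Y -comb_eq !scaleN1r ![- _ + _]addrC.
  apply: le_trans (norm_sqrD _ _) _; apply: lerD; rewrite ler_pM2l//.
  apply: le_trans (sq _); apply: lerXn2r; rewrite ?nnegrE// normrZ ger0_norm//. by rewrite ler_piMl.
 apply: (lee_comb2 _ _ i1 i2) => //. by have := e_ge1 tr; move: (e r) => v v1; nra.
Qed.

End Second.

End Estimates.

Local Notation X x := (state P W t T S b sigma x a).

(** The state is an arbitrary mild solution selected by [xget]. The estimate [first_diff2] with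
    equal initial states identifies it with the constructed solution at each time, almost surely,
    and thus gives it second moments. *)
Lemma state_spec x : [/\ prog (X x), cont (X x), mild x (X x) (X x) &
 exists2 U : R, 0 < U & forall s, t <= s <= T -> (\int[P]_w (`|X x s w| ^+ 2)%:E <= U%:E)%E].
Proof.
have [Y [[pY cY _] mY [U U0 hU]]] := mild_exists x.
have [pX cX mX] : mild_solution P W t T S b sigma x a (X x).
 by apply: xgetPex; exists Y; split.
split => //; exists (2 * U); first exact: mulr_gt0.
move=> s sT; apply: (@le_trans _ _ (2%:E * \int[P]_w (`|X x s w - Y s w| ^+ 2)%:E +
  2%:E * \int[P]_w (`|Y s w| ^+ 2)%:E)%E).
 apply: int_le2 => //; [| |move=> w; rewrite sqr_ge0/=].
 - apply: borel_normX => //.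
  by apply: (borelB dvH) => //; exact: (prog_meas _ sT).
 - by apply: borel_normX => //; exact: (prog_meas _ sT).
 - by apply: le_trans (norm_sqrD _ _); rewrite subrK.
have h := first_diff2 pX cX mX pY cY mY sT.
apply: (lee_comb2 _ _ h (hU s sT)) => //.
by rewrite subrr normr0 expr0n/= !(mulr0, mul0r) add0r.
Qed.

(** Comparison with the Picard image of the zero process. The resulting bound depends on the control
    only through its mean square, so it is uniform over controls when [L0] is bounded. *)
Lemma moment (x : H) (M : R) : 0 <= M -> (M0 x (EI P t T (grow ((fun _ _ => 0)%R : R -> Om -> H))) <= M%:E)%E ->
 forall s, t <= s <= T ->
 (\int[P]_w (`|X x s w| ^+ 2)%:E <= (2 * (2 * M) * expR (la * (s - t)))%:E)%E.
Proof.
move=> M0 hM; have [pX cX mX [U U0 hU]] := state_spec x.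
have p0 : prog ((fun _ _ => 0)%R : R -> Om -> H) by exact: prog_cst.
have z2 : L2p ((fun _ _ => 0)%R : R -> Om -> H).
 rewrite /L2p (_ : (fun _ _ => _) = fun _ _ => 0 : R); first by rewrite EI_cst// mul0r ltry.
 by apply/funext => r; apply/funext => w; rewrite normr0 expr0n.
have [Y lY] := link_ex x p0 z2.
have mY := link_mild p0 lY.
have [pY _] := link_prog lY.
have e0 s : t <= s -> 1 <= expR (la * (s - t)).
 by move=> ts; rewrite -expR0 ler_expR mulr_ge0 ?subr_ge0// ltW.
apply: (@sup_trick R R (fun s => t <= s <= T) (fun s => \int[P]_w (`|X x s w| ^+ 2)%:E)%E _ _ U).
- by move=> s _; exact: expR_ge0.
- exact: U0.
- exact: mulr_ge0.
- move=> B B0 hB s sT.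
 apply: (@le_trans _ _ (2%:E * \int[P]_w (`|X x s w - Y s w| ^+ 2)%:E +
  2%:E * \int[P]_w (`|Y s w| ^+ 2)%:E)%E). apply: int_le2 => //; [| |move=> w; rewrite sqr_ge0/=].
  + apply: borel_normX => //.
   by apply: (borelB dvH) => //; exact: (prog_meas _ sT).
  + by apply: borel_normX => //; exact: (prog_meas _ sT).
  + by apply: le_trans (norm_sqrD _ _); rewrite subrK.
 have hB' q : t <= q <= s -> (\int[P]_w (`|X x q w - 0| ^+ 2)%:E <= (B * expR (la * (q - t)))%:E)%E.
  move=> /andP[tq qs]; under eq_integral do rewrite subr0.
  by apply: hB; rewrite tq (le_trans qs)//; case/andP: sT.
 have h := mild_diff pX p0 mX mY (ltW B0) sT hB'. have h' := le_trans (mild_L2 p0 mY sT) hM.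
 apply: (lee_comb2 _ _ h h') => //. rewrite subrr normr0 expr0n/= mulr0 add0r.
 have ts : t <= s by case/andP: sT. have h1 := ler_wpM2l M0 (e0 s ts); rewrite mulr1 in h1.
 have Be := mulr_ge0 (ltW B0) (expR_ge0 (la * (s - t))). move: (expR _) h1 Be => e h1 Be. nra.
- move=> s sT; apply: le_trans (hU s sT) _; rewrite lee_fin ler_peMr ?(ltW U0)//.
 by apply: e0; case/andP: sT.
Qed.

Lemma cost_split (l : H -> L -> R) (g : H -> R) (Cl : R) (x : H) : 0 < Cl ->
 {within [set: H] `*` L0, continuous (fun z => l z.1 z.2)} ->
 cost_lip l g Cl ->
 [/\ (leb \x P)%E.-integrable (strip t T) (fun z => (l (X x z.1 z.2) (a z.1 z.2))%:E),
   P.-integrable setT (fun w => (g (X x T w))%:E) &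
   cost P W t T S b sigma l g x a =
   (fine (\int[(leb \x P)%E]_(z in strip t T) (l (X x z.1 z.2) (a z.1 z.2))%:E) +
    fine (\int[P]_w (g (X x T w))%:E))%:E].
Proof.
move=> Cl0 lc hl; have [pX cX mX [U U0 hU]] := state_spec x.
have hX : L2p (X x) by exact: (L2_of_bound pX hU).
have ml : pmeas t T (fun r w => l (X x r w) (a r w)).
 apply: (Gs_pmeas HW (lexx T)); apply/borel_real; first exact: stripG_meas.
 by apply: (coef_prog lc pX); rewrite tT lexx.
have mg : measT (fun w => g (X x T w)).
 have [a0 La0] : L0 !=set0 by exists (a T point); exact: La. have gc : continuous g.
  move=> y; apply/cvgrPdist_le => e e0. have q0 : 0 < Cl^-1 * e by rewrite mulr_gt0// invr_gt0.
  apply: filterS (nbhsx_ballx y _ q0) => z; rewrite -ball_normE => /= yz.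
  have [_ _ h] := hl y z _ La0; apply: le_trans h _; rewrite -ler_pdivlMl//. exact: ltW.
 apply: (EI_section2 (f := fun r w => g (X x r w)) tTT).
 apply: (Gs_pmeas HW (lexx T)); apply/borel_real; first exact: stripG_meas.
 apply: (coef_prog (f := fun y _ => g y) _ pX); last by rewrite tT lexx.
 apply: continuous_subspaceT => z; apply: continuous_comp; [exact: cvg_fst|exact: gc].
have fin : (EI P t T (fun r w => `|l (X x r w) (a r w)|)%R < +oo)%E.
 apply: (@le_lt_trans _ _ (EI P t T (fun r w => (2 * Cl) * grow (X x) r w)%R)).
  apply: EI_le => r w rT; rewrite normr_ge0/=.
  have [_ h _] := hl (X x r w) 0 _ (La w rT); apply: le_trans h _.
  rewrite /grow (mulrC 2) -mulrA; apply: ler_wpM2l; first exact: ltW.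
  have := sqr_ge0 (`|X x r w| - 1); have := sqr_ge0 `|a r w|; have := sqr_ge0 `|X x r w|.
  by rewrite sqrrB1; lra.
 have gl := grow_lty pX hX. have mgr : pmeas t T (grow (X x)) by exact: (grow_pmeas pX).
 rewrite (EI_Z P mgr)//; last by rewrite mulr_ge0// ltW.
  by apply: lte_mul_pinfty => //; rewrite lee_fin mulr_ge0// ltW.
 by move=> r w; rewrite /grow !addr_ge0// sqr_ge0.
have [i1 i2 e1] := strip_fubini ml fin.
have i3 : P.-integrable setT (fun w => (g (X x T w))%:E).
 apply/integrableP; split; first exact/mEFinP.
 apply: (@le_lt_trans _ _ (\int[P]_w (`|g 0| + Cl + Cl * `|X x T w| ^+ 2)%:E)%E).
  apply: le_int => [//|w _|w _]; first exact: abse_ge0. rewrite /=.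
  have [_ _ h] := hl (X x T w) 0 _ (La w tTT).
  rewrite lee_fin subr0 in h *; have := ler_normB (g (X x T w) - g 0) (- g 0).
  rewrite opprK subrK normrN => h'; apply: le_trans h' _; rewrite addrC -addrA.
  apply: lerD => //; apply: le_trans h _; rewrite -{2}(mulr1 Cl) -mulrDr.
  apply: ler_wpM2l; first exact: ltW. have := sqr_ge0 (`|X x T w| - 1); have := sqr_ge0 `|X x T w|.
  by rewrite sqrrB1; lra.
 apply: le_lt_trans (ltry _); apply: (int_affine _ _ _ (ltW Cl0) (hU T tTT)).
 - by apply: borel_normX => //; exact: (prog_meas).
 - by move=> w; exact: sqr_ge0.
 - by rewrite addr_ge0// ltW.
split => //; rewrite /cost unlock /=.
rewrite (integralD_EFin measurableT i2 i3).
by rewrite -e1 EFinD !fineK//; exact: integrable_fin_num.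
Qed.

(** * Bounds and semiconcavity of the cost *)

Section Cost.
Variables (l : H -> L -> R) (g : H -> R) (Cl : R) (Cl0 : 0 < Cl)
 (l_cont : {within [set: H] `*` L0, continuous (fun z => l z.1 z.2)})
 (hl : cost_lip l g Cl).
Local Notation J := (cost P W t T S b sigma l g).

Let mXs x s : t <= s <= T -> measT (fun w => `|X x s w| ^+ 2).
Proof.
move=> sT; have [pX _ _ _] := state_spec x.
by apply: borel_normX => //; exact: (prog_meas pX sT).
Qed.

(** Covers two situations at once: costs bounded from below, with [be = be' = 0], and costs
    controlled by second moments that are uniform in the control. *)
Lemma cost_lower x (al be al' be' U : R) : 0 <= al -> 0 <= be -> 0 <= al' -> 0 <= be' -> 0 <= U ->
 (forall y v, L0 v -> - l y v <= al + be * `|y| ^+ 2) ->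
 (forall y, - g y <= al' + be' * `|y| ^+ 2) ->
 (forall s, t <= s <= T -> (\int[P]_w (`|X x s w| ^+ 2)%:E <= U%:E)%E) ->
 ((- ((al + be * U) * expR (T - t) + (al' + be' * U)))%:E <= J x a)%E.
Proof.
move=> al0 be0 al0' be0' U0 hl' hg' hU; have [i1 i2 ->] := cost_split x Cl0 l_cont hl.
have [pX _ _ _] := state_spec x.
have mh : pmeas t T (fun r w => al + be * `|X x r w| ^+ 2).
 apply: measurable_funD; first exact: mcst.
 by apply: measurable_funM; [exact: mcst|exact: (prog_pow HW 2 tTT pX)].
have h0 (r : R) (w : Om) : 0 <= al + be * `|X x r w| ^+ 2.
 by rewrite addr_ge0// mulr_ge0// sqr_ge0.
have K0 : 0 <= al + be * U by rewrite addr_ge0// mulr_ge0.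
have h1 : ((- fine (\int[(leb \x P)%E]_(z in strip t T) (l (X x z.1 z.2) (a z.1 z.2))%:E))%:E <=
  ((al + be * U) * (expR (1 * (T - t)) / 1))%:E)%E.
 apply: (le_trans (@neg_le R _ _ (leb \x P)%E (strip t T) (fun z => l (X x z.1 z.2) (a z.1 z.2))
  (fun z => al + be * `|X x z.1 z.2| ^+ 2) _ i1 mh _ _)).
 - exact: strip_meas.
 - by move=> z _; exact: h0.
 - by move=> [r w] [/= + _]; rewrite in_itv => rT; apply: hl'; exact: La.
 rewrite -(EI_prod P mh (fun r w _ => h0 r w)). apply: (EI_exp tT ltr01 K0 mh h0) => r rT.
 apply: le_trans (int_affine (mXs x rT) _ al0 be0 (hU r rT)) _.
  by move=> w; exact: sqr_ge0.
 rewrite mul1r lee_fin ler_peMr// -expR0 ler_expR subr_ge0. by case/andP: rT.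
have h2 : ((- fine (\int[P]_w (g (X x T w))%:E))%:E <= (al' + be' * U)%:E)%E.
 apply: (le_trans (@neg_le R _ _ P setT (fun w => g (X x T w))
  (fun w => al' + be' * `|X x T w| ^+ 2) measurableT i2 _ _ _)).
 - apply: measurable_funD; first exact: mcst.
  by apply: measurable_funM; [exact: mcst|exact: mXs].
 - by move=> w _; rewrite addr_ge0// mulr_ge0// sqr_ge0.
 - by move=> w _; exact: hg'.
 by apply: (int_affine (mXs x tTT) _ al0' be0' (hU T tTT)) => w; exact: sqr_ge0.
rewrite !lee_fin mul1r divr1 in h1 h2 *.
by rewrite opprD lerD// lerNl.
Qed.

Variables (hC2 : almost_affine).

(** The same control serves for [x], [x'] and the point between them. [semi_lip] bounds the second
    difference of the costs by [|X - X'|^2] and [|Y|], whose means grow at rate [2 c]; integration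
    in time divides the running part by [2 c]. *)
Lemma cost_semiconcave (Kl Kg k : R) x x' : (forall v, L0 v -> semiconcave Kl (fun y => l y v)) ->
 semiconcave Kg g -> 0 <= k <= 1 ->
 k * fine (J x a) + (1 - k) * fine (J x' a) - fine (J (k *: x + (1 - k) *: x') a) <=
 (8 * (`|Kl| + Cl) / (2 * c) + 8 * (`|Kg| + Cl)) *
  (k * (1 - k) * `|x - x'| ^+ 2 * expR (2 * c * (T - t))).
Proof.
move=> hKl hKg k01; have /andP[k0 k1] := k01.
have [La0 Ta] : L0 (a T point) /\ True by split => //; exact: La.
have hg y y' : `|g y - g y'| <= Cl * `|y - y'| by case: (hl y y' La0).
set z := k *: x + (1 - k) *: x'.
have kk : 0 <= k * (1 - k) by rewrite mulr_ge0// subr_ge0.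
set q := k * (1 - k) * `|x - x'| ^+ 2.
have q0 : 0 <= q by rewrite mulr_ge0// sqr_ge0.
have [pX cX mX _] := state_spec x; have [pX' cX' mX' _] := state_spec x'.
have [pZ cZ mZ _] := state_spec z.
pose Y r w := k *: X x r w + (1 - k) *: X x' r w - X z r w.
have pY : prog Y by apply: (progB dvH) => //; apply: (progD dvH); exact: (progZc dvH).
pose h (A r : R) (w : Om) : R := `|A| * (k * (1 - k)) * `|X x r w - X x' r w| ^+ 2 + Cl * `|Y r w|.
have h0 A r w : 0 <= h A r w.
 by apply: addr_ge0; [apply: mulr_ge0; [exact: mulr_ge0|exact: sqr_ge0]|apply: mulr_ge0 => //; exact: ltW].
have hb A r : t <= r <= T ->
  (\int[P]_w (h A r w)%:E <= (8 * (`|A| + Cl) * q * expR (2 * c * (r - t)))%:E)%E.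
 move=> rT; have mD : measT (fun w => `|X x r w - X x' r w| ^+ 2).
  apply: borel_normX => //. by apply: (borelB dvH) => //; exact: (prog_meas _ rT).
 have mY : measT (fun w => `|Y r w|).
  by apply: borel_norm0 => //; exact: (prog_meas pY rT).
 have d1 := first_diff2 pX cX mX pX' cX' mX' rT. have d2 := second_diff hC2
  k01 pX cX mX pX' cX' mX' pZ cZ mZ rT.
 have d3 : (\int[P]_w (`|Y r w|)%:E <= (8 * q * expR (2 * c * (r - t)))%:E)%E.
  apply: int_sqrt => //; first by apply: mulr_ge0; [exact: mulr_ge0|exact: expR_ge0].
  apply: le_trans d2 _; rewrite lee_fin -/q.
  have -> : 4 * c * (r - t) = 2 * c * (r - t) + 2 * c * (r - t) by ring.
  rewrite expRD; move: (expR _) => e.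
  have -> : (8 * q * e) ^+ 2 = 54 * q ^+ 2 * (e * e) + 10 * (q * e) ^+ 2 by ring.
  by rewrite lerDl mulr_ge0// sqr_ge0.
 apply: (@le_trans _ _ ((`|A| * (k * (1 - k)))%:E * \int[P]_w (`|X x r w - X x' r w| ^+ 2)%:E +
  Cl%:E * \int[P]_w (`|Y r w|)%:E)%E). apply: int_le2 => //; [exact: mulr_ge0|exact: ltW|].
  by move=> w; rewrite h0/=.
 apply: (lee_comb2 _ _ d1 d3); [exact: mulr_ge0|exact: ltW|]. apply: ler_eq; rewrite /q; ring.
have mh A : pmeas t T (h A).
 apply: measurable_funD; apply: measurable_funM; try exact: mcst.
  exact: (prog_pow HW 2 tTT (progB dvH pX pX')).
 exact: (prog_pow HW 1 tTT pY).
have [i1 i2 ->] := cost_split x Cl0 l_cont hl.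
have [j1 j2 ->] := cost_split x' Cl0 l_cont hl.
have [n1 n2 ->] := cost_split z Cl0 l_cont hl.
have s1 : (k * fine (\int[(leb \x P)%E]_(z in strip t T) (l (X x z.1 z.2) (a z.1 z.2))%:E) +
  (1 - k) * fine (\int[(leb \x P)%E]_(z in strip t T) (l (X x' z.1 z.2) (a z.1 z.2))%:E) -
  fine (\int[(leb \x P)%E]_(y in strip t T) (l (X z y.1 y.2) (a y.1 y.2))%:E))%R <=
  8 * (`|Kl| + Cl) * q * (expR (2 * c * (T - t)) / (2 * c)).
 rewrite -lee_fin.
 apply: (le_trans (@comb_le R _ _ (leb \x P)%E (strip t T) (fun y => l (X x y.1 y.2) (a y.1 y.2))
  (fun y => l (X x' y.1 y.2) (a y.1 y.2)) (fun y => l (X z y.1 y.2) (a y.1 y.2))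
  (fun y => h Kl y.1 y.2) k _ i1 j1 n1 (mh Kl) _ _)).
 - exact: strip_meas.
 - by move=> y _; exact: h0.
 - move=> [r w] [/= + _]; rewrite in_itv => rT.
  have hly y y' : `|l y (a r w) - l y' (a r w)| <= Cl * `|y - y'| by case: (hl y y' (La w rT)).
  exact: (semi_lip (hKl _ (La w rT)) hly).
 rewrite -(EI_prod P (mh Kl) (fun r w _ => h0 Kl r w)).
 apply: (EI_exp tT _ _ (mh Kl) (h0 Kl)); [exact: mulr_gt0| |exact: hb].
 by apply: mulr_ge0 => //; apply: mulr_ge0 => //; apply: addr_ge0 => //; exact: ltW.
have s2 : k * fine (\int[P]_w (g (X x T w))%:E) + (1 - k) * fine (\int[P]_w (g (X x' T w))%:E) -
  fine (\int[P]_w (g (X z T w))%:E) <= 8 * (`|Kg| + Cl) * q * expR (2 * c * (T - t)).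
 rewrite -lee_fin; apply: le_trans (hb Kg T tTT).
 apply: (@comb_le R _ _ P setT (fun w => g (X x T w)) (fun w => g (X x' T w))
  (fun w => g (X z T w)) (h Kg T) k measurableT i2 j2 n2).
 - exact: (EI_section2 tTT (mh Kg)).
 - by move=> w _; exact: h0.
 - by move=> w _; exact: (semi_lip hKg hg).
apply: le_trans (_ : _ <= 8 * (`|Kl| + Cl) * q * (expR (2 * c * (T - t)) / (2 * c)) +
 8 * (`|Kg| + Cl) * q * expR (2 * c * (T - t))) _.
 apply: le_trans (lerD s1 s2); rewrite /= le_eqVlt; apply/orP; left; apply/eqP.
 move: (fine _) (fine _) (fine _) (fine _) (fine _) (fine _) => *; ring.
apply: ler_eq; rewrite -/q; ring.
Qed.
End Cost.
End FixedControl.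

(** * The value function *)

Variables (p : R) (p_gt2 : 2 < p).
Local Notation controls := (controls P W t L0 p T).

(** Only square integrability of controls is used in the estimates; it follows from [y^2 <= 1 + y^p]
    for [p > 2] on a bounded time interval. *)
Lemma controls_spec a : controls a -> [/\ forall s w, t <= s <= T -> L0 (a s w), prog a &
 (EI P t T (fun r w => `|a r w| ^+ 2)%R < +oo)%E].
Proof.
move=> [La pa ap]; split; [exact: La|exact: pa|].
have mp : pmeas t T (fun r w => `|a r w| `^ p).
 exact: (measurableT_comp (measurable_powR p) (prog_pow HW 1 tTT pa)).
apply: (@le_lt_trans _ _ (EI P t T (fun r w => 1 + `|a r w| `^ p)%R)).
 by apply: EI_le => r w _; rewrite sqr_ge0 sqr_le_powR.
rewrite (EI_D P (f := fun _ _ => 1) (g := fun r w => `|a r w| `^ p))//; last first.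
 exact: mcst.
by rewrite EI_cst//; apply: lte_add_pinfty => //; exact: ltry.
Qed.

Lemma const_control v : L0 v -> controls (fun _ _ => v).
Proof.
move=> Lv; split; [by move=> *|exact: prog_cst|].
by have := EI_cst P tT (powR_ge0 `|v| p) => h; rewrite -/(EI P t T (fun _ _ => `|v| `^ p)) h ltry.
Qed.

Variables (l : H -> L -> R) (g : H -> R) (Cl : R) (Cl0 : 0 < Cl) (L0_neq0 : L0 !=set0)
 (l_cont : {within [set: H] `*` L0, continuous (fun z => l z.1 z.2)})
 (hl : cost_lip l g Cl)
 (below : ~ bounded_set L0 -> (exists m : R, forall x a, L0 a -> m <= l x a) /\
   (exists m : R, forall x, m <= g x)).
Local Notation J := (cost P W t T S b sigma l g).
Local Notation V := (value P W t L0 p T S b sigma l g).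

Lemma cost_fin x a : controls a -> (fine (J x a))%:E = J x a.
Proof.
by move=> /controls_spec[La pa a2]; have [_ _ ->] := cost_split La pa a2 x Cl0 l_cont hl.
Qed.

(** For unbounded [L0] the lower bounds on [l] and [g] are assumed. For bounded [L0] the growth of
    [l] and [g] is controlled by second moments, which are uniform in the control. *)
Lemma cost_bounded_below x : exists m : R, forall a, controls a -> (m%:E <= J x a)%E.
Proof.
have [[M [_ hM]]|nb] := pselect (bounded_set L0); last first.
 have [[m1 h1] [m2 h2]] := below nb.
 exists (- (`|m1| * expR (T - t) + `|m2|)) => a /controls_spec[La pa a2].
 have [_ _ _ [U U0 hU]] := state_spec La pa a2 x.
 have := @cost_lower a La pa a2 l g Cl Cl0 l_cont hl x `|m1| 0 `|m2| 0 U.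
 rewrite !mul0r !addr0; apply => //; first exact: ltW.
 - move=> y v Lv; rewrite mul0r addr0; apply: le_trans (_ : - m1 <= _); first by rewrite lerN2 h1.
  by rewrite -normrN ler_norm.
 - move=> y; rewrite mul0r addr0; apply: le_trans (_ : - m2 <= _); first by rewrite lerN2 h2.
  by rewrite -normrN ler_norm.
have {}hM v : L0 v -> `|v| ^+ 2 <= (M + 1) ^+ 2.
 move=> Lv; have M1 : M < M + 1 by rewrite ltrDl. have h := hM (M + 1) M1 v Lv.
 by rewrite lerXn2r ?nnegrE//; exact: le_trans h.
set D := (M + 1) ^+ 2 in hM; have D0 : 0 <= D by exact: sqr_ge0.
pose M1 := 3 * `|x| ^+ 2 + 9 * C ^+ 2 * (T - t + 33) * ((1 + D) * (T - t)).
have Tt : 0 <= T - t by rewrite subr_ge0.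
have K0 : 0 <= 9 * C ^+ 2 * (T - t + 33).
 by apply: mulr_ge0; [apply: mulr_ge0 => //; exact: sqr_ge0|exact: addr_ge0].
have M10 : 0 <= M1.
 apply: addr_ge0; first by apply: mulr_ge0 => //; exact: sqr_ge0.
 by apply: mulr_ge0 => //; apply: mulr_ge0 => //; exact: addr_ge0.
pose U := 2 * (2 * M1) * expR (la * (T - t)).
have M12 : 0 <= 2 * (2 * M1) by apply: mulr_ge0 => //; exact: mulr_ge0.
have U0 : 0 <= U by apply: mulr_ge0; [exact: M12|exact: expR_ge0].
exists (- ((Cl * (2 + D) + Cl * U) * expR (T - t) + (`|g 0| + Cl + Cl * U))) => a.
move=> /controls_spec[La pa a2].
have y2 (y : R) : y <= 1 + y ^+ 2.
 by have := sqr_ge0 (y - 1); have := sqr_ge0 y; rewrite sqrrB1; lra.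
apply: (cost_lower La pa a2 Cl0 l_cont hl) => //; try exact: ltW.
- by apply: mulr_ge0; [exact: ltW|exact: addr_ge0].
- by apply: addr_ge0 => //; exact: ltW.
- move=> y v Lv; have [_ h _] := hl y 0 Lv.
 apply: le_trans (le_trans h _); first by rewrite -normrN ler_norm.
 rewrite -mulrDr; apply: ler_wpM2l; first exact: ltW. by have := hM v Lv; have := y2 `|y|; lra.
- move=> y; have [v Lv] := L0_neq0; have [_ _ h] := hl 0 y Lv.
 rewrite sub0r normrN in h.
 have h1 := ler_norm (g 0 - g y); have h2 := ler_norm (- g 0); rewrite normrN in h2.
 have h3 := ler_wpM2l (ltW Cl0) (y2 `|y|); rewrite mulrDr mulr1 in h3. by lra.
- move=> s sT; have /andP[ts sT'] := sT.
 apply: le_trans (moment La pa a2 (x := x) M10 _ sT) _; last first.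
  rewrite lee_fin; apply: ler_wpM2l; first exact: M12.
  by rewrite ler_expR; apply: ler_wpM2l; [exact: ltW|exact: lerB].
 rewrite /M0 /M1 EFinD; apply: leeD => //.
 rewrite (EFinM (9 * C ^+ 2 * (T - t + 33))); apply: lee_wpmul2l => //.
 rewrite -(EI_cst P tT (addr_ge0 ler01 D0)); apply: EI_le => r w rT.
 rewrite /grow normr0 expr0n/= addr0 addr_ge0 ?sqr_ge0//= lerD2l. exact/hM/La.
Qed.

Lemma value_fin x : V x \is a fin_num.
Proof.
have [m hm] := cost_bounded_below x; have [v Lv] := L0_neq0.
have cv := const_control Lv.
apply: fin_real; apply/andP; split.
 apply: (lt_le_trans (ltNyr m)); apply: le_ereal_inf_tmp => _ [a ca <-]. exact: hm.
apply: (@le_lt_trans _ _ (J x (fun _ _ => v))); first by apply: ereal_inf_lbound; exists (fun _ _ => v).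
by rewrite -(cost_fin x cv) ltry.
Qed.

Variables (hC2 : almost_affine).

(** For every control, the value at [x] and [x'] is at most its cost there, while at the middle
    point the infimum over controls is taken last. The constant does not depend on the control, so
    the inequality survives. *)
Lemma value_semiconcave (Kl Kg : R) : (forall v, L0 v -> semiconcave Kl (fun y => l y v)) ->
 semiconcave Kg g ->
 semiconcave ((8 * (`|Kl| + Cl) / (2 * c) + 8 * (`|Kg| + Cl)) * expR (2 * c * (T - t)))
  (fun x => fine (V x)).
Proof.
move=> hKl hKg k x x' k01; have /andP[k0 k1] := k01.
set z := k *: x + _; set Q := (X in _ <= X).
have VJ y a : controls a -> fine (V y) <= fine (J y a).
 move=> ca; rewrite -lee_fin (fineK (value_fin y)) (cost_fin y ca).
 by apply: ereal_inf_lbound; exists a.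
rewrite lerBlDl -lerBlDr -lee_fin (fineK (value_fin z)).
apply: le_ereal_inf_tmp => _ [a ca <-]; rewrite -(cost_fin z ca) lee_fin lerBlDr -lerBlDl.
have [La pa a2] := controls_spec ca.
have h := cost_semiconcave La pa a2 Cl0 l_cont hl hC2 x x' hKl hKg k01.
apply: le_trans (_ : _ <= k * fine (J x a) + (1 - k) * fine (J x' a) - fine (J z a)) _.
 rewrite lerD2r; apply: lerD; apply: ler_wpM2l => //; [exact: VJ|by rewrite subr_ge0|exact: VJ].
by apply: le_trans h _; rewrite /Q le_eqVlt; apply/orP; left; apply/eqP; ring.
Qed.

End Mild.

Theorem theorem3p11 (R : realType) (H Xi : hilbertType R)
    (L : completeNormedModType R) (L0 : set L) (p : R)
    (DA : set H) (A : H -> H) (S : R -> bounded_op H H)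
    (b : H -> L -> H) (sigma : H -> L -> hs Xi H) (l : H -> L -> R) (g : H -> R)
    (sepH : separable H) (sepXi : separable Xi) (sepL : separable L)
    (L0_neq0 : L0 !=set0)
    (L0_convex : convex_set (L0 : set (convex_lmodType L)))
    (p_gt2 : 2 < p)
    (A_linear : linear_on DA A) (A_dense : dense DA)
    (A_maximal : maximal_dissipative DA A)
    (S_semigroup : contraction_semigroup S) (S_generated : generates DA A S)
    (b_cont : {within [set: H] `*` L0, continuous (fun z => b z.1 z.2)})
    (sigma_cont : {within [set: H] `*` L0, continuous (fun z => sigma z.1 z.2)})
    (hyp_a : exists2 C : R, 0 < C &
      forall x x' a, L0 a ->
        [/\ `|b x a - b x' a| <= C * `|x - x'|,
            `|sigma x a - sigma x' a| <= C * `|x - x'|,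
            `|b x a| <= C * (1 + `|x| + `|a|) &
            `|sigma x a| <= C * (1 + `|x| + `|a|)])
    (l_cont : {within [set: H] `*` L0, continuous (fun z => l z.1 z.2)})
    (hyp_b : exists2 C : R, 0 < C &
      forall x x' a, L0 a ->
        [/\ `|l x a - l x' a| <= C * `|x - x'|,
            `|l x a| <= C * (1 + `|x| + `|a| ^+ 2) &
            `|g x - g x'| <= C * `|x - x'|])
    (hyp_b_below : ~ bounded_set L0 ->
      (exists m : R, forall x a, L0 a -> m <= l x a) /\
      (exists m : R, forall x, m <= g x))
    (b_diff : forall x a, differentiable (fun y => b y a) x)
    (sigma_diff : forall x a, differentiable (fun y => sigma y a) x)
    (hyp_c : exists2 C : R, 0 < C &
      forall (x x' : H) a, L0 a ->
        (opnorm (fun h =>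
             'd (fun y => b y a) x h - 'd (fun y => b y a) x' h)%R
           <= (C * `|x - x'|)%:E)%E /\
        (opnorm (fun h =>
             'd (fun y => sigma y a) x h - 'd (fun y => sigma y a) x' h)%R
           <= (C * `|x - x'|)%:E)%E)
    (hyp_d_l : exists K : R, forall a, L0 a -> semiconcave K (fun x => l x a))
    (hyp_d_g : exists K : R, semiconcave K g) :
  exists C1 C2 : R, [/\ 0 <= C1, 0 <= C2 &
    forall T t : R, 0 < T -> 0 <= t <= T ->
    forall (d : measure_display) (Om : measurableType d) (P : probability Om R)
      (W : R -> Xi -> Om -> R),
    reference_space P W t T ->
    let V := value P W t L0 p T S b sigma l g in
    (forall x, V x \is a fin_num) /\
    semiconcave (C1 * expR (C2 * (T - t))) (fun x => fine (V x))].

Proof.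
have [Ca Ca0 ha] := hyp_a; have [Cc Cc0 hc] := hyp_c; have [Cl Cl0 hl] := hyp_b.
have [Kl hKl] := hyp_d_l; have [Kg hKg] := hyp_d_g.
(* One constant that dominates those of the Lipschitz and growth conditions and of the
   derivatives. *)
pose C := Ca + Cc; have C0 : 0 < C by exact: addr_gt0.
have CaC (y : R) : 0 <= y -> Ca * y <= C * y by move=> y0; rewrite ler_wpM2r// lerDl ltW.
have hC x x' a : L0 a -> [/\ `|b x a - b x' a| <= C * `|x - x'|,
    `|sigma x a - sigma x' a| <= C * `|x - x'|,
    `|b x a| <= C * (1 + `|x| + `|a|) & `|sigma x a| <= C * (1 + `|x| + `|a|)].
  move=> La; have [h1 h2 h3 h4] := ha x x' a La.
  have n0 : 0 <= 1 + `|x| + `|a| by rewrite !addr_ge0.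
  by split; [apply: le_trans h1 _|apply: le_trans h2 _|apply: le_trans h3 _|
    apply: le_trans h4 _]; apply: CaC.
have hC2 k x x' a : L0 a -> 0 <= k <= 1 ->
    `|k *: b x a + (1 - k) *: b x' a - b (k *: x + (1 - k) *: x') a| <=
      C * (k * (1 - k) * `|x - x'| ^+ 2) /\
    `|k *: sigma x a + (1 - k) *: sigma x' a - sigma (k *: x + (1 - k) *: x') a| <=
      C * (k * (1 - k) * `|x - x'| ^+ 2).
  move=> La k01; have /andP[k0 k1] := k01.
  have CcC : Cc * (k * (1 - k) * `|x - x'| ^+ 2) <= C * (k * (1 - k) * `|x - x'| ^+ 2).
    apply: ler_wpM2r; last by rewrite lerDr ltW.
    by apply: mulr_ge0; [rewrite mulr_ge0// subr_ge0|exact: sqr_ge0].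
  split; apply: le_trans CcC.
    apply: (@taylor2 R H H (fun y => b y a) Cc (ltW Cc0) (fun y => b_diff y a)) => // y y'.
    by case: (hc y y' a La).
  apply: (@taylor2 R H (hs Xi H) (fun y => sigma y a) Cc (ltW Cc0) (fun y => sigma_diff y a)) => // y y'.
  by case: (hc y y' a La).
(* The rates are fixed before [T], [t] and the probability space are introduced, so the constants
   [C1] and [C2] cannot depend on them. *)
have [c [c0 c4 c2]] := const_exists C; have [la la0 hla] := rate_exists C.
have [vH dvH] := separable_seq sepH; have [vL dvL] := separable_seq sepL.
have [ch dch] := hs_dense_seq sepXi sepH.
exists (8 * (`|Kl| + Cl) / (2 * c) + 8 * (`|Kg| + Cl)), (2 * c); split.
- have h (K : R) : 0 <= 8 * (`|K| + Cl) by apply: mulr_ge0 => //; apply: addr_ge0 => //; exact: ltW.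
  by apply: addr_ge0 => //; apply: divr_ge0 => //; apply: mulr_ge0 => //; exact: ltW.
- by apply: mulr_ge0 => //; exact: ltW.
move=> T t T0 /andP[t0 tT] d Om P W HW V; split.
  exact: (value_fin HW tT S_semigroup dvH dvL dch b_cont sigma_cont C0 hC c0 c4 la0 hla p_gt2 Cl0
    L0_neq0 l_cont hl hyp_b_below).
exact: (value_semiconcave HW tT S_semigroup dvH dvL dch b_cont sigma_cont C0 hC c0 c4 c2 la0 hla
  p_gt2 Cl0 L0_neq0 l_cont hl hyp_b_below hC2 hKl hKg).
Qed.
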